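(* Let $k\in\mathbb{N}$, $i_1,\ldots,i_k\in\{0,1,\ldots,m\}$, and let $\chi_l(\tau,{\bf y})=\psi_l(\tau)\varphi_l({\bf y})$ $(l=1,\ldots,k)$ with non-random functions $\psi_l:[t,T]\to\mathbb{R}$, $\varphi_l:{\bf X}\to\mathbb{R}$ such that $\chi_l\in H_2(\Pi,[t,T])$. Suppose that: 1. every $\psi_l$ $(l=1,\ldots,k)$ is continuous on $[t,T]$; 2. $\{\phi_j(x)\}_{j=0}^{\infty}$ is a complete orthonormal system of functions in $L_2([t,T])$, each of which satisfies condition $(\star)$; 3. for $l=1,\ldots,k$ and $q=2^{k+1}$, $\int_{\bf X}|\varphi_l({\bf y})|^q\,\Pi(d{\bf y})<\infty$. Then for the iterated stochastic integral with respect to martingale Poisson measures $$P[\chi^{(k)}]_{T,t}=\int_t^T\int_{\bf X}\chi_k(t_k,{\bf y}_k)\ldots\int_t^{t_2}\int_{\bf X}\chi_1(t_1,{\bf y}_1)\,\tilde\nu^{(i_1)}(dt_1,d{\bf y}_1)\ldots\tilde\nu^{(i_k)}(dt_k,d{\bf y}_k)$$ the following expansion, converging in the mean-square sense, is valid: $$P[\chi^{(k)}]_{T,t}=\mathop{\rm l.i.m.}_{p_1,\ldots,p_k\to\infty}\sum_{j_1=0}^{p_1}\ldots\sum_{j_k=0}^{p_k}C_{j_k\ldots j_1}\Biggl(\prod_{g=1}^k\pi_{j_g}^{(g,i_g)}-\mathop{\rm l.i.m.}_{N\to\infty}\sum_{(l_1,\ldots,l_k)\in{\rm G}_k}\prod_{g=1}^k\phi_{j_g}(\tau_{l_g})\int_{\bf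 X}\varphi_g({\bf y})\,\tilde\nu^{(i_g)}([\tau_{l_g},\tau_{l_g+1}),d{\bf y})\Biggr),$$ where the random variables $$\pi_j^{(g,i_g)}=\int_t^T\phi_j(\tau)\int_{\bf X}\varphi_g({\bf y})\,\tilde\nu^{(i_g)}(d\tau,d{\bf y})$$ are independent for different $i_g\ne0$ and uncorrelated for different $j$ (for $i_g\neq 0$), and $$C_{j_k\ldots j_1}=\int_{[t,T]^k}K(t_1,\ldots,t_k)\prod_{l=1}^k\phi_{j_l}(t_l)\,dt_1\ldots dt_k,$$ with $K(t_1,\ldots,t_k)=\psi_1(t_1)\ldots\psi_k(t_k)$ if $t_1<\ldots<t_k$ and $K(t_1,\ldots,t_k)=0$ otherwise (for $k\ge2$, $t_1,\ldots,t_k\in[t,T]$), and $K(t_1)=\psi_1(t_1)$ for $k=1$.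
   Context: Let $0\le t<T$, ${\bf X}=\mathbb{R}^n$, and let $(\Omega,{\rm F},{\sf P})$ be a probability space with a non-decreasing family of $\sigma$-algebras $\{{\rm F}_s, s\in[0,T]\}$, ${\rm F}_s\subset{\rm F}$; ${\sf M}$ denotes expectation, and l.i.m. denotes the limit in the mean-square sense. $\Pi$ is a measure on the Borel $\sigma$-algebra $\mathcal B$ of ${\bf X}$, and $\mathcal B_0=\{A\in\mathcal B:\Pi(A)<\infty\}$. The $\nu^{(i)}(dt,d{\bf y})$, $i=1,\ldots,m$, are independent Poisson random measures on $[0,T]\times{\bf X}$ with ${\sf M}\{\nu^{(i)}(\Delta,A)\}=|\Delta|\Pi(A)$ ($|\Delta|$ is Lebesgue measure of $\Delta$), such that $\nu^{(i)}([0,s),A)$ is ${\rm F}_s$-measurable and $\nu^{(i)}([s,s+h),A)$, $h>0$, is independent of ${\rm F}_s$, for all $A\in\mathcal B_0$. The martingale Poisson measures are $\tilde\nu^{(i)}(dt,d{\bf y})=\nu^{(i)}(dt,d{\bf y})-\Pi(d{\bf y})dt$ for $i=1,\ldots,m$, and $\tilde\nu^{(0)}(dt,d{\bf y})=\Pi(d{\bf y})dt$ (so integrals with respect to $\tilde\nu^{(0)}$ are ordinary integrals, assumed to exist whenever they occur). $H_2(\Pi,[t,T])$ is the class of random functions $\varphi:[t,T]\times{\bf X}\times\Omega\to\mathbb{R}$ which are ${\rm F}_s$-measurable for all $s\in[t,T]$, ${\bf y}\in{\bf X}$ and satisfy $\int_t^T\int_{\bf X}{\sf M}\{|\varphi(s,{\bf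 y})|^2\}\Pi(d{\bf y})ds<\infty$. The stochastic integral of $\varphi\in H_2(\Pi,[t,T])$ with respect to a martingale Poisson measure is the mean-square limit of the integrals of step functions $\varphi^{(N)}\in H_2(\Pi,[t,T])$ with $\int_t^T\int_{\bf X}{\sf M}\{|\varphi-\varphi^{(N)}|^2\}\Pi(d{\bf y})ds\to0$. Condition $(\star)$ for a function $f:[t,T]\to\mathbb{R}$: $f$ is continuous on $[t,T]$ except possibly at finitely many points of finite (jump) discontinuity, and $f$ is right-continuous on $[t,T]$. $\{\tau_j\}_{j=0}^N$ is a partition (depending on $N$) $t=\tau_0<\ldots<\tau_N=T$ with $\max_{0\le j\le N-1}(\tau_{j+1}-\tau_j)\to0$ as $N\to\infty$. ${\rm G}_k={\rm H}_k\setminus{\rm L}_k$, where ${\rm H}_k=\{(l_1,\ldots,l_k): l_1,\ldots,l_k=0,1,\ldots,N-1\}$ and ${\rm L}_k=\{(l_1,\ldots,l_k)\in{\rm H}_k: l_g\ne l_r \text{ for } g\ne r,\ g,r=1,\ldots,k\}$. *)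

(* Defs.v *)
From HB Require Import structures.
From mathcomp Require Import all_boot all_order all_algebra.
From mathcomp Require Import all_classical all_reals all_analysis.
From mathcomp Require Import measurable_realfun.

Set Implicit Arguments.
Unset Strict Implicit.
Unset Printing Implicit Defensive.

Import Order.TTheory GRing.Theory Num.Theory.
Import numFieldNormedType.Exports.

Local Open Scope classical_set_scope.
Local Open Scope ring_scope.

(* R^n with its Borel sigma-algebra. *)
Notation borelRn R n := (g_sigma_algebraType (@open 'rV[R]_n)).

Section probability_notions.
Context {d : measure_display} {Omega : measurableType d} {R : realType}.
Variable P : probability Omega R.

(* Product rule for the finitely many set systems G i with D i.  It is only
   applied to sigma-algebras: taking A i = Omega for some of the i gives the
   product rule for every subfamily. *)
Definition mutually_independent (I : finType) (D : pred I)
    (G : I -> set_system Omega) : Prop :=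
  forall A : I -> set Omega, (forall i, D i -> G i (A i)) ->
    P (\bigcap_(i in [set` D]) A i) = (\prod_(i | D i) P (A i))%E.

Definition independent2 (G H : set_system Omega) : Prop :=
  forall A B, G A -> H B -> P (A `&` B) = (P A * P B)%E.

(* The sigma-algebra generated by the random variables Z j, j in D. *)
Definition sigma_generated {d' : measure_display} {V : measurableType d'}
    (J : Type) (D : set J) (Z : J -> Omega -> V) : set_system Omega :=
  <<s \bigcup_(j in D) g_sigma_algebra_preimage (Z j) >>.

Definition lim_in_mean_square (I : Type) (U : set_system I)
    (X : I -> Omega -> R) (Z : Omega -> R) : Prop :=
  measurable_fun setT Z /\
  (fun x => 'E_P[(fun w => ((X x w - Z w) ^+ 2)%R)]%E) @ U --> 0%E.

Definition filtration (T : R) (F : R -> set_system Omega) : Prop :=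
  [/\ forall s, s \in `[0, T] -> sigma_algebra setT (F s),
      forall s, s \in `[0, T] -> F s `<=` measurable &
      forall s s', s \in `[0, T] -> s' \in `[0, T] -> s <= s' -> F s `<=` F s'].

End probability_notions.

(* p_1, ..., p_k tend to infinity jointly, independently of each other. *)
Definition multi_infty (k : nat) : set_system ('I_k -> nat) :=
  [set A | exists n0 : nat,
     forall p : 'I_k -> nat, (forall l, (n0 <= p l)%N) -> A p].

(* The nodes tau j with N < j are irrelevant. *)
Definition is_partition {R : realType} (a b : R) (N : nat) (tau : nat -> R) :
    Prop :=
  [/\ tau 0%N = a, tau N = b & forall j, (j < N)%N -> tau j < tau j.+1].

Section stochastic_integral.
Context {d : measure_display} {Omega : measurableType d} {R : realType}.
Context {dY : measure_display} {Y : measurableType dY}.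
Variables (P : probability Omega R) (F : R -> set_system Omega).
Variable Pi : {measure set Y -> \bar R}.

Local Notation mu := (@lebesgue_measure R).

Definition rectangle (T : R) (D : set R) (A : set Y) : Prop :=
  [/\ measurable D, D `<=` `[0, T], measurable A & (Pi A < +oo)%E].

(* nu is a random measure (kernel) on R x Y.  Only rectangles with base in
   [0, T] matter, and Pi is not assumed to be sigma-finite. *)
Definition poisson_random_measure (T : R) (nu : R.-ker Omega ~> (R * Y)%type) :
    Prop :=
  (forall D A, rectangle T D A -> forall c : nat,
     let lambda := fine (mu D * Pi A)%E in
     P [set w | nu w (D `*` A) = (c%:R)%:E] =
     (lambda ^+ c / c`!%:R * expR (- lambda))%:E) /\
  (forall (r : nat) (D : 'I_r -> set R) (A : 'I_r -> set Y),
     (forall j, rectangle T (D j) (A j)) ->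
     trivIset setT (fun j => D j `*` A j) ->
     mutually_independent P xpredT (fun j =>
       g_sigma_algebra_preimage (fun w => nu w (D j `*` A j) : \bar R))).

(* nu ord0 is unused: the index 0 stands for the deterministic measure
   Pi(dy)dt, see stoch_int below. *)
Definition poisson_system (T : R) (m : nat)
    (nu : 'I_m.+1 -> R.-ker Omega ~> (R * Y)%type) : Prop :=
  [/\ forall i, i != ord0 -> poisson_random_measure T (nu i),
      mutually_independent P (fun i => i != ord0) (fun i =>
        sigma_generated [set DA : set R * set Y | rectangle T DA.1 DA.2]
          (fun DA w => nu i w (DA.1 `*` DA.2) : \bar R)),
      forall i s A, i != ord0 -> s \in `[0, T] -> measurable A ->
        (Pi A < +oo)%E ->
        g_sigma_algebra_preimage (fun w => nu i w (`[0, s[ `*` A) : \bar R)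
          `<=` F s &
      forall i s h A, i != ord0 -> 0 <= s -> 0 < h -> s + h <= T ->
        measurable A -> (Pi A < +oo)%E ->
        independent2 P (g_sigma_algebra_preimage
          (fun w => nu i w (`[s, s + h[ `*` A) : \bar R)) (F s)].

(* The class H_2(Pi, [a, b]).  Joint measurability is what gives a meaning to
   the integral in the last clause. *)
Definition H2 (a b : R) (xi : R -> Y -> Omega -> R) : Prop :=
  [/\ measurable_fun (`[a, b] `*` setT `*` setT)
        (fun z : R * Y * Omega => xi z.1.1 z.1.2 z.2),
      forall s y, s \in `[a, b] -> g_sigma_algebra_preimage (xi s y) `<=` F s &
      (\int[mu]_(s in `[a, b]) \int[Pi]_y
         'E_P[(fun w => (`|xi s y w| ^+ 2)%R)] < +oo)%E].

(* The step function
     sum_(j < step_N) sum_(c < step_r)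
       step_xi j c w * 1_[step_tau j, step_tau (j+1))(s) * 1_(step_A c)(y). *)
Record step_data := StepData {
  step_N : nat;
  step_r : nat;
  step_tau : nat -> R;
  step_A : nat -> set Y;
  step_xi : nat -> nat -> Omega -> R }.

Definition is_step (a b : R) (st : step_data) : Prop :=
  [/\ is_partition a b (step_N st) (step_tau st),
      forall c, (c < step_r st)%N ->
        measurable (step_A st c) /\ (Pi (step_A st c) < +oo)%E &
      forall j c, (j < step_N st)%N -> (c < step_r st)%N ->
        g_sigma_algebra_preimage (step_xi st j c) `<=` F (step_tau st j) /\
        ('E_P[(fun w => (step_xi st j c w ^+ 2)%R)] < +oo)%E].

Definition step_fun (st : step_data) (s : R) (y : Y) (w : Omega) : R :=
  \sum_(j < step_N st) \sum_(c < step_r st)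
    step_xi st j c w * \1_(`[step_tau st j, step_tau st j.+1[) s *
    \1_(step_A st c) y.

(* The martingale Poisson measure of D x A. *)
Definition compensated (nu : R.-ker Omega ~> (R * Y)%type)
    (D : set R) (A : set Y) (w : Omega) : R :=
  fine (nu w (D `*` A)) - fine (mu D * Pi A)%E.

Definition step_int (nu : R.-ker Omega ~> (R * Y)%type) (st : step_data)
    (w : Omega) : R :=
  \sum_(j < step_N st) \sum_(c < step_r st)
    step_xi st j c w *
    compensated nu `[step_tau st j, step_tau st j.+1[ (step_A st c) w.

(* Z is a version of the integral of xi over [a, b] x Y with respect to the
   compensated nu; stochastic integrals being mean-square limits, they are only
   determined up to almost sure equality, whence a predicate. *)
Definition martingale_int (nu : R.-ker Omega ~> (R * Y)%type) (a b : R)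
    (xi : R -> Y -> Omega -> R) (Z : Omega -> R) : Prop :=
  H2 a b xi /\
  exists st : nat -> step_data,
    [/\ forall N, is_step a b (st N),
        (fun N => \int[mu]_(s in `[a, b]) \int[Pi]_y
           'E_P[(fun w => (`|xi s y w - step_fun (st N) s y w| ^+ 2)%R)])%E
          @ \oo --> 0%E &
        lim_in_mean_square P \oo (fun N => step_int nu (st N)) Z].

(* Z is a version of the ordinary, pathwise, integral with respect to
   Pi(dy)ds, which is required to converge absolutely. *)
Definition ordinary_int (a b : R) (xi : R -> Y -> Omega -> R)
    (Z : Omega -> R) : Prop :=
  [/\ H2 a b xi, measurable_fun setT Z &
      {ae P, forall w,
         (\int[mu]_(s in `[a, b]) \int[Pi]_y `|xi s y w|%:E < +oo)%E /\
         (Z w)%:E = (\int[mu]_(s in `[a, b]) \int[Pi]_y (xi s y w)%:E)%E}].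

(* Integral over [a, b] x Y with respect to the i-th measure, i = 0, ..., m. *)
Definition stoch_int (m : nat) (nu : 'I_m.+1 -> R.-ker Omega ~> (R * Y)%type)
    (i : 'I_m.+1) (a b : R) (xi : R -> Y -> Omega -> R) (Z : Omega -> R) :
    Prop :=
  if i == ord0 then ordinary_int a b xi Z else martingale_int (nu i) a b xi Z.

(* Z is a version of the iterated integral of chi_1, ..., chi_k over [t, T].
   J l s is the l-fold iterated integral with upper limit s. *)
Definition iterated_int (m : nat)
    (nu : 'I_m.+1 -> R.-ker Omega ~> (R * Y)%type) (t T : R) (k : nat)
    (i : 'I_k -> 'I_m.+1) (chi : 'I_k -> R -> Y -> R) (Z : Omega -> R) : Prop :=
  exists J : nat -> R -> Omega -> R,
    [/\ forall s w, J 0%N s w = 1,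
        forall (l : 'I_k) (s : R), s \in `[t, T] ->
          stoch_int nu (i l) t s
            (fun tau y w => chi l tau y * J l tau w) (J l.+1 s) &
        Z = J k T].

End stochastic_integral.

Section deterministic_notions.
Context {R : realType}.
Local Notation mu := (@lebesgue_measure R).

(* Condition (star): right continuity, and continuity except at finitely many
   points with finite one-sided limits. *)
Definition star_condition (t T : R) (f : R -> R) : Prop :=
  [/\ exists D : seq R, forall x, x \in `[t, T] -> x \notin D ->
        f @ within `[t, T] (nbhs x) --> f x,
      forall x, x \in `[t, T[ -> f @ at_right x --> f x &
      forall x, x \in `]t, T] -> cvg (f @ at_left x)].

Definition square_integrable (t T : R) (f : R -> R) : Prop :=
  measurable_fun `[t, T] f /\
  (\int[mu]_(x in `[t, T]) (f x ^+ 2)%:E < +oo)%E.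

Definition orthonormal_system (t T : R) (f : nat -> R -> R) : Prop :=
  (forall j, square_integrable t T (f j)) /\
  (forall j j', (\int[mu]_(x in `[t, T]) (f j x * f j' x))%R = (j == j')%:R).

(* The finite linear combinations are dense in L_2([t, T]). *)
Definition complete_system (t T : R) (f : nat -> R -> R) : Prop :=
  forall h, square_integrable t T h -> forall e : R, 0 < e ->
    exists (N : nat) (c : nat -> R),
      (\int[mu]_(x in `[t, T]) ((h x - \sum_(j < N) c j * f j x) ^+ 2)%:E
         < e%:E)%E.

(* The integral over the cube [t, T]^k, as a k-fold iterated Lebesgue
   integral; it is used for bounded, almost everywhere continuous f. *)
Fixpoint cube_int (t T : R) (k : nat) : (k.-tuple R -> R) -> R :=
  match k with
  | 0%N => fun f => f [tuple]
  | k'.+1 => fun f =>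
      \int[mu]_(x in `[t, T])
        cube_int t T (fun s : k'.-tuple R => f [tuple of x :: s])
  end.

(* For k = 1 the sorting condition is void. *)
Definition volterra_kernel (k : nat) (psi : 'I_k -> R -> R) (s : k.-tuple R) :
    R :=
  if sorted <%R s then \prod_(l < k) psi l (tnth s l) else 0.

Definition fourier_coef (t T : R) (k : nat) (psi : 'I_k -> R -> R)
    (f : nat -> R -> R) (j : 'I_k -> nat) : R :=
  cube_int t T (fun s : k.-tuple R =>
    volterra_kernel psi s * \prod_(l < k) f (j l) (tnth s l)).

End deterministic_notions.

(* Main.v *)
(** For weights [Phi] on the grid of the N-th partition put
    [X_N(Phi) = sum_(l injective) Phi(l) prod_g S N g (l_g)].  If [l_g] is the
    largest index, the sum over the other ones is known at time [tau_(l_g)];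
    peeling off [g], the isometry of the integral (Cauchy-Schwarz if [i_g = 0])
    and induction on [k] give
    [E X_N(Phi)^2 <= c sum_l Phi(l)^2 prod_g Delta_(l_g)], [c] independent of [N].

    - For the Volterra kernel [K], [X_N(K)] converges to the iterated integral:
      on increasing indices the sum is an iterated Riemann sum.
    - For [Phi = prod_g f_(j_g)], [X_N(Phi)] is Cauchy: replace [Phi] by a
      function constant on the boxes of a fixed coarser partition.  On a box the
      sum factorizes, and the product of the factors converges in L2 because the
      Riemann sums are bounded in L^q, q = 2^(k+1) > 2k.
    - The sum over all [l] is the product of the Riemann sums of the [pi_g], so
      the sum over the non-injective [l] converges as well, and the bracket in
      the expansion is exactly [lim X_N(prod_g f_(j_g))].

    By the bound, the error of a partial sum is at most
    [c lim_N sum_l (K - sum_j C_j prod_g f_(j_g))^2 prod_g Delta_(l_g)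
     = c (int K^2 - sum_j C_j^2)], which Parseval's identity, applied one
    variable at a time, sends to 0.

    The [pi_g] are mean-square limits of linear combinations of compensated
    counts of rectangles, hence almost surely equal to variables that are
    measurable for the sigma-algebra of [nu^(i_g)]; this gives independence. *)

Require Import Defs.
From HB Require Import structures.
From mathcomp Require Import all_boot all_order all_algebra.
From mathcomp Require Import all_classical all_reals all_analysis.
From mathcomp Require Import measurable_realfun.
From mathcomp Require Import zify ring lra.

Set Implicit Arguments.
Unset Strict Implicit.
Unset Printing Implicit Defensive.

Import Order.TTheory GRing.Theory Num.Theory.
Import numFieldNormedType.Exports.

Local Open Scope classical_set_scope.
Local Open Scope ring_scope.

(** * Square integrable functions *)

(** [Pi] need not be sigma-finite, while Fubini is used throughout. Square integrability puts the
    carriers of the finitely many [phi g] into a countable union [D] of sets of finite measure, and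
    integrals are taken against the restriction [PiD]; what step functions do outside [D] counts as
    approximation error. Stochastic integrals are fixed only almost surely and the filtration need
    not be complete, so integration is a relation between integrand and variable, and adaptedness
    means having an adapted version. The record [kernel] keeps what ordinary and martingale
    integrals share; factors are never compared with one another, so several may use the same noise.
    The moment bounds come from the Chen-Stein identity: it yields the moment-cumulant recursion for
    sums of independent compensated counts, whose cumulants are bounded, uniformly in the partition,
    by a multiple of the integral of [phi^2 + |phi|^q]. To reach such finite sums, [phi] is rounded
    to simple functions. *)

Lemma cvg0_le (R : realType) (u v : nat -> R) :
  (forall n, 0 <= u n <= v n) -> v @ \oo --> 0 -> u @ \oo --> 0.
Proof.
move=> uv v0; apply: (squeeze_cvgr _ (cvg_cst 0) v0).
by apply: nearW => n; exact: uv.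
Qed.

Section square_integrable_functions.
Context {d : measure_display} {T : measurableType d} {R : realType}.
Variable m : {measure set T -> \bar R}.
Implicit Types X Y Z : T -> R.

Definition int1 X := m.-integrable setT (fun x => (X x)%:E).

Definition L2 X :=
  measurable_fun setT X /\ (\int[m]_x ((X x) ^+ 2)%:E < +oo)%E.

Definition ip X Y : R := \int[m]_x (X x * Y x).

(** The squared norm. A divergent integral is read as 0 by [fine], so a bound on [e2] carries
    information only together with [L2]. *)
Definition e2 X : R := ip X X.

Lemma eq_int1 X Y : (forall x, X x = Y x) -> int1 X -> int1 Y.
Proof. by move=> /funext ->. Qed.

Lemma int1_meas X : int1 X -> measurable_fun setT X.
Proof. by move=> /integrableP[/measurable_EFinP]. Qed.

Lemma int1_le X Y : measurable_fun setT X -> int1 Y ->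
  (forall x, `|X x| <= `|Y x|) -> int1 X.
Proof.
move=> mX iY XY; apply: le_integrable iY => //; first exact/measurable_EFinP.
by move=> x _ /=; rewrite lee_fin.
Qed.

Lemma int1D X Y : int1 X -> int1 Y -> int1 (fun x => X x + Y x).
Proof.
by move=> iX iY; have := integrableD measurableT iX iY;
   apply: eq_integrable => // x _ /=; rewrite EFinD.
Qed.

Lemma int1Z c X : int1 X -> int1 (fun x => c * X x).
Proof. by move=> iX; have := integrableZl measurableT c iX. Qed.

Lemma int1_sum (I : Type) (s : seq I) (X : I -> T -> R) :
  (forall i, int1 (X i)) -> int1 (fun x => \sum_(i <- s) X i x).
Proof.
move=> iX; elim: s => [|a s IH].
  by apply: (@eq_int1 (fun=> 0)) => [x|]; [rewrite big_nil|exact: integrable0].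
by apply: eq_int1 (int1D (iX a) IH) => x; rewrite big_cons.
Qed.

Lemma RintD X Y : int1 X -> int1 Y ->
  \int[m]_x (X x + Y x) = \int[m]_x X x + \int[m]_x Y x.
Proof. by move=> iX iY; exact: RintegralD. Qed.

Lemma RintZ c X : int1 X -> \int[m]_x (c * X x) = c * \int[m]_x X x.
Proof. by move=> iX; exact: RintegralZl. Qed.

Lemma Rint_sum (I : Type) (s : seq I) (X : I -> T -> R) :
  (forall i, int1 (X i)) ->
  \int[m]_x (\sum_(i <- s) X i x) = \sum_(i <- s) \int[m]_x X i x.
Proof.
move=> iX; elim: s => [|a s IH].
  under eq_Rintegral do rewrite big_nil.
  by rewrite big_nil /Rintegral integral0.
under eq_Rintegral do rewrite big_cons.
by rewrite RintD// ?big_cons ?IH//; exact: int1_sum.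
Qed.

Lemma Rint_le X Y : int1 X -> int1 Y -> (forall x, X x <= Y x) ->
  \int[m]_x X x <= \int[m]_x Y x.
Proof. by move=> iX iY XY; exact: le_Rintegral. Qed.

Lemma Rint_EFin X : int1 X ->
  (\int[m]_x X x)%:E = (\int[m]_x (X x)%:E)%E.
Proof.
by move=> iX; rewrite /Rintegral fineK//; exact: integrable_fin_num.
Qed.

Lemma L2_meas X : L2 X -> measurable_fun setT X.
Proof. by case. Qed.

Lemma ge0_int1 X : measurable_fun setT X -> (forall x, 0 <= X x) ->
  (\int[m]_x (X x)%:E < +oo)%E -> int1 X.
Proof.
move=> mX X0 Xoo; apply/integrableP; split; first exact/measurable_EFinP.
by under eq_integral do rewrite abse_EFin ger0_norm//.
Qed.

Lemma L2_int1 X : L2 X -> int1 (fun x => X x ^+ 2).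
Proof.
move=> [mX Xoo]; apply: ge0_int1 => //; last by move=> x; exact: sqr_ge0.
exact: measurable_funX.
Qed.

Lemma int1_L2 X : measurable_fun setT X -> int1 (fun x => X x ^+ 2) -> L2 X.
Proof.
move=> mX iX; split => //.
exact: integrable_lty iX.
Qed.

Lemma L2_mul X Y : L2 X -> L2 Y -> int1 (fun x => X x * Y x).
Proof.
move=> LX LY; apply: (@int1_le _ (fun x => X x ^+ 2 + Y x ^+ 2)).
- by apply: measurable_funM; exact: L2_meas.
- by apply: int1D; exact: L2_int1.
- move=> x; rewrite [leRHS]ger0_norm ?addr_ge0 ?sqr_ge0//.
  rewrite ler_norml; apply/andP; split; nra.
Qed.

Lemma L20 : L2 (fun=> 0).
Proof.
split; first exact: measurable_cst.
by rewrite integral0_eq// => x _; rewrite expr0n.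
Qed.

Lemma L2D X Y : L2 X -> L2 Y -> L2 (fun x => X x + Y x).
Proof.
move=> LX LY; apply: int1_L2.
  by apply: measurable_funD; exact: L2_meas.
apply: (@int1_le _ (fun x => 2 * X x ^+ 2 + 2 * Y x ^+ 2)).
- by apply: measurable_funX; apply: measurable_funD; exact: L2_meas.
- by apply: int1D; apply: int1Z; exact: L2_int1.
- move=> x; rewrite !ger0_norm ?sqr_ge0 ?addr_ge0//; try by rewrite mulr_ge0 ?sqr_ge0.
  by have := sqr_ge0 (X x - Y x); nra.
Qed.

Lemma L2Z c X : L2 X -> L2 (fun x => c * X x).
Proof.
move=> LX; apply: int1_L2; first exact: measurable_funM (L2_meas LX).
under [X in int1 X]eq_fun do rewrite exprMn.
exact/int1Z/L2_int1.
Qed.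

Lemma L2B X Y : L2 X -> L2 Y -> L2 (fun x => X x - Y x).
Proof.
move=> LX LY; under [X in L2 X]eq_fun do rewrite -mulN1r.
exact/L2D/L2Z.
Qed.

Lemma L2_sum (I : Type) (s : seq I) (P : pred I) (X : I -> T -> R) :
  (forall i, P i -> L2 (X i)) -> L2 (fun x => \sum_(i <- s | P i) X i x).
Proof.
move=> LX; elim: s => [|a s IH].
  by under [X in L2 X]eq_fun do rewrite big_nil; exact: L20.
under [X in L2 X]eq_fun do rewrite big_cons.
by case: (boolP (P a)) => // Pa; apply: L2D => //; exact: LX.
Qed.

Lemma L2_bounded_mul X Y (M : R) : measurable_fun setT X -> (forall x, `|X x| <= M) ->
  L2 Y -> L2 (fun x => X x * Y x).
Proof.
move=> mX XM LY; apply: int1_L2.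
  by apply: measurable_funM => //; exact: L2_meas.
apply: (@int1_le _ (fun x => M ^+ 2 * Y x ^+ 2)).
- by apply: measurable_funX; apply: measurable_funM => //; exact: L2_meas.
- exact/int1Z/L2_int1.
- move=> x; rewrite exprMn [leLHS]normrM [leRHS]normrM; apply: ler_wpM2r => //; rewrite !normrX.
  by rewrite ler_pXn2r ?nnegrE// (le_trans (XM x))// ler_norm.
Qed.

Lemma ipC X Y : ip X Y = ip Y X.
Proof. by rewrite /ip; under eq_Rintegral do rewrite mulrC. Qed.

Lemma ipDl X Y Z : L2 X -> L2 Y -> L2 Z ->
  ip (fun x => X x + Y x) Z = ip X Z + ip Y Z.
Proof.
move=> LX LY LZ; rewrite /ip.
by under eq_Rintegral do rewrite mulrDl; rewrite RintD//; exact: L2_mul.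
Qed.

Lemma ipDr X Y Z : L2 X -> L2 Y -> L2 Z ->
  ip Z (fun x => X x + Y x) = ip Z X + ip Z Y.
Proof. by move=> *; rewrite ipC ipDl// ipC [ip Y Z]ipC. Qed.

Lemma ipZl c X Z : L2 X -> L2 Z -> ip (fun x => c * X x) Z = c * ip X Z.
Proof.
move=> LX LZ; rewrite /ip.
by under eq_Rintegral do rewrite -mulrA; rewrite RintZ//; exact: L2_mul.
Qed.

Lemma ip_suml (I : Type) (s : seq I) (X : I -> T -> R) Z :
  (forall i, L2 (X i)) -> L2 Z ->
  ip (fun x => \sum_(i <- s) X i x) Z = \sum_(i <- s) ip (X i) Z.
Proof.
move=> LX LZ; rewrite /ip; under eq_Rintegral do rewrite mulr_suml.
by rewrite Rint_sum// => i; exact: L2_mul.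
Qed.

Lemma e2E X : e2 X = \int[m]_x (X x ^+ 2).
Proof. by []. Qed.

Lemma e2_ge0 X : 0 <= e2 X.
Proof. by apply: Rintegral_ge0 => x _; rewrite -expr2 sqr_ge0. Qed.

Lemma e2_EFin X : L2 X -> (e2 X)%:E = (\int[m]_x (X x ^+ 2)%:E)%E.
Proof. by move=> LX; rewrite e2E Rint_EFin//; exact: L2_int1. Qed.

Lemma e2_le_EFin X c : L2 X -> (\int[m]_x (X x ^+ 2)%:E <= c%:E)%E -> e2 X <= c.
Proof. by move=> LX; rewrite -e2_EFin// lee_fin. Qed.

Lemma e2Z c X : L2 X -> e2 (fun x => c * X x) = c ^+ 2 * e2 X.
Proof.
by move=> LX; rewrite /e2 ipZl//; [rewrite ipC ipZl// mulrA|exact: L2Z].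
Qed.

Lemma e2D X Y : L2 X -> L2 Y ->
  e2 (fun x => X x + Y x) = e2 X + 2 * ip X Y + e2 Y.
Proof.
move=> LX LY; rewrite /e2 ipDl//; last exact: L2D.
rewrite ipC ipDl// [X in _ + X]ipC ipDl// (ipC Y X); ring.
Qed.

Lemma e2B X Y : L2 X -> L2 Y ->
  e2 (fun x => X x - Y x) = e2 X - 2 * ip X Y + e2 Y.
Proof.
move=> LX LY; under [X in e2 X]eq_fun do rewrite -mulN1r.
rewrite e2D//; last exact: L2Z.
rewrite e2Z// ipC ipZl// (ipC Y X); ring.
Qed.

Lemma e2_subC X Y : e2 (fun x => X x - Y x) = e2 (fun x => Y x - X x).
Proof. by rewrite !e2E; apply: eq_Rintegral => x _; ring. Qed.

Lemma e2D_le X Y : L2 X -> L2 Y ->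
  e2 (fun x => X x + Y x) <= 2 * e2 X + 2 * e2 Y.
Proof.
move=> LX LY; have := e2_ge0 (fun x => X x - Y x).
by rewrite e2B// e2D//; lra.
Qed.

Lemma e2_dist X Y Z : L2 X -> L2 Y -> L2 Z ->
  e2 (fun x => X x - Z x) <=
  2 * e2 (fun x => X x - Y x) + 2 * e2 (fun x => Y x - Z x).
Proof.
move=> LX LY LZ.
rewrite (_ : (fun x => X x - Z x) = (fun x => (X x - Y x) + (Y x - Z x))).
  by apply: e2D_le; exact: L2B.
by apply/funext => x; ring.
Qed.

(** [e2] of [X - c Y] is nonnegative for every [c]. For [e2 Y = 0] it is affine in [c], and the [c]
    tried there makes it equal to [- e2 X - 2] unless [ip X Y = 0]; otherwise [c] is the
    minimiser. *)
Lemma cauchy_schwarz X Y : L2 X -> L2 Y -> ip X Y ^+ 2 <= e2 X * e2 Y.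
Proof.
move=> LX LY.
have H c : 0 <= e2 X - 2 * c * ip X Y + c ^+ 2 * e2 Y.
  have := e2_ge0 (fun x => X x - c * Y x).
  rewrite e2B//; last exact: L2Z.
  by rewrite e2Z// ipC ipZl// (ipC Y X) mulrA.
have [Y0|Y0] := eqVneq (e2 Y) 0.
  rewrite Y0 mulr0; have := H ((e2 X + 1) / ip X Y).
  have [->|XY0] := eqVneq (ip X Y) 0; first by rewrite expr0n.
  rewrite Y0 mulr0 addr0 -mulrA mulrVK ?unitfE//.
  by have := e2_ge0 X; lra.
have Yp : 0 < e2 Y by rewrite lt_def Y0 e2_ge0.
have := H (ip X Y / e2 Y).
rewrite -(pmulr_lge0 _ Yp) => H'; rewrite -subr_ge0.
by apply: le_trans H' _; rewrite le_eqVlt; apply/orP; left; apply/eqP; field.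
Qed.

Lemma ip_small X Y a b : L2 X -> L2 Y -> 0 <= a -> 0 <= b ->
  e2 X <= a ^+ 2 -> e2 Y <= b ^+ 2 -> `|ip X Y| <= a * b.
Proof.
move=> LX LY a0 b0 Xa Yb.
rewrite -(@ler_pXn2r _ 2)// ?nnegrE ?mulr_ge0//.
rewrite real_normK ?num_real// exprMn (le_trans (cauchy_schwarz LX LY))//.
by rewrite ler_pM ?e2_ge0.
Qed.

Lemma e2_sum_le (I : finType) (P : pred I) (X : I -> T -> R) :
  (forall i, P i -> L2 (X i)) ->
  e2 (fun x => \sum_(i | P i) X i x) <= #|I|%:R * \sum_(i | P i) e2 (X i).
Proof.
move=> LX.
have -> : \sum_(i | P i) e2 (X i) = \int[m]_x (\sum_(i | P i) X i x ^+ 2).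
  transitivity (\int[m]_x (\sum_i (if P i then X i x else 0) ^+ 2)).
    rewrite Rint_sum; last first.
      move=> i; case: (boolP (P i)) => Pi; first exact/L2_int1/LX.
      exact/L2_int1/L20.
    rewrite [LHS]big_mkcond; apply: eq_bigr => i _; case: (boolP (P i)) => Pi //.
    by rewrite /Rintegral integral0_eq// => x _; rewrite expr0n.
  apply: eq_Rintegral => x _; rewrite [RHS]big_mkcond; apply: eq_bigr => i _.
  by case: ifP => //; rewrite expr0n.
rewrite -RintZ; last first.
  under [X in int1 X]eq_fun do rewrite big_mkcond.
  apply: int1_sum => i; case: (boolP (P i)) => Pi; first exact/L2_int1/LX.
  by apply: eq_int1 (L2_int1 L20) => x; rewrite expr0n.
rewrite e2E; apply: Rint_le.
- exact/L2_int1/L2_sum.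
- apply: int1Z; under [X in int1 X]eq_fun do rewrite big_mkcond.
  apply: int1_sum => i; case: (boolP (P i)) => Pi; first exact/L2_int1/LX.
  by apply: eq_int1 (L2_int1 L20) => x; rewrite expr0n.
- move=> x.
  (* Pointwise Cauchy-Schwarz against the constant 1, by induction on the list; the square of
     [n a - S] supplies the mixed term. *)
  have cs (s : seq I) (a : I -> R) :
      (\sum_(i <- s) a i) ^+ 2 <= (size s)%:R * \sum_(i <- s) a i ^+ 2.
    elim: s => [|i s IH]; first by rewrite !big_nil mulr0 expr0n.
    rewrite !big_cons [size _]/=.
    set S := \sum_(j <- s) a j in IH *; set Q := \sum_(j <- s) a j ^+ 2 in IH *.
    have Q0 : 0 <= Q by apply: sumr_ge0 => j _; exact: sqr_ge0.
    rewrite -natr1 sqrrD.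
    have [s0|s0] := posnP (size s).
      rewrite s0 mul0r in IH.
      have S0 : S = 0 by apply/eqP; rewrite -sqrf_eq0; apply/eqP/le_anti; rewrite IH sqr_ge0.
      by rewrite S0 s0; nra.
    have n0 : 0 < (size s)%:R :> R by rewrite ltr0n.
    have : 0 <= ((size s)%:R * a i - S) ^+ 2 by exact: sqr_ge0.
    set n := (size s)%:R in IH n0 * => H.
    rewrite -(ler_pM2l n0); nra.
  rewrite big_mkcond [X in _ <= _ * X]big_mkcond/= (le_trans (cs _ _))//.
  rewrite cardE enumT ler_wpM2l// le_eqVlt; apply/orP; left; apply/eqP.
  by apply: eq_bigr => i _; case: ifP; rewrite ?expr0n.
Qed.

Lemma Rint_ae X Y : measurable_fun setT X -> measurable_fun setT Y ->
  {ae m, forall x, X x = Y x} -> \int[m]_x X x = \int[m]_x Y x.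
Proof.
move=> mX mY XY; congr fine; apply: ae_eq_integral => //.
- exact/measurable_EFinP.
- exact/measurable_EFinP.
- by apply: filterS XY => x XY _; rewrite XY.
Qed.

Lemma L2_ae X Y : measurable_fun setT Y ->
  {ae m, forall x, X x = Y x} -> L2 X -> L2 Y.
Proof.
move=> mY XY [mX Xoo]; split => //.
rewrite -(@ae_eq_integral _ _ _ m _ _ (fun x => (X x ^+ 2)%:E))//.
- by apply/measurable_EFinP; exact: measurable_funX.
- by apply/measurable_EFinP; exact: measurable_funX.
- by apply: filterS XY => x XY _; rewrite XY.
Qed.

Lemma ip_ae X Y X' Y' :
  measurable_fun setT X -> measurable_fun setT Y ->
  measurable_fun setT X' -> measurable_fun setT Y' ->
  {ae m, forall x, X x = X' x} -> {ae m, forall x, Y x = Y' x} ->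
  ip X Y = ip X' Y'.
Proof.
move=> mX mY mX' mY' XX YY; apply: Rint_ae.
- exact: measurable_funM.
- exact: measurable_funM.
- by apply: filterS2 XX YY => x -> ->.
Qed.

Lemma e2_ae X Y : measurable_fun setT X -> measurable_fun setT Y ->
  {ae m, forall x, X x = Y x} -> e2 X = e2 Y.
Proof. by move=> mX mY XY; exact: ip_ae. Qed.

Lemma e2_eq0 X : L2 X -> e2 X = 0 -> {ae m, forall x, X x = 0}.
Proof.
move=> LX X0; have mX := L2_meas LX.
have := @ae_eq_integral_abs _ _ _ m _ measurableT (fun x => (X x ^+ 2)%:E).
move=> /(_ _)/iffLR h.
have : \forall x \ae m, setT x -> (X x ^+ 2)%:E = cst 0%E x.
  apply: h; first by apply/measurable_EFinP; exact: measurable_funX.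
  under eq_integral do rewrite abse_EFin ger0_norm ?sqr_ge0//.
  by rewrite -e2_EFin// X0.
apply: filterS => x /(_ I) /= [] /eqP; rewrite sqrf_eq0 => /eqP ->.
by [].
Qed.

Lemma ae_e2_0 X : measurable_fun setT X -> {ae m, forall x, X x = 0} -> e2 X = 0.
Proof.
move=> mX X0; rewrite (@e2_ae X (fun=> 0))//.
by rewrite /e2 /ip /Rintegral integral0_eq// => x _; rewrite mulr0.
Qed.

Lemma e2_sumE (I : Type) (s : seq I) (X : I -> T -> R) :
  (forall i, L2 (X i)) -> e2 (fun x => \sum_(i <- s) X i x) =
  \sum_(i <- s) \sum_(j <- s) ip (X i) (X j).
Proof.
move=> LX; rewrite /e2 ip_suml//; last exact: L2_sum.
apply: eq_bigr => i _; rewrite ipC ip_suml//.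
by apply: eq_bigr => j _; exact: ipC.
Qed.

(** The defect [e2 (Xn n) - e2 X] is a small square plus twice [ip (Xn n - X) X], which
    Cauchy-Schwarz controls. *)
Lemma e2_cvg_cont X (Xn : nat -> T -> R) :
  L2 X -> (forall n, L2 (Xn n)) ->
  (fun n => e2 (fun x => Xn n x - X x)) @ \oo --> 0 ->
  e2 (Xn n) @[n --> \oo] --> e2 X.
Proof.
move=> LX LXn cvg.
have E n : e2 (Xn n) = e2 X + 2 * ip (fun x => Xn n x - X x) X
    + e2 (fun x => Xn n x - X x).
  rewrite [in RHS]e2B// /e2.
  have -> : ip (fun x => Xn n x - X x) X = ip (Xn n) X - ip X X.
    under [X in ip X]eq_fun do rewrite -mulN1r.
    by rewrite ipDl// ?ipZl ?mulN1r//; exact: L2Z.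
  ring.
rewrite (funext E) [X in _ --> X](_ : _ = e2 X + 2 * 0 + 0); last by rewrite mulr0 !addr0.
apply: cvgD => //; apply: cvgD; first exact: cvg_cst.
apply: cvgM; first exact: cvg_cst.
apply/norm_cvg0P.
apply: (@cvg0_le _ _
  (fun n => Num.sqrt (e2 (fun x => Xn n x - X x)) * Num.sqrt (e2 X))).
- move=> n; rewrite normr_ge0/=; apply: ip_small => //.
  + exact: L2B.
  + by rewrite sqr_sqrtr// e2_ge0.
  + by rewrite sqr_sqrtr// e2_ge0.
- rewrite -(mul0r (Num.sqrt (e2 X))) -{1}(@sqrtr0 R).
  apply: cvgM; last exact: cvg_cst.
  by apply: (cvg_comp _ _ cvg); exact: sqrt_continuous.
Qed.

End square_integrable_functions.

Section measurability_wrt_subsigma_algebra.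
Context {d : measure_display} {T : measurableType d}.
Context {d' : measure_display} {V : measurableType d'}.

(** Adaptedness is stated by inclusion of preimages; here it becomes [measurable_fun] on the same
    space retyped by [G], where the closure properties of measurable functions are at hand. *)
Lemma sub_preimageP (G : set_system T) (X : T -> V) : sigma_algebra setT G ->
  g_sigma_algebra_preimage X `<=` G <->
  measurable_fun setT (X : g_sigma_algebraType G -> V).
Proof.
move=> sG; split => [XG mT B mB|mX _ [B mB <-]].
  rewrite /measurable/= sigma_algebra_id//; apply: XG; by exists B.
by have := mX measurableT B mB; rewrite /measurable/= sigma_algebra_id.
Qed.

Lemma sub_preimage_measurable (G : set_system T) (X : T -> V) :
  G `<=` measurable -> g_sigma_algebra_preimage X `<=` G ->
  measurable_fun setT X.
Proof. by move=> Gm XG _ B mB; apply: Gm; apply: XG; exists B. Qed.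

End measurability_wrt_subsigma_algebra.

Lemma cvg_expr (R : realType) (u : nat -> R) (l : R) p :
  u @ \oo --> l -> u n ^+ p @[n --> \oo] --> l ^+ p.
Proof.
move=> ul; elim: p => [|p IH]; first exact: cvg_cst.
under eq_fun do rewrite exprS; rewrite exprS; exact: cvgM.
Qed.

(** * Completeness of L2 and almost everywhere limits *)

Section riesz_fischer.
Context {d : measure_display} {T : measurableType d} {R : realType}.
Variable P : probability T R.
Implicit Types X Y Z : T -> R.

Lemma L2_cst c : L2 P (fun=> c).
Proof.
split; first exact: measurable_cst.
by rewrite integral_cst//= probability_setT mule1 ltry.
Qed.

Lemma L2_L1 X : L2 P X -> int1 P X.
Proof. by move=> LX; apply: eq_int1 (L2_mul LX (L2_cst 1)) => x; rewrite mulr1. Qed.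

(** Fatou for the lower limit, which coincides almost everywhere with the given measurable [g]. *)
Lemma fatou_ae (f : nat -> T -> R) (g : T -> R) (C : R) :
  (forall n, measurable_fun setT (f n)) -> measurable_fun setT g ->
  (forall n x, 0 <= f n x) ->
  {ae P, forall x, f ^~ x @ \oo --> g x} ->
  (forall n, \int[P]_x (f n x)%:E <= C%:E)%E ->
  (\int[P]_x (g x)%:E <= C%:E)%E.
Proof.
move=> mf mg f0 fg fC.
have mfE n : measurable_fun setT (EFin \o f n) by exact/measurable_EFinP.
rewrite (@ae_eq_integral _ _ _ P _ (fun x => limn_einf (fun n => (f n x)%:E)))//.
- apply: le_trans (@fatou _ _ _ P _ measurableT (fun n => EFin \o f n) mfE _) _.
    by move=> n x _; rewrite lee_fin.
  rewrite limn_einf_lim; apply: lime_le; first exact: is_cvg_einfs.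
  apply: nearW => n; apply: le_trans (fC n); apply: ereal_inf_lbound.
  by exists n => /=.
- exact/measurable_EFinP.
- rewrite (_ : (fun x => _) = (fun x => - limn_esup (fun n => (- f n x)%:E))%E).
    apply: measurableT_comp => //; apply: measurable_fun_limn_esup => n.
    by apply/measurable_EFinP; exact: measurableT_comp.
  apply/funext => x; rewrite /limn_einf; congr (- limn_esup _)%E.
- apply: filterS fg => x fg _; symmetry.
  have /cvg_limn_einf_sup[-> _] // : (fun n => (f n x)%:E) @ \oo --> (g x)%:E.
  by apply: cvg_EFin => //; exact: nearW.
Qed.

Lemma geometric_quarter_half n : ((4^-1 : R) ^+ n = 2^-1 ^+ n * 2^-1 ^+ n).
Proof. by rewrite -exprMn; congr (_ ^+ _); field. Qed.

(* Chebyshev in the form [|D| <= 2^n D^2 + 2^-n] makes the L1 norms summable. *)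
Lemma ae_normal_cvg (D : nat -> T -> R) :
  (forall n, L2 P (D n)) -> (forall n, e2 P (D n) <= 4^-1 ^+ n) ->
  {ae P, forall x, cvgn [normed series (D ^~ x)]}.
Proof.
move=> LD DE.
pose g x := (\sum_(n <oo) (`|D n x|)%:E)%E.
have mD n : measurable_fun setT (fun x => (`|D n x|)%:E).
  by apply/measurable_EFinP; apply: measurableT_comp => //; exact: L2_meas.
have mg : measurable_fun setT g.
  by apply: ge0_emeasurable_sum => // n x _ _; rewrite lee_fin.
have gfin : (\int[P]_x g x < +oo)%E.
  rewrite integral_nneseries//.
  have B n : (\int[P]_x (`|D n x|)%:E <= (2 * 2^-1 ^+ n)%:E)%E.
    have h0 : 0 < 2^-1 ^+ n :> R by rewrite exprn_gt0.
    have iD : int1 P (fun x => `|D n x|).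
      by apply: int1_le (L2_L1 (LD n)) _ => [|x]; [apply/measurable_EFinP; exact: mD|rewrite normr_id].
    rewrite -Rint_EFin// lee_fin.
    apply: le_trans (_ : \int[P]_x ((2^-1 ^+ n)^-1 * D n x ^+ 2 + 2^-1 ^+ n) <= _).
      apply: Rint_le => //.
        by apply: int1D; [exact/int1Z/L2_int1|exact/L2_L1/L2_cst].
      move=> x; rewrite -(ler_pM2l h0) mulrDr mulrA mulfV ?gt_eqF// mul1r.
      have := sqr_ge0 (`|D n x| - 2^-1 ^+ n).
      rewrite -[D n x ^+ 2]real_normK ?num_real//.
      have := normr_ge0 (D n x); set a := `|D n x|; set b := 2^-1 ^+ n in h0 *.
      by nra.
    rewrite RintD; [|exact/int1Z/L2_int1|exact/L2_L1/L2_cst].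
    rewrite RintZ; last exact/L2_int1.
    rewrite -e2E Rintegral_cst//= probability_setT mulr1.
    have := DE n; rewrite geometric_quarter_half => H.
    by rewrite mulr_natl mulr2n lerD2r ler_pdivrMl.
  apply: (@le_lt_trans _ _ (\sum_(n <oo) (2 * 2^-1 ^+ n)%:E)%E).
    by apply: lee_nneseries => n *; [exact: integral_ge0|exact: B].
  have c : (fun n => \sum_(0 <= i < n) (2 * 2^-1 ^+ i)%:E)%E @ \oo --> ((2 / (1 - 2^-1))%:E : \bar R).
    rewrite (_ : (fun n => _) = EFin \o series (geometric 2 2^-1)); last first.
      by apply/funext => n /=; rewrite sumEFin.
    apply: cvg_EFin; first exact: nearW.
    by apply: cvg_geometric_series; rewrite ger0_norm//; lra.
  by move/cvg_lim : c => -> //; rewrite ltry.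
have ig : P.-integrable setT g.
  apply/integrableP; split => //; under eq_integral do rewrite gee0_abs ?nneseries_ge0//.
  exact: gfin.
have := integrable_ae measurableT ig; apply: filterS => x /(_ I) gx.
apply: nondecreasing_is_cvgn.
  by rewrite (_ : [normed series _] = series (fun n => `|D n x|))//; exact: nondecreasing_series.
exists (fine (g x)) => _ [n _ <-].
rewrite -lee_fin fineK// /series/= -sumEFin.
by apply: nneseries_lim_ge => k _ _; rewrite lee_fin.
Qed.

Lemma subseq_choice (Q : nat -> nat -> Prop) :
  (forall k, exists N, forall n, (N <= n)%N -> Q k n) ->
  exists phi : nat -> nat, forall k, (k <= phi k)%N /\ Q k (phi k).
Proof.
move=> H; have [k|phi Hphi] := @choice _ _ (fun k n => (k <= n)%N /\ Q k n).
  have [N HN] := H k; exists (maxn k N); split; first exact: leq_maxl.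
  exact/HN/leq_maxr.
by exists phi.
Qed.

Lemma L2_subseq (X : nat -> T -> R) Z : L2 P Z -> (forall n, L2 P (X n)) ->
  (fun n => e2 P (fun x => X n x - Z x)) @ \oo --> 0 ->
  exists phi : nat -> nat, (forall k, (k <= phi k)%N) /\
    {ae P, forall x, X (phi k) x @[k --> \oo] --> Z x}.
Proof.
move=> LZ LX XZ.
have [phi Hphi] : exists phi : nat -> nat,
    forall k, (k <= phi k)%N /\ e2 P (fun x => X (phi k) x - Z x) <= 4^-1 ^+ k.
  apply: (@subseq_choice (fun k n => e2 P (fun x => X n x - Z x) <= 4^-1 ^+ k)) => k.
  have k0 : 0 < 4^-1 ^+ k :> R by rewrite exprn_gt0.
  move/cvgrPdist_le : XZ => /(_ _ k0)[N _ HN]; exists N => n Nn.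
  by have := HN n Nn; rewrite sub0r normrN; apply: le_trans; exact: ler_norm.
exists phi; split => [k|]; first by have [] := Hphi k.
have := @ae_normal_cvg (fun k x => X (phi k) x - Z x)
  (fun k => L2B (LX _) LZ) (fun k => (Hphi k).2).
apply: filterS => x /normed_cvg/cvg_series_cvg_0 H.
have -> : (fun k => X (phi k) x) = (fun k => (X (phi k) x - Z x) + Z x).
  by apply/funext => k; rewrite subrK.
by rewrite -[X in _ --> X]add0r; apply: cvgD => //; exact: cvg_cst.
Qed.

(** A subsequence converges almost everywhere and Fatou carries the moment bound over, so
    mean-square convergence is enough even for a high power [p]. *)
Lemma moment_limit (X : nat -> T -> R) Z p C : L2 P Z -> (forall n, L2 P (X n)) ->
  (fun n => e2 P (fun x => X n x - Z x)) @ \oo --> 0 ->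
  (forall n, \int[P]_x (`|X n x| ^+ p)%:E <= C%:E)%E ->
  (\int[P]_x (`|Z x| ^+ p)%:E <= C%:E)%E.
Proof.
move=> LZ LX /(L2_subseq LZ LX)[phi [_ aephi]] XC.
apply: (@fatou_ae (fun k x => `|X (phi k) x| ^+ p)) => //.
- move=> n; apply: measurable_funX; apply: measurableT_comp => //.
  exact: L2_meas (LX _).
- by apply: measurable_funX; apply: measurableT_comp => //; exact: L2_meas LZ.
- by apply: filterS aephi => x H; apply: cvg_expr; exact: cvg_norm.
Qed.

(** The limit is built from an upper limit defined at every point, not chosen up to null sets: this
    makes it exactly measurable for every sigma-algebra [G] that all the [X n] respect. *)
Lemma riesz_fischer (X : nat -> T -> R) : (forall n, L2 P (X n)) ->
  (forall e : R, 0 < e -> exists N, forall m n, (N <= m)%N -> (N <= n)%N ->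
     e2 P (fun x => X m x - X n x) <= e) ->
  exists Z, [/\ L2 P Z, (fun n => e2 P (fun x => X n x - Z x)) @ \oo --> 0 &
    forall G, sigma_algebra setT G ->
      (forall n, g_sigma_algebra_preimage (X n) `<=` G) ->
      g_sigma_algebra_preimage Z `<=` G].
Proof.
move=> LX cauchy.
have [phi Hphi] : exists phi : nat -> nat, forall k, (k <= phi k)%N /\
    (forall n, (phi k <= n)%N -> e2 P (fun x => X n x - X (phi k) x) <= 4^-1 ^+ k).
  apply: (@subseq_choice (fun k n => forall n', (n <= n')%N ->
    e2 P (fun x => X n' x - X n x) <= 4^-1 ^+ k)) => k.
  have [N HN] := cauchy (4^-1 ^+ k) ltac:(by rewrite exprn_gt0).
  by exists N => n Nn n' nn'; apply: HN => //; exact: leq_trans nn'.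
(* The running maximum makes the subsequence nondecreasing, so consecutive terms lie beyond the same
   threshold [phi k]. *)
pose psi k := (\max_(i < k.+1) phi i)%N.
have phipsi k : (phi k <= psi k)%N by exact: (leq_bigmax ord_max).
have psiS k : (psi k <= psi k.+1)%N.
  by rewrite /psi [leqRHS]big_ord_recr/= leq_max leqnn.
pose Y k := X (psi k).
have LY k : L2 P (Y k) by exact: LX.
(* Through [X (phi k)] the squared distance is at most [4 * 4^-k]; the factor [1/2] absorbs the
   4. *)
have DY k : e2 P (fun x => 2^-1 * (Y k.+1 x - Y k x)) <= 4^-1 ^+ k.
  rewrite e2Z; last exact: L2B.
  have h := e2_dist (LX (psi k.+1)) (LX (phi k)) (LX (psi k)).
  rewrite [X in _ <= _ + 2 * X]e2_subC in h.
  have h1 := (Hphi k).2 _ (leq_trans (phipsi k) (psiS k)).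
  have h2 := (Hphi k).2 _ (phipsi k).
  by rewrite /Y; lra.
have aeY : {ae P, forall x, cvgn (Y ^~ x)}.
  have := ae_normal_cvg (fun k => L2Z 2^-1 (L2B (LY k.+1) (LY k))) DY.
  apply: filterS => x /normed_cvg H.
  have E : (fun n => Y n x) = (fun n => Y 0%N x + 2 * [series 2^-1 * (Y k.+1 x - Y k x)]_k n).
    apply/funext => n; rewrite /series/= -mulr_sumr mulrA divff ?mul1r//.
    by rewrite telescope_sumr// addrC subrK.
  rewrite E; apply: is_cvgD; first exact: is_cvg_cst.
  by apply: is_cvgM => //; exact: is_cvg_cst.
pose Z x := fine (limn_esup (fun k => (Y k x)%:E)).
have aeZ : {ae P, forall x, Y k x @[k --> \oo] --> Z x}.
  apply: filterS aeY => x /cvg_ex[l Yl].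
  have /cvg_limn_einf_sup[_ h] : (fun n => (Y n x)%:E) @ \oo --> l%:E.
    by apply: cvg_EFin => //; exact: nearW.
  by rewrite /Z h.
have mZ G : sigma_algebra setT G ->
    (forall n, g_sigma_algebra_preimage (X n) `<=` G) ->
    g_sigma_algebra_preimage Z `<=` G.
  move=> sG XG; apply/sub_preimageP => //.
  apply: (measurableT_comp (fine_measurable measurableT)).
  apply: measurable_fun_limn_esup => n; apply/measurable_EFinP.
  by apply/sub_preimageP => //; exact: XG.
have mZT : measurable_fun setT Z.
  apply: (@sub_preimage_measurable _ _ _ _ measurable) => //; apply: mZ.
    exact: sigma_algebra_measurable.
  move=> n _ [B mB <-]; exact: (L2_meas (LX n)).
(* Fatou in the second index of the Cauchy condition; it gives the convergence and, with [e = 1],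
   the square integrability of [Z]. *)
have key n (e : R) : 0 <= e -> (forall k, (n <= k)%N -> e2 P (fun x => X n x - X k x) <= e) ->
    (\int[P]_x ((X n x - Z x) ^+ 2)%:E <= e%:E)%E.
  move=> e0 ne.
  apply: (@fatou_ae (fun k x => (X n x - Y (k + n)%N x) ^+ 2)) => //.
  - by move=> k; apply: measurable_funX; apply: measurable_funB; exact: L2_meas.
  - by apply: measurable_funX; apply: measurable_funB => //; exact: L2_meas.
  - by move=> k x; exact: sqr_ge0.
  - apply: filterS aeZ => x Zx.
    apply: cvg_expr; apply: cvgB; first exact: cvg_cst.
    by have := Zx; rewrite -(cvg_shiftn n).
  - move=> k; rewrite -e2_EFin; last exact: L2B.
    rewrite lee_fin; apply: ne.
    apply: leq_trans (phipsi _); apply: leq_trans (Hphi _).1; exact: leq_addl.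
have LXZ n : L2 P (fun x => X n x - Z x) -> L2 P Z.
  move=> h; have := L2B (LX n) h.
  by congr (L2 P _); apply/funext => x; ring.
have [N HN] := cauchy 1 ltr01.
have LZ : L2 P Z.
  apply: (LXZ N); split.
    by apply: measurable_funB => //; exact: L2_meas.
  apply: le_lt_trans (ltry 1); apply: key => // k Nk; exact: HN.
exists Z; split => //.
apply/cvgrPdist_le => e e0.
have [M HM] := cauchy e e0; exists M => // n /= Mn.
rewrite sub0r normrN ger0_norm ?e2_ge0//.
apply: e2_le_EFin; first exact: L2B.
by apply: key => [|k nk]; [exact: ltW|apply: HM => //; exact: leq_trans nk].
Qed.

End riesz_fischer.

(** * Independence and Poisson moments *)

Section independence.
Context {d : measure_display} {T : measurableType d} {R : realType}.
Variable P : probability T R.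

(** Independence says that the law of the pair and the product of the marginal laws agree on
    rectangles, hence everywhere; Fubini for the product then gives integrability and the
    factorization. *)
Lemma indep_prod (X Y : T -> R) :
  independent2 P (g_sigma_algebra_preimage X) (g_sigma_algebra_preimage Y) ->
  int1 P X -> int1 P Y ->
  int1 P (fun x => X x * Y x) /\
  \int[P]_x (X x * Y x) = (\int[P]_x X x) * (\int[P]_x Y x).
Proof.
have mnorm : measurable_fun [set: R] (fun y : R => (`|y|)%:E).
  by apply/measurable_EFinP; exact: normr_measurable.
have mid : measurable_fun [set: R] (fun y : R => y%:E).
  by apply/measurable_EFinP; exact: measurable_id.
move=> ind iX iY; have mX := int1_meas iX; have mY := int1_meas iY.
pose X' : {mfun T >-> R} := HB.pack X (isMeasurableFun.Build _ _ _ _ X mX).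
pose Y' : {mfun T >-> R} := HB.pack Y (isMeasurableFun.Build _ _ _ _ Y mY).
pose XY := fun w => (X w, Y w) : R * R.
have mXY : measurable_fun setT XY by exact/measurable_fun_pair.
pose XY' : {mfun T >-> (R * R)%type} :=
  HB.pack XY (isMeasurableFun.Build _ _ _ _ XY mXY).
pose mu := distribution P X'; pose nu := distribution P Y'.
have prodE A : measurable A -> (mu \x nu)%E A = distribution P XY' A.
  apply: product_measure_unique => B C mB mC.
  apply: (ind (X @^-1` B) (Y @^-1` C)); first by exists B; rewrite ?setTI.
  by exists C; rewrite ?setTI.
have mulm : measurable_fun setT (fun z : R * R => (z.1 * z.2)%:E).
  by apply/measurable_EFinP; apply: measurable_funM.
have intE (g : R * R -> \bar R) :
    (\int[mu \x nu]_z g z = \int[distribution P XY']_z g z)%E.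
  by apply: eq_measure_integral => A mA _; exact: prodE.
have iprod : (mu \x nu)%E.-integrable setT (fun z => (z.1 * z.2)%:E).
  apply/integrableP; split => //.
  rewrite fubini_tonelli1; [|exact: measurableT_comp|by []].
  rewrite /fubini_F/=.
  under eq_integral => x _.
    under eq_integral => y _ do rewrite normrM EFinM.
    rewrite ge0_integralZl//.
    rewrite (ge0_integral_distribution Y' (f := fun y => (`|y|)%:E)); [|exact: mnorm|by []].
    over.
  rewrite ge0_integralZr ?integral_ge0//=.
  rewrite (ge0_integral_distribution X' (f := fun y => (`|y|)%:E)); [|exact: mnorm|by []].
  move/integrableP : iX => [_ X1]; move/integrableP : iY => [_ Y1].
  apply: lte_mul_pinfty; last exact: Y1.
    by apply: integral_ge0 => ? _; rewrite lee_fin /=.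
  rewrite ge0_fin_numE; first exact: X1.
  by apply: integral_ge0 => ? _; rewrite lee_fin /=.
have iXY : int1 P (fun x => X x * Y x).
  apply/integrableP; split.
    by apply/measurable_EFinP; exact: measurable_funM.
  move/integrableP : iprod => [_]; apply: le_lt_trans.
  rewrite intE.
  rewrite (ge0_integral_distribution XY' (f := fun z => `|(z.1 * z.2)%:E|%E))//.
  exact: measurableT_comp.
split=> //; apply/EFin_inj; rewrite EFinM !Rint_EFin//.
rewrite -(integral_distribution (X := XY') (f := fun z => (z.1 * z.2)%:E))//.
rewrite -intE.
have iu : mu.-integrable setT (fun x : R => x%:E).
  exact: (@integrable_pushforward _ _ _ _ _ _ mX P setT _ mid iX measurableT).
have iv : nu.-integrable setT (fun x : R => x%:E).
  exact: (@integrable_pushforward _ _ _ _ _ _ mY P setT _ mid iY measurableT).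
have Eu : (\int[mu]_x x%:E = \int[P]_x (X x)%:E)%E.
  exact: (integral_distribution (X := X') mid iX).
have Ev : (\int[nu]_x x%:E = \int[P]_x (Y x)%:E)%E.
  exact: (integral_distribution (X := Y') mid iY).
rewrite -integral12_prod_meas1// /fubini_F/=.
transitivity (\int[mu]_x (x%:E * (\int[P]_x (Y x)%:E)))%E.
  by apply: eq_integral => x _; rewrite -Ev -integralZl.
by rewrite -Rint_EFin// integralZr// Eu.
Qed.

(** For fixed [B], the measure of the intersection with [B] and [P] scaled by [P B] are finite
    measures that agree on a pi-system containing the whole space. *)
Lemma indep_gen (G H : set_system T) : setI_closed G -> G setT ->
  G `<=` measurable -> H `<=` measurable ->
  independent2 P G H -> independent2 P <<s G >> H.
Proof.
move=> GI GT Gm Hm GH A B GA HB; have mB := Hm _ HB.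
pose m1 := mrestr P mB.
pose m2 := mscale (NngNum (fine_ge0 (measure_ge0 P B))) P.
have PB : P B \is a fin_num by exact: fin_num_measure.
have m2E C : m2 C = (P C * P B)%E.
  by rewrite muleC -[in RHS](fineK PB).
have : m1 A = m2 A.
  apply: (@g_sigma_algebra_measure_unique _ _ _ G Gm (fun=> setT)) => //.
  - by rewrite bigcup_const.
  - by move=> C GC; transitivity (m2 C) => //; rewrite m2E; exact: GH.
  - by move=> _; rewrite (_ : _ setT = P B) ?ltey_eq ?PB//; congr (P _); exact: setTI.
by rewrite m2E.
Qed.

End independence.

(** * Variables with all moments; moments of a Poisson variable *)

Section moments.
Context {d : measure_display} {T : measurableType d} {R : realType}.
Variable P : probability T R.
Implicit Types X Y : T -> R.

(** Finiteness of all moments at once is stable under products, which spares the tracking of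
    exponents. *)
Definition allmom X := measurable_fun setT X /\ forall p, int1 P (fun w => X w ^+ p).

Lemma allmom_meas X : allmom X -> measurable_fun setT X. Proof. by case. Qed.

Lemma allmomX X k : allmom X -> allmom (fun w => X w ^+ k).
Proof.
move=> [mX iX]; split=> [|p]; first exact: measurable_funX.
by under [F in int1 P F]eq_fun do rewrite -exprM; exact: iX.
Qed.

Lemma allmom_mul X Y : allmom X -> allmom Y -> int1 P (fun w => X w * Y w).
Proof.
move=> aX aY; apply: L2_mul; apply: int1_L2.
- exact: allmom_meas.
- exact: aX.2.
- exact: allmom_meas.
- exact: aY.2.
Qed.

Lemma allmomM X Y : allmom X -> allmom Y -> allmom (fun w => X w * Y w).
Proof.
move=> aX aY; split=> [|p]; first by apply: measurable_funM; exact: allmom_meas.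
under [F in int1 P F]eq_fun do rewrite exprMn.
by apply: allmom_mul; exact: allmomX.
Qed.

Lemma allmom_cst c : allmom (fun=> c).
Proof. by split=> [|p]; [exact: measurable_cst|exact/L2_L1/L2_cst]. Qed.

Lemma allmomZ c X : allmom X -> allmom (fun w => c * X w).
Proof. by move=> aX; apply: allmomM => //; exact: allmom_cst. Qed.

Lemma allmomD X Y : allmom X -> allmom Y -> allmom (fun w => X w + Y w).
Proof.
move=> aX aY; split=> [|p]; first by apply: measurable_funD; exact: allmom_meas.
under [F in int1 P F]eq_fun do rewrite exprDn.
apply: int1_sum => i; under [F in int1 P F]eq_fun do rewrite -mulr_natl.
by apply: int1Z; apply: allmom_mul; exact: allmomX.
Qed.

Lemma allmom_sum (I : Type) (s : seq I) (Q : pred I) (X : I -> T -> R) :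
  (forall i, allmom (X i)) -> allmom (fun w => \sum_(i <- s | Q i) X i w).
Proof.
move=> aX; elim: s => [|a s IH].
  by under [F in allmom F]eq_fun do rewrite big_nil; exact: allmom_cst.
under [F in allmom F]eq_fun do rewrite big_cons.
by case: (Q a) => //; exact: allmomD.
Qed.

Lemma allmom_poly X (A : {poly R}) : allmom X -> allmom (fun w => A.[X w]).
Proof.
move=> aX; under [F in allmom F]eq_fun do rewrite horner_coef.
by apply: allmom_sum => i; apply: allmomZ; exact: allmomX.
Qed.

Lemma allmom_int1 X : allmom X -> int1 P X.
Proof. by move=> aX; apply: eq_int1 (aX.2 1%N) => w; rewrite expr1. Qed.

Lemma allmom_L2 X : allmom X -> L2 P X.
Proof. by move=> aX; apply: int1_L2; [exact: allmom_meas|exact: aX.2]. Qed.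

Section poisson_variable.
Variables (N : T -> \bar R) (lam : R).
Hypotheses (lam0 : 0 <= lam) (mN : measurable_fun setT N).
Hypothesis Npois : forall c : nat,
  P [set w | N w = (c%:R)%:E] = (lam ^+ c / c`!%:R * expR (- lam))%:E.
Let n w := fine (N w).
Let pmf c := lam ^+ c / c`!%:R * expR (- lam).

Let pmf_ge0 c : 0 <= pmf c.
Proof. by rewrite !mulr_ge0 ?expR_ge0 ?invr_ge0 ?exprn_ge0. Qed.

Let mNc c : measurable [set w | N w = (c%:R)%:E].
Proof.
rewrite (_ : [set _ | _] = N @^-1` [set (c%:R)%:E])//.
by rewrite -[X in measurable X]setTI; exact: mN.
Qed.

Let mn : measurable_fun setT n.
Proof. exact: (measurableT_comp (fine_measurable measurableT)). Qed.

Let NcP : P (\bigcup_c [set w | N w = (c%:R)%:E]) = 1%E.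
Proof.
rewrite measure_bigcup//; last first.
  move=> i j _ _ [w [/= -> [/eqP]]].
  by rewrite eqr_nat => /eqP.
rewrite (eq_eseriesr (g := fun c => (pmf c)%:E)); last by move=> i _; exact: Npois.
rewrite [RHS](_ : _ = (expR (- lam))%:E * (expR lam)%:E)%E; last first.
  by rewrite -EFinM expRN mulVf ?gt_eqF ?expR_gt0.
under eq_eseriesr do rewrite /pmf EFinM muleC.
rewrite nneseriesZl/=; last first.
  by move=> c _; rewrite lee_fin divr_ge0// exprn_ge0.
congr *%E; rewrite /expR -EFin_lim; last exact: is_cvg_series_exp_coeff.
apply/congr_lim/funext => c/=; rewrite /series/= -sumEFin.
by apply: eq_bigl => i; rewrite in_setT.
Qed.

Let NcC : P (~` \bigcup_c [set w | N w = (c%:R)%:E]) = 0%E.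
Proof.
by rewrite probability_setC ?NcP ?subee//; exact: bigcup_measurable.
Qed.

Let mU : measurable (\bigcup_c [set w | N w = (c%:R)%:E]).
Proof. exact: bigcup_measurable. Qed.

(** [N] is known only through its point masses; they sum to [exp (- lam) * exp lam = 1], so no mass
    is left for infinity or for non-integers. *)
Lemma poisson_ae : {ae P, forall w, exists c : nat, N w = (c%:R)%:E}.
Proof.
exists (~` \bigcup_c [set w | N w = (c%:R)%:E]); split.
- exact: measurableC.
- exact: NcC.
- by move=> w /= H [c _ Nw]; apply: H; exists c.
Qed.

Lemma poisson_int (g : R -> R) : measurable_fun setT g -> (forall x, 0 <= g x) ->
  (\int[P]_w (g (n w))%:E = \sum_(c <oo) (g c%:R * pmf c)%:E)%E.
Proof.
move=> mg g0.
have mgn : measurable_fun setT (fun w => (g (n w))%:E).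
  by apply/measurable_EFinP; exact: measurableT_comp.
rewrite (ge0_negligible_integral (measurableC mU))//; last by move=> w _; rewrite lee_fin.
have tF : trivIset setT (fun c : nat => [set w | N w = (c%:R)%:E]).
  move=> i j _ _ [w [/= -> [/eqP]]].
  by rewrite eqr_nat => /eqP.
rewrite setDE setCK setTI ge0_integral_bigcup//;
  do ?[exact: measurable_funTS|by move=> w _; rewrite lee_fin].
apply: eq_eseriesr => c _.
transitivity (\int[P]_(w in [set w | N w = (c%:R)%:E]) (g c%:R)%:E)%E.
  by apply: eq_integral => w; rewrite inE/= /n => ->.
by rewrite integral_cst//= Npois.
Qed.

(** The index shift [(c + 1) * pmf (c + 1) = lam * pmf c]. With absolute values it holds in the
    extended reals, before any moment is known to be finite, and so it can drive the induction of
    [poisson_allmom]. *)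
Lemma poisson_shift p :
  (\int[P]_w (`|n w| ^+ p.+1)%:E = lam%:E * \int[P]_w (`|n w + 1| ^+ p)%:E)%E.
Proof.
have m1 k : measurable_fun setT (fun x : R => `|x| ^+ k).
  by apply: measurable_funX; exact: normr_measurable.
rewrite (poisson_int (g := fun x => `|x| ^+ p.+1))//.
rewrite (poisson_int (g := fun x => `|x + 1| ^+ p))//; last first.
  by apply: (measurableT_comp (m1 p)); apply: measurable_funD.
rewrite nneseries_recl//; last by move=> c _; rewrite lee_fin mulr_ge0 ?exprn_ge0.
rewrite normr0 exprS !mul0r add0e -nneseriesZl; last first.
  by move=> c _; rewrite lee_fin mulr_ge0 ?exprn_ge0.
rewrite -[in LHS](addn0 1%N).
rewrite -nneseries_addn; last by move=> c; rewrite lee_fin mulr_ge0 ?exprn_ge0.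
apply: eq_eseriesr => c _; rewrite -EFinM addn1; congr EFin.
rewrite natr1 !normr_nat /pmf factS natrM !exprS.
have c0 : c.+1%:R != 0 :> R by rewrite pnatr_eq0.
have f0 : c`!%:R != 0 :> R by rewrite pnatr_eq0 -lt0n fact_gt0.
move: (c.+1%:R : R) c0 => x c0.
by field; rewrite f0 c0.
Qed.

(** Induction through [poisson_shift]; [|n + 1|^k] is dominated by [2^k (|n|^k + 1)], which is
    integrable by the induction hypothesis. *)
Lemma poisson_allmom : allmom n.
Proof.
split=> // p; elim: p => [|p IH]; first exact/L2_L1/L2_cst.
have fin k : int1 P (fun w => n w ^+ k) -> (\int[P]_w (`|n w + 1| ^+ k)%:E < +oo)%E.
  move=> ik.
  have ink : int1 P (fun w => `|n w| ^+ k).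
    apply: int1_le ik _ => [|w]; last by rewrite -normrX normr_id.
    by apply: measurable_funX; exact: measurableT_comp.
  have i1 : int1 P (fun w => 2 ^+ k * (`|n w| ^+ k + 1)).
    by apply: int1Z; apply: int1D => //; exact/L2_L1/L2_cst.
  apply: le_lt_trans (integrable_lty measurableT i1).
  apply: ge0_le_integral => //.
  - apply/measurable_EFinP; apply: measurable_funX; apply: measurableT_comp => //.
    by apply: measurable_funD => //; exact: measurable_cst.
  - exact/measurable_EFinP/(int1_meas i1).
  - move=> w _; rewrite lee_fin; set a := `|n w|.
    have a0 : 0 <= a by exact: normr_ge0.
    have h : `|n w + 1| <= 2 * Num.max a 1.
      apply: (le_trans (ler_normD _ _)); rewrite normr1 -/a.
      by case: (leP a 1); lra.
    apply: le_trans (_ : (2 * Num.max a 1) ^+ k <= _).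
      by rewrite lerXn2r// nnegrE// mulr_ge0// le_max a0.
    rewrite exprMn ler_wpM2l ?exprn_ge0//.
    by case: (leP a 1) => _; rewrite ?expr1n ?lerDl ?lerDr// exprn_ge0.
apply/integrableP; split.
  by apply/measurable_EFinP; exact: measurable_funX.
under eq_integral do rewrite abse_EFin normrX.
rewrite poisson_shift; apply: lte_mul_pinfty; rewrite ?lee_fin//.
exact: fin.
Qed.

Lemma poisson_monomial p :
  \int[P]_w (n w * n w ^+ p) = lam * \int[P]_w ((n w + 1) ^+ p).
Proof.
have an := poisson_allmom.
have an1 : allmom (fun w => n w + 1) by apply: allmomD => //; exact: allmom_cst.
have := poisson_shift p => /(congr1 fine).
rewrite fineM//; last first.
  apply: (integrable_fin_num measurableT).
  apply: (int1_le (Y := fun w => (n w + 1) ^+ p)) (an1.2 p) _ => [|w].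
    by apply: measurable_funX; apply: measurableT_comp => //; exact: allmom_meas an1.
  by rewrite -normrX normr_id.
move=> /= H; transitivity (\int[P]_w (`|n w| ^+ p.+1)).
  apply: Rint_ae.
  - by apply: measurable_funM => //; exact: measurable_funX.
  - by apply: measurable_funX; exact: measurableT_comp.
  - by apply: filterS poisson_ae => w [c Nw]; rewrite /n Nw/= normr_nat exprS.
rewrite /Rintegral H; congr (_ * _); apply: Rint_ae.
- by apply: measurable_funX; apply: measurableT_comp => //; exact: allmom_meas an1.
- by apply: measurable_funX; exact: allmom_meas an1.
- by apply: filterS poisson_ae => w [c Nw]; rewrite /n Nw/= natr1 normr_nat.
Qed.

Lemma poisson_poly (Q : {poly R}) :
  \int[P]_w (n w * Q.[n w]) = lam * \int[P]_w (Q.[n w + 1]).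
Proof.
have an := poisson_allmom.
have an1 : allmom (fun w => n w + 1) by apply: allmomD => //; exact: allmom_cst.
under eq_Rintegral do rewrite horner_coef mulr_sumr.
under [in RHS]eq_Rintegral do rewrite horner_coef.
rewrite !Rint_sum; last 2 first.
- by move=> i; apply: int1Z; exact: an1.2.
- by move=> i; apply: allmom_mul => //; apply: allmomZ; exact: allmomX.
rewrite mulr_sumr; apply: eq_bigr => i _.
under eq_Rintegral do rewrite mulrCA.
rewrite RintZ; last by apply: allmom_mul => //; exact: allmomX.
rewrite poisson_monomial RintZ; last exact: an1.2.
exact: mulrCA.
Qed.

(** The Chen-Stein identity of the Poisson law, for polynomials and centred at [lam]. *)
Lemma poisson_stein (Q : {poly R}) :
  \int[P]_w ((n w - lam) * Q.[n w - lam]) =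
  lam * (\int[P]_w (Q.[n w - lam + 1]) - \int[P]_w (Q.[n w - lam])).
Proof.
have an := poisson_allmom.
have anl : allmom (fun w => n w - lam) by apply: allmomD => //; exact: allmom_cst.
have E x : Q.[x - lam] = (Q \Po ('X - lam%:P)).[x].
  by rewrite horner_comp !hornerE.
transitivity (\int[P]_w (n w * Q.[n w - lam] + - lam * Q.[n w - lam])).
  by apply: eq_Rintegral => w _; ring.
have aQ : allmom (fun w => Q.[n w - lam]) by exact: allmom_poly.
rewrite RintD; last 2 first.
- exact: allmom_mul.
- by apply: int1Z; exact: allmom_int1.
rewrite RintZ; last exact: allmom_int1.
under eq_Rintegral do rewrite E.
rewrite poisson_poly mulrBr mulNr; congr (_ * _ - _).
by apply: eq_Rintegral => w _; rewrite -E addrAC.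
Qed.

End poisson_variable.
End moments.

(* m plays the role of the cumulants of a variable with moments M. *)
Lemma moment_recursion_bound (R : realType) (K : R) (p : nat) : 0 <= K ->
  exists B : R, forall (M m : nat -> R), M 0%N = 1 ->
    (forall q, M q.+1 = \sum_(i < q) 'C(q, i)%:R * m (q.+1 - i)%N * M i) ->
    (forall r, (2 <= r <= p)%N -> `|m r| <= K) -> `|M p| <= B.
Proof.
move=> K0.
elim/ltn_ind: p => -[|q] IH.
  by exists 1 => M m M0 _ _; rewrite M0 normr1.
have [B HB] : exists B : nat -> R, forall i, (i < q)%N ->
    forall (M m : nat -> R), M 0%N = 1 ->
    (forall q, M q.+1 = \sum_(i < q) 'C(q, i)%:R * m (q.+1 - i)%N * M i) ->
    (forall r, (2 <= r <= i)%N -> `|m r| <= K) -> `|M i| <= B i.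
  have [i|B HB] := @choice nat R (fun i b => (i < q)%N ->
    forall (M m : nat -> R), M 0%N = 1 ->
    (forall q, M q.+1 = \sum_(i < q) 'C(q, i)%:R * m (q.+1 - i)%N * M i) ->
    (forall r, (2 <= r <= i)%N -> `|m r| <= K) -> `|M i| <= b).
    have [iq|iq] := boolP (i < q)%N; last by exists 0.
    by have [b Hb] := IH i (ltn_trans iq (ltnSn q)); exists b.
  by exists B.
exists (\sum_(i < q) 'C(q, i)%:R * K * B i) => M m M0 Mrec mK.
rewrite Mrec; apply: le_trans (ler_norm_sum _ _ _) _.
apply: ler_sum => i _; rewrite !normrM normr_nat.
apply: ler_pM => //.
  rewrite ler_wpM2l//; apply: mK.
  by rewrite leq_subr andbT; have := ltn_ord i; lia.
apply: HB => // r /andP[r2 ri]; apply: mK; rewrite r2/=.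
by rewrite (leq_trans ri)// (leq_trans (ltnW (ltn_ord i))).
Qed.

(** * Linear combinations of independent compensated Poisson variables *)

Section poisson_family.
Context {d : measure_display} {T : measurableType d} {R : realType}.
Variable P : probability T R.

Lemma sub_preimage_comp (V : T -> R) (h : R -> R) : measurable_fun setT h ->
  g_sigma_algebra_preimage (fun w => h (V w)) `<=` g_sigma_algebra_preimage V.
Proof.
move=> mh _ [B mB <-]; exists (h @^-1` B) => //.
by rewrite -[X in measurable X]setTI; exact: mh.
Qed.

Variables (r : nat) (N : 'I_r -> T -> \bar R) (lam c : 'I_r -> R).
Hypotheses (lam0 : forall a, 0 <= lam a) (mN : forall a, measurable_fun setT (N a)).
Hypothesis Npois : forall a (k : nat),
  P [set w | N a w = (k%:R)%:E] = (lam a ^+ k / k`!%:R * expR (- lam a))%:E.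
Let n a w := fine (N a w) - lam a.
Hypothesis ind : forall a, independent2 P (g_sigma_algebra_preimage (n a))
  (g_sigma_algebra_preimage (fun w => \sum_(b | b != a) c b * n b w)).
Let X w := \sum_a c a * n a w.

Let an a : allmom P (n a).
Proof.
apply: allmomD; last exact: allmom_cst.
by apply: poisson_allmom (mN a) (Npois a).
Qed.

Lemma poisson_family_allmom : allmom P X.
Proof. by apply: allmom_sum => a; exact: allmomZ. Qed.

Let Z a w := \sum_(b | b != a) c b * n b w.

Let aZ a : allmom P (Z a).
Proof. by apply: allmom_sum => b; exact: allmomZ. Qed.

Let XE a w : X w = Z a w + c a * n a w.
Proof. by rewrite /X (bigD1 a)//= addrC. Qed.

(** At [x] this polynomial is the mean of [(Z a + c a x)^p]: the other variables are integrated out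
    with [n a] frozen at [x]. *)
Let Q a p : {poly R} :=
  \sum_(i < p.+1) ('C(p, i)%:R * c a ^+ i * \int[P]_w (Z a w ^+ (p - i))) *: 'X^i.

(** Fubini for the independent pair [n a], [Z a] in polynomial form. Two polynomials are left free
    because the Stein identity needs both the factor [n a] and the shift by 1. *)
Let sep a p (A B : {poly R}) :
  \int[P]_w (A.[n a w] * (Z a w + c a * B.[n a w]) ^+ p) =
  \int[P]_w (A.[n a w] * (Q a p).[B.[n a w]]).
Proof.
have aB i : allmom P (fun w => A.[n a w] * B.[n a w] ^+ i).
  by apply: allmomM; [exact: allmom_poly|apply: allmomX; exact: allmom_poly].
transitivity (\int[P]_w (\sum_(i < p.+1)
    'C(p, i)%:R * c a ^+ i * ((A.[n a w] * B.[n a w] ^+ i) * Z a w ^+ (p - i)))).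
  apply: eq_Rintegral => w _; rewrite exprDn mulr_sumr; apply: eq_bigr => i _.
  by rewrite -mulr_natl exprMn; ring.
rewrite Rint_sum; last first.
  by move=> i; apply: int1Z; apply: allmom_mul => //; exact: allmomX.
transitivity (\int[P]_w (\sum_(i < p.+1)
    'C(p, i)%:R * c a ^+ i * \int[P]_w (Z a w ^+ (p - i)) * (A.[n a w] * B.[n a w] ^+ i))).
  rewrite Rint_sum; last by move=> i; apply: int1Z; exact: allmom_int1.
  apply: eq_bigr => i _; rewrite RintZ; last by apply: allmom_mul => //; exact: allmomX.
  rewrite RintZ; last exact: allmom_int1.
  have H : independent2 P
      (g_sigma_algebra_preimage (fun w => A.[n a w] * B.[n a w] ^+ i))
      (g_sigma_algebra_preimage (fun w => Z a w ^+ (p - i))).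
    move=> E1 E2 H1 H2; apply: ind.
    - apply: (sub_preimage_comp (h := fun x => A.[x] * B.[x] ^+ i)) H1.
      by apply: measurable_funM; [|apply: measurable_funX]; exact: measurable_poly.
    - apply: (sub_preimage_comp (h := fun x => x ^+ (p - i))) H2.
      exact: measurable_funX.
  have [_ ->] := indep_prod H (allmom_int1 (aB i)) ((aZ a).2 _).
  by rewrite -!mulrA; congr (_ * (_ * _)); exact: mulrC.
apply: eq_Rintegral => w _; rewrite /Q horner_sum mulr_sumr; apply: eq_bigr => i _.
by rewrite hornerZ hornerXn; ring.
Qed.

(** The Chen-Stein identity in each variable separately, the others being integrated out by [sep];
    one more jump in [n a] moves [X] by [c a]. *)
Lemma poisson_family_stein p :
  \int[P]_w (X w ^+ p.+1) =
  \sum_a c a * lam a * (\int[P]_w ((X w + c a) ^+ p) - \int[P]_w (X w ^+ p)).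
Proof.
have aX := poisson_family_allmom.
transitivity (\int[P]_w (\sum_a c a * (n a w * X w ^+ p))).
  apply: eq_Rintegral => w _; rewrite exprS mulr_suml.
  by apply: eq_bigr => a _; rewrite mulrA.
rewrite Rint_sum; last first.
  by move=> a; apply: int1Z; apply: allmom_mul => //; exact: allmomX.
apply: eq_bigr => a _; rewrite RintZ; last by apply: allmom_mul => //; exact: allmomX.
rewrite -mulrA; congr (_ * _).
have E1 := sep a p 'X 'X; have E2 := sep a p 1 'X; have E3 := sep a p 1 ('X + 1).
transitivity (\int[P]_w (n a w * (Q a p).[n a w])).
  transitivity (\int[P]_w ('X.[n a w] * (Z a w + c a * 'X.[n a w]) ^+ p)).
    by apply: eq_Rintegral => w _; rewrite !hornerE -XE.
  by rewrite E1; apply: eq_Rintegral => w _; rewrite hornerX.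
rewrite (poisson_stein (lam0 a) (mN a) (Npois a)); congr (_ * (_ - _)).
- transitivity (\int[P]_w ((1 : {poly R}).[n a w] * (Z a w + c a * ('X + 1).[n a w]) ^+ p)).
    by rewrite E3; apply: eq_Rintegral => w _; rewrite !hornerE.
  by apply: eq_Rintegral => w _; rewrite !hornerE (XE a); congr (_ ^+ _); ring.
- transitivity (\int[P]_w ((1 : {poly R}).[n a w] * (Z a w + c a * 'X.[n a w]) ^+ p)).
    by rewrite E2; apply: eq_Rintegral => w _; rewrite !hornerE.
  by apply: eq_Rintegral => w _; rewrite !hornerE (XE a).
Qed.

(** The moment-cumulant recursion: in [(X + c a)^q - X^q] the top power cancels, and the sum of
    [lam * c^r] appears as the cumulant of order [r = q + 1 - i >= 2]. Order 1 is absent because the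
    variables are centred. *)
Lemma poisson_family_recursion q :
  \int[P]_w (X w ^+ q.+1) = \sum_(i < q) 'C(q, i)%:R *
    (\sum_a lam a * c a ^+ (q.+1 - i)) * \int[P]_w (X w ^+ i).
Proof.
have aX := poisson_family_allmom.
rewrite poisson_family_stein.
under eq_bigr => a _.
  have -> : \int[P]_w ((X w + c a) ^+ q) = \int[P]_w (X w ^+ q) +
      \sum_(i < q) ('C(q, i)%:R * c a ^+ (q - i) * \int[P]_w (X w ^+ i)).
    transitivity (\int[P]_w (X w ^+ q + \sum_(i < q) ('C(q, i)%:R * c a ^+ (q - i)) * X w ^+ i)).
      apply: eq_Rintegral => w _; rewrite addrC exprDn big_ord_recr/= subnn expr0 mul1r binn mulr1n addrC.
      by congr (_ + _); apply: eq_bigr => i _; rewrite -mulr_natl mulrA.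
    rewrite RintD; [|exact: aX.2|by apply: int1_sum => i; apply: int1Z; exact: aX.2].
    rewrite Rint_sum; last by move=> i; apply: int1Z; exact: aX.2.
    by congr (_ + _); apply: eq_bigr => i _; rewrite RintZ//; exact: aX.2.
  rewrite addrAC subrr add0r mulr_sumr.
  over.
rewrite exchange_big/=; apply: eq_bigr => i _.
rewrite mulr_sumr mulr_suml; apply: eq_bigr => a _.
by rewrite subSn ?(ltnW (ltn_ord i))// exprS; ring.
Qed.

End poisson_family.

Lemma memI (R : realType) (a b x : R) : a <= x -> x <= b -> x \in `[a, b].
Proof. by move=> ax xb; rewrite in_itv/= ax. Qed.

Lemma int1_ae (d : measure_display) (T : measurableType d) (R : realType)
    (m : {measure set T -> \bar R}) (X Z : T -> R) : measurable_fun setT Z ->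
  {ae m, forall x, X x = Z x} -> int1 m X -> int1 m Z.
Proof.
move=> mZ XZ iX; apply/integrableP; split; first exact/measurable_EFinP.
rewrite -(@ae_eq_integral _ _ _ m _ _ (fun x => `|(X x)%:E|%E))//.
- by case/integrableP : iX.
- by apply/measurable_EFinP; apply: measurableT_comp => //; exact: int1_meas iX.
- by apply/measurable_EFinP; exact: measurableT_comp.
- by apply: filterS XZ => x ->.
Qed.

Section subsigma_algebra_closure.
Context {d : measure_display} {T : measurableType d} {R : realType}.
Variable G : set_system T.
Hypothesis sG : sigma_algebra setT G.

Definition Gm (X : T -> R) := g_sigma_algebra_preimage X `<=` G.

Lemma Gm_cst c : Gm (fun=> c).
Proof. by apply/sub_preimageP => //; exact: measurable_cst. Qed.

Lemma GmD X Y : Gm X -> Gm Y -> Gm (fun w => X w + Y w).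
Proof.
move=> /(sub_preimageP _ sG) mX /(sub_preimageP _ sG) mY.
by apply/sub_preimageP => //; exact: (measurable_funD mX mY).
Qed.

Lemma GmM X Y : Gm X -> Gm Y -> Gm (fun w => X w * Y w).
Proof.
move=> /(sub_preimageP _ sG) mX /(sub_preimageP _ sG) mY.
by apply/sub_preimageP => //; exact: (measurable_funM mX mY).
Qed.

Lemma GmZ c X : Gm X -> Gm (fun w => c * X w).
Proof. by move=> gX; apply: GmM => //; exact: Gm_cst. Qed.

Lemma GmB X Y : Gm X -> Gm Y -> Gm (fun w => X w - Y w).
Proof.
move=> gX gY; under [Z in Gm Z]eq_fun do rewrite -mulN1r.
by apply: GmD => //; exact: GmZ.
Qed.

Lemma Gm_sum (I : Type) (s : seq I) (Q : pred I) X :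
  (forall i, Q i -> Gm (X i)) -> Gm (fun w => \sum_(i <- s | Q i) X i w).
Proof.
move=> gX; elim: s => [|a s IH].
  by under [Z in Gm Z]eq_fun do rewrite big_nil; exact: Gm_cst.
under [Z in Gm Z]eq_fun do rewrite big_cons.
by case: (boolP (Q a)) => // Qa; apply: GmD => //; exact: gX.
Qed.

Lemma Gm_comp X (h : R -> R) : measurable_fun setT h -> Gm X -> Gm (fun w => h (X w)).
Proof. by move=> mh gX; apply: subset_trans gX; exact: sub_preimage_comp. Qed.

End subsigma_algebra_closure.

(** * Increments of one noise *)

Section increments.
Context {d : measure_display} {Omega : measurableType d} {R : realType}.
Context {dY : measure_display} {Y : measurableType dY}.
Variables (P : probability Omega R) (F : R -> set_system Omega).
Variables (Pi : {measure set Y -> \bar R}) (T : R).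
Variable nu : R.-ker Omega ~> (R * Y)%type.
Local Notation mu := (@lebesgue_measure R).

Definition finset_ A := measurable A /\ (Pi A < +oo)%E.

(** The hypotheses on a single noise in the form on which the isometry rests: Poisson counts,
    adaptedness, and increments independent of the past. *)
Definition adapted_counts :=
  [/\ forall D A, rectangle Pi T D A -> forall c : nat,
       P [set w | nu w (D `*` A) = (c%:R)%:E] =
       (fine (mu D * Pi A)%E ^+ c / c`!%:R * expR (- fine (mu D * Pi A)%E))%:E,
     forall s A, s \in `[0, T] -> measurable A -> (Pi A < +oo)%E ->
        g_sigma_algebra_preimage (fun w => nu w (`[0, s[ `*` A) : \bar R) `<=` F s &
     forall s h A, 0 <= s -> 0 < h -> s + h <= T ->
        measurable A -> (Pi A < +oo)%E ->
        independent2 P (g_sigma_algebra_preimage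
          (fun w => nu w (`[s, s + h[ `*` A) : \bar R)) (F s)].

Hypothesis Ffil : filtration T F.
Hypothesis Hnu : adapted_counts.

Let sF (s : R) : 0 <= s -> s <= T -> sigma_algebra setT (F s).
Proof. by move=> s0 sT; case: Ffil => + _ _; apply; exact: memI. Qed.

Lemma F_mono (s s' : R) : 0 <= s -> s <= s' -> s' <= T -> F s `<=` F s'.
Proof.
move=> s0 ss sT; case: Ffil => _ _; apply => //; apply: memI => //.
- exact: le_trans sT.
- exact: le_trans ss.
Qed.

Lemma F_meas (s : R) (X : Omega -> R) : 0 <= s -> s <= T -> Gm (F s) X -> measurable_fun setT X.
Proof.
move=> s0 sT; apply: sub_preimage_measurable.
by case: Ffil => _ + _; apply; exact: memI.
Qed.

Definition cnt s A w : R := fine (nu w (`[0, s[ `*` A)).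

(** A difference of counts of [[0, b)] and [[0, a)]: adaptedness is given for such sets, and
    additivity in time becomes an identity at every point. It matches the count of [[a, b)] only
    almost surely, [fine] being additive where the counts are finite. *)
Definition inc a b A w : R := cnt b A w - cnt a A w - (b - a) * fine (Pi A).

Lemma incD (a b c : R) A w : inc a c A w = inc a b A w + inc b c A w.
Proof. by rewrite /inc; ring. Qed.

Lemma cnt_adapted (s : R) A : finset_ A -> 0 <= s -> s <= T -> Gm (F s) (cnt s A).
Proof.
move=> [mA PA] s0 sT; case: Hnu => _ H _; have sG := sF s0 sT.
apply/sub_preimageP => //.
have /(sub_preimageP _ sG) h := H s A (memI s0 sT) mA PA.
exact: (measurableT_comp (fine_measurable measurableT) h).
Qed.

Lemma inc_adapted (a b : R) A : finset_ A -> 0 <= a -> a <= b -> b <= T ->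
  Gm (F b) (inc a b A).
Proof.
move=> fA a0 ab bT; have b0 := le_trans a0 ab; have sG := sF b0 bT.
apply: GmB => //; last exact: Gm_cst.
apply: GmB => //; first exact: cnt_adapted.
apply: subset_trans (F_mono a0 ab bT).
by apply: cnt_adapted => //; exact: le_trans bT.
Qed.

Lemma rectangle_itv (a b : R) A : finset_ A -> 0 <= a -> b <= T -> rectangle Pi T `[a, b[ A.
Proof.
move=> [mA PA] a0 bT; split => //.
move=> x /=; rewrite !in_itv/= => /andP[ax xb].
by rewrite (le_trans a0 ax) (le_trans (ltW xb) bT).
Qed.

Lemma nu_measurable D A : measurable D -> measurable A ->
  measurable_fun setT (fun w => nu w (D `*` A)).
Proof. by move=> mD mA; apply: measurable_kernel; exact: measurableX. Qed.

Lemma nu_ae D A : rectangle Pi T D A ->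
  {ae P, forall w, exists c : nat, nu w (D `*` A) = (c%:R)%:E}.
Proof.
move=> rDA; case: Hnu => H _ _; have [mD _ mA _] := rDA.
have l0 : 0 <= fine (mu D * Pi A)%E by rewrite fine_ge0// mule_ge0.
exact: (poisson_ae l0 (nu_measurable mD mA) (H _ _ rDA)).
Qed.

Lemma fine_muPi (a b : R) A : a <= b -> finset_ A ->
  fine (mu `[a, b[ * Pi A)%E = (b - a) * fine (Pi A).
Proof.
move=> ab [mA PA]; rewrite lebesgue_measure_itv/= lte_fin.
have PAf : Pi A \is a fin_num by rewrite ge0_fin_numE.
case: ltP => ba; first by rewrite -EFinD fineM.
have -> : b = a by apply/le_anti; rewrite ab ba.
by rewrite mul0e subrr mul0r.
Qed.

Lemma inc_ae (a b : R) A : finset_ A -> 0 <= a -> a <= b -> b <= T ->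
  {ae P, forall w, inc a b A w = compensated Pi nu `[a, b[ A w}.
Proof.
move=> fA a0 ab bT; have b0 := le_trans a0 ab; have aT := le_trans ab bT.
have := nu_ae (rectangle_itv fA (lexx 0) bT).
apply: filterS => w [c Nc].
rewrite /inc /compensated fine_muPi//; congr (_ - _).
have mA : measurable A by case: fA.
pose n1 := nu w (`[0, a[ `*` A); pose n2 := nu w (`[a, b[ `*` A).
have E : nu w (`[0, b[ `*` A) = (n1 + n2)%E.
  rewrite -measureU.
  - congr (nu w _); apply/seteqP; split => -[x y] /=; rewrite !in_itv/=.
      move=> [/andP[x0 xb] Ay]; have [xa|ax] := ltP x a; [left|right];
        by rewrite ?x0 ?xb.
    move=> [[/andP[x0 xa] Ay]|[/andP[ax xb] Ay]].
      by rewrite x0 (lt_le_trans xa).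
    by rewrite xb (le_trans a0 ax).
  - by apply: measurableX => //; exact: measurable_itv.
  - by apply: measurableX => //; exact: measurable_itv.
  - rewrite -subset0 => -[x y] [[/= + _] [/= + _]]; rewrite !in_itv/= => /andP[_ xa] /andP[ax _].
    by rewrite ltNge ax in xa.
(* An integer value of the total makes both summands finite. *)
have /andP[f1 f2] : (n1 \is a fin_num) && (n2 \is a fin_num).
  by rewrite -fin_numD -E Nc.
by rewrite /cnt E fineD// addrAC subrr add0r.
Qed.

Lemma inc_measurable (a b : R) A : finset_ A -> 0 <= a -> a <= b -> b <= T ->
  measurable_fun setT (inc a b A).
Proof.
move=> fA a0 ab bT; apply: (F_meas (le_trans a0 ab) bT).
exact: inc_adapted.
Qed.

Lemma compensated_measurable D A : measurable D -> measurable A ->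
  measurable_fun setT (compensated Pi nu D A).
Proof.
move=> mD mA; apply: measurable_funB => //.
by apply: (measurableT_comp (fine_measurable measurableT)); exact: nu_measurable.
Qed.

Lemma compensated_allmom D A : rectangle Pi T D A -> allmom P (compensated Pi nu D A).
Proof.
move=> rDA; have [mD _ mA _] := rDA; case: Hnu => H _ _.
have l0 : 0 <= fine (mu D * Pi A)%E by rewrite fine_ge0// mule_ge0.
apply: allmomD; last exact: allmom_cst.
exact: (poisson_allmom l0 (nu_measurable mD mA) (H _ _ rDA)).
Qed.

Lemma allmom_ae (X Z : Omega -> R) : measurable_fun setT Z ->
  {ae P, forall w, X w = Z w} -> allmom P X -> allmom P Z.
Proof.
move=> mZ XZ [mX iX]; split=> // p.
have : L2 P (fun w => X w ^+ p).
  by apply: int1_L2; [exact: measurable_funX|under [G in int1 P G]eq_fun do rewrite -exprM].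
move=> /(L2_ae _ _)/L2_L1; apply; first exact: measurable_funX.
by apply: filterS XZ => w ->.
Qed.

Lemma inc_allmom (a b : R) A : finset_ A -> 0 <= a -> a <= b -> b <= T ->
  allmom P (inc a b A).
Proof.
move=> fA a0 ab bT; apply: allmom_ae (compensated_allmom (rectangle_itv fA a0 bT)).
- exact: inc_measurable.
- by apply: filterS (inc_ae fA a0 ab bT) => w ->.
Qed.

Lemma compensated_mean D A : rectangle Pi T D A ->
  \int[P]_w compensated Pi nu D A w = 0.
Proof.
move=> rDA; have [mD _ mA _] := rDA; case: Hnu => H _ _.
have l0 : 0 <= fine (mu D * Pi A)%E by rewrite fine_ge0// mule_ge0.
have := poisson_stein l0 (nu_measurable mD mA) (H _ _ rDA) 1.
under eq_Rintegral do rewrite hornerC mulr1.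
under [X in _ = _ * (X - _)]eq_Rintegral do rewrite hornerC.
under [X in _ = _ * (_ - X)]eq_Rintegral do rewrite hornerC.
by rewrite subrr mulr0.
Qed.

(** The Stein identity for the polynomial ['X]; the constant 1 gave the mean. *)
Lemma compensated_var D A : rectangle Pi T D A ->
  \int[P]_w (compensated Pi nu D A w ^+ 2) = fine (mu D * Pi A)%E.
Proof.
move=> rDA; have [mD _ mA _] := rDA; case: Hnu => H _ _.
have l0 : 0 <= fine (mu D * Pi A)%E by rewrite fine_ge0// mule_ge0.
have := poisson_stein l0 (nu_measurable mD mA) (H _ _ rDA) 'X.
under eq_Rintegral do rewrite hornerX -expr2.
under [X in _ = _ * (X - _)]eq_Rintegral do rewrite hornerX.
under [X in _ = _ * (_ - X)]eq_Rintegral do rewrite hornerX.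
move=> ->; rewrite RintD; last 2 first.
- exact/allmom_int1/compensated_allmom.
- exact/L2_L1/L2_cst.
by rewrite Rintegral_cst//= probability_setT mulr1 addrAC subrr add0r mulr1.
Qed.

Lemma compensated_indep (a b : R) A : finset_ A -> 0 <= a -> a < b -> b <= T ->
  independent2 P (g_sigma_algebra_preimage (compensated Pi nu `[a, b[ A)) (F a).
Proof.
move=> [mA PA] a0 ab bT; case: Hnu => _ _ H E1 E2 H1 H2.
have := H a (b - a) A a0; rewrite subr_gt0 addrC subrK => /(_ ab bT mA PA) h.
apply: h H2; case: H1 => B mB <-.
exists ((fun x : \bar R => fine x - fine (mu `[a, b[ * Pi A)%E) @^-1` B) => //.
rewrite -[X in measurable X]setTI.
have m : measurable_fun [set: \bar R] (fun x : \bar R => fine x - fine (mu `[a, b[ * Pi A)%E).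
  by apply: measurable_funB => //; exact: fine_measurable.
exact: m.
Qed.

Section product_with_past.
Variables (a b : R) (A : set Y) (V : Omega -> R).
Hypotheses (fA : finset_ A) (a0 : 0 <= a) (ab : a <= b) (bT : b <= T).
Hypotheses (gV : Gm (F a) V) (iV : int1 P V).

Lemma inc_diag B w : inc a a B w = 0.
Proof. by rewrite /inc; ring. Qed.

Let prod_past p : int1 P (fun w => inc a b A w ^+ p * V w) /\
  \int[P]_w (inc a b A w ^+ p * V w) =
  \int[P]_w (inc a b A w ^+ p) * \int[P]_w V w.
Proof.
have aT := le_trans ab bT.
(* Independence from the past is given for [h > 0], so the empty interval is treated by hand;
   writing [0 ^ p] covers the power [p = 0] as well. *)
move: ab; rewrite le_eqVlt => /predU1P[E|ab'].
  rewrite -E; have h w : inc a a A w ^+ p = (0 ^+ p) :> R by rewrite inc_diag.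
  split.
    by apply: eq_int1 (int1Z (0 ^+ p) iV) => w; rewrite h.
  under eq_Rintegral do rewrite h; rewrite RintZ//.
  under [in RHS]eq_Rintegral do rewrite h.
  by rewrite Rintegral_cst//= probability_setT mulr1.
have ae := inc_ae fA a0 ab bT.
have rr := rectangle_itv fA a0 bT.
have mV := int1_meas iV.
have am := inc_allmom fA a0 ab bT.
have ac := compensated_allmom rr.
have ind : independent2 P
    (g_sigma_algebra_preimage (fun w => compensated Pi nu `[a, b[ A w ^+ p))
    (g_sigma_algebra_preimage V).
  move=> E1 E2 H1 H2; apply: (compensated_indep fA a0 ab' bT); last exact: gV.
  apply: (sub_preimage_comp (h := fun x => x ^+ p)) H1.
  exact: measurable_funX.
have [i1 e1] := indep_prod ind (ac.2 p) iV.
have m1 : measurable_fun setT (fun w => inc a b A w ^+ p).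
  by apply: measurable_funX; exact: allmom_meas am.
have m2 : measurable_fun setT (fun w => compensated Pi nu `[a, b[ A w ^+ p).
  by apply: measurable_funX; exact: allmom_meas ac.
split.
  apply: int1_ae i1; first exact: measurable_funM.
  by apply: filterS ae => w ->.
transitivity (\int[P]_w (compensated Pi nu `[a, b[ A w ^+ p * V w)).
  apply: Rint_ae; [exact: measurable_funM|exact: measurable_funM|].
  by apply: filterS ae => w ->.
rewrite e1; congr (_ * _); apply: Rint_ae => //.
by apply: filterS ae => w ->.
Qed.

Lemma inc2_past_int1 : int1 P (fun w => inc a b A w ^+ 2 * V w).
Proof. by have [] := prod_past 2. Qed.

Lemma inc_past : \int[P]_w (inc a b A w * V w) = 0.
Proof.
have [_] := prod_past 1; under eq_Rintegral do rewrite expr1.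
move=> ->; under eq_Rintegral do rewrite expr1.
have rr := rectangle_itv fA a0 bT.
rewrite (@Rint_ae _ _ _ P _ (compensated Pi nu `[a, b[ A)).
- by rewrite compensated_mean ?mul0r.
- exact: inc_measurable.
- exact: allmom_meas (compensated_allmom rr).
- exact: inc_ae.
Qed.

Lemma inc2_past : \int[P]_w (inc a b A w ^+ 2 * V w) =
  (b - a) * fine (Pi A) * \int[P]_w V w.
Proof.
have [_ ->] := prod_past 2; congr (_ * _).
have rr := rectangle_itv fA a0 bT.
rewrite (@Rint_ae _ _ _ P _ (fun w => compensated Pi nu `[a, b[ A w ^+ 2)).
- by rewrite compensated_var// fine_muPi.
- by apply: measurable_funX; exact: inc_measurable.
- by apply: measurable_funX; exact: allmom_meas (compensated_allmom rr).
- by apply: filterS (inc_ae fA a0 ab bT) => w ->.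
Qed.

End product_with_past.

Lemma finset_U A B : finset_ A -> finset_ B -> finset_ (A `|` B).
Proof.
move=> [mA PA] [mB PB]; split; first exact: measurableU.
by apply: le_lt_trans (measureU2 Pi mA mB) _; exact: lte_add_pinfty.
Qed.

Lemma finset_S A B : measurable A -> A `<=` B -> finset_ B -> finset_ A.
Proof.
move=> mA AB [mB PB]; split => //.
by apply: le_lt_trans PB; apply: le_measure => //; rewrite inE.
Qed.

Lemma fine_PiU A B : finset_ A -> finset_ B -> [disjoint A & B] ->
  fine (Pi (A `|` B)) = fine (Pi A) + fine (Pi B).
Proof.
move=> [mA PA] [mB PB] /disj_set2P AB; rewrite measureU// fineD// ge0_fin_numE//.
Qed.

Lemma inc_ae_U (a b : R) A B : finset_ A -> finset_ B -> [disjoint A & B] ->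
  0 <= a -> a <= b -> b <= T ->
  {ae P, forall w, inc a b (A `|` B) w = inc a b A w + inc a b B w}.
Proof.
move=> fA fB dAB a0 ab bT; have b0 := le_trans a0 ab.
have bTr := rectangle_itv (finset_U fA fB) (lexx 0) bT.
have aTr := rectangle_itv (finset_U fA fB) (lexx 0) (le_trans ab bT).
have mA : measurable A by case: fA.
have mB : measurable B by case: fB.
have split_cnt s w c : nu w (`[0, s[ `*` (A `|` B)) = (c%:R)%:E ->
    cnt s (A `|` B) w = cnt s A w + cnt s B w.
  move=> Nc; pose n1 := nu w (`[0, s[ `*` A); pose n2 := nu w (`[0, s[ `*` B).
  have E : nu w (`[0, s[ `*` (A `|` B)) = (n1 + n2)%E.
    rewrite -measureU.
    - congr (nu w _); apply/seteqP; split => -[x y] /=; tauto.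
    - by apply: measurableX.
    - by apply: measurableX.
    - move/disj_set2P : dAB; rewrite -!subset0 => h -[x y] [[/= _ Ay] [/= _ By]].
      exact: (h y).
  have /andP[f1 f2] : (n1 \is a fin_num) && (n2 \is a fin_num).
    by rewrite -fin_numD -E Nc.
  by rewrite /cnt E fineD.
apply: filterS2 (nu_ae bTr) (nu_ae aTr) => w [c Nc] [c' Nc'].
by rewrite /inc (split_cnt _ _ _ Nc) (split_cnt _ _ _ Nc') fine_PiU//; ring.
Qed.

End increments.

(** * Elementary processes and their integrals *)

Section lebesgue_on_R.
Variable R : realType.
Local Notation mu := (@lebesgue_measure R).

(** Lebesgue measure carried over to the canonical measurable structure of [R], with the same
    measurable sets, so that products with [PiD] and [P] can be formed. *)
Definition leb : set R -> \bar R := fun A => mu A.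

Let leb0 : leb set0 = 0%E. Proof. exact: measure0. Qed.
Let leb_ge0 A : (0 <= leb A)%E. Proof. exact: measure_ge0. Qed.
Let leb_sigma_additive : semi_sigma_additive leb.
Proof. exact: (@measure_semi_sigma_additive _ _ _ mu). Qed.
HB.instance Definition _ := isMeasure.Build _ R R leb leb0 leb_ge0 leb_sigma_additive.

Let leb_sigma_finite : sigma_finite setT leb.
Proof. exact: (@sigma_finiteT _ _ _ mu). Qed.

HB.instance Definition _ := Measure_isSigmaFinite.Build _ R R leb leb_sigma_finite.

Let id_measurable : measurable_fun setT (id : measurableTypeR R -> R).
Proof. by move=> _ A mA; rewrite setTI. Qed.

Lemma ge0_integral_leb (D : set R) (f : R -> \bar R) : measurable D ->
  measurable_fun D f -> (forall x, D x -> 0 <= f x)%E ->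
  (\int[leb]_(x in D) f x = \int[mu]_(x in D) f x)%E.
Proof.
move=> mD mf f0.
have := @ge0_integral_pushforward _ _ _ _ _ _ id_measurable mu D f mD mf.
move=> <-.
  by apply: eq_measure_integral => A mA _.
by move=> x; rewrite inE => Dx; exact: f0.
Qed.

Lemma integral_leb (D : set R) (f : R -> \bar R) : measurable D -> measurable_fun D f ->
  (\int[leb]_(x in D) f x = \int[mu]_(x in D) f x)%E.
Proof.
move=> mD mf; rewrite integralE [RHS]integralE; congr (_ - _)%E.
  by apply: ge0_integral_leb => //; exact: measurable_funepos.
by apply: ge0_integral_leb => //; exact: measurable_funeneg.
Qed.

End lebesgue_on_R.

Lemma integral_restricted d (T : measurableType d) (R : realType)
    (m m' : {measure set T -> \bar R}) (D : set T) (f : T -> \bar R) :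
  measurable D -> (forall A, measurable A -> m' A = m (A `&` D)) ->
  measurable_fun setT f -> (forall x, 0 <= f x)%E ->
  (\int[m']_x f x = \int[m]_(x in D) f x)%E.
Proof.
move=> mD mm' mf f0.
have mDC : measurable (~` D) by exact: measurableC.
rewrite -(setUv D) ge0_integral_setU//; last 2 first.
- by rewrite setUv.
- by apply/disj_set2P; exact: setICr.
have -> : (\int[m']_(x in ~` D) f x = 0)%E.
  apply: null_set_integral => //.
    exact: measurable_funTS.
  rewrite -[LHS]/(m' (~` D)) mm'//.
  by rewrite setICl measure0.
rewrite adde0; apply: eq_measure_integral => A mA AD.
by rewrite mm'// setIidl.
Qed.

(** The complement of the union is null for the restricted measure, so together with the [D n] it
    covers the space by sets of finite measure. *)
Lemma sigma_finite_restriction d (T : measurableType d) (R : realType)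
    (m : {measure set T -> \bar R}) (D : nat -> set T) :
  (forall n, measurable (D n) /\ (m (D n) < +oo)%E) ->
  exists m' : {sigma_finite_measure set T -> \bar R},
    forall A, measurable A -> m' A = m (A `&` \bigcup_n D n).
Proof.
move=> HD; have mU : measurable (\bigcup_n D n).
  by apply: bigcup_measurable => n _; have [] := HD n.
have sf : sigma_finite setT (mrestr m mU).
  exists (fun n => if n is k.+1 then D k else ~` \bigcup_n D n).
    apply/seteqP; split => // x _.
    have [[k _ Dk]|nD] := pselect ((\bigcup_n D n) x); first by exists k.+1.
    by exists 0%N.
  case=> [|k]; split.
  - exact: measurableC.
  - by rewrite /mrestr setICl measure0.
  - by have [] := HD k.
  - rewrite /mrestr; apply: le_lt_trans (HD k).2; apply: le_measure; rewrite ?inE.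
    + by apply: measurableI => //; have [] := HD k.
    + by have [] := HD k.
    + by apply: subIsetl.
pose m' : {sigma_finite_measure set T -> \bar R} :=
  HB.pack (mrestr m mU) (Measure_isSigmaFinite.Build _ _ _ (mrestr m mU) sf).
by exists m'.
Qed.

Lemma prod_int d1 d2 (T1 : measurableType d1) (T2 : measurableType d2) (R : realType)
    (m1 : {sigma_finite_measure set T1 -> \bar R})
    (m2 : {sigma_finite_measure set T2 -> \bar R}) (u : T1 -> R) (v : T2 -> R) :
  int1 m1 u -> int1 m2 v ->
  int1 (m1 \x m2)%E (fun z => u z.1 * v z.2) /\
  \int[(m1 \x m2)%E]_z (u z.1 * v z.2) = (\int[m1]_x u x) * (\int[m2]_x v x).
Proof.
move=> iu iv; have mu := int1_meas iu; have mv := int1_meas iv.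
have muv : measurable_fun setT (fun z : T1 * T2 => (u z.1 * v z.2)%:E).
  apply/measurable_EFinP; apply: measurable_funM.
    exact: (measurableT_comp mu).
  exact: (measurableT_comp mv).
have iprod : (m1 \x m2)%E.-integrable setT (fun z => (u z.1 * v z.2)%:E).
  apply/integrableP; split => //.
  rewrite fubini_tonelli1; [|exact: measurableT_comp|by []].
  rewrite /fubini_F/=.
  have mau : measurable_fun setT (fun x => (`|u x|)%:E).
    by apply/measurable_EFinP; exact: measurableT_comp.
  have mav : measurable_fun setT (fun x => (`|v x|)%:E).
    by apply/measurable_EFinP; exact: measurableT_comp.
  have E x : (\int[m2]_y `|u x * v y|%:E = (`|u x|)%:E * \int[m2]_y (`|v y|)%:E)%E.
    rewrite -ge0_integralZl//.
    by apply: eq_integral => y _; rewrite normrM EFinM.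
  under eq_integral do rewrite E.
  rewrite ge0_integralZr//; do ?[by apply: integral_ge0 => y _; rewrite lee_fin].
  move/integrableP : iu => [_ u1]; move/integrableP : iv => [_ v1].
  apply: lte_mul_pinfty; last exact: v1.
    by apply: integral_ge0 => ? _; rewrite lee_fin /=.
  rewrite ge0_fin_numE; first exact: u1.
  by apply: integral_ge0 => ? _; rewrite lee_fin /=.
split=> //; apply: EFin_inj; rewrite EFinM !Rint_EFin//.
rewrite -integral12_prod_meas1// /fubini_F/=.
transitivity (\int[m1]_x ((u x)%:E * \int[m2]_y (v y)%:E))%E.
  by apply: eq_integral => x _; rewrite -integralZl//; apply: eq_integral => y _; rewrite EFinM.
by rewrite -(Rint_EFin iv) integralZr.
Qed.

(* MathComp-Analysis does not infer that a product of sigma-finite measures is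
   sigma-finite, hence the explicit hypothesis on the first factor. *)
Section sigma_finite_first_factor.
Context d1 d2 (T1 : measurableType d1) (T2 : measurableType d2) (R : realType).
Variables (m1 : {measure set T1 -> \bar R}) (m2 : {sigma_finite_measure set T2 -> \bar R}).
Hypothesis sf : sigma_finite setT m1.

Let sigma_finite_copy : exists m : {sigma_finite_measure set T1 -> \bar R},
  forall A, measurable A -> m A = m1 A.
Proof.
have [G GT Goo] := sf.
have [m mE] := sigma_finite_restriction Goo; exists m => A mA.
by rewrite mE// -GT setIT.
Qed.

Section copy.
Variable m : {sigma_finite_measure set T1 -> \bar R}.
Hypothesis mE : forall A, measurable A -> m A = m1 A.

Let intE1 D (g : T1 -> \bar R) : (\int[m]_(z in D) g z = \int[m1]_(z in D) g z)%E.
Proof. by apply: eq_measure_integral => A mA _; exact: mE. Qed.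

Let intE (g : T1 * T2 -> \bar R) : (\int[m \x m2]_z g z = \int[m1 \x m2]_z g z)%E.
Proof. by apply: eq_measure_integral => A mA _; exact: intE1. Qed.

Lemma tonelli_copy (f : T1 * T2 -> \bar R) : measurable_fun setT f -> (forall x, 0 <= f x)%E ->
  (\int[m1 \x m2]_z f z = \int[m1]_x \int[m2]_y f (x, y))%E.
Proof. by move=> mf f0; rewrite -intE fubini_tonelli1// intE1. Qed.

Lemma prod_int_copy (u : T1 -> R) (v : T2 -> R) : int1 m1 u -> int1 m2 v ->
  int1 (m1 \x m2)%E (fun z => u z.1 * v z.2) /\
  \int[(m1 \x m2)%E]_z (u z.1 * v z.2) = (\int[m1]_x u x) * (\int[m2]_x v x).
Proof.
move=> /integrableP[mu iu] iv.
have iu' : int1 m u by apply/integrableP; split; rewrite ?intE1.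
have [/integrableP[mi i] e] := prod_int iu' iv; split.
  by apply/integrableP; split => //; rewrite -intE.
by move: e; rewrite /Rintegral intE intE1.
Qed.

End copy.

Lemma tonelli (f : T1 * T2 -> \bar R) : measurable_fun setT f -> (forall x, 0 <= f x)%E ->
  (\int[m1 \x m2]_z f z = \int[m1]_x \int[m2]_y f (x, y))%E.
Proof. by have [m mE] := sigma_finite_copy; exact: tonelli_copy mE _. Qed.

Lemma prod_int_sf (u : T1 -> R) (v : T2 -> R) : int1 m1 u -> int1 m2 v ->
  int1 (m1 \x m2)%E (fun z => u z.1 * v z.2) /\
  \int[(m1 \x m2)%E]_z (u z.1 * v z.2) = (\int[m1]_x u x) * (\int[m2]_x v x).
Proof. by have [m mE] := sigma_finite_copy; exact: prod_int_copy mE _ _. Qed.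

End sigma_finite_first_factor.

(** Nondecreasing covers are taken, so that a single index serves both coordinates of a point. *)
Lemma product_sigma_finite d1 d2 (T1 : measurableType d1) (T2 : measurableType d2)
    (R : realType) (m1 : {sigma_finite_measure set T1 -> \bar R})
    (m2 : {sigma_finite_measure set T2 -> \bar R}) :
  sigma_finite setT (m1 \x m2)%E.
Proof.
have /sigma_finiteP[G [TG ndG Goo]] := sigma_finiteT m1.
have /sigma_finiteP[H [TH ndH Hoo]] := sigma_finiteT m2.
exists (fun n => G n `*` H n).
  apply/seteqP; split => // -[x y] _.
  have [n _ Gn] : (\bigcup_n G n) x by rewrite -TG.
  have [k _ Hk] : (\bigcup_n H n) y by rewrite -TH.
  exists (maxn n k) => //; split => /=.
    by move: x Gn; exact/subsetPset/ndG/leq_maxl.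
  by move: y Hk; exact/subsetPset/ndH/leq_maxr.
move=> k; have [? ?] := Goo k; have [? ?] := Hoo k.
split; first exact: measurableX.
by rewrite product_measure1E// lte_mul_pinfty// ge0_fin_numE.
Qed.

(** * Covariances of increments weighted by past variables *)

Section elementary_covariance.
Context {d : measure_display} {Omega : measurableType d} {R : realType}.
Context {dY : measure_display} {Y : measurableType dY}.
Variables (P : probability Omega R) (F : R -> set_system Omega).
Variables (Pi : {measure set Y -> \bar R}) (T : R).
Variable nu : R.-ker Omega ~> (R * Y)%type.
Hypothesis Ffil : filtration T F.
Hypothesis Hnu : adapted_counts P F Pi T nu.
Local Notation inc := (inc Pi nu).
Local Notation finset_ := (finset_ Pi).

Let sF (s : R) : 0 <= s -> s <= T -> sigma_algebra setT (F s).
Proof. by move=> s0 sT; case: Ffil => + _ _; apply; exact: memI. Qed.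

Lemma past_inc_L2 (z : Omega -> R) (a b : R) A : Gm (F a) z -> L2 P z ->
  finset_ A -> 0 <= a -> a <= b -> b <= T -> L2 P (fun w => z w * inc a b A w).
Proof.
move=> gz Lz fA a0 ab bT; have sa := sF a0 (le_trans ab bT).
apply: int1_L2.
  apply: measurable_funM; first exact: L2_meas Lz.
  exact: (inc_measurable Ffil Hnu).
have gz2 : Gm (F a) (fun w => z w ^+ 2).
  by under [X in Gm _ X]eq_fun do rewrite expr2; exact: GmM.
apply: eq_int1 (inc2_past_int1 Ffil Hnu fA a0 ab bT gz2 (L2_int1 Lz)) => w.
by rewrite exprMn mulrC.
Qed.

Lemma past_inc_adapted (z : Omega -> R) (a b : R) A : Gm (F a) z ->
  finset_ A -> 0 <= a -> a <= b -> b <= T -> Gm (F b) (fun w => z w * inc a b A w).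
Proof.
move=> gz fA a0 ab bT; apply: GmM; first exact: sF (le_trans a0 ab) bT.
  by apply: subset_trans gz _; exact: (F_mono Ffil).
exact: (inc_adapted Ffil Hnu).
Qed.

(** Everything but the later increment is known at time [a'], and that increment is centred and
    independent of the past. *)
Lemma cov_disjoint (z z' : Omega -> R) (a b a' b' : R) A A' :
  Gm (F a) z -> L2 P z -> Gm (F a') z' -> L2 P z' -> finset_ A -> finset_ A' ->
  0 <= a -> a <= b -> b <= a' -> a' <= b' -> b' <= T ->
  ip P (fun w => z w * inc a b A w) (fun w => z' w * inc a' b' A' w) = 0.
Proof.
move=> gz Lz gz' Lz' fA fA' a0 ab ba' ab' bT.
have a'0 : 0 <= a' by rewrite (le_trans a0)// (le_trans ab).
have a'T := le_trans ab' bT; have bT' := le_trans ba' a'T.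
have b0 := le_trans a0 ab.
have gV : Gm (F a') (fun w => z w * inc a b A w * z' w).
  apply: GmM => //; first exact: sF.
  apply: subset_trans (past_inc_adapted gz fA a0 ab bT') _.
  exact: (F_mono Ffil).
have iV := L2_mul (past_inc_L2 gz Lz fA a0 ab bT') Lz'.
rewrite -[RHS](inc_past Ffil Hnu fA' a'0 ab' bT gV iV).
by apply: eq_Rintegral => w _; ring.
Qed.

Section same_interval.
Variables (z z' : Omega -> R) (a b : R).
Hypotheses (gz : Gm (F a) z) (Lz : L2 P z) (gz' : Gm (F a) z') (Lz' : L2 P z').
Hypotheses (a0 : 0 <= a) (ab : a <= b) (bT : b <= T).

Let gV : Gm (F a) (fun w => z w * z' w).
Proof. by apply: GmM => //; exact: sF (le_trans ab bT). Qed.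

Let iV : int1 P (fun w => z w * z' w).
Proof. exact: L2_mul. Qed.

Lemma cov_same_set A : finset_ A ->
  ip P (fun w => z w * inc a b A w) (fun w => z' w * inc a b A w) =
  ip P z z' * ((b - a) * fine (Pi A)).
Proof.
move=> fA; rewrite [RHS]mulrC -(inc2_past Ffil Hnu fA a0 ab bT gV iV).
by apply: eq_Rintegral => w _; ring.
Qed.

Let LU A (u : Omega -> R) : Gm (F a) u -> L2 P u -> finset_ A -> L2 P (fun w => u w * inc a b A w).
Proof. by move=> gu Lu fA; exact: past_inc_L2. Qed.

Let mU A (u : Omega -> R) : Gm (F a) u -> L2 P u -> finset_ A ->
  measurable_fun setT (fun w => u w * inc a b A w).
Proof. by move=> gu Lu fA; apply: L2_meas; exact: LU. Qed.

Let cov_U A B C (u v : Omega -> R) : Gm (F a) u -> L2 P u -> Gm (F a) v -> L2 P v ->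
  finset_ A -> finset_ B -> finset_ C -> [disjoint A & B] ->
  ip P (fun w => u w * inc a b (A `|` B) w) (fun w => v w * inc a b C w) =
  ip P (fun w => u w * inc a b A w) (fun w => v w * inc a b C w) +
  ip P (fun w => u w * inc a b B w) (fun w => v w * inc a b C w).
Proof.
move=> gu Lu gv Lv fA fB fC dAB; have fAB := finset_U fA fB.
rewrite -ipDl//; do ?exact: LU.
apply: ip_ae; do ?exact: mU.
- by apply: measurable_funD; exact: mU.
- by apply: filterS (inc_ae_U Hnu fA fB dAB a0 ab bT) => w ->; rewrite mulrDr.
- exact: aeW.
Qed.

Let cov_Ur A B C (u v : Omega -> R) : Gm (F a) u -> L2 P u -> Gm (F a) v -> L2 P v ->
  finset_ A -> finset_ B -> finset_ C -> [disjoint A & B] ->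
  ip P (fun w => v w * inc a b C w) (fun w => u w * inc a b (A `|` B) w) =
  ip P (fun w => v w * inc a b C w) (fun w => u w * inc a b A w) +
  ip P (fun w => v w * inc a b C w) (fun w => u w * inc a b B w).
Proof. by move=> *; rewrite ipC cov_U//; congr (_ + _); exact: ipC. Qed.

(** [cov_same_set] for [A], [B] and their union, expanded bilinearly, leaves twice the mixed term
    equal to 0: orthogonality follows from additivity of the variances. *)
Let cov_disj_set A B : finset_ A -> finset_ B -> [disjoint A & B] ->
  ip P (fun w => z w * inc a b A w) (fun w => z' w * inc a b B w) = 0.
Proof.
move=> fA fB dAB; have fAB := finset_U fA fB.
have := cov_same_set fAB; rewrite cov_U// !cov_Ur// !cov_same_set// fine_PiU//.
have -> : ip P (fun w => z w * inc a b B w) (fun w => z' w * inc a b A w) =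
    ip P (fun w => z w * inc a b A w) (fun w => z' w * inc a b B w).
  by apply: eq_Rintegral => w _; ring.
by set c := ip P (fun w => z w * inc a b A w) _; lra.
Qed.

Lemma cov_same_interval A B : finset_ A -> finset_ B ->
  ip P (fun w => z w * inc a b A w) (fun w => z' w * inc a b B w) =
  ip P z z' * ((b - a) * fine (Pi (A `&` B))).
Proof.
move=> fA fB; have mA : measurable A by case: fA.
have mB : measurable B by case: fB.
have fI : finset_ (A `&` B) by apply: finset_S fA => //; exact: measurableI.
have fD : finset_ (A `\` B) by apply: finset_S fA => //; exact: measurableD.
have fD' : finset_ (B `\` A) by apply: finset_S fB => //; exact: measurableD.
have d1 : [disjoint A `&` B & A `\` B].
  by apply/disj_set2P; rewrite -subset0 => x [[_ Bx] [_ /(_ Bx)]].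
have d2 : [disjoint A `&` B & B `\` A].
  by apply/disj_set2P; rewrite -subset0 => x [[Ax _] [_ /(_ Ax)]].
have d3 : [disjoint A `\` B & A `&` B].
  by apply/disj_set2P; rewrite -subset0 => x [[_ +] [_ Bx]] => /(_ Bx).
have d4 : [disjoint A `\` B & B `\` A].
  by apply/disj_set2P; rewrite -subset0 => x [[Ax _] [_ /(_ Ax)]].
have EA : A = (A `&` B) `|` (A `\` B) by rewrite setUIDK.
have EB : B = (A `&` B) `|` (B `\` A) by rewrite setIC setUIDK.
have fA' : finset_ ((A `&` B) `|` (A `\` B)) by rewrite -EA.
have fB' : finset_ ((A `&` B) `|` (B `\` A)) by rewrite -EB.
have -> : ip P (fun w => z w * inc a b A w) (fun w => z' w * inc a b B w) =
    ip P (fun w => z w * inc a b ((A `&` B) `|` (A `\` B)) w)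
      (fun w => z' w * inc a b ((A `&` B) `|` (B `\` A)) w).
  by rewrite -EA -EB.
rewrite cov_U// !cov_Ur//.
by rewrite cov_same_set// !cov_disj_set// !addr0.
Qed.

End same_interval.

(** With [a <= a'] and [e = min b b'], the first interval is cut at [a'] and [e], the second at [e];
    only the common piece [[a', e)] correlates. *)
Lemma inc_cov (z z' : Omega -> R) (a b a' b' : R) A A' :
  Gm (F a) z -> L2 P z -> Gm (F a') z' -> L2 P z' -> finset_ A -> finset_ A' ->
  0 <= a -> a <= b -> b <= T -> 0 <= a' -> a' <= b' -> b' <= T ->
  ip P (fun w => z w * inc a b A w) (fun w => z' w * inc a' b' A' w) =
  ip P z z' * (Num.max 0 (Num.min b b' - Num.max a a') * fine (Pi (A `&` A'))).
Proof.
move=> + + + + + + + + + + + +.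
wlog aa' : z z' a b a' b' A A' / a <= a'.
  move=> H gz Lz gz' Lz' fA fA' a0 ab bT a0' ab' bT'.
  case/orP: (le_total a a') => aa'; first exact: H.
  by rewrite ipC H// (ipC P z') (minC b') (maxC a') setIC.
move=> gz Lz gz' Lz' fA fA' a0 ab bT a0' ab' bT'.
rewrite (max_idPr aa').
have [ba'|/ltW ba'] := leP b a'.
  rewrite (cov_disjoint gz Lz gz' Lz' fA fA')//.
  rewrite (max_idPl _) ?mul0r ?mulr0//.
  by rewrite subr_le0 ge_min ba'.
pose e := Num.min b b'.
have a'e : a' <= e by rewrite le_min ba' ab'.
have eb : e <= b by rewrite ge_min lexx.
have eb' : e <= b' by rewrite ge_min lexx orbT.
have e0 := le_trans a0' a'e; have eT := le_trans eb bT; have a'T := le_trans a'e eT.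
have gza' : Gm (F a') z by apply: subset_trans gz _; exact: (F_mono Ffil).
have gze : Gm (F e) z by apply: subset_trans gza' _; exact: (F_mono Ffil).
have gze' : Gm (F e) z' by apply: subset_trans gz' _; exact: (F_mono Ffil).
rewrite -/e (max_idPr _) ?subr_ge0// -cov_same_interval//.
have E1 : (fun w => z w * inc a b A w) =
    (fun w => z w * inc a a' A w + (z w * inc a' e A w + z w * inc e b A w)).
  by apply/funext => w; rewrite (incD _ _ a a' b) (incD _ _ a' e b) !mulrDr.
have E2 : (fun w => z' w * inc a' b' A' w) =
    (fun w => z' w * inc a' e A' w + z' w * inc e b' A' w).
  by apply/funext => w; rewrite (incD _ _ a' e b') mulrDr.
have L1 : L2 P (fun w => z w * inc a a' A w) by exact: past_inc_L2.
have L2' : L2 P (fun w => z w * inc a' e A w) by exact: past_inc_L2.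
have L3 : L2 P (fun w => z w * inc e b A w) by exact: past_inc_L2.
have L4 : L2 P (fun w => z' w * inc a' e A' w) by exact: past_inc_L2.
have L5 : L2 P (fun w => z' w * inc e b' A' w) by exact: past_inc_L2.
have L45 := L2D L4 L5.
rewrite E1 E2 ipDl//; last exact: L2D.
rewrite ipDl// !ipDr//.
have -> : ip P (fun w => z w * inc a a' A w) (fun w => z' w * inc a' e A' w) = 0.
  exact: cov_disjoint.
have -> : ip P (fun w => z w * inc a a' A w) (fun w => z' w * inc e b' A' w) = 0.
  exact: cov_disjoint.
have -> : ip P (fun w => z w * inc a' e A w) (fun w => z' w * inc e b' A' w) = 0.
  exact: cov_disjoint.
have -> : ip P (fun w => z w * inc e b A w) (fun w => z' w * inc a' e A' w) = 0.
  by rewrite ipC; apply: cov_disjoint.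
(* One of the two remainders is an empty interval, [e] being [b] or [b']. *)
have -> : ip P (fun w => z w * inc e b A w) (fun w => z' w * inc e b' A' w) = 0.
  transitivity (\int[P]_(w in setT) (0 : R)); last by rewrite Rintegral_cst// mul0r.
  case/orP: (le_total b b') => bb'.
    have -> : e = b by exact/min_idPl.
    by apply: eq_Rintegral => w _; rewrite inc_diag; ring.
  have -> : e = b' by exact/min_idPr.
  by apply: eq_Rintegral => w _; rewrite inc_diag; ring.
by rewrite !addr0 !add0r.
Qed.

End elementary_covariance.

Lemma itv_leb (R : realType) (a b a' b' : R) :
  leb (`[a, b[ `&` `[a', b'[) = (Num.max 0 (Num.min b b' - Num.max a a'))%:E.
Proof.
have -> : `[a, b[ `&` `[a', b'[ = [set` `[Num.max a a', Num.min b b'[] :> set R.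
  apply/seteqP; split => x /=; rewrite !in_itv/= ge_max lt_min.
    by move=> [/andP[-> ->] /andP[-> ->]].
  by move=> /andP[/andP[-> ->] /andP[-> ->]].
rewrite /leb lebesgue_measure_itv/= lte_fin.
have [h|h] := boolP (Num.max a a' < Num.min b b').
  rewrite -EFinB; congr EFin; apply/esym/max_idPr.
  by rewrite subr_ge0 ltW.
by rewrite (max_idPl _)// subr_le0 leNgt.
Qed.

Lemma itv_int1 (R : realType) (a b : R) : int1 (leb (R := R)) (\1_(`[a, b[ : set R)).
Proof.
apply: ge0_int1 => //; rewrite integral_indic// setIT.
by have h := itv_leb a b a b; rewrite setIid in h; rewrite [X in (X < _)%E]h ltry.
Qed.

Lemma itv_int (R : realType) (a b : R) : a <= b ->
  \int[leb (R := R)]_s \1_(`[a, b[ : set R) s = b - a.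
Proof.
move=> ab; rewrite /Rintegral integral_indic// setIT; have h := itv_leb a b a b; rewrite setIid in h.
by rewrite [X in fine X]h/= minxx maxxx; apply/max_idPr; rewrite subr_ge0.
Qed.

(** * The isometry and its closure *)

Section elementary_processes.
Context {d : measure_display} {Omega : measurableType d} {R : realType}.
Context {dY : measure_display} {Y : measurableType dY}.
Variables (P : probability Omega R) (F : R -> set_system Omega).
Variables (Pi : {measure set Y -> \bar R}) (T : R).
Variable nu : R.-ker Omega ~> (R * Y)%type.
Hypothesis Ffil : filtration T F.
Hypothesis Hnu : adapted_counts P F Pi T nu.
Variables (D : set Y) (PiD : {sigma_finite_measure set Y -> \bar R}).
Hypothesis mD : measurable D.
Hypothesis PiDE : forall A, measurable A -> PiD A = Pi (A `&` D).
Local Notation finset_ := (finset_ Pi).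

Definition space_time := ((leb (R := R) \x PiD) \x P)%E.

(** A past variable times the indicator of a rectangle. The inclusion [eAD] makes [Pi] and [PiD]
    agree on [eA]. *)
Record elem := Elem {
  ez : Omega -> R; ea : R; eb : R; eA : set Y;
  ezF : Gm (F ea) ez; ezL : L2 P ez; ea0 : 0 <= ea; eab : ea <= eb; ebT : eb <= T;
  eAf : finset_ eA; eAD : eA `<=` D }.

Definition ef (e : elem) (z : R * Y * Omega) : R :=
  ez e z.2 * (\1_(`[ea e, eb e[ : set R) z.1.1 * \1_(eA e) z.1.2).

Definition ei (e : elem) (w : Omega) : R := ez e w * inc Pi nu (ea e) (eb e) (eA e) w.

Definition efun (s : seq elem) z : R := \sum_(e <- s) ef e z.
Definition eint (s : seq elem) w : R := \sum_(e <- s) ei e w.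

Lemma ei_L2 e : L2 P (ei e).
Proof.
apply: (past_inc_L2 Ffil Hnu); [exact: ezF|exact: ezL|exact: eAf|exact: ea0|exact: eab|exact: ebT].
Qed.

Let eA_meas e : measurable (eA e). Proof. by case: (eAf e). Qed.

Let ef_prod e e' : int1 space_time (fun z => ef e z * ef e' z) /\
  \int[space_time]_z (ef e z * ef e' z) = ip P (ez e) (ez e') *
    (Num.max 0 (Num.min (eb e) (eb e') - Num.max (ea e) (ea e')) * fine (Pi (eA e `&` eA e'))).
Proof.
pose S : set (R * Y) := (`[ea e, eb e[ `&` `[ea e', eb e'[) `*` (eA e `&` eA e').
have mI : measurable (`[ea e, eb e[ `&` `[ea e', eb e'[ : set R).
  by apply: measurableI; exact: measurable_itv.
have mA : measurable (eA e `&` eA e') by apply: measurableI; exact: eA_meas.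
have mS : measurable S by exact: measurableX.
pose l : R := Num.max 0 (Num.min (eb e) (eb e') - Num.max (ea e) (ea e')).
have fA : Pi (eA e `&` eA e') \is a fin_num.
  rewrite ge0_fin_numE//; apply: le_lt_trans (eAf e).2; apply: le_measure; rewrite ?inE//.
have SE : ((leb (R := R) \x PiD) S = l%:E * Pi (eA e `&` eA e'))%E.
  rewrite product_measure1E// PiDE// [X in (X * _)%E]itv_leb; congr (_ * Pi _)%E.
  by apply/setIidl => y [Ay _]; exact: (eAD Ay).
have Sfin : ((leb (R := R) \x PiD) S < +oo)%E.
  by rewrite SE lte_mul_pinfty// ?lee_fin ?le_max ?lexx// ltey_eq fA.
have i1 : int1 (leb (R := R) \x PiD)%E (\1_S : _ -> R).
  apply: ge0_int1 => //.
  by rewrite integral_indic// setIT.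
have i2 : int1 P (fun w => ez e w * ez e' w) by apply: L2_mul; exact: ezL.
have E z : ef e z * ef e' z = \1_S z.1 * (ez e z.2 * ez e' z.2).
  rewrite /ef /S !indicE !in_setX !in_setI.
  by do 4 case: (_ \in _); rewrite /= ?(mulr1, mulr0, mul1r, mul0r).
have [j1 j2] := prod_int_sf (product_sigma_finite (leb (R := R)) PiD) i1 i2.
split; first by apply: eq_int1 j1 => z; rewrite E.
under eq_Rintegral do rewrite E.
rewrite [LHS]j2 mulrC; congr (_ * _).
transitivity (fine (l%:E * Pi (eA e `&` eA e'))%E); last by rewrite fineM.
by rewrite /Rintegral integral_indic// setIT; congr fine; exact: SE.
Qed.

Lemma ef_measurable e : measurable_fun setT (ef e).
Proof.
apply: measurable_funM; last first.
  apply: measurable_funM; apply: measurableT_comp => //.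
  - exact: measurableT_comp.
  - exact: measurableT_comp.
exact: (measurableT_comp (L2_meas (ezL e))).
Qed.

Lemma ef_L2 e : L2 space_time (ef e).
Proof.
apply: int1_L2; first exact: ef_measurable.
by apply: eq_int1 (ef_prod e e).1 => z; rewrite expr2.
Qed.

Lemma efun_L2 s : L2 space_time (efun s).
Proof. by apply: L2_sum => e _; exact: ef_L2. Qed.

Lemma eint_L2 s : L2 P (eint s).
Proof. by apply: L2_sum => e _; exact: ei_L2. Qed.

(** Both sides are double sums of the same Gram coefficients, computed by [ef_prod] and by
    [inc_cov]. *)
Lemma elementary_isometry s : e2 space_time (efun s) = e2 P (eint s).
Proof.
rewrite /efun /eint (e2_sumE _ ef_L2) (e2_sumE _ ei_L2).
apply: eq_bigr => e _; apply: eq_bigr => e' _.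
rewrite /ip (ef_prod e e').2; symmetry.
apply: (inc_cov Ffil Hnu); [exact: ezF|exact: ezL|exact: ezF|exact: ezL|exact: eAf|exact: eAf
  |exact: ea0|exact: eab|exact: ebT|exact: ea0|exact: eab|exact: ebT].
Qed.

Lemma efun_cat s s' z : efun (s ++ s') z = efun s z + efun s' z.
Proof. exact: big_cat. Qed.

Lemma eint_cat s s' w : eint (s ++ s') w = eint s w + eint s' w.
Proof. exact: big_cat. Qed.

Let sF (s : R) : 0 <= s -> s <= T -> sigma_algebra setT (F s).
Proof. by move=> s0 sT; case: Ffil => + _ _; apply; exact: memI. Qed.

Program Definition escale (c : R) (e : elem) : elem :=
  @Elem (fun w => c * ez e w) (ea e) (eb e) (eA e) _ _ (ea0 e) (eab e) (ebT e) (eAf e) (@eAD e).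
Next Obligation.
move=> c e; apply: GmZ; last exact: ezF.
by apply: sF; [exact: ea0|exact: le_trans (eab e) (ebT e)].
Qed.
Next Obligation. by move=> c e; apply: L2Z; exact: ezL. Qed.

Lemma efun_scale c s z : efun (map (escale c) s) z = c * efun s z.
Proof. by rewrite /efun big_map mulr_sumr; apply: eq_bigr => e _; rewrite /ef/=; ring. Qed.

Lemma eint_scale c s w : eint (map (escale c) s) w = c * eint s w.
Proof. by rewrite /eint big_map mulr_sumr; apply: eq_bigr => e _; rewrite /ei/=; ring. Qed.

(** The closure in L2 of the graph of [efun s |-> eint s]; one list [s] has to approximate both
    sides. By the isometry, [xi] determines [Z] almost surely. *)
Definition integral_of xi Z := [/\ L2 space_time xi, L2 P Z &
  forall eps : R, 0 < eps -> exists s,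
    e2 space_time (fun z => xi z - efun s z) <= eps /\
    e2 P (fun w => Z w - eint s w) <= eps].

Lemma integral_ofD xi Z xi' Z' : integral_of xi Z -> integral_of xi' Z' ->
  integral_of (fun z => xi z + xi' z) (fun w => Z w + Z' w).
Proof.
move=> [Lxi LZ H] [Lxi' LZ' H']; split; [exact: L2D|exact: L2D|move=> eps e0].
have e4 : 0 < eps / 4 by rewrite divr_gt0.
have [s [s1 s2]] := H _ e4; have [s' [s1' s2']] := H' _ e4.
exists (s ++ s'); split.
  have -> : (fun z => xi z + xi' z - efun (s ++ s') z) =
      (fun z => (xi z - efun s z) + (xi' z - efun s' z)).
    by apply/funext => z; rewrite efun_cat; ring.
  have := e2D_le (L2B Lxi (efun_L2 s)) (L2B Lxi' (efun_L2 s')); lra.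
have -> : (fun w => Z w + Z' w - eint (s ++ s') w) =
    (fun w => (Z w - eint s w) + (Z' w - eint s' w)).
  by apply/funext => z; rewrite eint_cat; ring.
have := e2D_le (L2B LZ (eint_L2 s)) (L2B LZ' (eint_L2 s')); lra.
Qed.

Lemma integral_ofZ c xi Z : integral_of xi Z ->
  integral_of (fun z => c * xi z) (fun w => c * Z w).
Proof.
move=> [Lxi LZ H]; split; [exact: L2Z|exact: L2Z|move=> eps e0].
have c0 : 0 < c ^+ 2 + 1 by have := sqr_ge0 c; lra.
have e1 : 0 < eps / (c ^+ 2 + 1) by rewrite divr_gt0.
have [s [s1 s2]] := H _ e1; exists (map (escale c) s).
have bnd (x : R) : 0 <= x -> x <= eps / (c ^+ 2 + 1) -> c ^+ 2 * x <= eps.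
  rewrite ler_pdivlMr// => x0; have := sqr_ge0 c; nra.
split.
  under [X in e2 _ X]eq_fun do rewrite efun_scale -mulrBr.
  rewrite e2Z; last exact: L2B (efun_L2 _).
  by apply: bnd => //; exact: e2_ge0.
under [X in e2 _ X]eq_fun do rewrite eint_scale -mulrBr.
rewrite e2Z; last exact: L2B (eint_L2 _).
by apply: bnd => //; exact: e2_ge0.
Qed.

Lemma integral_ofB xi Z xi' Z' : integral_of xi Z -> integral_of xi' Z' ->
  integral_of (fun z => xi z - xi' z) (fun w => Z w - Z' w).
Proof.
move=> H /(integral_ofZ (-1)) /(integral_ofD H).
by congr integral_of; apply/funext => x; rewrite mulN1r.
Qed.

Lemma integral_of_isometry xi Z : integral_of xi Z -> e2 space_time xi = e2 P Z.
Proof.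
move=> [Lxi LZ H].
have [s Hs] : exists s : nat -> seq elem, forall n,
    e2 space_time (fun z => efun (s n) z - xi z) <= n.+1%:R^-1 /\ e2 P (fun w => eint (s n) w - Z w) <= n.+1%:R^-1.
  have [n|s Hs] := @choice nat (seq elem) (fun n s =>
    e2 space_time (fun z => efun s z - xi z) <= n.+1%:R^-1 /\ e2 P (fun w => eint s w - Z w) <= n.+1%:R^-1).
    have [|s Hs] := H (n.+1%:R^-1); first by rewrite invr_gt0.
    case: Hs => Hs1 Hs2; exists s; split; first by rewrite e2_subC.
    by rewrite e2_subC.
  by exists s.
have cvg_harm : (fun n => n.+1%:R^-1 : R) @ \oo --> 0 by exact: cvg_harmonic.
have c1 : e2 space_time (efun (s n)) @[n --> \oo] --> e2 space_time xi.
  apply: e2_cvg_cont => // [n|]; first exact: efun_L2.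
  by apply: cvg0_le cvg_harm => n; rewrite e2_ge0 (Hs n).1.
have c2 : e2 P (eint (s n)) @[n --> \oo] --> e2 P Z.
  apply: e2_cvg_cont => // [n|]; first exact: eint_L2.
  by apply: cvg0_le cvg_harm => n; rewrite e2_ge0 (Hs n).2.
apply: (cvg_unique _ c1) => //=.
by under eq_fun do rewrite elementary_isometry.
Qed.

Lemma integral_of_closed xi Z : L2 space_time xi -> L2 P Z ->
  (forall eps : R, 0 < eps -> exists xi' Z', [/\ integral_of xi' Z',
     e2 space_time (fun z => xi z - xi' z) <= eps &
     e2 P (fun w => Z w - Z' w) <= eps]) -> integral_of xi Z.
Proof.
move=> Lxi LZ H; split => // eps e0.
have e4 : 0 < eps / 4 by rewrite divr_gt0.
have [xi' [Z' [[Lxi' LZ' H'] h1 h2]]] := H _ e4.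
have [s [s1 s2]] := H' _ e4; exists s; split.
  by have := e2_dist Lxi Lxi' (efun_L2 s); lra.
by have := e2_dist LZ LZ' (eint_L2 s); lra.
Qed.

Lemma integral_of_elem s : integral_of (efun s) (eint s).
Proof.
split; [exact: efun_L2|exact: eint_L2|move=> eps e0; exists s].
rewrite !ae_e2_0 ?(ltW e0)//.
- by apply: measurable_funB; exact: L2_meas (eint_L2 s).
- by apply: aeW => w; rewrite subrr.
- by apply: measurable_funB; exact: L2_meas (efun_L2 s).
- by apply: aeW => w; rewrite subrr.
Qed.

End elementary_processes.

(** The integral of a nonnegative function is a supremum over simple functions below it, hence
    monotone without measurability. The iterated integrals in the definition of the stochastic
    integral call for this: as [Pi] need not be sigma-finite, their inner integrals are not known to
    be measurable in time. *)
Lemma ge0_le_integral_unmeasured d (T : measurableType d) (R : realType)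
    (m : {measure set T -> \bar R}) (D : set T) (f g : T -> \bar R) :
  (forall x, D x -> 0 <= f x)%E -> (forall x, D x -> f x <= g x)%E ->
  (\int[m]_(x in D) f x <= \int[m]_(x in D) g x)%E.
Proof.
move=> f0 fg; have g0 x : D x -> (0 <= g x)%E by move=> Dx; apply: le_trans (fg _ Dx); exact: f0.
rewrite !ge0_integralE//; apply: ge_ereal_sup => _ [h /= hf <-].
apply: ereal_sup_ubound; exists h => // x; apply: le_trans (hf x) _.
by rewrite /patch; case: ifPn => // /set_mem; exact: fg.
Qed.

Lemma part_mono (R : realType) (a b : R) N tau : is_partition a b N tau ->
  forall j j', (j <= j')%N -> (j' <= N)%N -> tau j <= tau j'.
Proof.
move=> [_ _ H] j; elim=> [|j' IH]; first by rewrite leqn0 => /eqP ->.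
rewrite leq_eqVlt => /predU1P[->//|jj'] j'N.
by apply: le_trans (ltW (H j' _)) => //; apply: IH => //; exact: ltnW.
Qed.

Lemma part_ge (R : realType) (a b : R) N tau j : is_partition a b N tau -> (j <= N)%N -> a <= tau j.
Proof. by move=> H jN; have [<- _ _] := H; exact: part_mono H _ _ _ jN. Qed.

Lemma part_le (R : realType) (a b : R) N tau j : is_partition a b N tau -> (j <= N)%N -> tau j <= b.
Proof. by move=> H jN; have [_ <- _] := H; exact: part_mono H _ _ jN _. Qed.

Lemma ae_ord d (T : measurableType d) (R : realType) (m : {measure set T -> \bar R})
    (n : nat) (Q : 'I_n -> T -> Prop) :
  (forall i, {ae m, forall x, Q i x}) -> {ae m, forall x, forall i, Q i x}.
Proof. by move=> H; apply: filter_forall. Qed.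

Section space_time_bound.
Context {d : measure_display} {Omega : measurableType d} {R : realType}.
Context {dY : measure_display} {Y : measurableType dY}.
Variables (P : probability Omega R) (Pi : {measure set Y -> \bar R}).
Variables (D : set Y) (PiD : {sigma_finite_measure set Y -> \bar R}).
Hypothesis mD : measurable D.
Hypothesis PiDE : forall A, measurable A -> PiD A = Pi (A `&` D).
Local Notation mu := (@lebesgue_measure R).
Local Notation space_time := (space_time P PiD).

Lemma space_time_tonelli (g : R * Y * Omega -> R) : measurable_fun setT g -> (forall z, 0 <= g z) ->
  (\int[space_time]_z (g z)%:E = \int[leb (R := R)]_s \int[PiD]_y \int[P]_w (g (s, y, w))%:E)%E.
Proof.
move=> mg g0; rewrite /space_time tonelli; first last.
- by move=> z; rewrite lee_fin.
- exact/measurable_EFinP.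
- exact: product_sigma_finite.
rewrite tonelli//; last 3 first.
- exact: (@sigma_finiteT _ _ _ (leb (R := R))).
- apply: (measurable_fun_fubini_tonelli_F (fun z : R * Y * Omega => (g z)%:E)) => //; exact/measurable_EFinP.
- by move=> z; apply: integral_ge0 => w _; rewrite lee_fin.
Qed.

(** The bridge from [PiD] to the iterated integrals over [Pi] of the definitions. It is an
    inequality, as [h] may have mass outside [D]. *)
Lemma space_time_le (a b : R) (g : R * Y * Omega -> R) (h : R -> Y -> \bar R) :
  measurable_fun setT g -> (forall z, 0 <= g z) ->
  (forall s y, s \in `[a, b] -> D y -> \int[P]_w (g (s, y, w))%:E <= h s y)%E ->
  (forall s y w, ~~ (s \in `[a, b]) -> g (s, y, w) = 0) ->
  (forall s y, 0 <= h s y)%E ->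
  (\int[space_time]_z (g z)%:E <= \int[mu]_(s in `[a, b]) \int[Pi]_y h s y)%E.
Proof.
move=> mg g0 gh gab h0; rewrite space_time_tonelli//.
have mk : measurable_fun setT (fun z : R * Y => \int[P]_w (g (z, w))%:E)%E.
  apply: (measurable_fun_fubini_tonelli_F (fun z : R * Y * Omega => (g z)%:E)) => //; exact/measurable_EFinP.
have k0 s : (0 <= \int[PiD]_y \int[P]_w (g (s, y, w))%:E)%E.
  by apply: integral_ge0 => y _; apply: integral_ge0 => w _; rewrite lee_fin.
have mK : measurable_fun setT (fun s => \int[PiD]_y \int[P]_w (g (s, y, w))%:E)%E.
  apply: (measurable_fun_fubini_tonelli_F (m2 := PiD) (fun z : R * Y => \int[P]_w (g (z, w))%:E)%E) => //.
  by move=> z; apply: integral_ge0 => w _; rewrite lee_fin.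
have -> : (\int[leb (R := R)]_s \int[PiD]_y \int[P]_w (g (s, y, w))%:E =
    \int[mu]_(s in `[a, b]) \int[PiD]_y \int[P]_w (g (s, y, w))%:E)%E.
  rewrite -ge0_integral_leb//; last exact: measurable_funTS.
  rewrite [RHS]integral_mkcond; apply: eq_integral => s _; rewrite /patch; case: ifPn => // sab.
  rewrite integral0_eq// => y _; rewrite integral0_eq// => w _; rewrite gab//.
  by apply: contra sab => sab; rewrite inE.
apply: ge0_le_integral_unmeasured => // s sab.
rewrite (integral_restricted mD PiDE); first last.
- by move=> y; apply: integral_ge0 => w _; rewrite lee_fin.
- exact: (measurableT_comp mk).
rewrite integral_mkcond; apply: ge0_le_integral_unmeasured => y _; rewrite /patch.
  by case: ifPn => // _; apply: integral_ge0 => w _; rewrite lee_fin.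
case: ifPn => [/set_mem Dy|_]; last exact: h0.
exact: gh.
Qed.

End space_time_bound.

(** * Step functions and the definition of the martingale integral *)

Section step_functions.
Context {d : measure_display} {Omega : measurableType d} {R : realType}.
Context {dY : measure_display} {Y : measurableType dY}.
Variables (P : probability Omega R) (F : R -> set_system Omega).
Variables (Pi : {measure set Y -> \bar R}) (T : R).
Variable nu : R.-ker Omega ~> (R * Y)%type.
Hypothesis Ffil : filtration T F.
Hypothesis Hnu : adapted_counts P F Pi T nu.
Local Notation finset_ := (finset_ Pi).
Local Notation inc := (inc Pi nu).
Local Notation mu := (@lebesgue_measure R).
Variables (a b : R).
Hypotheses (a0 : 0 <= a) (bT : b <= T).

Section one_step.
Variables (st : step_data (Omega := Omega) (R := R) (Y := Y)).
Hypothesis Hst : is_step P F Pi a b st.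

Let part : is_partition a b (step_N st) (step_tau st). Proof. by case: Hst. Qed.
Let tau0 j : (j < step_N st)%N -> 0 <= step_tau st j.
Proof. by move=> jN; apply: le_trans a0 _; apply: part_ge part _; exact: ltnW. Qed.
Let tauS j : (j < step_N st)%N -> step_tau st j <= step_tau st j.+1.
Proof. by move=> jN; apply: part_mono part _ _ _ _. Qed.
Let tauT j : (j < step_N st)%N -> step_tau st j.+1 <= T.
Proof. by move=> jN; apply: le_trans bT; apply: part_le part _. Qed.
Let stF j c : (j < step_N st)%N -> (c < step_r st)%N -> Gm (F (step_tau st j)) (step_xi st j c).
Proof. by move=> jN cr; case: Hst => _ _ /(_ j c jN cr)[]. Qed.
Let stL j c : (j < step_N st)%N -> (c < step_r st)%N -> L2 P (step_xi st j c).
Proof.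
move=> jN cr; split; first by apply: (F_meas Ffil (tau0 jN) _ (stF jN cr)); exact: le_trans (tauS jN) (tauT jN).
by case: Hst => _ _ /(_ j c jN cr)[_]; rewrite unlock.
Qed.
Let stA c : (c < step_r st)%N -> finset_ (step_A st c).
Proof. by case: Hst => _ + _; apply. Qed.

Lemma step_elems (D : set Y) : measurable D -> exists s : seq (elem P F Pi T D),
  [/\ all (fun e => (a <= ea e) && (eb e <= b)) s,
   (forall z, efun s z = step_fun st z.1.1 z.1.2 z.2 * \1_D z.1.2) &
   (forall w, eint nu s w = \sum_(j < step_N st) \sum_(c < step_r st) step_xi st j c w *
     inc (step_tau st j) (step_tau st j.+1) (step_A st c `&` D) w)].
Proof.
move=> mD.
have AD c : (c < step_r st)%N -> finset_ (step_A st c `&` D).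
  move=> cr; have [mA PA] := stA cr; apply: (@finset_S _ _ _ _ _ (step_A st c)); [exact: measurableI|exact: subIsetl|by []].
pose mk (jc : 'I_(step_N st) * 'I_(step_r st)) : elem P F Pi T D :=
  Elem (stF (ltn_ord jc.1) (ltn_ord jc.2)) (stL (ltn_ord jc.1) (ltn_ord jc.2))
   (tau0 (ltn_ord jc.1)) (tauS (ltn_ord jc.1)) (tauT (ltn_ord jc.1))
   (AD _ (ltn_ord jc.2)) (@subIsetr _ _ _).
exists (map mk (enum {: 'I_(step_N st) * 'I_(step_r st)})); split=> [|z|w].
  rewrite all_map; apply/allP => jc _ /=; have jN := ltn_ord jc.1.
  rewrite (part_le part jN) andbT; exact: part_ge part (ltnW jN).
  rewrite /efun big_map big_enum/= /step_fun pair_big/= mulr_suml.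
  apply: eq_bigr => jc _; rewrite /ef/= [in LHS]indicI/=; ring.
by rewrite /eint big_map big_enum/= pair_big.
Qed.

Lemma step_fun0 s y w : s \notin `[a, b[ -> step_fun st s y w = 0.
Proof.
move=> sab; rewrite /step_fun big1// => j _; rewrite big1// => c _.
rewrite indicE memNset ?mulr0 ?mul0r// => /=; rewrite in_itv/= => /andP[s1 s2].
move/negP : sab; apply; rewrite in_itv/= (le_trans _ s1) ?(lt_le_trans s2)//.
- exact: part_le part _.
- by apply: part_ge part _; exact: ltnW.
Qed.

Lemma step_int_ae (D : set Y) : measurable D ->
  {ae P, forall w, step_int Pi nu st w =
   \sum_(j < step_N st) \sum_(c < step_r st) step_xi st j c w *
     inc (step_tau st j) (step_tau st j.+1) (step_A st c `&` D) w +
   \sum_(j < step_N st) \sum_(c < step_r st) step_xi st j c w *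
     inc (step_tau st j) (step_tau st j.+1) (step_A st c `\` D) w}.
Proof.
move=> mD.
have H : {ae P, forall w, forall (j : 'I_(step_N st)) (c : 'I_(step_r st)),
   compensated Pi nu `[step_tau st j, step_tau st j.+1[ (step_A st c) w =
   inc (step_tau st j) (step_tau st j.+1) (step_A st c `&` D) w +
   inc (step_tau st j) (step_tau st j.+1) (step_A st c `\` D) w}.
  apply: ae_ord => j; apply: ae_ord => c.
  have jN := ltn_ord j; have fA := stA (ltn_ord c); have [mA _] := fA.
  have fI : finset_ (step_A st c `&` D).
    by apply: (finset_S _ _ fA); [exact: measurableI|exact: subIsetl].
  have fD : finset_ (step_A st c `\` D).
    by apply: (finset_S _ _ fA); [exact: measurableD|exact: subDsetl].
  have dj : [disjoint step_A st c `&` D & step_A st c `\` D].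
    by apply/disj_set2P/seteqP; split => // y [[_ ?] [_ ?]].
  have := inc_ae_U Hnu fI fD dj (tau0 jN) (tauS jN) (tauT jN).
  have := inc_ae Hnu fA (tau0 jN) (tauS jN) (tauT jN).
  by rewrite setUIDK; apply: filterS2 => w <-.
apply: filterS H => w H; rewrite /step_int -big_split/=; apply: eq_bigr => j _.
by rewrite -big_split/=; apply: eq_bigr => c _; rewrite -mulrDr H.
Qed.

Lemma step_int_measurable : measurable_fun setT (step_int Pi nu st).
Proof.
apply: measurable_sum => j; apply: measurable_sum => c.
apply: measurable_funM; first exact: L2_meas (stL (ltn_ord j) (ltn_ord c)).
by apply: compensated_measurable => //; case: (stA (ltn_ord c)).
Qed.

End one_step.

Variables (D : set Y) (PiD : {sigma_finite_measure set Y -> \bar R}).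
Hypothesis mD : measurable D.
Hypothesis PiDE : forall A, measurable A -> PiD A = Pi (A `&` D).

Local Notation err xi st := (\int[mu]_(s in `[a, b]) \int[Pi]_y
  'E_P[(fun w => (`|xi s y w - step_fun st s y w| ^+ 2)%R)])%E.

(** The integrand lives on [D], a step function need not. Inside [D] the step function is a list of
    elementary processes within the error of [xi]; outside [D] its whole square belongs to the same
    error, so the isometry there bounds the corresponding part of the integral. *)
Lemma step_approx (st : step_data (Omega := Omega) (R := R) (Y := Y)) xi (c : R) :
  is_step P F Pi a b st -> (forall s y w, ~ D y -> xi s y w = 0) ->
  L2 (space_time P PiD) (fun z => xi z.1.1 z.1.2 z.2 * \1_`[a, b[ z.1.1) ->
  (err xi st <= c%:E)%E ->
  L2 P (step_int Pi nu st) /\ exists s : seq (elem P F Pi T D),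
    [/\ all (fun e => (a <= ea e) && (eb e <= b)) s,
    e2 (space_time P PiD) (fun z => xi z.1.1 z.1.2 z.2 * \1_`[a, b[ z.1.1 - efun s z) <= c &
    e2 P (fun w => step_int Pi nu st w - eint nu s w) <= c].
Proof.
move=> Hst xiD Lxi errc.
have E0 s y : (0 <= 'E_P[(fun w => (`|xi s y w - step_fun st s y w| ^+ 2)%R)])%E.
  by rewrite unlock; apply: integral_ge0 => w _; rewrite lee_fin exprn_ge0.
have [s [sall sE siE]] := step_elems Hst mD.
(* The finitely many pieces outside [D], continued by empty sets, form a second carrier with a
   sigma-finite restriction [PiD'] of its own. *)
pose A c := if (c < step_r st)%N then step_A st c `\` D else set0.
have mA n : measurable (A n) /\ (Pi (A n) < +oo)%E.
  rewrite /A; case: ifPn => [cr|_]; last by rewrite measure0.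
  have [_ /(_ n cr)[mAn PAn] _] := Hst.
  by apply: (finset_S (B := step_A st n)); [exact: measurableD|exact: subDsetl|].
have [PiD' PiDE'] := sigma_finite_restriction mA.
have mD' : measurable (\bigcup_n A n) by apply: bigcup_measurable => n _; have [] := mA n.
have DD' y : (\bigcup_n A n) y -> ~ D y.
  by move=> [n _]; rewrite /A; case: ifPn => // _ [].
have [s' [_ sE' siE']] := step_elems Hst mD'.
have siE'' w : eint nu s' w = \sum_(j < step_N st) \sum_(c < step_r st) step_xi st j c w *
     inc (step_tau st j) (step_tau st j.+1) (step_A st c `\` D) w.
  rewrite siE'; apply: eq_bigr => j _; apply: eq_bigr => c' _; congr (_ * inc _ _ _ w).
  apply/seteqP; split => y [Ay]; first by move/DD'.
  by move=> Dy; split => //; exists c' => //; rewrite /A ltn_ord.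
have siae : {ae P, forall w, eint nu s w + eint nu s' w = step_int Pi nu st w}.
  by apply: filterS (step_int_ae Hst mD) => w ->; rewrite siE siE''.
have Lsi := eint_L2 Ffil Hnu s; have Lsi' := eint_L2 Ffil Hnu s'.
have msi := step_int_measurable Hst.
have Lst : L2 P (step_int Pi nu st) by apply: L2_ae siae _ => //; exact: L2D.
split=> //; exists s; split => //.
  apply: e2_le_EFin; first by apply: L2B => //; exact: (efun_L2 PiDE).
  have ml : L2 (space_time P PiD) (fun z => xi z.1.1 z.1.2 z.2 * \1_`[a, b[ z.1.1 - efun s z).
    by apply: L2B => //; exact: (efun_L2 PiDE).
  apply: le_trans errc; apply: (space_time_le mD PiDE) => //.
  - exact: measurable_funX (L2_meas ml).
  - by move=> z; exact: sqr_ge0.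
  - move=> u y _ Dy; rewrite unlock; apply: ge0_le_integral_unmeasured => w _; rewrite lee_fin ?sqr_ge0//.
    rewrite real_normK ?num_real// sE/= [\1_D _]indicE mem_set// mulr1.
    have [uab|uab] := boolP (u \in `[a, b[); first by rewrite indicE mem_set// mulr1.
    by rewrite (step_fun0 Hst)// indicE memNset ?mulr0 ?subr0 ?expr0n ?sqr_ge0//; exact/negP.
  - move=> u y w uab; have uab' : u \notin `[a, b[.
      by apply: contra uab; rewrite !in_itv/= => /andP[-> /ltW].
    by rewrite sE/= (step_fun0 Hst)// indicE memNset ?mulr0 ?mul0r ?subr0 ?expr0n//; exact/negP.
rewrite (@e2_ae _ _ _ _ _ (eint nu s')).
- rewrite -(elementary_isometry Ffil Hnu PiDE').
  apply: e2_le_EFin; first exact: (efun_L2 PiDE').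
  have ml := efun_L2 PiDE' s'.
  apply: le_trans errc; apply: (space_time_le mD' PiDE') => //.
  - exact: measurable_funX (L2_meas ml).
  - by move=> z; exact: sqr_ge0.
  - move=> u y _ Dy; rewrite unlock; apply: ge0_le_integral_unmeasured => w _; rewrite lee_fin ?sqr_ge0//.
    rewrite real_normK ?num_real// sE'/= indicE mem_set// mulr1 xiD ?sub0r ?sqrrN//; exact: DD'.
  - move=> u y w uab; have uab' : u \notin `[a, b[.
      by apply: contra uab; rewrite !in_itv/= => /andP[-> /ltW].
    by rewrite sE'/= (step_fun0 Hst)// mul0r expr0n.
- by apply: measurable_funB => //; exact: L2_meas Lsi.
- exact: L2_meas Lsi'.
- by apply: filterS siae => w <-; ring.
Qed.

(** The closed interval of the definition is replaced by [[a, b)] to match the half-open cells; the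
    product with the indicator is measurable on the whole space although [xi] is measurable only
    over [[a, b]]. *)
Lemma H2_L2 xi : H2 P F Pi a b xi ->
  L2 (space_time P PiD) (fun z => xi z.1.1 z.1.2 z.2 * \1_`[a, b[ z.1.1).
Proof.
move=> [mxi _ xioo].
have mI : measurable_fun setT (fun z : R * Y * Omega => xi z.1.1 z.1.2 z.2 * \1_`[a, b[ z.1.1).
  have mS : measurable (`[a, b] `*` setT `*` setT : set (R * Y * Omega)).
    by apply: measurableX => //; apply: measurableX.
  have -> : (fun z : R * Y * Omega => xi z.1.1 z.1.2 z.2 * \1_`[a, b[ z.1.1) =
     (fun z => ((fun z : R * Y * Omega => xi z.1.1 z.1.2 z.2) \_ (`[a, b] `*` setT `*` setT)) z * \1_`[a, b[ z.1.1).
    apply/funext => -[[s y] w]/=; rewrite /patch; case: ifPn => // /negP h.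
    rewrite indicE memNset ?mulr0//= => sab; apply: h; rewrite inE/=; split => //; split => //.
    by move: sab; rewrite !in_itv/= => /andP[-> /ltW].
  apply: measurable_funM; first exact: (measurable_restrictT _ mS).1.
  by apply: measurableT_comp => //; apply: measurableT_comp.
split=> //; apply: le_lt_trans xioo.
apply: (space_time_le mD PiDE) => //.
- exact: measurable_funX mI.
- by move=> z; exact: sqr_ge0.
- move=> u y _ Dy; rewrite unlock; apply: ge0_le_integral_unmeasured => w _; rewrite lee_fin ?sqr_ge0//=.
  rewrite real_normK ?num_real// exprMn; have := sqr_ge0 (xi u y w).
  by rewrite indicE; case: (_ \in _); rewrite /= ?expr1n ?mulr1 ?expr0n ?mulr0.
- move=> u y w uab; rewrite indicE memNset ?mulr0 ?expr0n//= => sab; move/negP : uab; apply.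
  by move: sab; rewrite !in_itv/= => /andP[-> /ltW].
- by move=> s y; rewrite unlock; apply: integral_ge0 => w _; rewrite lee_fin exprn_ge0.
Qed.

(* The approximating elementary processes only use times in [a, b]. *)
Definition integral_from xi Z := [/\ L2 (space_time P PiD) xi, L2 P Z &
  forall eps : R, 0 < eps -> exists s : seq (elem P F Pi T D),
    [/\ all (fun e => (a <= ea e) && (eb e <= b)) s,
        e2 (space_time P PiD) (fun z => xi z - efun s z) <= eps &
        e2 P (fun w => Z w - eint nu s w) <= eps]].

Lemma martingale_integral_from xi Z : (forall s y w, ~ D y -> xi s y w = 0) ->
  martingale_int P F Pi nu a b xi Z ->
  integral_from (fun z => xi z.1.1 z.1.2 z.2 * \1_`[a, b[ z.1.1) Z.
Proof.
move=> xiD [Hxi [st [Hst sterr [mZ stZ]]]]; have Lxi := H2_L2 Hxi.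
have K (c : R) : 0 < c -> exists n, (err xi (st n) <= c%:E)%E /\
    ('E_P[(fun w => ((step_int Pi nu (st n) w - Z w) ^+ 2)%R)] <= c%:E)%E.
  move=> c0.
  have nb (u : nat -> \bar R) : u @ \oo --> 0%E -> \forall n \near \oo, (u n <= c%:E)%E.
    move=> u0; have : nbhs (0%:E : \bar R) [set x | (x < c%:E)%E] by apply: open_ereal_lt'; rewrite lte_fin.
    move=> /u0 H; have H' : \forall n \near \oo, (u n < c%:E)%E by exact: H.
  by apply: filterS H' => n; exact: ltW.
  have [n _ Hn] := filterI (nb _ sterr) (nb _ stZ).
  by exists n; exact: (Hn n (leqnn _)).
have LZ : L2 P Z.
  have [n [n1 n2]] := K 1 ltr01; have [Ls _] := step_approx (Hst n) xiD Lxi n1.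
  have -> : Z = (fun w => step_int Pi nu (st n) w - (step_int Pi nu (st n) w - Z w)).
    by apply/funext => w; ring.
  apply: L2B => //; split; first by apply: measurable_funB => //; exact: L2_meas Ls.
  by move: n2; rewrite unlock => /le_lt_trans; apply; exact: ltry.
split => // eps e0; have e4 : 0 < eps / 4 by rewrite divr_gt0.
have [n [n1 n2]] := K _ e4; have [Ls [s [sall s1 s2]]] := step_approx (Hst n) xiD Lxi n1.
exists s; split; [exact: sall|lra|].
have h : e2 P (fun w => step_int Pi nu (st n) w - Z w) <= eps / 4.
  by apply: e2_le_EFin; [exact: L2B|move: n2; rewrite unlock].
have := e2_dist LZ Ls (eint_L2 Ffil Hnu s); rewrite (e2_subC P Z (step_int Pi nu (st n))); lra.
Qed.

End step_functions.

Lemma int1_cvg d (T : measurableType d) (R : realType) (m : {measure set T -> \bar R})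
    (f_ : nat -> T -> R) (f g : T -> R) :
  (forall n, measurable_fun setT (f_ n)) -> measurable_fun setT f ->
  {ae m, forall x, f_ ^~ x @ \oo --> f x} -> int1 m g ->
  {ae m, forall x n, `|f_ n x| <= g x} ->
  int1 m f /\ \int[m]_x f_ n x @[n --> \oo] --> \int[m]_x f x.
Proof.
move=> mf_ mf fcvg ig fg.
have [|||||if_ _ icvg] := @dominated_convergence _ _ _ m _ measurableT
  (fun n x => (f_ n x)%:E) (fun x => (f x)%:E) (fun x => (g x)%:E).
- by move=> n; exact/measurable_EFinP.
- exact/measurable_EFinP.
- by apply: filterS fcvg => x H _; apply: cvg_comp H _; exact: cvg_id.
- exact: ig.
- by apply: filterS fg => x H n _; rewrite lee_fin.
split=> //.
have ifn n : int1 m (f_ n).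
  apply/integrableP; split; first exact/measurable_EFinP.
  have /integrableP[_] := ig; apply: le_lt_trans; apply: ae_ge0_le_integral => //.
  - by apply/measurable_EFinP; apply: measurableT_comp.
  - by apply/measurable_EFinP; apply: measurableT_comp => //; exact: int1_meas ig.
  - by apply: filterS fg => x H _; rewrite /= lee_fin (le_trans (H n))// ler_norm.
apply: fine_cvg; rewrite fineK//; exact: integrable_fin_num.
Qed.

Lemma cvg0_eq0 (R : realType) (x : R) (u : nat -> R) : 0 <= x -> (forall n, x <= u n) ->
  u @ \oo --> 0 -> x = 0.
Proof.
move=> x0 xu u0; apply/eqP; rewrite eq_le x0 andbT; apply/ler_addgt0Pr => e e0.
have /cvgrPdist_le/(_ _ e0)[n _ /(_ n (leqnn n))/=] := u0.
by rewrite sub0r normrN add0r => /(le_trans (ler_norm _)); apply: le_trans.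
Qed.

Section bounded_multiplication.
Context d (T : measurableType d) (R : realType) (m : {measure set T -> \bar R}).

Lemma e2_bounded_mul (X Y : T -> R) (M : R) : measurable_fun setT X -> (forall x, `|X x| <= M) ->
  L2 m Y -> e2 m (fun x => X x * Y x) <= M ^+ 2 * e2 m Y.
Proof.
move=> mX XM LY; rewrite !e2E -RintZ; last exact: L2_int1.
apply: Rint_le.
- by apply: L2_int1; exact: L2_bounded_mul XM LY.
- exact: int1Z (L2_int1 LY).
- move=> x; rewrite exprMn ler_wpM2r ?sqr_ge0// -(real_normK (num_real (X x))).
  by rewrite ler_pXn2r ?nnegrE// (le_trans (normr_ge0 _) (XM x)).
Qed.

Definition trunc (n : nat) (x : R) : R := x * \1_(`[- n%:R, n%:R]%classic : set R) x.

Lemma trunc_measurable n : measurable_fun setT (trunc n).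
Proof. by apply: measurable_funM => //; exact: measurable_indic. Qed.

Lemma trunc_bound n x : `|trunc n x| <= n%:R.
Proof.
rewrite /trunc indicE; case: (boolP (_ \in _)) => [/set_mem/=|_]; last by rewrite mulr0 normr0.
by rewrite mulr1 in_itv/= ler_norml.
Qed.

Lemma trunc_le n x : `|trunc n x| <= `|x|.
Proof. by rewrite /trunc indicE; case: (_ \in _); rewrite ?mulr1// mulr0 normr0. Qed.

Lemma truncB_le n x : `|x - trunc n x| <= `|x|.
Proof. by rewrite /trunc indicE; case: (_ \in _); rewrite ?mulr1 ?subrr ?normr0// mulr0 subr0. Qed.

Lemma trunc_cvg x : trunc n x @[n --> \oo] --> x.
Proof.
apply: cvg_near_cst; exists (Num.Def.archi_bound `|x|) => // n /= hn.
rewrite /trunc indicE mem_set ?mulr1//= in_itv/= -ler_norml.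
have := @archi_boundP R `|x| (normr_ge0 x); have : (Num.Def.archi_bound `|x|)%:R <= n%:R :> R by rewrite ler_nat.
by move=> h1 h2; exact: le_trans (ltW h2) h1.
Qed.

Lemma trunc_L2 n X : L2 m X -> L2 m (fun x => trunc n (X x)) /\
  e2 m (fun x => trunc n (X x)) <= e2 m X.
Proof.
move=> LX; have mt : measurable_fun setT (fun x => trunc n (X x)).
  by apply: measurableT_comp; [exact: trunc_measurable|exact: L2_meas LX].
have le x : `|trunc n (X x) ^+ 2| <= `|X x ^+ 2|.
  by rewrite !normrX ler_pXn2r ?nnegrE// trunc_le.
have L : L2 m (fun x => trunc n (X x)).
  by apply: int1_L2 => //; apply: int1_le (L2_int1 LX) le; exact: measurable_funX.
split=> //; rewrite !e2E; apply: Rint_le; [exact: L2_int1|exact: L2_int1|].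
by move=> x; have := le x; rewrite !ger0_norm ?sqr_ge0.
Qed.

Lemma trunc_e2 X : L2 m X -> e2 m (fun x => X x - trunc n (X x)) @[n --> \oo] --> 0.
Proof.
move=> LX; have mX := L2_meas LX.
have mt n : measurable_fun setT (fun x => trunc n (X x)).
  by apply: measurableT_comp => //; exact: trunc_measurable.
have [|||||_] := @int1_cvg _ _ _ m (fun n x => (X x - trunc n (X x)) ^+ 2) (fun=> 0) (fun x => X x ^+ 2).
- by move=> n; apply: measurable_funX; exact: measurable_funB.
- exact: measurable_cst.
- apply: aeW => x; have -> : (0 : R) = (X x - X x) ^+ 2 by rewrite subrr expr0n.
  apply: cvg_expr.
  by apply: cvgB; [exact: cvg_cst|exact: trunc_cvg].
- exact: L2_int1.
- apply: aeW => x n; rewrite normrX -[leRHS]real_normK ?num_real//.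
  by rewrite ler_pXn2r ?nnegrE// truncB_le.
by rewrite (_ : \int[m]_x 0 = 0)// /Rintegral integral0.
Qed.

End bounded_multiplication.

(** * Past variables times integrals over a cell *)

Section stochastic_kernels.
Context {d : measure_display} {Omega : measurableType d} {R : realType}.
Context {dY : measure_display} {Y : measurableType dY}.
Variables (P : probability Omega R) (F : R -> set_system Omega).
Variables (Pi : {measure set Y -> \bar R}) (T : R).
Hypothesis Ffil : filtration T F.
Local Notation mu := (@lebesgue_measure R).

Let sF (s : R) : 0 <= s -> s <= T -> sigma_algebra setT (F s).
Proof. by move=> s0 sT; case: Ffil => + _ _; apply; exact: memI. Qed.

(** The limit supplied by [riesz_fischer] is exactly [G]-measurable and equals [Z] almost surely;
    [Z] itself need not be [G]-measurable. *)
Lemma limit_adapted G (X : nat -> Omega -> R) Z : sigma_algebra setT G ->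
  (forall n, Gm G (X n)) -> (forall n, L2 P (X n)) -> L2 P Z ->
  e2 P (fun w => X n w - Z w) @[n --> \oo] --> 0 ->
  exists X', Gm G X' /\ {ae P, forall w, Z w = X' w}.
Proof.
move=> sG GX LX LZ c1.
have [e e0|X' [LX' c2 gX]] := riesz_fischer LX.
  have e4 : 0 < e / 4 by rewrite divr_gt0.
  have /cvgrPdist_le/(_ _ e4)[N _ HN] := c1; exists N => m n Nm Nn.
  have := HN _ Nm; have := HN _ Nn; rewrite !sub0r !normrN !ger0_norm ?e2_ge0// => h1 h2.
  by have := e2_dist (LX m) LZ (LX n); rewrite (e2_subC P Z); lra.
exists X'; split; first exact: gX.
have : e2 P (fun w => Z w - X' w) = 0.
  apply: (@cvg0_eq0 _ _ (fun n => 2 * e2 P (fun w => X n w - Z w) +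
      2 * e2 P (fun w => X n w - X' w))) => [|n|].
  - exact: e2_ge0.
  - by have := e2_dist LZ (LX n) LX'; rewrite (e2_subC P Z (X n)).
  - have -> : (0 : R) = 2 * 0 + 2 * 0 by ring.
    by apply: cvgD; apply: cvgM => //; exact: cvg_cst.
by move=> /(e2_eq0 (L2B LZ LX')); apply: filterS => w /eqP; rewrite subr_eq0 => /eqP.
Qed.

(** Adapted up to a null set, because [F a] need not contain the null sets and integrals are fixed
    only almost surely. *)
Definition past (a : R) (X : Omega -> R) :=
  L2 P X /\ exists X', Gm (F a) X' /\ {ae P, forall w, X w = X' w}.

Lemma past_cst (a c : R) : 0 <= a -> a <= T -> past a (fun=> c).
Proof.
move=> a0 aT; split; first exact: L2_cst.
by exists (fun=> c); split; [by apply: Gm_cst; exact: sF|exact: aeW].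
Qed.

Lemma pastD (a : R) X Z : 0 <= a -> a <= T -> past a X -> past a Z -> past a (fun w => X w + Z w).
Proof.
move=> a0 aT [LX [X' [gX XX]]] [LZ [Z' [gZ ZZ]]]; split; first exact: L2D.
exists (fun w => X' w + Z' w); split; first by apply: GmD => //; exact: sF.
by apply: filterS2 XX ZZ => w -> ->.
Qed.

Lemma pastZ (a c : R) X : 0 <= a -> a <= T -> past a X -> past a (fun w => c * X w).
Proof.
move=> a0 aT [LX [X' [gX XX]]]; split; first exact: L2Z.
exists (fun w => c * X' w); split; first by apply: GmZ => //; exact: sF.
by apply: filterS XX => w ->.
Qed.

Lemma past_sum (a : R) (I : Type) (s : seq I) (Q : pred I) X : 0 <= a -> a <= T ->
  (forall i, Q i -> past a (X i)) -> past a (fun w => \sum_(i <- s | Q i) X i w).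
Proof.
move=> a0 aT H; elim: s => [|x s IH].
  by under [Z in past a Z]eq_fun do rewrite big_nil; exact: past_cst.
under [Z in past a Z]eq_fun do rewrite big_cons.
by case: (boolP (Q x)) => // Qx; apply: pastD => //; exact: H.
Qed.

Lemma past_mono (a b : R) X : 0 <= a -> a <= b -> b <= T -> past a X -> past b X.
Proof.
move=> a0 ab bT [LX [X' [gX XX]]]; split=> //; exists X'; split=> //.
by apply: subset_trans gX _; exact: (F_mono Ffil).
Qed.

(* Integrands of the form phi(y) G(s, w); phi is fixed. *)
Definition horizon := (leb (R := R) \x P)%E.

Lemma cell_L2 (a b : R) X : a <= b -> L2 P X ->
  L2 horizon (fun z => X z.2 * \1_`[a, b[ z.1) /\
  e2 horizon (fun z => X z.2 * \1_`[a, b[ z.1) = (b - a) * e2 P X.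
Proof.
move=> ab LX.
have [j1 j2] := prod_int (itv_int1 a b) (L2_int1 LX).
have E (z : R * Omega) : (X z.2 * \1_`[a, b[ z.1) ^+ 2 = \1_`[a, b[ z.1 * X z.2 ^+ 2.
  by rewrite indicE; case: (_ \in _); rewrite ?(mulr1, mulr0, mul1r, mul0r) ?expr0n.
split.
  apply: int1_L2; last by apply: eq_int1 j1 => z; rewrite E.
  apply: measurable_funM; first exact: (measurableT_comp (L2_meas LX)).
  exact: measurableT_comp.
rewrite e2E; under eq_Rintegral do rewrite E.
by rewrite j2 e2E itv_int.
Qed.

Section martingale_case.
Variable nu : R.-ker Omega ~> (R * Y)%type.
Hypothesis Hnu : adapted_counts P F Pi T nu.
Variables (D : set Y) (PiD : {sigma_finite_measure set Y -> \bar R}).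
Hypothesis mD : measurable D.
Hypothesis PiDE : forall A, measurable A -> PiD A = Pi (A `&` D).
Local Notation space_time := (space_time P PiD).
Local Notation integral_of := (integral_of P F Pi T nu D PiD).
Local Notation integral_from := (integral_from P F Pi T nu).

Lemma integral_from_of (a b : R) xi Z : integral_from a b D PiD xi Z -> integral_of xi Z.
Proof. by move=> [Lx LZ H]; split=> // eps /H[s [_ s1 s2]]; exists s. Qed.

Lemma eint_adapted (a b : R) (s : seq (elem P F Pi T D)) : 0 <= b -> b <= T ->
  all (fun e => (a <= ea e) && (eb e <= b)) s -> Gm (F b) (eint nu s).
Proof.
move=> b0 bT; have sb := sF b0 bT; elim: s => [_|e s IH /= /andP[/andP[_ eb_b] /IH gs]].
  by under [Z in Gm _ Z]eq_fun do rewrite /eint big_nil; exact: Gm_cst.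
under [Z in Gm _ Z]eq_fun do rewrite /eint big_cons.
apply: GmD => //; have bT' := le_trans eb_b bT; apply: GmM => //.
  have gz : Gm (F (ea e)) (ez e) by exact: ezF.
  apply: subset_trans gz _; apply: (F_mono Ffil) => //; first exact: ea0.
  exact: le_trans (eab e) eb_b.
have gi := inc_adapted Ffil Hnu (eAf e) (ea0 e) (eab e) bT'; apply: subset_trans gi _.
by apply: (F_mono Ffil) => //; exact: le_trans (ea0 e) (eab e).
Qed.

(** All the processes start at time [a] or later, so a bounded variable known at time [a] can be
    absorbed into each coefficient. *)
Lemma elems_mul (a b M : R) (X : Omega -> R) (s : seq (elem P F Pi T D)) : 0 <= a ->
  Gm (F a) X -> (forall w, `|X w| <= M) -> all (fun e => (a <= ea e) && (eb e <= b)) s ->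
  exists s' : seq (elem P F Pi T D), (forall z, efun s' z = X z.2 * efun s z) /\
    (forall w, eint nu s' w = X w * eint nu s w).
Proof.
move=> a0 gX XM; elim: s => [_|e s IH /= /andP[/andP[aea _] /IH[s' [h1 h2]]]].
  by exists nil; split=> z; rewrite /efun /eint !big_nil mulr0.
have aT : a <= T by apply: le_trans (ebT e); apply: le_trans (eab e).
have eT : ea e <= T by exact: le_trans (eab e) (ebT e).
have gz : Gm (F (ea e)) (fun w => X w * ez e w).
  apply: GmM; [exact: sF (ea0 e) eT| |exact: ezF].
  by apply: subset_trans gX _; exact: (F_mono Ffil).
have Lz : L2 P (fun w => X w * ez e w).
  by apply: L2_bounded_mul XM (ezL e); exact: (F_meas Ffil a0 aT).
exists (Elem gz Lz (ea0 e) (eab e) (ebT e) (eAf e) (@eAD _ _ _ _ _ _ _ _ _ _ e) :: s').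
split=> z; first by rewrite /efun !big_cons -!/(efun _ _) h1 /ef/=; ring.
by rewrite /eint !big_cons -!/(eint _ _ _) h2 /ei/=; ring.
Qed.

Lemma integral_from_mul (a b M : R) (X : Omega -> R) xi Z : 0 <= a -> a <= T ->
  Gm (F a) X -> (forall w, `|X w| <= M) -> integral_from a b D PiD xi Z ->
  integral_of (fun z => X z.2 * xi z) (fun w => X w * Z w).
Proof.
move=> a0 aT gX XM [Lxi LZ H]; have mX := F_meas Ffil a0 aT gX.
have mX' : measurable_fun setT (fun z : R * Y * Omega => X z.2) by exact: measurableT_comp.
split; [by apply: L2_bounded_mul mX' _ Lxi => z; exact: XM|exact: L2_bounded_mul XM LZ|move=> eps e0].
have c0 : 0 < M ^+ 2 + 1 by have := sqr_ge0 M; lra.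
have e1 : 0 < eps / (M ^+ 2 + 1) by rewrite divr_gt0.
have [s [sab s1 s2]] := H _ e1; have [s' [h1 h2]] := elems_mul a0 gX XM sab.
have bnd (x : R) : 0 <= x -> x <= eps / (M ^+ 2 + 1) -> M ^+ 2 * x <= eps.
  by rewrite ler_pdivlMr// => x0; have := sqr_ge0 M; nra.
exists s'; split.
  under [X in e2 _ X]eq_fun do rewrite h1 -mulrBr.
  apply: le_trans (e2_bounded_mul mX' _ (L2B Lxi (efun_L2 PiDE s))) _; first by move=> z; exact: XM.
  by apply: bnd s1; exact: e2_ge0.
under [X in e2 _ X]eq_fun do rewrite h2 -mulrBr.
apply: le_trans (e2_bounded_mul mX XM (L2B LZ (eint_L2 Ffil Hnu s))) _.
by apply: bnd s2; exact: e2_ge0.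
Qed.

(** Elementary processes with times in [[a, b]] have integrals known at time [b], and
    [limit_adapted] keeps this up to a null set. *)
Lemma integral_from_past (a b : R) xi Z : 0 <= b -> b <= T ->
  integral_from a b D PiD xi Z -> past b Z.
Proof.
move=> b0 bT [_ LZ H]; split=> //.
have [n|s Hs] := @choice nat (seq (elem P F Pi T D)) (fun n s =>
    all (fun e => (a <= ea e) && (eb e <= b)) s /\ e2 P (fun w => eint nu s w - Z w) <= n.+1%:R^-1).
  have [|s [s0 _ s2]] := H (n.+1%:R^-1); first by rewrite invr_gt0.
  by exists s; split => //; rewrite e2_subC.
have cvg_harm : (fun n => n.+1%:R^-1 : R) @ \oo --> 0 by exact: cvg_harmonic.
apply: (@limit_adapted (F b) (fun n => eint nu (s n))) => //.
- exact: sF.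
- by move=> n; apply: eint_adapted => //; exact: (Hs n).1.
- by move=> n; exact: (eint_L2 Ffil Hnu).
- by apply: cvg0_le cvg_harm => n; rewrite e2_ge0 (Hs n).2.
Qed.

Variable phi : Y -> R.
Hypothesis phiD : forall y, ~ D y -> phi y = 0.
Hypothesis Lphi : L2 PiD phi.

(** The norm factorizes, so [e2 PiD phi] is the constant of the isometry for integrands with a fixed
    [phi]. *)
Lemma phi_horizon G : L2 horizon G ->
  L2 space_time (fun z => phi z.1.2 * G (z.1.1, z.2)) /\
  e2 space_time (fun z => phi z.1.2 * G (z.1.1, z.2)) = e2 PiD phi * e2 horizon G.
Proof.
move=> LG; have mG := L2_meas LG; have mphi := L2_meas Lphi.
have mg : measurable_fun setT (fun z : R * Y * Omega => phi z.1.2 * G (z.1.1, z.2)).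
  apply: measurable_funM; first by apply: (measurableT_comp mphi); exact: measurableT_comp.
  apply: (measurableT_comp mG); apply: measurable_fun_pair.
    exact: (measurableT_comp measurable_fst).
  exact: measurable_snd.
have E : (\int[space_time]_z ((phi z.1.2 * G (z.1.1, z.2)) ^+ 2)%:E = (e2 PiD phi * e2 horizon G)%:E)%E.
  rewrite space_time_tonelli//; [|exact: measurable_funX|by move=> z; exact: sqr_ge0].
  have mG2 : measurable_fun setT (fun z => (G z ^+ 2)%:E).
    by apply/measurable_EFinP; exact: measurable_funX.
  have c0 s : (0 <= \int[P]_w (G (s, w) ^+ 2)%:E)%E by apply: integral_ge0 => w _; rewrite lee_fin sqr_ge0.
  transitivity (\int[leb (R := R)]_s ((e2 PiD phi)%:E * \int[P]_w (G (s, w) ^+ 2)%:E))%E.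
    apply: eq_integral => s _; rewrite e2_EFin//.
    rewrite -ge0_integralZr//; last 2 first.
    - by apply/measurable_EFinP; exact: measurable_funX.
    - by move=> y _; rewrite lee_fin sqr_ge0.
    apply: eq_integral => y _; rewrite -ge0_integralZl//; last 3 first.
    - exact: (measurableT_comp mG2).
    - by move=> w _; rewrite lee_fin sqr_ge0.
    - by rewrite lee_fin sqr_ge0.
    by apply: eq_integral => w _; rewrite /= exprMn EFinM.
  rewrite ge0_integralZl//; last 2 first.
  - apply: (measurable_fun_fubini_tonelli_F (fun z => (G z ^+ 2)%:E)%E) => // z.
    by rewrite lee_fin sqr_ge0.
  - by rewrite lee_fin e2_ge0.
  rewrite EFinM (e2_EFin LG) /horizon fubini_tonelli1// => z.
  by rewrite lee_fin sqr_ge0.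
have L : L2 space_time (fun z => phi z.1.2 * G (z.1.1, z.2)).
  by split => //; rewrite E ltry.
by split=> //; apply: EFin_inj; rewrite e2_EFin.
Qed.

Definition martingale_rel (G : R * Omega -> R) Z :=
  L2 horizon G /\ integral_of (fun z => phi z.1.2 * G (z.1.1, z.2)) Z.

Lemma martingale_relD G Z G' Z' : martingale_rel G Z -> martingale_rel G' Z' ->
  martingale_rel (fun z => G z + G' z) (fun w => Z w + Z' w).
Proof.
move=> [LG H] [LG' H']; split; first exact: L2D.
by have := integral_ofD Ffil Hnu PiDE H H'; congr integral_of; apply/funext => z; ring.
Qed.

Lemma martingale_relZ c G Z : martingale_rel G Z ->
  martingale_rel (fun z => c * G z) (fun w => c * Z w).
Proof.
move=> [LG H]; split; first exact: L2Z.
by have := integral_ofZ Ffil Hnu PiDE c H; congr integral_of; apply/funext => z; ring.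
Qed.

Lemma martingale_rel_e2 G Z : martingale_rel G Z ->
  L2 P Z /\ e2 P Z = e2 PiD phi * e2 horizon G.
Proof.
move=> [LG H]; have [_ LZ _] := H; split => //.
by rewrite -(integral_of_isometry Ffil Hnu PiDE H) (phi_horizon LG).2.
Qed.

Lemma phi_integral_from (a b : R) S : 0 <= a -> b <= T ->
  martingale_int P F Pi nu a b (fun _ y _ => phi y) S ->
  integral_from a b D PiD (fun z => phi z.1.2 * \1_`[a, b[ z.1.1) S.
Proof.
by move=> a0 bT; apply: (martingale_integral_from Ffil Hnu a0 bT mD PiDE) => s y w; exact: phiD.
Qed.

Section cell.
Variables (a b : R) (S : Omega -> R).
Hypotheses (a0 : 0 <= a) (ab : a <= b) (bT : b <= T).
Hypothesis HS : integral_from a b D PiD (fun z => phi z.1.2 * \1_`[a, b[ z.1.1) S.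
Let C : R := e2 PiD phi * (b - a).
Let C0 : 0 <= C. Proof. by rewrite mulr_ge0 ?e2_ge0// subr_ge0. Qed.

Let cell_bounded X (M : R) : Gm (F a) X -> (forall w, `|X w| <= M) ->
  martingale_rel (fun z => X z.2 * \1_`[a, b[ z.1) (fun w => X w * S w) /\
  e2 P (fun w => X w * S w) = C * e2 P X.
Proof.
move=> gX XM; have aT := le_trans ab bT; have mX := F_meas Ffil a0 aT gX.
have LX : L2 P X.
  have := L2_bounded_mul mX XM (L2_cst P 1).
  by under [Z in L2 _ Z]eq_fun do rewrite mulr1.
have [Lc ec] := cell_L2 ab LX.
have H : martingale_rel (fun z => X z.2 * \1_`[a, b[ z.1) (fun w => X w * S w).
  split=> //; have := integral_from_mul a0 aT gX XM HS.
  by congr integral_of; apply/funext => z /=; ring.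
by split=> //; rewrite (martingale_rel_e2 H).2 ec mulrA.
Qed.

(** A product of two square integrable variables need not be square integrable. The truncations of
    [X] satisfy the isometry, and Fatou passes the bound to the limit. *)
Let cell_square X : Gm (F a) X -> L2 P X ->
  L2 P (fun w => X w * S w) /\ e2 P (fun w => X w * S w) <= C * e2 P X.
Proof.
move=> gX LX; have aT := le_trans ab bT; have mX := L2_meas LX.
have [_ LS _] := HS; have mS := L2_meas LS.
have gt n : Gm (F a) (fun w => trunc n (X w)).
  by apply: Gm_comp => //; exact: trunc_measurable.
have mt n := F_meas Ffil a0 aT (gt n).
have E : (\int[P]_w ((X w * S w) ^+ 2)%:E <= (C * e2 P X)%:E)%E.
  apply: (@fatou_ae _ _ _ P (fun n w => (trunc n (X w) * S w) ^+ 2)).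
  - by move=> n; apply: measurable_funX; exact: measurable_funM.
  - by apply: measurable_funX; exact: measurable_funM.
  - by move=> n w; exact: sqr_ge0.
  - apply: aeW => w; apply: cvg_expr; apply: cvgM; [exact: trunc_cvg|exact: cvg_cst].
  - move=> n; have [H e] := cell_bounded (gt n) (fun w => trunc_bound n (X w)).
    rewrite -e2_EFin; last exact: (martingale_rel_e2 H).1.
    by rewrite e lee_fin ler_wpM2l// (trunc_L2 n LX).2.
have L : L2 P (fun w => X w * S w).
  by split; [exact: measurable_funM|exact: le_lt_trans E (ltry _)].
by split=> //; rewrite -lee_fin e2_EFin.
Qed.

(** [X] is replaced by its adapted version and truncated; the errors of integrand and integral are
    both controlled by the error of the truncation, and the relation is closed. *)
Lemma cell_martingale_rel X : past a X ->
  martingale_rel (fun z => X z.2 * \1_`[a, b[ z.1) (fun w => X w * S w).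
Proof.
move=> [LX [X' [gX XX]]]; have aT := le_trans ab bT.
have mX' := F_meas Ffil a0 aT gX; have LX' := L2_ae mX' XX LX.
have [_ LS _] := HS; have mS := L2_meas LS.
have [LXS' _] := cell_square gX LX'.
have LXS : L2 P (fun w => X w * S w).
  apply: (L2_ae _ _ LXS'); first exact: measurable_funM (L2_meas LX) mS.
  by apply: filterS XX => w ->.
have [Lc _] := cell_L2 ab LX; split => //.
apply: (integral_of_closed Ffil Hnu PiDE) => //; first exact: (phi_horizon Lc).1.
move=> eps e0; have e1 : 0 < eps / (C + 1) by rewrite divr_gt0// ltr_wpDl.
have /cvgrPdist_le/(_ _ e1)[n _ /(_ n (leqnn n))/=] := trunc_e2 LX'.
rewrite sub0r normrN ger0_norm ?e2_ge0// => Hn.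
have gt : Gm (F a) (fun w => trunc n (X' w)).
  by apply: Gm_comp => //; exact: trunc_measurable.
have mt := F_meas Ffil a0 aT gt.
have Lt := (trunc_L2 n LX').1.
have [[Lct Ht] _] := cell_bounded gt (fun w => trunc_bound n (X' w)).
have bnd : C * e2 P (fun w => X' w - trunc n (X' w)) <= eps.
  move: Hn; rewrite ler_pdivlMr ?ltr_wpDl//; have := e2_ge0 P (fun w => X' w - trunc n (X' w)); nra.
have LB := L2B LX Lt.
have eB : e2 P (fun w => X w - trunc n (X' w)) = e2 P (fun w => X' w - trunc n (X' w)).
  apply: e2_ae; [exact: L2_meas LB|exact: L2_meas (L2B LX' Lt)|].
  by apply: filterS XX => w ->.
exists (fun z => phi z.1.2 * (trunc n (X' z.2) * \1_`[a, b[ z.1.1)), (fun w => trunc n (X' w) * S w).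
split=> //.
  have [LB' eB'] := cell_L2 ab LB; have [LBp eBp] := phi_horizon LB'.
  rewrite -eB in bnd; apply: le_trans bnd; rewrite /C -mulrA -eB' -eBp le_eqVlt; apply/orP; left; apply/eqP.
  by congr (e2 _ _); apply/funext => z /=; ring.
have [LBS eBS] := cell_square (GmB (sF a0 aT) gX gt) (L2B LX' Lt).
apply: le_trans bnd; apply: le_trans eBS; rewrite le_eqVlt; apply/orP; left; apply/eqP.
apply: e2_ae; [| exact: L2_meas LBS|].
- by apply: measurable_funB; [exact: L2_meas LXS|exact: measurable_funM].
- by apply: filterS XX => w ->; rewrite mulrBl.
Qed.

End cell.

End martingale_case.
End stochastic_kernels.

(** * The index 0: ordinary integrals *)

Section ordinary_relation.
Context {d : measure_display} {Omega : measurableType d} {R : realType}.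
Context {dY : measure_display} {Y : measurableType dY}.
Variables (P : probability Omega R) (F : R -> set_system Omega).
Variables (Pi : {measure set Y -> \bar R}) (T : R).
Hypothesis T0 : 0 <= T.
Local Notation mu := (@lebesgue_measure R).
Local Notation horizon := (horizon P).

Definition supported (G : R * Omega -> R) := forall z, z.1 \notin `[0, T] -> G z = 0.

(** For almost every [w] the section in time is square integrable by Fubini, and Cauchy-Schwarz on
    [[0, T]] gives integrability and the factor [T]. *)
Lemma horizon_section G : L2 horizon G -> supported G ->
  {ae P, forall w, int1 (leb (R := R)) (fun s => G (s, w)) /\
    ((\int[leb (R := R)]_s G (s, w)) ^+ 2)%:E <= T%:E * \int[leb (R := R)]_s (G (s, w) ^+ 2)%:E}%E.
Proof.
move=> LG sG; have mG := L2_meas LG.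
have mG2 : measurable_fun setT (fun z => (G z ^+ 2)%:E).
  by apply/measurable_EFinP; exact: measurable_funX.
have G0 z : (0 <= (G z ^+ 2)%:E)%E by rewrite lee_fin sqr_ge0.
have mK := @measurable_fun_fubini_tonelli_G _ _ _ _ _ (leb (R := R)) (fun z => (G z ^+ 2)%:E) mG2 G0.
have iK : P.-integrable setT (fun w => \int[leb (R := R)]_s (G (s, w) ^+ 2)%:E)%E.
  apply/integrableP; split => //.
  under eq_integral => w _ do rewrite gee0_abs ?integral_ge0//.
  case: LG => _; rewrite /horizon fubini_tonelli2//.
have := integrable_ae measurableT iK; apply: filterS => w /(_ Logic.I) fw.
have mGw : measurable_fun setT (fun s => G (s, w)) by exact: measurableT_comp mG _.
have Lw : L2 (leb (R := R)) (fun s => G (s, w)).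
  by split => //; rewrite -ge0_fin_numE// integral_ge0.
have mI : measurable (`[0, T] : set R) by exact: measurable_itv.
have IE : (\int[leb (R := R)]_s ((\1_`[0, T] s : R) ^+ 2)%:E = T%:E)%E.
  transitivity (\int[leb (R := R)]_s (\1_`[0, T] s)%:E)%E.
    by apply: eq_integral => s _; rewrite indicE; case: (_ \in _); rewrite ?expr1n ?expr0n.
  rewrite integral_indic// setIT; have h := @lebesgue_measure_itv R `[0, T].
  rewrite [LHS]h/= lte_fin; case: ltP => [_|T0']; first by rewrite -EFinB subr0.
  by congr EFin; apply: le_anti; rewrite T0 T0'.
have LI : L2 (leb (R := R)) (\1_`[0, T] : R -> R).
  by split; [exact: measurable_indic|rewrite IE ltry].
have E s : G (s, w) = \1_`[0, T] s * G (s, w).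
  rewrite indicE; have [_|sT] := boolP (_ \in _); first by rewrite mul1r.
  by rewrite mul0r sG//=; apply: contra sT => sT; rewrite inE.
split; first by apply: eq_int1 (L2_mul LI Lw) => s; rewrite -E.
rewrite -(fineK fw) -EFinM lee_fin.
have := cauchy_schwarz LI Lw; rewrite /ip; under eq_Rintegral do rewrite -E.
move=> /le_trans; apply; rewrite le_eqVlt; apply/orP; left; apply/eqP; congr (_ * _).
by apply: EFin_inj; rewrite e2_EFin.
Qed.

Definition ordinary_rel (c : R) (G : R * Omega -> R) (Z : Omega -> R) :=
  [/\ L2 horizon G, supported G, measurable_fun setT Z &
    {ae P, forall w, Z w = c * \int[leb (R := R)]_s G (s, w)}].

Lemma ordinary_rel_e2 c G Z : ordinary_rel c G Z ->
  L2 P Z /\ e2 P Z <= c ^+ 2 * T * e2 horizon G.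
Proof.
move=> [LG sG mZ ZE]; have mG := L2_meas LG.
have mG2 : measurable_fun setT (fun z => (G z ^+ 2)%:E).
  by apply/measurable_EFinP; exact: measurable_funX.
have G0 z : (0 <= (G z ^+ 2)%:E)%E by rewrite lee_fin sqr_ge0.
have mK := @measurable_fun_fubini_tonelli_G _ _ _ _ _ (leb (R := R)) (fun z => (G z ^+ 2)%:E) mG2 G0.
have K0 w : (0 <= \int[leb (R := R)]_s (G (s, w) ^+ 2)%:E)%E by exact: integral_ge0.
have cT : 0 <= c ^+ 2 * T by rewrite mulr_ge0 ?sqr_ge0.
have E : (\int[P]_w (Z w ^+ 2)%:E <= (c ^+ 2 * T * e2 horizon G)%:E)%E.
  rewrite EFinM e2_EFin// /horizon fubini_tonelli2// -ge0_integralZl//.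
  apply: ae_ge0_le_integral => //.
  - by move=> w _; rewrite lee_fin sqr_ge0.
  - by apply/measurable_EFinP; exact: measurable_funX.
  - by move=> w _; apply: mule_ge0; [rewrite lee_fin|exact: K0].
  - exact: measurable_funeM.
  apply: filterS2 ZE (horizon_section LG sG) => w -> [_ h] _.
  rewrite exprMn EFinM [X in (_ <= X * _)%E]EFinM -muleA.
  by apply: lee_wpmul2l => //; rewrite lee_fin sqr_ge0.
  by move=> w _; exact: K0.
have LZ : L2 P Z by split => //; apply: le_lt_trans E (ltry _).
by split=> //; exact: e2_le_EFin.
Qed.

Lemma ordinary_relD c G Z G' Z' : ordinary_rel c G Z -> ordinary_rel c G' Z' ->
  ordinary_rel c (fun z => G z + G' z) (fun w => Z w + Z' w).
Proof.
move=> [LG sG mZ ZE] [LG' sG' mZ' ZE']; split.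
- exact: L2D.
- by move=> z zT; rewrite sG// sG'// addr0.
- exact: measurable_funD.
- have h := horizon_section LG sG; have h' := horizon_section LG' sG'.
  apply: filterS2 (filterI ZE ZE') (filterI h h') => w [-> ->] [[i1 _] [i2 _]].
  by rewrite -mulrDr RintD.
Qed.

Lemma ordinary_relZ c x G Z : ordinary_rel c G Z ->
  ordinary_rel c (fun z => x * G z) (fun w => x * Z w).
Proof.
move=> [LG sG mZ ZE]; split.
- exact: L2Z.
- by move=> z zT; rewrite sG// mulr0.
- exact: measurable_funM.
- apply: filterS2 ZE (horizon_section LG sG) => w -> [i1 _].
  by rewrite RintZ// mulrCA.
Qed.

Variables (phi : Y -> R).
Hypothesis iphi : int1 Pi phi.
Let c := \int[Pi]_y phi y.

(** The inner integral of [phi y * G s w] is [c * G s w], so that an integral in time alone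
    remains. *)
Lemma ordinary_int_rel (a b : R) (G : R -> Omega -> R) Z : 0 <= a -> b <= T ->
  ordinary_int P F Pi a b (fun s y w => phi y * G s w) Z ->
  L2 horizon (fun z => G z.1 z.2 * \1_`[a, b[ z.1) ->
  ordinary_rel c (fun z => G z.1 z.2 * \1_`[a, b[ z.1) Z.
Proof.
move=> a0 bT [_ mZ ZE] LG.
have sG : supported (fun z => G z.1 z.2 * \1_`[a, b[ z.1).
  move=> z zT; rewrite indicE memNset ?mulr0//= in_itv/= => /andP[az zb].
  by move: zT; rewrite in_itv/= (le_trans a0 az) (le_trans (ltW zb) bT).
split=> //; have mG := L2_meas LG.
apply: filterS2 ZE (horizon_section LG sG) => w [_ Zw] [iw _].
apply: EFin_inj; rewrite Zw EFinM (Rint_EFin iw) -(integralZl _ iw)//.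
transitivity (\int[mu]_(s in `[a, b]) (c * G s w)%:E)%E.
  apply: eq_integral => s _; rewrite EFinM (Rint_EFin iphi) -integralZr//.
have mGw : measurable_fun setT (fun s => (c * (G s w * \1_`[a, b[ s))%:E).
  by apply/measurable_EFinP; apply: measurable_funM => //; exact: int1_meas iw.
have mI : measurable (`[a, b[ : set R) by exact: measurable_itv.
have E s : s \in `[a, b[%classic -> (c * G s w)%:E = (c * (G s w * \1_`[a, b[ s))%:E.
  by move=> sab; rewrite indicE sab mulr1.
rewrite -integral_itv_bndo_bndc; last first.
  by apply: eq_measurable_fun (measurable_funTS mGw) => s sab; rewrite E.
transitivity (\int[mu]_(s in `[a, b[) (c * (G s w * \1_`[a, b[ s))%:E)%E.
  by apply: eq_integral => s sab; rewrite E.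
rewrite -integral_leb//; last exact: measurable_funTS.
rewrite [LHS]integral_mkcond; apply: eq_integral => s _; rewrite /patch; case: ifPn => [_|sab]; first by rewrite EFinM.
by rewrite indicE (negbTE sab) mulr0 mule0.
Qed.

Lemma cell_ordinary_rel (a b : R) S X : 0 <= a -> a <= b -> b <= T ->
  ordinary_int P F Pi a b (fun _ y _ => phi y) S -> L2 P X ->
  ordinary_rel c (fun z => X z.2 * \1_`[a, b[ z.1) (fun w => X w * S w).
Proof.
move=> a0 ab bT HS LX; have [L1 _] := cell_L2 ab (L2_cst P 1).
have [|_ sG mS SE] := @ordinary_int_rel a b (fun=> fun=> 1) S a0 bT _ L1.
  by have : (fun _ y _ => phi y) = (fun (_ : R) y (_ : Omega) => phi y * 1);
     [by apply/funext => s; apply/funext => y; rewrite mulr1|move=> <-].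
have [LX1 _] := cell_L2 ab LX; split => //.
- by move=> z /sG; rewrite mul1r => ->; rewrite mulr0.
- by apply: measurable_funM => //; exact: L2_meas LX.
- apply: filterS2 SE (horizon_section L1 sG) => w -> [iw _]/=.
  rewrite mulrCA -RintZ//; congr (_ * _); apply: eq_Rintegral => s _ /=; ring.
Qed.

Lemma cell_ordinary_past (a b : R) S : filtration T F -> 0 <= a -> a <= b -> b <= T ->
  ordinary_int P F Pi a b (fun _ y _ => phi y) S -> past P F b S.
Proof.
move=> Ffil a0 ab bT HS; have H := cell_ordinary_rel a0 ab bT HS (L2_cst P 1).
have [LS _] := ordinary_rel_e2 H; have [_ _ mS SE] := H; split.
  by apply: L2_ae LS; [case: HS|apply: aeW => w; rewrite mul1r].
exists (fun=> c * \int[leb (R := R)]_s (1 * \1_`[a, b[ s)); split.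
  by apply: Gm_cst; case: Ffil => + _ _; apply; apply: memI => //; exact: le_trans ab.
by apply: filterS SE => w; rewrite mul1r.
Qed.

End ordinary_relation.

(** * Both kinds of integral under one relation *)

Section integration_relation.
Context {d : measure_display} {Omega : measurableType d} {R : realType}.
Context {dY : measure_display} {Y : measurableType dY}.
Variables (P : probability Omega R) (F : R -> set_system Omega).
Variables (Pi : {measure set Y -> \bar R}) (T : R) (m : nat).
Variable nu : 'I_m.+1 -> R.-ker Omega ~> (R * Y)%type.
Hypothesis T0 : 0 <= T.
Hypothesis Ffil : filtration T F.
Hypothesis Hnu : forall i, i != ord0 -> adapted_counts P F Pi T (nu i).
Variables (D : set Y) (PiD : {sigma_finite_measure set Y -> \bar R}).
Hypothesis mD : measurable D.
Hypothesis PiDE : forall A, measurable A -> PiD A = Pi (A `&` D).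
Variables (phi : Y -> R) (i : 'I_m.+1).
Hypothesis phiD : forall y, ~ D y -> phi y = 0.
Hypothesis Lphi : L2 PiD phi.
Hypothesis iphi : i = ord0 -> int1 Pi phi.
Local Notation horizon := (horizon P).

(* Z is the integral of phi(y) G(s, w) with respect to the i-th measure. *)
Definition irel (G : R * Omega -> R) (Z : Omega -> R) :=
  if i == ord0 then ordinary_rel P T (\int[Pi]_y phi y) G Z
  else martingale_rel P F Pi T (nu i) D PiD phi G Z.

(** The constant of the martingale isometry plus that of the ordinary bound: one value serves
    whichever case applies. *)
Definition irel_cst : R := e2 PiD phi + (\int[Pi]_y phi y) ^+ 2 * T.

Lemma irel_cst_ge0 : 0 <= irel_cst.
Proof. by rewrite addr_ge0 ?e2_ge0// mulr_ge0 ?sqr_ge0. Qed.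

Lemma irel_e2 G Z : irel G Z ->
  [/\ L2 horizon G, L2 P Z & e2 P Z <= irel_cst * e2 horizon G].
Proof.
rewrite /irel /irel_cst; case: eqP => [_|/eqP i0] H.
  have [LG _ _ _] := H; have [LZ h] := ordinary_rel_e2 T0 H; split => //.
  by apply: le_trans h _; rewrite ler_wpM2r ?e2_ge0// lerDr e2_ge0.
have [LG _] := H; have [LZ ->] := martingale_rel_e2 Ffil (Hnu i0) PiDE Lphi H; split => //.
by rewrite ler_wpM2r ?e2_ge0// lerDl mulr_ge0 ?sqr_ge0.
Qed.

Lemma irelD G Z G' Z' : irel G Z -> irel G' Z' ->
  irel (fun z => G z + G' z) (fun w => Z w + Z' w).
Proof.
rewrite /irel; case: eqP => [_|/eqP i0]; first exact: ordinary_relD.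
exact: (martingale_relD Ffil (Hnu i0) PiDE).
Qed.

Lemma irelZ c G Z : irel G Z -> irel (fun z => c * G z) (fun w => c * Z w).
Proof.
rewrite /irel; case: eqP => [_|/eqP i0]; first exact: ordinary_relZ.
exact: (martingale_relZ Ffil (Hnu i0) PiDE).
Qed.

Lemma irel_cell (a b : R) S X : 0 <= a -> a <= b -> b <= T ->
  stoch_int P F Pi nu i a b (fun _ y _ => phi y) S -> past P F a X ->
  irel (fun z => X z.2 * \1_`[a, b[ z.1) (fun w => X w * S w).
Proof.
move=> a0 ab bT; rewrite /stoch_int /irel; case: eqP => [i0|/eqP i0] HS pX.
  by apply: (cell_ordinary_rel T0 (iphi i0)) HS _ => //; case: pX.
have HS' := phi_integral_from Ffil (Hnu i0) mD PiDE phiD a0 bT HS.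
exact: (cell_martingale_rel Ffil (Hnu i0) PiDE Lphi a0 ab bT HS' pX).
Qed.

Lemma past_cell (a b : R) S : 0 <= a -> a <= b -> b <= T ->
  stoch_int P F Pi nu i a b (fun _ y _ => phi y) S -> past P F b S.
Proof.
move=> a0 ab bT; rewrite /stoch_int; case: eqP => [i0|/eqP i0] HS.
  exact: (cell_ordinary_past T0 (iphi i0)) HS.
have HS' := phi_integral_from Ffil (Hnu i0) mD PiDE phiD a0 bT HS.
apply: (integral_from_past Ffil (Hnu i0) _ bT HS'); exact: le_trans ab.
Qed.

Lemma irel_process (a b : R) (G : R -> Omega -> R) Z : 0 <= a -> b <= T ->
  stoch_int P F Pi nu i a b (fun s y w => phi y * G s w) Z ->
  L2 horizon (fun z => G z.1 z.2 * \1_`[a, b[ z.1) ->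
  irel (fun z => G z.1 z.2 * \1_`[a, b[ z.1) Z.
Proof.
move=> a0 bT; rewrite /stoch_int /irel; case: eqP => [i0|/eqP i0] HZ LG.
  exact: (ordinary_int_rel T0 (iphi i0)) HZ LG.
split=> //.
have H := martingale_integral_from Ffil (Hnu i0) a0 bT mD PiDE _ HZ.
have {}H := integral_from_of (H _).
have E : (fun z : R * Y * Omega => phi z.1.2 * (G (z.1.1, z.2).1 (z.1.1, z.2).2 * \1_`[a, b[ (z.1.1, z.2).1)) =
  (fun z => phi z.1.2 * G z.1.1 z.2 * \1_`[a, b[ z.1.1) by apply/funext => z /=; rewrite mulrA.
by rewrite E; apply: H => s y w Dy; rewrite phiD// mul0r.
Qed.

End integration_relation.

(** * Multiple sums over cells *)

Section peel_maximum.
Variables (N k : nat).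
Implicit Types (g : 'I_k.+1) (q : 'I_N) (l : {ffun 'I_k.+1 -> 'I_N}) (u : {ffun 'I_k -> 'I_N}).

(** Insertion of the value [q] at position [g]; [frem] deletes the position. Together they split a
    sum over tuples at one coordinate. *)
Definition fins g q u : {ffun 'I_k.+1 -> 'I_N} :=
  [ffun j => if unlift g j is Some j' then u j' else q].
Definition frem g l : {ffun 'I_k -> 'I_N} := [ffun j => l (lift g j)].

Lemma fins_at g q u : fins g q u g = q.
Proof. by rewrite ffunE unlift_none. Qed.

Lemma fins_lift g q u j : fins g q u (lift g j) = u j.
Proof. by rewrite ffunE liftK. Qed.

Lemma frem_fins g q u : frem g (fins g q u) = u.
Proof. by apply/ffunP => j; rewrite ffunE fins_lift. Qed.

Lemma fins_frem g l : fins g (l g) (frem g l) = l.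
Proof.
apply/ffunP => j; rewrite ffunE; case: unliftP => [j' ->|->//].
by rewrite ffunE.
Qed.

Lemma sum_fins (V : nmodType) g (Q : pred {ffun 'I_k.+1 -> 'I_N}) (F : {ffun 'I_k.+1 -> 'I_N} -> V) :
  \sum_(l | Q l) F l = \sum_(q : 'I_N) \sum_(u | Q (fins g q u)) F (fins g q u).
Proof.
rewrite (reindex (fun p : 'I_N * {ffun 'I_k -> 'I_N} => fins g p.1 p.2))/=; last first.
  exists (fun l => (l g, frem g l)) => [[q u] _|l _] /=; last exact: fins_frem.
  by rewrite fins_at frem_fins.
by rewrite pair_big_dep/=.
Qed.

Lemma prod_fins (V : comNzSemiRingType) g q u (F : 'I_k.+1 -> 'I_N -> V) :
  \prod_(j < k.+1) F j (fins g q u j) = F g q * \prod_(j < k) F (lift g j) (u j).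
Proof.
rewrite (bigD1_ord g)//= fins_at; congr (_ * _).
by apply: eq_bigr => j _; rewrite fins_lift.
Qed.

Definition smax g l := [forall j, (j != g) ==> (l j < l g)%N].

Lemma smax_uniq l : injective l -> exists g, forall g', smax g' l = (g' == g).
Proof.
move=> il; have [g _ gmax] := @arg_maxnP _ (ord0 : 'I_k.+1) xpredT (fun j => l j : nat) isT.
exists g => g'; apply/idP/eqP => [/forallP/(_ g)|->].
  case: eqVneq => // gg' /= lg; have /= := gmax g' isT; by rewrite leqNgt lg.
apply/forallP => j; apply/implyP => jg; have /= h := gmax j isT; rewrite ltn_neqAle h andbT.
by apply: contra jg => /eqP/val_inj/il ->.
Qed.

Lemma sum_smax (V : nmodType) (Q : pred {ffun 'I_k.+1 -> 'I_N}) (F : {ffun 'I_k.+1 -> 'I_N} -> V) :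
  (forall l, Q l -> injectiveb l) ->
  \sum_(l | Q l) F l = \sum_g \sum_(l | Q l && smax g l) F l.
Proof.
move=> Qi; rewrite [RHS](exchange_big_dep Q)/=; last by move=> g l _ /andP[].
apply: eq_bigr => l Ql; have [g Hg] := smax_uniq (injectiveP _ (Qi _ Ql)).
by rewrite (big_pred1 g)// => g' /=; rewrite Ql Hg.
Qed.

(** The tuples whose product of cell integrals is known at time [tau r], since cell [q] ends at
    [tau q.+1]. *)
Definition below (r : nat) (j : nat) (l : {ffun 'I_j -> 'I_N}) :=
  injectiveb l && [forall x, (l x < r)%N].

Lemma below_fins (r : nat) g q u :
  (below r (fins g q u) && smax g (fins g q u)) = (q < r)%N && below q u.
Proof.
apply/idP/idP.
  move=> /andP[/andP[/injectiveP il /forallP lr] /forallP lm].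
  have := lr g; rewrite fins_at => ->/=; apply/andP; split.
    by apply/injectiveP => j j' e; apply: (@lift_inj _ g); apply: il; rewrite !fins_lift.
  by apply/forallP => j; have := lm (lift g j); rewrite fins_lift fins_at eq_sym neq_lift.
move=> /andP[qr /andP[/injectiveP il /forallP lq]].
have lift_ne j : g != lift g j by rewrite neq_lift.
apply/andP; split; last first.
  apply/forallP => j; case: (unliftP g j) => [j' ->|->]; last by rewrite eqxx.
  by apply/implyP => _; rewrite fins_lift fins_at.
apply/andP; split.
  apply/injectiveP => j1 j2; case: (unliftP g j1) => [j1' ->|->]; case: (unliftP g j2) => [j2' ->|->] //.
  - by rewrite !fins_lift => /il ->.
  - by rewrite fins_lift fins_at => e; have := lq j1'; rewrite e ltnn.
  - by rewrite fins_lift fins_at => e; have := lq j2'; rewrite -e ltnn.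
apply/forallP => j; case: (unliftP g j) => [j' ->|->]; last by rewrite fins_at.
by rewrite fins_lift; apply: ltn_trans qr.
Qed.

Lemma sum_below (V : nmodType) r (F : {ffun 'I_k.+1 -> 'I_N} -> V) :
  \sum_(l | below r l) F l =
  \sum_g \sum_(q : 'I_N | (q < r)%N) \sum_(u | below q u) F (fins g q u).
Proof.
rewrite sum_smax; last by move=> l /andP[].
apply: eq_bigr => g _; rewrite (sum_fins g) [RHS]big_mkcond/=.
apply: eq_bigr => q _; case: ifP => qr; last by rewrite big_pred0// => u; rewrite below_fins qr.
by apply: eq_bigl => u; rewrite below_fins qr.
Qed.

End peel_maximum.

Section multiple_sums.
Context {d : measure_display} {Omega : measurableType d} {R : realType}.
Variables (P : probability Omega R) (F : R -> set_system Omega) (T C : R) (N : nat) (tau : nat -> R).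
Hypothesis Ffil : filtration T F.
Hypothesis C0 : 0 <= C.
Hypothesis tau0 : forall q, (q <= N)%N -> 0 <= tau q.
Hypothesis tauT : forall q, (q <= N)%N -> tau q <= T.
Hypothesis tau_mono : forall q q', (q <= q')%N -> (q' <= N)%N -> tau q <= tau q'.
Local Notation past := (past P F).
Local Notation delta q := (tau q.+1 - tau q).

(** What the bound uses of the integrals of one factor over the cells: adaptedness and a one-sided
    isometry with past coefficients. *)
Definition cell_family (S : 'I_N -> Omega -> R) :=
  (forall (q : 'I_N) X, past (tau q) X -> past (tau q.+1) (fun w => X w * S q w)) /\
  (forall (Q : pred 'I_N) (X : 'I_N -> Omega -> R), (forall q : 'I_N, past (tau q) (X q)) ->
     e2 P (fun w => \sum_(q | Q q) X q w * S q w) <= C * \sum_(q | Q q) delta q * e2 P (X q)).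

(** Cauchy-Schwarz over the position of the largest index costs a factor [k.+1] at each stage, which
    accumulates to [k!]; each peeled factor costs one [C] from the second part of [cell_family]. *)
Lemma multiple_sum k (S : 'I_k -> 'I_N -> Omega -> R) (Phi : {ffun 'I_k -> 'I_N} -> R) (r : nat) :
  (forall g, cell_family (S g)) -> (r <= N)%N ->
  past (tau r) (fun w => \sum_(l | below r l) Phi l * \prod_(g < k) S g (l g) w) /\
  e2 P (fun w => \sum_(l | below r l) Phi l * \prod_(g < k) S g (l g) w) <=
    C ^+ k * k`!%:R * \sum_(l | below r l) Phi l ^+ 2 * \prod_(g < k) delta (l g).
Proof.
elim: k S Phi r => [|k IH] S Phi r HS rN.
  set l0 : {ffun 'I_0 -> 'I_N} := [ffun x : 'I_0 => False_rect _ (notF (ltn_ord x))].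
  have b0 l : below r l = (l == l0).
    have -> : l = l0 by apply/ffunP => -[].
    rewrite eqxx; apply/andP; split; last by apply/forallP => -[].
    by apply/injectiveP => -[].
  rewrite (big_pred1 l0)//; under eq_fun => w do rewrite (big_pred1 l0)// big_ord0 mulr1.
  split; first by apply: (past_cst P Ffil); [exact: tau0|exact: tauT].
  rewrite big_ord0 expr0 fact0 !mul1r mulr1 e2E /Rintegral integral_cst//= probability_setT mule1//.
(* The coefficient of the last cell: all other factors summed below [q], hence known at [tau q], as
   [cell_family] requires. *)
pose X g (q : 'I_N) w := \sum_(u | below q u) Phi (fins g q u) * \prod_(j < k) S (lift g j) (u j) w.
have HX (g : 'I_k.+1) (q : 'I_N) := IH (fun j => S (lift g j)) (fun u => Phi (fins g q u)) q
  (fun j => HS (lift g j)) (ltnW (ltn_ord q)).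
have E w : \sum_(l | below r l) Phi l * \prod_(g < k.+1) S g (l g) w =
   \sum_g \sum_(q : 'I_N | (q < r)%N) X g q w * S g q w.
  rewrite sum_below; apply: eq_bigr => g _; apply: eq_bigr => q _.
  rewrite mulr_suml; apply: eq_bigr => u _.
  by rewrite (prod_fins g q u (fun g q => S g q w)); ring.
rewrite (funext E).
have pXS g (q : 'I_N) : past (tau q.+1) (fun w => X g q w * S g q w).
  by apply: (HS g).1; exact: (HX g q).1.
have pg g : past (tau r) (fun w => \sum_(q : 'I_N | (q < r)%N) X g q w * S g q w).
  apply: (past_sum Ffil); [exact: tau0|exact: tauT|move=> q qr].
  apply: (past_mono Ffil _ _ _ (pXS g q)); [exact: tau0|exact: tau_mono|exact: tauT].
split; first by apply: (past_sum Ffil) => //; [exact: tau0|exact: tauT].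
apply: le_trans (e2_sum_le (P := xpredT) _) _; first by move=> g _; case: (pg g).
rewrite card_ord sum_below factS natrM exprS.
have -> : C * C ^+ k * (k.+1%:R * k`!%:R) = k.+1%:R * (C * (C ^+ k * k`!%:R)) :> R by ring.
rewrite -mulrA ler_wpM2l// mulr_sumr; apply: ler_sum => g _.
have h := (HS g).2 (fun q : 'I_N => (q < r)%N) (X g) (fun q => (HX g q).1); apply: le_trans h _.
rewrite -mulrA ler_wpM2l// mulr_sumr; apply: ler_sum => q _.
have d0 : 0 <= delta q by rewrite subr_ge0 tau_mono.
apply: le_trans (ler_wpM2l d0 (HX g q).2) _.
rewrite mulrCA ler_wpM2l ?mulr_ge0 ?exprn_ge0// mulr_sumr le_eqVlt; apply/orP; left; apply/eqP.
by apply: eq_bigr => u _; rewrite (prod_fins g q u (fun _ q => delta q)); ring.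
Qed.

End multiple_sums.

(** * Riemann sums of piecewise continuous functions *)

Section piecewise_continuous.
Variables (R : realType) (t T : R).
Hypothesis tT : t < T.

Definition cutoff (h : R -> R) (s : R) : R := h s * \1_(`[t, T[ : set R) s.

(** The common ground of the continuous [psi] and of the functions with finitely many jumps: enough
    for Riemann sums to converge, and closed under products. *)
Definition pc (h : R -> R) := [/\ measurable_fun setT (cutoff h),
  exists M : R, forall s, s \in `[t, T] -> `|h s| <= M &
  exists D : seq R, forall x, x \in `[t, T] -> x \notin D -> h @ within `[t, T] (nbhs x) --> h x].

Lemma pc_bound h : pc h -> exists2 M : R, 0 <= M & forall s, s \in `[t, T] -> `|h s| <= M.
Proof.
move=> [_ [M HM] _]; exists `|M| => // s sT; apply: le_trans (HM s sT) (ler_norm _).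
Qed.

Lemma pc_cst c : pc (fun=> c).
Proof.
split; [by apply: measurable_funM => //; exact: measurable_indic|by exists (`|c|)|].
by exists nil => x _ _; exact: cvg_cst.
Qed.

Lemma pcM h h' : pc h -> pc h' -> pc (fun s => h s * h' s).
Proof.
move=> [mh [M HM] [D HD]] [mh' [M' HM'] [D' HD']]; split.
- have -> : cutoff (fun s => h s * h' s) = (fun s => cutoff h s * cutoff h' s).
    apply/funext => s; rewrite /cutoff indicE; case: (_ \in _); by rewrite ?mulr1// !mulr0.
  exact: measurable_funM.
- exists (M * M') => s sT; rewrite normrM ler_pM//; [exact: HM|exact: HM'].
- exists (D ++ D') => x xT; rewrite mem_cat negb_or => /andP[xD xD'].
  by apply: cvgM; [exact: HD|exact: HD'].
Qed.

Lemma pc_within h : {within `[t, T], continuous h} -> pc h.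
Proof.
move=> ch; split.
- have -> : cutoff h = (h \_ `[t, T[).
    apply/funext => s; rewrite /cutoff indicE /patch; case: (_ \in _); by rewrite ?mulr1// mulr0.
  apply/(measurable_restrictT _ _).1; first exact: measurable_itv.
  apply: (measurable_funS (E := `[t, T])); first exact: measurable_itv.
  - by apply: subset_itvl; rewrite bnd_simp.
  - exact: (subspace_continuous_measurable_fun (measurable_itv _) ch).
- have /compact_bounded[M [_ HM]] := continuous_compact ch (@segment_compact R t T).
  by exists (M + 1) => s sT; apply: (HM (M + 1)); [rewrite ltrDl|exists s].
- by exists nil => x xT _; have /subspace_continuousP := ch; apply.
Qed.

(** The work is in boundedness: one-sided limits bound the function near every point, and
    compactness of [[t, T]] makes the bound global. *)
Lemma pc_star h : square_integrable t T h -> star_condition t T h -> pc h.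
Proof.
move=> [mh _] [[D HD] rc lc]; split.
- have -> : cutoff h = (h \_ `[t, T[).
    apply/funext => s; rewrite /cutoff indicE /patch; case: (_ \in _); by rewrite ?mulr1// mulr0.
  apply/(measurable_restrictT _ _).1; first exact: measurable_itv.
  apply: (measurable_funS (E := `[t, T])) => //.
  by apply: subset_itvl; rewrite bnd_simp.
- have /compact_near_coveringP/near_covering_withinP cov := @segment_compact R t T.
  have /= := cov R +oo%R (fun M x => `|h x| <= M) _.
  move=> H; suff [M [_ HM]] : \forall M \near +oo%R, `[t, T]%classic `<=` (fun x => `|h x| <= M).
    by exists (M + 1) => s sT; apply: (HM (M + 1)); [rewrite ltrDl|exact: sT].
  apply: H => x xT.
  have loc (l : R) (W : set R) : (forall y, W y -> `|l - h y| < 1) ->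
      forall y M, W y -> `|l| + 1 < M -> `|h y| <= M.
    move=> Wl y M /Wl; rewrite distrC => Wy lM; apply: le_trans (ltW lM).
    have -> : h y = l + (h y - l) by ring.
    by apply: le_trans (ler_normD _ _) _; rewrite lerD2l ltW.
  have [BR [BR0 HR]] : exists B : R, 0 <= B /\ \forall y \near x^'+, y <= T -> `|h y| <= B.
    have [xltT|] := ltP x T.
      have xI : x \in `[t, T[ by move: xT; rewrite /= !in_itv/= xltT andbT => /andP[].
      have /cvgrPdist_lt/(_ 1 ltr01)[e e0 He] := rc x xI.
      exists (`|h x| + 2); split; first by rewrite addr_ge0.
      exists e => // y /= xy yx _; apply: (loc (h x) [set y]) => //; last by rewrite ltrD2l ltr1n.
      by move=> _ ->; apply: He.
    move=> Tx; exists 0; split=> //; exists 1 => //= y _ xy yT.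
    by have := lt_le_trans xy (le_trans yT Tx); rewrite ltxx.
  have [BL [BL0 HL]] : exists B : R, 0 <= B /\ \forall y \near x^'-, t <= y -> `|h y| <= B.
    have [tltx|] := ltP t x.
      have xI : x \in `]t, T] by move: xT; rewrite /= !in_itv/= tltx => /andP[].
      have /cvg_ex[l /cvgrPdist_lt/(_ 1 ltr01)[e e0 He]] := lc x xI.
      exists (`|l| + 2); split; first by rewrite addr_ge0.
      exists e => // y /= xy yx _; apply: (loc l [set y]) => //; last by rewrite ltrD2l ltr1n.
      by move=> _ ->; apply: He.
    move=> xt; exists 0; split=> //; exists 1 => //= y _ xy yT.
    by have := le_lt_trans yT (lt_le_trans xy xt); rewrite ltxx.
  pose B := BR + BL + `|h x|.
  exists ([set y | y \in `[t, T] -> `|h y| <= B], [set M | B < M]) => /=.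
    split; last by exists B; split => //; exact: num_real.
    case: HR => e1 /= e10 HR; case: HL => e2 /= e20 HL.
    exists (Num.min e1 e2) => /=; first by rewrite lt_min e10.
    move=> y /=; rewrite lt_min => /andP[y1 y2]; rewrite in_itv/= => /andP[ty yT].
    have [yx|xy|yx] := ltgtP y x.
    + by apply: le_trans (HL _ y2 yx ty) _; rewrite /B; have := normr_ge0 (h x); lra.
    + by apply: le_trans (HR _ y1 xy yT) _; rewrite /B; have := normr_ge0 (h x); lra.
    + by rewrite yx /B; lra.
  by move=> [y M] /= [HB BM] yT; apply: le_trans (HB yT) (ltW BM).
- by exists D.
Qed.

Lemma pc_indic (a b : R) : pc (\1_(`[a, b[ : set R)).
Proof.
split.
- by apply: measurable_funM; exact: measurable_indic.
- by exists 1 => s _; rewrite indicE; case: (_ \in _); rewrite ?normr1 ?normr0.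
- exists [:: a; b] => x _; rewrite !inE negb_or => /andP[xa xb].
  apply: cvg_within_filter; apply: cvg_near_cst.
  have [xlta|altx|] := ltgtP x a; last by move=> e; rewrite e eqxx in xa.
    near=> y; rewrite !indicE !memNset//= in_itv/= => /andP[]; rewrite leNgt.
      by rewrite xlta.
    suff -> : y < a by [].
    by near: y; exact: lt_nbhsl.
  have [xltb|bltx|] := ltgtP x b; last by move=> e; rewrite e eqxx in xb.
    near=> y; rewrite !indicE !mem_set//= in_itv/= ?(ltW altx)//.
    apply/andP; split; first by apply: ltW; near: y; exact: lt_nbhsr.
    by near: y; exact: lt_nbhsl.
  near=> y; rewrite !indicE !memNset//= in_itv/= => /andP[_].
    by rewrite ltNge (ltW bltx).
  rewrite ltNge => /negP; apply; apply: ltW; near: y; exact: lt_nbhsr.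
Unshelve. all: by end_near. Qed.

End piecewise_continuous.

(** * Riemann sums along the partitions *)

Section partitions.
Variables (R : realType) (t T : R) (tau : nat -> nat -> R).
Hypothesis tT : t < T.
Hypothesis part : forall N, (0 < N)%N -> is_partition t T N (tau N).
Hypothesis mesh0 : (fun N => \big[Order.max/0]_(j < N) (tau N j.+1 - tau N j)) @ \oo --> 0.
Local Notation pc := (pc t T).
Local Notation cut := (cutoff t T).
Local Notation leb := (leb (R := R)).
Local Notation cell N q := (`[tau N q, tau N q.+1[%classic : set R).

Lemma node_ge N q : (0 < N)%N -> (q <= N)%N -> t <= tau N q.
Proof. by move=> N0; exact: part_ge (part N0). Qed.
Lemma node_le N q : (0 < N)%N -> (q <= N)%N -> tau N q <= T.
Proof. by move=> N0; exact: part_le (part N0). Qed.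
Lemma node_mono N q q' : (0 < N)%N -> (q <= q')%N -> (q' <= N)%N -> tau N q <= tau N q'.
Proof. by move=> N0; exact: part_mono (part N0) _ _. Qed.
Lemma node_lt N q : (q < N)%N -> tau N q < tau N q.+1.
Proof. by move=> qN; have [_ _] := part (leq_trans (ltn0Sn _) qN); apply. Qed.
Lemma node_in N q : (0 < N)%N -> (q <= N)%N -> tau N q \in `[t, T].
Proof. by move=> N0 qN; rewrite in_itv/= node_ge ?node_le. Qed.

Lemma cell_disj N (q q' : nat) s : (q < N)%N -> (q' < N)%N ->
  cell N q s -> cell N q' s -> q = q'.
Proof.
move=> qN q'N /=; rewrite !in_itv/= => /andP[s1 s2] /andP[s3 s4].
have N0 : (0 < N)%N by exact: leq_trans qN.
case: (ltngtP q q') => // h.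
  by have := le_lt_trans (le_trans (node_mono N0 h (ltnW q'N)) s3) s2; rewrite ltxx.
by have := le_lt_trans (le_trans (node_mono N0 h (ltnW qN)) s1) s4; rewrite ltxx.
Qed.

Lemma cell_exists N r s : (0 < N)%N -> (r <= N)%N -> t <= s -> s < tau N r ->
  exists q : 'I_N, (q < r)%N /\ cell N q s.
Proof.
move=> N0; elim: r => [|r IH] rN ts sr.
  by have [e _ _] := part N0; move: sr; rewrite e ltNge ts.
have [sr'|rs] := ltP s (tau N r).
  by have [q [qr qs]] := IH (ltnW rN) ts sr'; exists q; split => //; exact: leqW.
by exists (Ordinal rN); split => //=; rewrite in_itv/= rs.
Qed.

Definition step N (h : R -> R) (s : R) : R := \sum_(q < N) h (tau N q) * \1_(cell N q) s.

Lemma sum_cell N (q : 'I_N) (c : 'I_N -> R) (Q : pred 'I_N) s : cell N q s ->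
  \sum_(q' | Q q') c q' * \1_(cell N q') s = if Q q then c q else 0.
Proof.
move=> qs; have H q' : q' != q -> c q' * \1_(cell N q') s = 0.
  move=> q'q; rewrite indicE memNset ?mulr0// => q's.
  by move/eqP : q'q; apply; apply: ord_inj; exact: cell_disj q's qs.
case: ifPn => Qq; last first.
  by rewrite big1// => q' Qq'; apply: H; apply: contraNneq Qq => <-.
rewrite (bigD1 q)//= big1 ?addr0; last by move=> q' /andP[_]; exact: H.
by rewrite indicE mem_set// mulr1.
Qed.

Lemma sum_cell0 N (c : 'I_N -> R) (Q : pred 'I_N) s :
  (forall q : 'I_N, Q q -> ~ cell N q s) -> \sum_(q | Q q) c q * \1_(cell N q) s = 0.
Proof. by move=> H; rewrite big1// => q Qq; rewrite indicE memNset ?mulr0//; exact: H. Qed.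

Lemma cell_sub N q s : (q < N)%N -> cell N q s -> s \in `[t, T[.
Proof.
move=> qN; have N0 : (0 < N)%N by exact: leq_trans qN.
rewrite /= !in_itv/= => /andP[s1 s2].
by rewrite (le_trans (node_ge N0 (ltnW qN)) s1) (lt_le_trans s2 (node_le N0 qN)).
Qed.

Lemma step0 N h s : s \notin `[t, T[ -> step N h s = 0.
Proof. by move=> sT; apply: sum_cell0 => q _ /(cell_sub (ltn_ord q)); exact/negP. Qed.

Lemma step_bound N h M : (forall s, s \in `[t, T] -> `|h s| <= M) -> 0 <= M ->
  forall s, `|step N h s| <= M * \1_(`[t, T[ : set R) s.
Proof.
move=> hM M0 s; have [sT|sT] := boolP (s \in `[t, T[); last first.
  by rewrite step0// normr0 mulr_ge0.
rewrite indicE mem_set ?mulr1//.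
have [->|N0] := posnP N; first by rewrite /step big_ord0 normr0.
move: sT; rewrite in_itv/= => /andP[ts sT].
have [|q [_ qs]] := @cell_exists N N s N0 (leqnn _) ts; first by have [_ -> _] := part N0.
rewrite /step (sum_cell (fun q => h (tau N q)) xpredT qs); apply: hM.
by apply: node_in => //; exact: ltnW.
Qed.

Lemma step_measurable N h : measurable_fun setT (step N h).
Proof.
apply: measurable_sum => q; apply: measurable_funM => //.
Qed.

Lemma mesh_lt (e : R) : 0 < e -> \forall N \near \oo, (0 < N)%N /\
  forall q, (q < N)%N -> tau N q.+1 - tau N q < e.
Proof.
move=> e0; have /cvgrPdist_lt/(_ _ e0) H := mesh0.
near=> N; split; first by near: N; exact: nbhs_infty_gt.
move=> q qN; have : `|0 - \big[Order.max/0]_(j < N) (tau N j.+1 - tau N j)| < e by near: N.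
rewrite sub0r normrN => /(le_lt_trans (ler_norm _)); apply: le_lt_trans.
exact: (le_bigmax _ (fun j : 'I_N => tau N j.+1 - tau N j) (Ordinal qN)).
Unshelve. all: by end_near. Qed.

Lemma step_cvg_at (h : R -> R) (x : R) : x \in `[t, T[ ->
  h @ within `[t, T] (nbhs x) --> h x -> step N h x @[N --> \oo] --> h x.
Proof.
move=> xT hx; apply/cvgrPdist_lt => e e0.
have /cvgrPdist_lt/(_ _ e0) := hx.
move=> -[dl /= d0 Hd].
have [ts xltT] : t <= x /\ x < T by move: xT; rewrite in_itv/= => /andP.
near=> N.
have [N0 mN] : (0 < N)%N /\ forall q, (q < N)%N -> tau N q.+1 - tau N q < dl.
  by near: N; exact: mesh_lt.
have [|q [_ qs]] := @cell_exists N N x N0 (leqnn _) ts; first by have [_ -> _] := part N0.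
rewrite /step (sum_cell (fun q => h (tau N q)) xpredT qs)/=; apply: Hd; last first.
  by apply: node_in => //; exact: ltnW.
have := mN _ (ltn_ord q); move: qs; rewrite /= in_itv/= => /andP[q1 q2] h3.
by rewrite ger0_norm ?subr_ge0//; lra.
Unshelve. all: by end_near. Qed.

Lemma bounded_L2 (u : R -> R) M : measurable_fun setT u ->
  (forall s, `|u s| <= M * \1_(`[t, T[ : set R) s) -> L2 leb u /\ e2 leb u <= M ^+ 2 * (T - t).
Proof.
move=> mu uM.
have le s : `|u s ^+ 2| <= `|M ^+ 2 * \1_(`[t, T[ : set R) s|.
  have := uM s; rewrite indicE; case: (_ \in _); rewrite ?mulr1 ?mulr0.
    by move=> h; rewrite normrX [leRHS]normrX ler_pXn2r ?nnegrE//; exact: le_trans h (ler_norm _).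
  by rewrite normr_le0 => /eqP ->; rewrite expr0n normr0.
have iM := int1Z (M ^+ 2) (itv_int1 t T).
have L : L2 leb u by apply: int1_L2 => //; apply: int1_le iM le; exact: measurable_funX.
split=> //; rewrite e2E -(itv_int (ltW tT)) -RintZ; last exact: itv_int1.
apply: Rint_le => //; first exact: L2_int1.
move=> s; have := le s; rewrite ger0_norm ?sqr_ge0// ger0_norm// mulr_ge0// ?sqr_ge0//.
Qed.

Let indic_L2 : L2 leb (\1_(`[t, T[ : set R) : R -> R).
Proof.
have [|s|//] := @bounded_L2 (\1_(`[t, T[ : set R)) 1; first exact: measurable_indic.
by rewrite mul1r ger0_norm.
Qed.

Lemma L1_of_L2 (u : R -> R) : L2 leb u -> (forall s, s \notin `[t, T[ -> u s = 0) -> int1 leb u.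
Proof.
move=> Lu u0.
apply: eq_int1 (L2_mul indic_L2 Lu) => s; rewrite indicE.
have [_|sT] := boolP (_ \in _); first by rewrite mul1r.
by rewrite mul0r u0//; apply: contra sT => sT; rewrite inE.
Qed.

Lemma integral_sqr_le (u : R -> R) : L2 leb u -> (forall s, s \notin `[t, T[ -> u s = 0) ->
  (\int[leb]_s u s) ^+ 2 <= (T - t) * e2 leb u.
Proof.
move=> Lu u0.
have E s : \1_(`[t, T[ : set R) s * u s = u s.
  rewrite indicE; have [_|sT] := boolP (_ \in _); first by rewrite mul1r.
  by rewrite mul0r u0//; apply: contra sT => sT; rewrite inE.
have := cauchy_schwarz indic_L2 Lu; rewrite /ip; under eq_Rintegral do rewrite E.
move=> /le_trans; apply; rewrite ler_wpM2r ?e2_ge0// e2E -(itv_int (ltW tT)).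
rewrite le_eqVlt; apply/orP; left; apply/eqP; apply: eq_Rintegral => s _.
by rewrite indicE; case: (_ \in _); rewrite ?expr1n ?expr0n.
Qed.

Lemma cut0 h s : s \notin `[t, T[ -> cut h s = 0.
Proof. by move=> sT; rewrite /cut indicE memNset ?mulr0//; exact/negP. Qed.

Lemma cut_L2 h : pc h -> L2 leb (cut h).
Proof.
move=> hpc; have [M M0 HM] := pc_bound hpc; have [mh _ _] := hpc.
suff h0 : forall s, `|cut h s| <= M * \1_(`[t, T[ : set R) s by have [] := bounded_L2 mh h0.
move=> s; rewrite /cut normrM indicE.
have [sT|_] := boolP (_ \in _); last by rewrite normr0 !mulr0.
rewrite normr1 !mulr1; apply: HM.
by move: sT; rewrite inE/= !in_itv/= => /andP[-> /ltW].
Qed.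

Lemma step_L2 N h : pc h -> L2 leb (step N h).
Proof.
move=> hpc; have [M M0 HM] := pc_bound hpc.
by have [] := bounded_L2 (step_measurable N h) (@step_bound N h M HM M0).
Qed.

(** Dominated convergence, pointwise outside the finite and hence null set of discontinuities. *)
Lemma step_cvg h : pc h -> e2 leb (fun s => step N h s - cut h s) @[N --> \oo] --> 0.
Proof.
move=> hpc; have [M M0 HM] := pc_bound hpc; have [mh _ [D HD]] := hpc.
have [|||||_] := @int1_cvg _ _ _ leb (fun N s => (step N h s - cut h s) ^+ 2) (fun=> 0)
  (fun s => (2 * M) ^+ 2 * \1_(`[t, T[ : set R) s).
- by move=> N; apply: measurable_funX; apply: measurable_funB => //; exact: step_measurable.
- exact: measurable_cst.
- have : {ae leb, forall s : R, s \notin D}.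
    exists [set` D]; split; last by move=> s /= /negP; rewrite negbK.
      by apply: countable_measurable; [move=> x; exact: measurable_set1|exact/finite_set_countable/finite_seq].
    exact: (countable_lebesgue_measure0 (finite_set_countable (finite_seq D))).
  apply: filterS => s sD.
  have -> : (0 : R) = (cut h s - cut h s) ^+ 2 by rewrite subrr expr0n.
  apply: cvg_expr; apply: cvgB; last exact: cvg_cst.
  have [sT|sT] := boolP (s \in `[t, T[); last first.
    by rewrite cut0//; under eq_fun => N do rewrite step0//; exact: cvg_cst.
  rewrite /cut indicE mem_set// mulr1; apply: step_cvg_at => //; apply: HD => //.
  by move: sT; rewrite !in_itv/= => /andP[-> /ltW].
- by apply: int1Z; exact: (itv_int1 t T).
- apply: aeW => s N; rewrite normrX.
  have [sT|sT] := boolP (s \in `[t, T[); last first.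
    by rewrite cut0// step0// subrr normr0 expr0n mulr_ge0// sqr_ge0.
  have := @step_bound N h M HM M0 s; rewrite indicE mem_set// !mulr1 => h1.
  rewrite ler_pXn2r ?nnegrE ?mulr_ge0//.
  apply: le_trans (ler_normB _ _) _; rewrite (_ : 2 * M = M + M); last by ring.
  apply: lerD => //; rewrite /cut indicE mem_set// mulr1; apply: HM.
  by move: sT; rewrite !in_itv/= => /andP[-> /ltW].
by rewrite (_ : \int[leb]_x 0 = 0)// /Rintegral integral0.
Qed.

Lemma step_int N h : pc h -> \int[leb]_s step N h s = \sum_(q < N) h (tau N q) * (tau N q.+1 - tau N q).
Proof.
move=> hpc; have ii q : int1 leb (\1_(cell N q) : R -> R) by exact: itv_int1.
rewrite /step Rint_sum; last by move=> q; apply: int1Z; exact: ii.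
by apply: eq_bigr => q _; rewrite RintZ// itv_int// ltW// node_lt.
Qed.

Lemma riemann h : pc h ->
  \sum_(q < N) h (tau N q) * (tau N q.+1 - tau N q) @[N --> \oo] --> \int[leb]_s cut h s.
Proof.
move=> hpc; have Lc := cut_L2 hpc; have Ls N := step_L2 N hpc.
have ic := L1_of_L2 Lc (@cut0 h); have is_ N := L1_of_L2 (Ls N) (@step0 N h).
under eq_fun => N do rewrite -step_int//.
apply/cvgrPdist_le => e e0.
have T0 : 0 < T - t by rewrite subr_gt0.
(* The tolerance for the squared norm: Cauchy-Schwarz in time costs a factor [T - t]. *)
have c0 : 0 < e ^+ 2 / (T - t) by rewrite divr_gt0// exprn_gt0.
have /cvgrPdist_le/(_ _ c0) := step_cvg hpc; apply: filterS => N.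
rewrite sub0r normrN ger0_norm ?e2_ge0// ler_pdivlMr// => h1.
rewrite distrC -(ler_pXn2r (n := 2))// ?nnegrE ?(ltW e0)//.
have LB := L2B (Ls N) Lc.
have h2 : (\int[leb]_s (step N h s - cut h s)) ^+ 2 <= (T - t) * e2 leb (fun s => step N h s - cut h s).
  by apply: integral_sqr_le LB _ => s sT; rewrite step0// cut0// subrr.
have iB : \int[leb]_s (step N h s - cut h s) = \int[leb]_s step N h s - \int[leb]_s cut h s.
  under eq_Rintegral do rewrite -mulN1r.
  by rewrite RintD ?RintZ ?mulN1r//; exact: int1Z.
rewrite real_normK ?num_real// -iB; apply: le_trans h2 _; rewrite mulrC; exact: h1.
Qed.

End partitions.

(** Tolerances are chosen of the form [E / (a + 1)]; the [+ 1] allows [a = 0]. *)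
Lemma scaled_small (R : realType) (a E : R) : 0 <= a -> 0 < E -> a * (E / (a + 1)) <= E.
Proof.
move=> a0 E0; rewrite mulrA ler_pdivrMr ?ltr_wpDl//; have := mulr_ge0 a0 (ltW E0); nra.
Qed.

Section horizon_estimates.
Context {d : measure_display} {Omega : measurableType d} {R : realType}.
Variables (P : probability Omega R).
Local Notation horizon := (horizon P).
Local Notation leb := (leb (R := R)).

Lemma horizon_le (G : R * Omega -> R) (c : R -> R) : measurable_fun setT G -> int1 leb c ->
  (forall s, L2 P (fun w => G (s, w)) /\ e2 P (fun w => G (s, w)) <= c s) ->
  L2 horizon G /\ e2 horizon G <= \int[leb]_s c s.
Proof.
move=> mG ic H.
have mG2 : measurable_fun setT (fun z => (G z ^+ 2)%:E).
  by apply/measurable_EFinP; exact: measurable_funX.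
have G0 z : (0 <= (G z ^+ 2)%:E)%E by rewrite lee_fin sqr_ge0.
have E : (\int[horizon]_z (G z ^+ 2)%:E <= (\int[leb]_s c s)%:E)%E.
  rewrite /horizon fubini_tonelli1// (Rint_EFin ic).
  apply: ge0_le_integral_unmeasured => s _; first by apply: integral_ge0 => w _; rewrite lee_fin sqr_ge0.
  by have [Ls h] := H s; rewrite /fubini_F -e2_EFin// lee_fin.
have LG : L2 horizon G by split => //; exact: le_lt_trans E (ltry _).
by split => //; exact: e2_le_EFin.
Qed.

Variables (t T : R) (tau : nat -> nat -> R).
Hypothesis tT : t < T.
Hypothesis part : forall N, (0 < N)%N -> is_partition t T N (tau N).
Local Notation cell N q := (`[tau N q, tau N q.+1[%classic : set R).
Local Notation delta N q := (tau N q.+1 - tau N q).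

Lemma cells_int N (c : 'I_N -> R) (Q : pred 'I_N) :
  int1 leb (fun s => \sum_(q | Q q) c q * \1_(cell N q) s) /\
  \int[leb]_s (\sum_(q | Q q) c q * \1_(cell N q) s) = \sum_(q | Q q) c q * delta N q.
Proof.
have ii q : int1 leb (\1_(cell N q) : R -> R) by exact: itv_int1.
have E s : \sum_(q | Q q) c q * \1_(cell N q) s = \sum_q (if Q q then c q else 0) * \1_(cell N q) s.
  by rewrite big_mkcond/=; apply: eq_bigr => q _; case: ifP => _; rewrite ?mul0r.
rewrite (funext E); split; first by apply: int1_sum => q; exact: int1Z.
rewrite Rint_sum; last by move=> q; exact: int1Z.
rewrite [RHS]big_mkcond; apply: eq_bigr => q _; rewrite RintZ// itv_int; last by rewrite ltW// (node_lt part).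
by case: ifP => _; rewrite ?mul0r.
Qed.

Lemma cells_measurable N (X : 'I_N -> Omega -> R) (Q : pred 'I_N) :
  (forall q, measurable_fun setT (X q)) ->
  measurable_fun setT (fun z : R * Omega => \sum_(q | Q q) X q z.2 * \1_(cell N q) z.1).
Proof.
move=> mX; have E (z : R * Omega) : \sum_(q | Q q) X q z.2 * \1_(cell N q) z.1 =
    \sum_q (if Q q then X q z.2 else 0) * \1_(cell N q) z.1.
  by rewrite big_mkcond/=; apply: eq_bigr => q _; case: ifP => _; rewrite ?mul0r.
rewrite (funext E); apply: measurable_sum => q; apply: measurable_funM.
  by case: (Q q) => //; exact: (measurableT_comp (mX q)).
exact: measurableT_comp.
Qed.

Lemma cells_e2 N (X : 'I_N -> Omega -> R) (Q : pred 'I_N) : (0 < N)%N ->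
  (forall q, L2 P (X q)) ->
  e2 horizon (fun z => \sum_(q | Q q) X q z.2 * \1_(cell N q) z.1) <=
  \sum_(q | Q q) delta N q * e2 P (X q).
Proof.
move=> N0 LX; have [ic ec] := cells_int (fun q => e2 P (X q)) Q.
under eq_bigr do rewrite mulrC; rewrite -ec.
have [||_ //] := @horizon_le (fun z => \sum_(q | Q q) X q z.2 * \1_(cell N q) z.1) _ _ ic.
  by apply: cells_measurable => q; exact: L2_meas (LX q).
move=> s /=.
have [/existsP[q qs]|nq] := boolP [exists q : 'I_N, s \in `[tau N q, tau N q.+1[].
  under [X in L2 _ X]eq_fun do rewrite (sum_cell part (fun q => X q _) Q qs).
  under [X in e2 _ X]eq_fun do rewrite (sum_cell part (fun q => X q _) Q qs).
  rewrite (sum_cell part (fun q => e2 P (X q)) Q qs); case: (Q q) => //.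
  by rewrite ae_e2_0//; [split => //; exact: L20|exact: aeW].
have no (q : 'I_N) : ~ cell N q s by move=> qs; move/negP : nq; apply; apply/existsP; exists q.
under [X in L2 _ X]eq_fun do rewrite sum_cell0//.
under [X in e2 _ X]eq_fun do rewrite sum_cell0//.
rewrite sum_cell0// ae_e2_0//; [split => //; exact: L20|exact: aeW].
Qed.

End horizon_estimates.

(** * Iterated integrals as limits of iterated Riemann sums *)

Section kernels.
Context {d : measure_display} {Omega : measurableType d} {R : realType}.
Variables (P : probability Omega R) (F : R -> set_system Omega).
Variables (t T : R) (tau : nat -> nat -> R).
Hypothesis t0 : 0 <= t.
Hypothesis tT : t < T.
Hypothesis Ffil : filtration T F.
Hypothesis part : forall N, (0 < N)%N -> is_partition t T N (tau N).
Hypothesis mesh0 : (fun N => \big[Order.max/0]_(j < N) (tau N j.+1 - tau N j)) @ \oo --> 0.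
Local Notation horizon := (horizon P).
Local Notation leb := (leb (R := R)).
Local Notation past := (past P F).
Local Notation pc := (pc t T).
Local Notation cut := (cutoff t T).
Local Notation cell N q := (`[tau N q, tau N q.+1[%classic : set R).
Local Notation delta N q := (tau N q.+1 - tau N q).

(* rel G Z: Z is the integral of G; S N q is the integral of 1 over the q-th cell. *)
Record kernel (rel : (R * Omega -> R) -> (Omega -> R) -> Prop) (C : R)
    (S : nat -> nat -> Omega -> R) : Prop := Kernel {
  kernel_e2 : forall G Z, rel G Z ->
    [/\ L2 horizon G, L2 P Z & e2 P Z <= C * e2 horizon G];
  kernel0 : rel (fun=> 0) (fun=> 0);
  kernelD : forall G Z G' Z', rel G Z -> rel G' Z' ->
    rel (fun z => G z + G' z) (fun w => Z w + Z' w);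
  kernelZ : forall c G Z, rel G Z -> rel (fun z => c * G z) (fun w => c * Z w);
  kernel_cell : forall N q X, (q < N)%N -> past (tau N q) X ->
    rel (fun z => X z.2 * \1_(cell N q) z.1) (fun w => X w * S N q w);
  kernel_past : forall N q, (q < N)%N -> past (tau N q.+1) (S N q) }.

Lemma node0 N q : (0 < N)%N -> (q <= N)%N -> 0 <= tau N q.
Proof. by move=> N0 qN; exact: le_trans t0 (node_ge part N0 qN). Qed.

Section one_kernel.
Variables (rel : (R * Omega -> R) -> (Omega -> R) -> Prop) (C : R).
Variables (S : nat -> nat -> Omega -> R).
Hypothesis ker : kernel rel C S.
Hypothesis C0 : 0 <= C.

Lemma kernelB G Z G' Z' : rel G Z -> rel G' Z' ->
  rel (fun z => G z - G' z) (fun w => Z w - Z' w).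
Proof.
move=> H /(kernelZ ker (-1)) /(kernelD ker H).
by congr rel; apply/funext => x; rewrite mulN1r.
Qed.

Lemma kernel_sum (I : Type) (s : seq I) (Q : pred I) G Z : (forall i, Q i -> rel (G i) (Z i)) ->
  rel (fun z => \sum_(i <- s | Q i) G i z) (fun w => \sum_(i <- s | Q i) Z i w).
Proof.
move=> H; elim: s => [|i s IH].
  by have := kernel0 ker; congr rel; apply/funext => x; rewrite big_nil.
have -> : (fun z => \sum_(i <- i :: s | Q i) G i z) =
  (fun z => (if Q i then G i z else 0) + \sum_(i <- s | Q i) G i z).
  by apply/funext => z; rewrite big_cons; case: ifP => // _; rewrite add0r.
have -> : (fun z => \sum_(i <- i :: s | Q i) Z i z) =
  (fun z => (if Q i then Z i z else 0) + \sum_(i <- s | Q i) Z i z).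
  by apply/funext => z; rewrite big_cons; case: ifP => // _; rewrite add0r.
apply: (kernelD ker) => //; case: (boolP (Q i)) => [/H //|_]; exact: kernel0 ker.
Qed.

(** Square integrability of the product is not automatic; it comes from the relation for a single
    cell. *)
Lemma kernel_mul_past N q X : (q < N)%N -> past (tau N q) X ->
  past (tau N q.+1) (fun w => X w * S N q w).
Proof.
move=> qN pX; have N0 : (0 < N)%N by exact: leq_trans qN.
have [_ LXS _] := kernel_e2 ker (kernel_cell ker qN pX); split => //.
have q0 := node0 N0 (ltnW qN); have qT := node_le part N0 qN.
have [_ [X' [gX XX]]] := past_mono Ffil q0 (ltW (node_lt part qN)) qT pX.
have [_ [S' [gS SS]]] := kernel_past ker qN.
exists (fun w => X' w * S' w); split.
  by apply: GmM => //; case: Ffil => + _ _; apply; apply: memI => //; exact: node0.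
by apply: filterS2 XX SS => w -> ->.
Qed.

Lemma kernel_cells N (X : 'I_N -> Omega -> R) (Q : pred 'I_N) :
  (forall q : 'I_N, Q q -> past (tau N q) (X q)) ->
  rel (fun z => \sum_(q | Q q) X q z.2 * \1_(cell N q) z.1) (fun w => \sum_(q | Q q) X q w * S N q w).
Proof. by move=> pX; apply: kernel_sum => q Qq; apply: (kernel_cell ker) => //; exact: pX. Qed.

Lemma kernel_cell_family N : (0 < N)%N ->
  cell_family P F C (tau N) (fun q : 'I_N => S N q).
Proof.
move=> N0; split=> [q X pX|Q X pX]; first exact: kernel_mul_past.
have [_ _ h] := kernel_e2 ker (kernel_cells (Q := Q) (fun q _ => pX q)).
apply: le_trans h _; rewrite ler_wpM2l//; apply: (cells_e2 part) => // q.
by case: (pX q).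
Qed.

(** The invariant of the induction on the number of integrations: [J] is bounded in mean square with
    squared increments linear in time, and the discrete process [Y] is adapted and close to [J]
    uniformly over the nodes. *)
Record approx (J : R -> Omega -> R) (Y : nat -> nat -> Omega -> R) : Prop := Approx {
  approx_bound : exists B, forall s, s \in `[t, T] -> L2 P (J s) /\ e2 P (J s) <= B;
  approx_lip : exists B, forall s s', t <= s -> s <= s' -> s' <= T ->
    e2 P (fun w => J s' w - J s w) <= B * (s' - s);
  approx_past : forall N r, (0 < N)%N -> (r <= N)%N -> past (tau N r) (Y N r);
  approx_cvg : forall eps : R, 0 < eps -> \forall N \near \oo, forall r, (r <= N)%N ->
    e2 P (fun w => Y N r w - J (tau N r) w) <= eps }.

Variables (J J' : R -> Omega -> R) (Y : nat -> nat -> Omega -> R) (psi : R -> R).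
Hypothesis JY : approx J Y.
Hypothesis pcpsi : pc psi.
Hypothesis mJ : measurable_fun setT (fun z : R * Omega => cut psi z.1 * J z.1 z.2).
Let G s (z : R * Omega) := psi z.1 * J z.1 z.2 * \1_(`[t, s[ : set R) z.1.
Hypothesis relJ : forall s, s \in `[t, T] -> L2 horizon (G s) -> rel (G s) (J' s).
Let Y' N r w := \sum_(q < N | (q < r)%N) psi (tau N q) * Y N q w * S N q w.

Let G_meas s : s \in `[t, T] -> measurable_fun setT (G s).
Proof.
rewrite in_itv/= => /andP[ts sT].
have -> : G s = (fun z => cut psi z.1 * J z.1 z.2 * \1_(`[t, s[ : set R) z.1).
  apply/funext => z; rewrite /G /cutoff [\1_`[t, s[ _]indicE.
  have [zs|_] := boolP (_ \in _); last by rewrite !mulr0.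
  rewrite indicE mem_set ?mulr1//=; move: zs; rewrite inE/= !in_itv/= => /andP[-> /lt_le_trans]; exact.
by apply: measurable_funM => //; exact: measurableT_comp.
Qed.

Let psiJ_le B M (s : R) : (forall s, s \in `[t, T] -> `|psi s| <= M) -> 0 <= M ->
  L2 P (J s) /\ e2 P (J s) <= B -> s \in `[t, T] ->
  L2 P (fun w => psi s * J s w) /\ e2 P (fun w => psi s * J s w) <= M ^+ 2 * B.
Proof.
move=> HM M0 [LJ eJ] sT; split; first exact: L2Z.
rewrite e2Z// ler_pM ?sqr_ge0 ?e2_ge0//.
by rewrite -(real_normK (num_real (psi s))) ler_pXn2r ?nnegrE// HM.
Qed.

(** [G s' - G s] is carried by [[s, s')], which is the source of the linear bound on squared
    increments. *)
Lemma kernel_process : exists2 B, 0 <= B & forall s s', t <= s -> s <= s' -> s' <= T ->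
  L2 horizon (fun z => G s' z - G s z) /\ e2 horizon (fun z => G s' z - G s z) <= B * (s' - s).
Proof.
have [B HB] := approx_bound JY; have [M M0 HM] := pc_bound pcpsi.
have B0 : 0 <= B by have [|_] := HB t; [rewrite in_itv/= lexx ltW|apply: le_trans (e2_ge0 _ _)].
exists (M ^+ 2 * B); first by rewrite mulr_ge0 ?sqr_ge0.
move=> s s' ts ss' s'T; have ii := itv_int1 s s'; have ie := itv_int ss'.
rewrite -ie -RintZ//; apply: horizon_le; last 2 first.
- exact: int1Z.
- move=> u; have E w : G s' (u, w) - G s (u, w) = psi u * J u w * \1_(`[s, s'[ : set R) u.
    rewrite /G/= -mulrBr; congr (_ * _); rewrite !indicE !mem_setE !in_itv/=.
    have [tu|ut] := leP t u; last by rewrite (lt_geF (lt_le_trans ut ts))/= subrr.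
    have [su|us] /= := leP s u; first by rewrite subr0.
    by rewrite (lt_le_trans us ss') subrr.
  under [X in L2 _ X]eq_fun do rewrite E; under [X in e2 _ X]eq_fun do rewrite E.
  rewrite indicE; have [uI|_] := boolP (_ \in _).
    have uT : u \in `[t, T].
      move: uI; rewrite inE/= !in_itv/= => /andP[su us'].
      by rewrite (le_trans ts su) (ltW (lt_le_trans us' s'T)).
    under [X in L2 _ X]eq_fun do rewrite mulr1; under [X in e2 _ X]eq_fun do rewrite mulr1.
    by rewrite mulr1; exact: psiJ_le (HB _ uT) uT.
  under [X in L2 _ X]eq_fun do rewrite mulr0; under [X in e2 _ X]eq_fun do rewrite mulr0.
  by rewrite mulr0 ae_e2_0//; [split => //; exact: L20|exact: aeW].
- apply: measurable_funB; apply: G_meas; rewrite in_itv/= ?ts ?(le_trans ts ss')//=.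
  exact: le_trans s'T.
Qed.

Let Gt z : G t z = 0.
Proof. by rewrite /G set_itvco0 indicE in_set0 mulr0. Qed.

Let G_L2 s : s \in `[t, T] -> L2 horizon (G s).
Proof.
rewrite in_itv/= => /andP[ts sT]; have [B _ HB] := kernel_process.
by have [+ _] := HB t s (lexx _) ts sT; under [X in L2 _ X -> _]eq_fun do rewrite Gt subr0.
Qed.

(** By the kernel inequality it is enough to compare integrands. On a cell the difference comes from
    replacing [Y] by [J], then [J] at the node by [J] at [s], then [psi] at the node by [psi s]. *)
Lemma approx_step : approx J' Y'.
Proof.
have [B B0 HB] := kernel_process.
have [BJ HBJ] := approx_bound JY; have [BL HBL] := approx_lip JY; have [M M0 HM] := pc_bound pcpsi.
have BJ0 : 0 <= BJ by have [|_] := HBJ t; [rewrite in_itv/= lexx ltW|apply: le_trans (e2_ge0 _ _)].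
have BL0 : 0 <= BL.
  have := HBL t T (lexx _) (ltW tT) (lexx _); move/(le_trans (e2_ge0 _ _)).
  by rewrite pmulr_lge0// subr_gt0.
have relG s : s \in `[t, T] -> rel (G s) (J' s) by move=> sT; apply: relJ => //; exact: G_L2.
have pX N q : (q < N)%N -> past (tau N q) (fun w => psi (tau N q) * Y N q w).
  move=> qN; have N0 : (0 < N)%N by exact: leq_trans qN.
  apply: (pastZ Ffil); [exact: node0 (ltnW _)|exact: (node_le part N0 (ltnW qN))|].
  exact: (approx_past JY N0 (ltnW qN)).
split.
- exists (C * (B * (T - t))) => s sT; have [_ LJ h] := kernel_e2 ker (relG s sT); split => //.
  apply: le_trans h _; rewrite ler_wpM2l//.
  move: sT; rewrite in_itv/= => /andP[ts sT].
  have [_] := HB t s (lexx _) ts sT; under [X in e2 _ X <= _ -> _]eq_fun do rewrite Gt subr0.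
  by move=> /le_trans; apply; rewrite ler_wpM2l// lerB.
- exists (C * B) => s s' ts ss' s'T.
  have sI : s \in `[t, T] by rewrite in_itv/= ts (le_trans ss' s'T).
  have s'I : s' \in `[t, T] by rewrite in_itv/= s'T (le_trans ts ss').
  have [_ _ h] := kernel_e2 ker (kernelB (relG _ s'I) (relG _ sI)).
  by apply: le_trans h _; rewrite -mulrA ler_wpM2l//; have [] := HB s s' ts ss' s'T.
- move=> N r N0 rN; apply: (past_sum Ffil); [exact: node0|exact: (node_le part)|move=> q qr].
  apply: (past_mono Ffil _ _ _ (kernel_mul_past (ltn_ord q) (pX _ _ (ltn_ord q)))).
  + exact: node0.
  + exact: (node_mono part).
  + exact: (node_le part).
move=> eps e0.
pose E := eps / (C + 1); have E0 : 0 < E by rewrite divr_gt0// ltr_wpDl.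
have E3 : 0 < E / 3 by rewrite divr_gt0.
have Tt0 : 0 <= T - t by rewrite subr_ge0 ltW.
(* The factors 2 and 4 arise from [e2D_le], applied twice to a sum of three terms; each of the three
   contributions is granted a third of [E]. *)
pose a1 := (T - t) * (2 * M ^+ 2); pose a2 := (T - t) * (4 * M ^+ 2 * BL); pose a3 := 4 * BJ.
have a10 : 0 <= a1 by rewrite !mulr_ge0 ?sqr_ge0.
have a20 : 0 <= a2 by rewrite !mulr_ge0 ?sqr_ge0.
have a30 : 0 <= a3 by rewrite !mulr_ge0.
pose e1 := E / 3 / (a1 + 1); have e10 : 0 < e1 by rewrite divr_gt0// ltr_wpDl.
pose dl := E / 3 / (a2 + 1); have dl0 : 0 < dl by rewrite divr_gt0// ltr_wpDl.
pose e3 := E / 3 / (a3 + 1); have e30 : 0 < e3 by rewrite divr_gt0// ltr_wpDl.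
have /cvgrPdist_le/(_ _ e30) Hst := step_cvg part mesh0 pcpsi.
near=> N => r rN.
have YJ : forall r, (r <= N)%N -> e2 P (fun w => Y N r w - J (tau N r) w) <= e1.
  by near: N; exact: (approx_cvg JY e10).
have [N0 mN] : (0 < N)%N /\ forall q, (q < N)%N -> tau N q.+1 - tau N q < dl.
  by near: N; exact: mesh_lt.
have st : e2 leb (fun s => step tau N psi s - cut psi s) <= e3.
  suff : `|0 - e2 leb (fun s => step tau N psi s - cut psi s)| <= e3.
    by rewrite sub0r normrN ger0_norm ?e2_ge0.
  by near: N.
have rT := node_in part N0 rN.
have [_ LZ h] := kernel_e2 ker (kernelB (kernel_cells (Q := fun q : 'I_N => (q < r)%N)
   (fun q _ => pX N q (ltn_ord q))) (relG _ rT)).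
apply: le_trans h _.
have -> : eps = (C + 1) * E by rewrite /E mulrCA mulfV ?mulr1// gt_eqF// ltr_wpDl.
apply: (@le_trans _ _ (C * E)); last by rewrite ler_wpM2r ?(ltW E0)// lerDl.
rewrite ler_wpM2l//.
pose c1 := 2 * M ^+ 2 * e1 + 4 * M ^+ 2 * BL * dl.
have c10 : 0 <= c1.
  have h1 := mulr_ge0 (sqr_ge0 M) (ltW e10).
  by have h2 := mulr_ge0 (mulr_ge0 (sqr_ge0 M) BL0) (ltW dl0); rewrite /c1; lra.
have Lst : L2 leb (fun s => step tau N psi s - cut psi s).
  by apply: L2B; [exact: (step_L2 tT part)|exact: cut_L2].
have iI := itv_int1 t T; have eI := itv_int (ltW tT).
have ic1 : int1 leb (fun s => c1 * \1_(`[t, T[ : set R) s) by exact: int1Z.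
have ic2 : int1 leb (fun s => a3 * (step tau N psi s - cut psi s) ^+ 2) by apply: int1Z; exact: L2_int1.
have [|s|_ h2] := @horizon_le _ _ _ P (fun z => \sum_(q < N | (q < r)%N)
   psi (tau N q) * Y N q z.2 * \1_(cell N q) z.1 - G (tau N r) z) _ _ (int1D ic1 ic2).
- apply: measurable_funB; last exact: G_meas.
  apply: (@cells_measurable _ _ _ tau N (fun q w => psi (tau N q) * Y N q w) (fun q => (q < r)%N)) => q.
  apply: measurable_funM => //.
  by have [/L2_meas] := approx_past JY N0 (ltnW (ltn_ord q)).
- have cs0 : 0 <= c1 * \1_(`[t, T[ : set R) s + a3 * (step tau N psi s - cut psi s) ^+ 2.
    by rewrite addr_ge0// mulr_ge0// sqr_ge0.
  have trivial_case (W : Omega -> R) : (forall w, W w = 0) -> L2 P W /\ e2 P W <=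
      c1 * \1_(`[t, T[ : set R) s + a3 * (step tau N psi s - cut psi s) ^+ 2.
    by move=> /funext ->; rewrite ae_e2_0//; [split => //; exact: L20|exact: aeW].
  have [sr|sr] := boolP (s \in `[t, tau N r[); last first.
    apply: trivial_case => w; rewrite /G/= indicE memNset ?mulr0 ?subr0; last exact/negP.
    apply: sum_cell0 => q qr qs; move/negP : sr; apply; move: qs; rewrite /= !in_itv/= => /andP[s1 s2].
    rewrite (le_trans (node_ge part N0 (ltnW (ltn_ord q))) s1)/=.
    by apply: lt_le_trans s2 _; exact: (node_mono part).
  have /andP[ts sr'] : (t <= s) && (s < tau N r) by move: sr; rewrite in_itv.
  have [q [qr qs]] := cell_exists part N0 rN ts sr'.
  have qN := ltn_ord q.
  have sT : s \in `[t, T].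
    by rewrite in_itv/= ts/= ltW//; exact: lt_le_trans sr' (node_le part N0 rN).
  have sT' : s \in `[t, T[ by rewrite in_itv/= ts/=; exact: lt_le_trans sr' (node_le part N0 rN).
  have qT := node_in part N0 (ltnW qN).
  have [LJq eJq] := HBJ _ qT; have [LJs eJs] := HBJ _ sT.
  have [LYq _] := approx_past JY N0 (ltnW qN).
  have stE : step tau N psi s = psi (tau N q).
    by rewrite /step (sum_cell part (fun q => psi (tau N q)) xpredT qs).
  have cutE : cut psi s = psi s by rewrite /cutoff indicE mem_set// mulr1.
  rewrite stE cutE [in X in _ /\ _ <= X]indicE mem_set// mulr1.
  have WE w : \sum_(q < N | (q < r)%N) psi (tau N q) * Y N q w * \1_(cell N q) s - G (tau N r) (s, w) =
     psi (tau N q) * (Y N q w - J (tau N q) w) +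
     (psi (tau N q) * (J (tau N q) w - J s w) + (psi (tau N q) - psi s) * J s w).
    rewrite (sum_cell part (fun q => psi (tau N q) * Y N q w) (fun q : 'I_N => (q < r)%N) qs) qr.
    by rewrite /G/= indicE mem_set// mulr1; ring.
  rewrite /= (funext WE).
  have L1 := L2Z (psi (tau N q)) (L2B LYq LJq).
  have L2' := L2Z (psi (tau N q)) (L2B LJq LJs).
  have L3 := L2Z (psi (tau N q) - psi s) LJs.
  have L23 := L2D L2' L3.
  split; first exact: L2D.
  have h1 := e2D_le L1 L23; have h23 := e2D_le L2' L3.
  rewrite [e2 P (fun x => psi (tau N q) * (Y N q x - _))]e2Z in h1; last exact: L2B.
  rewrite e2Z in h23; last exact: L2B.
  rewrite e2Z// in h23.
  have hM : psi (tau N q) ^+ 2 <= M ^+ 2.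
    by rewrite -(real_normK (num_real (psi _))) ler_pXn2r ?nnegrE// HM.
  have hY := YJ _ (ltnW qN).
  have hJ : e2 P (fun w => J (tau N q) w - J s w) <= BL * dl.
    move: qs; rewrite /= in_itv/= => /andP[qs1 qs2].
    rewrite e2_subC; apply: le_trans (HBL _ _ _ qs1 _) _.
    - exact: (node_ge part N0 (ltnW qN)).
    - by move: sT; rewrite in_itv/= => /andP[].
    by rewrite ler_wpM2l//; have := mN _ qN; lra.
  have k1 : psi (tau N q) ^+ 2 * e2 P (fun w => Y N q w - J (tau N q) w) <= M ^+ 2 * e1.
    by apply: ler_pM; rewrite ?sqr_ge0 ?e2_ge0.
  have k2 : psi (tau N q) ^+ 2 * e2 P (fun w => J (tau N q) w - J s w) <= M ^+ 2 * (BL * dl).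
    by apply: ler_pM; rewrite ?sqr_ge0 ?e2_ge0.
  have k3 : (psi (tau N q) - psi s) ^+ 2 * e2 P (J s) <= (psi (tau N q) - psi s) ^+ 2 * BJ.
    by rewrite ler_wpM2l ?sqr_ge0.
  rewrite /c1 /a3; lra.
apply: le_trans h2 _; rewrite RintD// RintZ// RintZ ?eI; last exact: L2_int1.
rewrite -e2E.
have f1 := scaled_small a10 E3; have f2 := scaled_small a20 E3; have f3 := scaled_small a30 E3.
rewrite -/e1 in f1; rewrite -/dl in f2; rewrite -/e3 in f3.
have f4 : a3 * e2 leb (fun s => step tau N psi s - cut psi s) <= a3 * e3 by rewrite ler_wpM2l.
have -> : c1 * (T - t) = a1 * e1 + a2 * dl by rewrite /c1 /a1 /a2; ring.
lra.
Unshelve. all: by end_near. Qed.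

End one_kernel.
End kernels.

(** * Moments of Riemann sums *)

Section simple_approximation.
Variables (d : measure_display) (Y : measurableType d) (R : realType) (phi : Y -> R).
Hypothesis mphi : measurable_fun setT phi.

(* phi rounded towards 0 to a multiple of 1/n, up to the level n. *)
Definition level (n : nat) (bj : bool * 'I_(n * n)) : R := (-1) ^+ bj.1 * (bj.2.+1%:R / n%:R).
Definition level_set n (bj : bool * 'I_(n * n)) : set Y :=
  [set y | (bj.2.+1%:R <= n%:R * ((-1) ^+ bj.1 * phi y)) && (n%:R * ((-1) ^+ bj.1 * phi y) < bj.2.+2%:R)].
Definition rounded (n : nat) (y : Y) : R := \sum_(bj : bool * 'I_(n * n)) level bj * \1_(level_set bj) y.

Lemma level_set_measurable n bj : measurable (@level_set n bj).
Proof.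
have -> : @level_set n bj = (fun y => n%:R * ((-1) ^+ bj.1 * phi y)) @^-1` `[bj.2.+1%:R, bj.2.+2%:R[.
  by apply/seteqP; split => y /=; rewrite in_itv.
rewrite -[X in measurable X]setTI; apply: measurable_funM => //; exact: measurable_funM.
Qed.

Lemma level_set_trunc n bj y : @level_set n bj y ->
  [/\ (0 < n)%N, (-1) ^+ bj.1 * phi y = `|phi y|, phi y != 0 & Num.truncn (n%:R * `|phi y|) = bj.2.+1].
Proof.
case: bj => b j; rewrite /level_set/= => /andP[h1 h2].
have n0 : (0 < n)%N.
  rewrite lt0n; apply/eqP => e; have z : n%:R = 0 :> R by rewrite e.
  by move: h1; rewrite z mul0r leNgt ltr0n.
have np : 0 < n%:R :> R by rewrite ltr0n.
have p : 0 < (-1) ^+ b * phi y.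
  by rewrite -(pmulr_rgt0 _ np); apply: lt_le_trans h1; rewrite ltr0n.
have e : (-1) ^+ b * phi y = `|phi y|.
  by rewrite -(gtr0_norm p) normrM normrX normrN1 expr1n mul1r.
split=> //; first by apply: contraTneq p => ->; rewrite mulr0 ltxx.
by rewrite e in h1 h2; apply/truncn_def; rewrite h1 h2.
Qed.

Lemma level_set_disj n bj bj' y : @level_set n bj y -> @level_set n bj' y -> bj = bj'.
Proof.
move=> /level_set_trunc[_ e p h] /level_set_trunc[_ e' _ h'].
case: bj bj' e h e' h' => b j [b' j'] /= e h e' h'.
have -> : j = j' by apply/val_inj; move: h'; rewrite h => -[].
congr (_, _); move: e'; rewrite -e => e'.
have : phi y != 0 := p; case: b b' {e} e' => -[] //; rewrite expr1 expr0 mul1r mulN1r => e0.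
  by rewrite (_ : phi y = 0) ?eqxx//; lra.
by rewrite (_ : phi y = 0) ?eqxx//; lra.
Qed.

Lemma rounded_at n bj y : @level_set n bj y -> rounded n y = level bj.
Proof.
move=> Hy; rewrite /rounded (bigD1 bj)//= big1 ?addr0.
  by rewrite indicE mem_set// mulr1.
move=> bj' ne; rewrite indicE memNset ?mulr0// => Hy'.
by move/eqP : ne; apply; exact: level_set_disj Hy' Hy.
Qed.

Lemma rounded0 n y : (forall bj, ~ @level_set n bj y) -> rounded n y = 0.
Proof. by move=> H; rewrite /rounded big1// => bj _; rewrite indicE memNset ?mulr0. Qed.

Lemma level_norm n bj y : @level_set n bj y -> `|level bj| <= `|phi y|.
Proof.
move=> Hy; have [n0 e _ _] := level_set_trunc Hy.
rewrite /level normrM normrX normrN1 expr1n mul1r ger0_norm// ler_pdivrMr ?ltr0n// mulrC -e.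
by case/andP : Hy.
Qed.

Lemma rounded_le n y : `|rounded n y| <= `|phi y|.
Proof.
have [[bj Hy]|H] := pselect (exists bj, @level_set n bj y).
  by rewrite (rounded_at Hy); exact: level_norm.
rewrite rounded0 ?normr0// => bj Hy; by apply: H; exists bj.
Qed.

Lemma rounded_close n y : (0 < n)%N -> `|phi y| < n%:R -> `|phi y - rounded n y| <= n%:R^-1.
Proof.
move=> n0 yn; have np : 0 < n%:R :> R by rewrite ltr0n.
pose j := Num.truncn (n%:R * `|phi y|).
have nn : 0 <= n%:R * `|phi y| by rewrite mulr_ge0.
have /andP[j1 j2] := truncn_itv nn; rewrite -/j in j1 j2.
have key : `|phi y - (-1) ^+ (phi y < 0)%R * (j%:R / n%:R)| <= n%:R^-1.
  have -> : phi y - (-1) ^+ (phi y < 0)%R * (j%:R / n%:R) =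
     (-1) ^+ (phi y < 0)%R * (`|phi y| - j%:R / n%:R).
    by rewrite mulrBr; congr (_ - _); rewrite -realEsign// num_real.
  rewrite normrM normrX normrN1 expr1n mul1r ger0_norm; last first.
    by rewrite subr_ge0 ler_pdivrMr// mulrC.
  have e : n%:R^-1 + j%:R / n%:R = j.+1%:R / n%:R :> R by rewrite -addn1 natrD mulrDl mul1r addrC.
  by rewrite lerBlDr e ler_pdivlMr// mulrC ltW.
have [j0|jp] := posnP j.
  have -> : rounded n y = 0.
    apply: rounded0 => bj /level_set_trunc[_ _ _]; rewrite -/j j0; lia.
  by move: key; rewrite j0 mul0r mulr0 subr0.
have jn : (j.-1 < n * n)%N.
  by rewrite prednK// -(ler_nat R) natrM; apply: le_trans j1 _; rewrite ler_wpM2l// ltW.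
have Hy : @level_set n ((phi y < 0)%R, Ordinal jn) y.
  have e : (-1) ^+ (phi y < 0)%R * phi y = `|phi y|.
    by rewrite normrEsign// num_real.
  by rewrite /level_set/= e prednK// j1 j2.
by rewrite (rounded_at Hy) /level/= prednK.
Qed.

Lemma rounded_measurable n : measurable_fun setT (rounded n).
Proof.
apply: measurable_sum => bj; apply: measurable_funM => //; apply: measurable_indic.
exact: level_set_measurable.
Qed.

Lemma rounded_cvg y : rounded n y @[n --> \oo] --> phi y.
Proof.
apply/cvgrPdist_le => e e0.
have harm : (fun n => n%:R^-1 : R) @ \oo --> 0.
  by rewrite -cvg_shiftS; exact: cvg_harmonic.
have /cvgrPdist_le/(_ _ e0) H := harm.
near=> n; have yn : `|phi y| < n%:R by near: n; exact: nbhs_infty_gtr.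
have n0 : (0 < n)%N by rewrite -(ltr0n R); apply: le_lt_trans yn.
apply: le_trans (rounded_close n0 yn) _.
suff : `|0 - n%:R^-1| <= e :> R by rewrite sub0r normrN ger0_norm.
by near: n.
Unshelve. all: by end_near. Qed.

Variable m : {measure set Y -> \bar R}.
Hypothesis Lphi : L2 m phi.

Lemma rounded_L2 n : L2 m (rounded n).
Proof.
apply: int1_L2; first exact: rounded_measurable.
apply: int1_le (L2_int1 Lphi) _; first by apply: measurable_funX; exact: rounded_measurable.
by move=> y; rewrite !normrX ler_pXn2r ?nnegrE// rounded_le.
Qed.

Lemma rounded_e2 : e2 m (fun y => phi y - rounded n y) @[n --> \oo] --> 0.
Proof.
have [|||||_] := @int1_cvg _ _ _ m (fun n y => (phi y - rounded n y) ^+ 2) (fun=> 0) (fun y => 4 * phi y ^+ 2).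
- by move=> n; apply: measurable_funX; apply: measurable_funB => //; exact: rounded_measurable.
- exact: measurable_cst.
- apply: aeW => y; have -> : (0 : R) = (phi y - phi y) ^+ 2 by rewrite subrr expr0n.
  by apply: cvg_expr; apply: cvgB; [exact: cvg_cst|exact: rounded_cvg].
- by apply: int1Z; exact: L2_int1.
- apply: aeW => y n; rewrite normrX.
  have -> : 4 * phi y ^+ 2 = (2 * `|phi y|) ^+ 2 by rewrite exprMn real_normK ?num_real//; ring.
  rewrite ler_pXn2r ?nnegrE ?mulr_ge0//; apply: le_trans (ler_normB _ _) _.
  by rewrite (_ : 2 * `|phi y| = `|phi y| + `|phi y|) ?lerD ?rounded_le//; ring.
by rewrite (_ : \int[m]_x 0 = 0)// /Rintegral integral0.
Qed.

(** Chebyshev: the levels start at [1/n], so [phi^2 >= n^-2] on each of these sets. For [n = 0] the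
    set is empty. *)
Lemma level_set_finite n bj : (m (@level_set n bj) < +oo)%E.
Proof.
have mS := level_set_measurable bj; have [n0|n0] := posnP n.
  suff -> : level_set bj = set0 by rewrite measure0.
  by apply/seteqP; split => // y /level_set_trunc[+ _ _ _]; rewrite lt0n => /eqP.
have np : 0 < n%:R :> R by rewrite ltr0n.
have c0 : 0 < (n%:R^-1 : R) ^+ 2 by rewrite exprn_gt0 ?invr_gt0.
have [_ fin] := Lphi.
have : ((n%:R^-1 ^+ 2)%:E * m (level_set bj) <= \int[m]_y (phi y ^+ 2)%:E)%E.
  have e : (\int[m]_y ((n%:R^-1 ^+ 2)%:E * (\1_(level_set bj) y)%:E) = (n%:R^-1 ^+ 2)%:E * m (level_set bj))%E.
    rewrite ge0_integralZl//.
    - by rewrite integral_indic// setIT.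
    - by apply/measurable_EFinP; exact: measurable_indic.
  rewrite -e.
  apply: ge0_le_integral_unmeasured => y _; rewrite /= -EFinM lee_fin ?mulr_ge0 ?(ltW c0)//.
  rewrite indicE; case: (boolP (_ \in _)) => [/set_mem Hy|_]; last by rewrite mulr0 sqr_ge0.
  rewrite mulr1 -(real_normK (num_real (phi y))) ler_pXn2r ?nnegrE ?invr_ge0//.
  apply: le_trans (level_norm Hy); rewrite /level normrM normrX normrN1 expr1n mul1r ger0_norm//.
  by rewrite -[leLHS]mul1r ler_wpM2r ?invr_ge0// ler1n.
move=> /le_lt_trans/(_ fin); rewrite ltNge => H; rewrite ltNge; apply: contra H.
by rewrite leye_eq => /eqP ->; rewrite gt0_muley// lte_fin.
Qed.

End simple_approximation.

(** * Moments of sums of compensated counts *)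

Section compensated_moments.
Context {d : measure_display} {Omega : measurableType d} {R : realType}.
Context {dY : measure_display} {Y : measurableType dY}.
Variables (P : probability Omega R).
Variables (Pi : {measure set Y -> \bar R}) (T : R).
Variable nu : R.-ker Omega ~> (R * Y)%type.
Hypothesis Hnu : poisson_random_measure P Pi T nu.
Local Notation mu := (@lebesgue_measure R).

Section family.
Variables (r : nat) (D : 'I_r -> set R) (A : 'I_r -> set Y) (c : 'I_r -> R).
Hypothesis rect : forall j, rectangle Pi T (D j) (A j).
Hypothesis disj : trivIset setT (fun j => D j `*` A j).
Let N j w := nu w (D j `*` A j).
Let lam j := fine (mu (D j) * Pi (A j))%E.
Let n j w := fine (N j w) - lam j.

Let mN j : measurable_fun setT (N j).
Proof. by have [mD _ mA _] := rect j; apply: nu_measurable. Qed.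

(** A pi-system generating the information of the counts other than [a], whose own event [B a] is
    the whole space. *)
Let others (a : 'I_r) : set_system Omega := [set C | exists B : 'I_r -> set Omega,
  [/\ forall b, g_sigma_algebra_preimage (N b : Omega -> \bar R) (B b), B a = setT & C = \bigcap_b B b]].

Let preT b : g_sigma_algebra_preimage (N b : Omega -> \bar R) setT.
Proof. by exists setT => //; rewrite setTI preimage_setT. Qed.

Let preI b U V : g_sigma_algebra_preimage (N b : Omega -> \bar R) U ->
  g_sigma_algebra_preimage (N b : Omega -> \bar R) V -> g_sigma_algebra_preimage (N b : Omega -> \bar R) (U `&` V).
Proof.
move=> [U' mU <-] [V' mV <-]; exists (U' `&` V'); first exact: measurableI.
by rewrite !setTI.
Qed.

Let pre_meas b : g_sigma_algebra_preimage (N b : Omega -> \bar R) `<=` measurable.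
Proof. by move=> _ [B mB <-]; exact: mN. Qed.

Let ind (a : 'I_r) : independent2 P <<s others a >> (g_sigma_algebra_preimage (N a : Omega -> \bar R)).
Proof.
have [_ mut] := Hnu; have := mut r D A rect disj; rewrite /mutually_independent => prod.
have allT (B : 'I_r -> set Omega) : \bigcap_(i in [set` (xpredT : pred 'I_r)]) B i = \bigcap_i B i.
  by apply: eq_bigcap => //; apply/seteqP; split.
apply: indep_gen.
- move=> _ _ [B [HB Ba ->]] [B' [HB' Ba' ->]]; exists (fun b => B b `&` B' b); split.
  + by move=> b; exact: preI.
  + by rewrite Ba Ba' setIT.
  + apply/seteqP; split=> w; first by move=> [h h'] b _; split; [exact: h|exact: h'].
    by move=> h; split=> b _; have [] := h b I.
- by exists (fun=> setT); split => //; rewrite bigcap_const//; exists a.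
- move=> _ [B [HB _ ->]]; apply: fin_bigcap_measurable; first exact: finite_finset.
  by move=> b _; exact: pre_meas (HB b).
- exact: pre_meas.
move=> _ A' [B [HB Ba ->]] HA'.
pose B' b := if b == a then A' else B b.
have HB' b : g_sigma_algebra_preimage (N b : Omega -> \bar R) (B' b).
  by rewrite /B'; case: eqP => [->|].
have -> : \bigcap_b B b `&` A' = \bigcap_b B' b.
  apply/seteqP; split=> w.
    by move=> [h hA] b _; rewrite /B'; case: eqP => // _; exact: h.
  move=> h; split; last by have := h a I; rewrite /B' eqxx.
  move=> b _; have := h b I; rewrite /B'; case: eqP => // -> _; by rewrite Ba.
have := prod B' (fun b _ => HB' b); have := prod B (fun b _ => HB b).
rewrite !allT => -> ->; rewrite (bigD1 a)//= [in RHS](bigD1 a)//= Ba probability_setT mul1e /B' eqxx muleC.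
congr (_ * _)%E; apply: eq_bigr => b ba; by rewrite (negbTE ba).
Qed.

(** Joint independence gives the product rule on the pi-system [others a], [indep_gen] extends it,
    and the weighted sum of the remaining counts is measurable for the generated sigma-algebra. *)
Let ind_n (a : 'I_r) : independent2 P (g_sigma_algebra_preimage (n a))
  (g_sigma_algebra_preimage (fun w => \sum_(b | b != a) c b * n b w)).
Proof.
move=> E1 E2 H1 H2; rewrite setIC muleC; apply: ind.
  have sG : sigma_algebra setT <<s others a >> by exact: smallest_sigma_algebra.
  suff : Gm <<s others a >> (fun w => \sum_(b | b != a) c b * n b w) by apply.
  apply: Gm_sum => // b ba; apply: GmZ => //; apply: GmB => //; last exact: Gm_cst.
  apply: (@subset_trans _ (g_sigma_algebra_preimage (N b : Omega -> \bar R))).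
    move=> _ [B mB <-]; exists (fine @^-1` B) => //.
    by rewrite -[X in measurable X]setTI; exact: fine_measurable.
  move=> C HC; apply: sub_gen_smallest; exists (fun b' => if b' == b then C else setT); split.
  - by move=> b'; case: eqP => [->|].
  - by rewrite eq_sym (negbTE ba).
  - apply/seteqP; split => w; first by move=> Cw b' _; case: eqP.
    by move=> /(_ b I); rewrite eqxx.
case: H1 => B mB <-; exists ((fun x => fine x - lam a) @^-1` B) => //.
rewrite -[X in measurable X]setTI; apply: measurable_funB => //; exact: fine_measurable.
Qed.

Let lam0 j : 0 <= lam j. Proof. by rewrite fine_ge0// mule_ge0. Qed.

Let pois j (k : nat) : P [set w | N j w = (k%:R)%:E] = (lam j ^+ k / k`!%:R * expR (- lam j))%:E.
Proof. by have [H _] := Hnu; exact: H. Qed.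

Lemma compensated_family_allmom : allmom P (fun w => \sum_j c j * compensated Pi nu (D j) (A j) w).
Proof. exact: (poisson_family_allmom c lam0 mN pois). Qed.

Lemma compensated_family_recursion q :
  \int[P]_w ((\sum_j c j * compensated Pi nu (D j) (A j) w) ^+ q.+1) = \sum_(i < q) 'C(q, i)%:R *
    (\sum_j lam j * c j ^+ (q.+1 - i)) * \int[P]_w ((\sum_j c j * compensated Pi nu (D j) (A j) w) ^+ i).
Proof. exact: (poisson_family_recursion lam0 mN pois ind_n). Qed.

End family.

(** [B] depends only on the order and on the bound for the cumulants, not on the number of
    rectangles; this lets the partition and the simple approximation vary. *)
Lemma compensated_moment_bound (p : nat) (K : R) : 0 <= K -> exists B : R,
  forall (I : finType) (D : I -> set R) (A : I -> set Y) (c : I -> R),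
  (forall j, rectangle Pi T (D j) (A j)) ->
  (forall j j' z, (D j `*` A j) z -> (D j' `*` A j') z -> j = j') ->
  (forall r, (2 <= r <= p)%N -> `|\sum_j fine (mu (D j) * Pi (A j))%E * c j ^+ r| <= K) ->
  allmom P (fun w => \sum_j c j * compensated Pi nu (D j) (A j) w) /\
  `|\int[P]_w ((\sum_j c j * compensated Pi nu (D j) (A j) w) ^+ p)| <= B.
Proof.
move=> K0; have [B HB] := moment_recursion_bound p K0; exists B => I D A c rect disj mK.
have E w : \sum_j c j * compensated Pi nu (D j) (A j) w =
  \sum_(a < #|I|) c (enum_val a) * compensated Pi nu (D (enum_val a)) (A (enum_val a)) w.
  by rewrite (reindex (@enum_val I I))//; apply: onW_bij; exact: enum_val_bij.
have rect' (a : 'I_#|I|) : rectangle Pi T (D (enum_val a)) (A (enum_val a)) by exact: rect.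
have disj' : trivIset setT (fun a : 'I_#|I| => D (enum_val a) `*` A (enum_val a)).
  by move=> a a' _ _ [z [z1 z2]]; apply: enum_val_inj; exact: disj z1 z2.
rewrite (funext E); split; first exact: compensated_family_allmom.
under eq_Rintegral do rewrite E.
apply: (HB (fun p => \int[P]_w ((\sum_(a < #|I|) c (enum_val a) * compensated Pi nu (D (enum_val a)) (A (enum_val a)) w) ^+ p))
   (fun r => \sum_(a < #|I|) fine (mu (D (enum_val a)) * Pi (A (enum_val a)))%E * c (enum_val a) ^+ r)).
- by under eq_Rintegral do rewrite expr0; rewrite Rintegral_cst//= probability_setT mulr1.
- by move=> q; rewrite (compensated_family_recursion (fun a => c (enum_val a)) rect' disj').
- move=> r rp; have := mK r rp.
  by rewrite (reindex (@enum_val I I))//; apply: onW_bij; exact: enum_val_bij.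
Qed.

End compensated_moments.

(** Induction on the number of factors, splitting off the first; each step costs at most [2 L^2]. *)
Lemma prod_diff_le (R : realType) (k : nat) (L : R) (a b : 'I_k -> R) : 1 <= L ->
  (forall g, `|a g| <= L) -> (forall g, `|b g| <= L) ->
  (\prod_(g < k) a g - \prod_(g < k) b g) ^+ 2 <= (2 * L ^+ 2) ^+ k * \sum_(g < k) (a g - b g) ^+ 2.
Proof.
move=> L1; have L0 : 0 <= L by exact: le_trans L1.
elim: k a b => [|k IH] a b aL bL; first by rewrite !big_ord0 subrr expr0n mulr0.
rewrite !big_ord_recl; set A := \prod_(i < k) _; set B := \prod_(i < k) b _.
set Sg := \sum_(i < k) _.
have h : (A - B) ^+ 2 <= (2 * L ^+ 2) ^+ k * Sg by apply: IH.
have Sg0 : 0 <= Sg by apply: sumr_ge0 => g _; exact: sqr_ge0.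
have hA : A ^+ 2 <= (L ^+ 2) ^+ k.
  rewrite -(real_normK (num_real A)) -exprM mulnC exprM ler_pXn2r ?nnegrE ?exprn_ge0//.
  rewrite /A normr_prod -[leRHS](_ : \prod_(i < k) L = _); last by rewrite prodr_const card_ord.
  by apply: ler_prod => g _; rewrite normr_ge0 aL.
have hA' : A ^+ 2 <= (2 * L ^+ 2) ^+ k.
  apply: le_trans hA _; have L20 := sqr_ge0 L; apply: lerXn2r; rewrite ?nnegrE//.
    by rewrite mulr_ge0.
  by rewrite ler_peMl// ler1n.
have hb : b ord0 ^+ 2 <= L ^+ 2.
  by rewrite -(real_normK (num_real (b ord0))) ler_pXn2r ?nnegrE.
have hL : 1 <= L ^+ 2 by rewrite exprn_ege1.
have -> : a ord0 * A - b ord0 * B = (a ord0 - b ord0) * A + b ord0 * (A - B) by ring.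
have h2 (x y : R) : (x + y) ^+ 2 <= 2 * x ^+ 2 + 2 * y ^+ 2 by have := sqr_ge0 (x - y); lra.
have h3 := h2 ((a ord0 - b ord0) * A) (b ord0 * (A - B)); rewrite [_ ^+ 2 in X in _ <= X + _]exprMn [_ ^+ 2 in X in _ <= _ + X]exprMn in h3.
have hP : (2 * L ^+ 2) ^+ k.+1 = 2 * L ^+ 2 * (2 * L ^+ 2) ^+ k by exact: exprS.
apply: le_trans h3 _; rewrite hP.
set Q := (2 * L ^+ 2) ^+ k in hA' h *.
have Q0 : 0 <= Q by rewrite exprn_ge0// mulr_ge0// sqr_ge0.
have e1 : (a ord0 - b ord0) ^+ 2 * A ^+ 2 <= L ^+ 2 * Q * (a ord0 - b ord0) ^+ 2.
  rewrite mulrC ler_wpM2r ?sqr_ge0//; apply: le_trans hA' _.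
  by rewrite ler_peMl.
have e2 : b ord0 ^+ 2 * (A - B) ^+ 2 <= L ^+ 2 * (Q * Sg).
  by apply: ler_pM; rewrite ?sqr_ge0.
lra.
Qed.

(** If all factors are at most [L], the Lipschitz bound applies. Otherwise the largest, [m], exceeds
    [L], and the square is at most [4 m^(2k) <= 4 m^q / L] because [2k < q]; a moment bound makes
    this uniformly small as [L] grows. *)
Lemma prod_diff_trunc (R : realType) (k q : nat) (L : R) (a b : 'I_k -> R) : 1 <= L ->
  (k.*2 < q)%N ->
  (\prod_(g < k) a g - \prod_(g < k) b g) ^+ 2 <= (2 * L ^+ 2) ^+ k * \sum_(g < k) (a g - b g) ^+ 2 +
    4 / L * \sum_(g < k) (`|a g| ^+ q + `|b g| ^+ q).
Proof.
move=> L1 kq; have Lp : 0 < L by exact: lt_le_trans L1.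
pose m : R := \big[Order.max/0]_(g < k) Num.max `|a g| `|b g|.
have am g : `|a g| <= m.
  by apply: le_trans (le_bigmax _ (fun g => Num.max `|a g| `|b g|) g); rewrite le_max lexx.
have bm g : `|b g| <= m.
  by apply: le_trans (le_bigmax _ (fun g => Num.max `|a g| `|b g|) g); rewrite le_max lexx orbT.
have r0 : 0 <= 4 / L * \sum_(g < k) (`|a g| ^+ q + `|b g| ^+ q).
  apply: mulr_ge0; first by rewrite divr_ge0// ltW.
  by apply: sumr_ge0 => g _; rewrite addr_ge0 ?exprn_ge0.
have l0 : 0 <= (2 * L ^+ 2) ^+ k * \sum_(g < k) (a g - b g) ^+ 2.
  apply: mulr_ge0; first by rewrite exprn_ge0// mulr_ge0// sqr_ge0.
  by apply: sumr_ge0 => g _; exact: sqr_ge0.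
have [mL|Lm] := leP m L.
  apply: le_trans (prod_diff_le L1 _ _) _; [by move=> g; apply: le_trans (am g) mL|
    by move=> g; apply: le_trans (bm g) mL|by rewrite lerDl].
have m0 : 0 < m by exact: lt_trans Lm.
have m1 : 1 <= m by exact: le_trans L1 (ltW Lm).
have [g0 mE] : exists g, m = Num.max `|a g| `|b g|.
  have k0 : (0 < k)%N.
    by rewrite lt0n; apply/eqP => k0; move: m0; rewrite /m; move: a b {am bm r0 l0 m m1 Lm}; rewrite k0 => a b; rewrite big_ord0 ltxx.
  have F0 (g : 'I_k) : true -> 0 <= Num.max `|a g| `|b g| by rewrite le_max normr_ge0.
  by have [g _ Hg] := eq_bigmax (Ordinal k0) xpredT _ isT F0; exists g.
have mq : m ^+ q <= \sum_(g < k) (`|a g| ^+ q + `|b g| ^+ q).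
  rewrite (bigD1 g0)//= mE; apply: (@le_trans _ _ (`|a g0| ^+ q + `|b g0| ^+ q)).
    have h1 : 0 <= `|a g0| ^+ q by exact: exprn_ge0.
    have h2 : 0 <= `|b g0| ^+ q by exact: exprn_ge0.
    by case/orP: (le_total `|a g0| `|b g0|) => h; [rewrite (max_idPr h) lerDr|rewrite (max_idPl h) lerDl].
  by rewrite lerDl sumr_ge0// => g _; rewrite addr_ge0 ?exprn_ge0.
have pr (c : 'I_k -> R) : (forall g, `|c g| <= m) -> `|\prod_(g < k) c g| <= m ^+ k.
  move=> cm; rewrite normr_prod -[leRHS](_ : \prod_(i < k) m = _); last by rewrite prodr_const card_ord.
  by apply: ler_prod => g _; rewrite normr_ge0 cm.
have key : (\prod_(g < k) a g - \prod_(g < k) b g) ^+ 2 <= 4 * m ^+ k.*2.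
  rewrite -mul2n mulnC exprM (_ : 4 * (m ^+ k) ^+ 2 = (2 * m ^+ k) ^+ 2); last by ring.
  rewrite -real_normK ?num_real// ler_pXn2r ?nnegrE ?mulr_ge0 ?exprn_ge0 ?(ltW m0)//.
  apply: le_trans (ler_normB _ _) _; rewrite mulr_natl mulr2n.
  by apply: lerD; exact: pr.
apply: le_trans key _; apply: (@le_trans _ _ (4 / L * m ^+ q)); last first.
  apply: (@le_trans _ _ (4 / L * \sum_(g < k) (`|a g| ^+ q + `|b g| ^+ q))); last by rewrite lerDr.
  by rewrite ler_wpM2l// divr_ge0// ltW.
rewrite -mulrA ler_wpM2l// ler_pdivlMl//.
apply: (@le_trans _ _ (m ^+ k.*2.+1)); last by apply: ler_weXn2l.
by rewrite exprS ler_wpM2r ?exprn_ge0 ?(ltW m0)// ltW.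
Qed.

Lemma cvg_fin_sum (R : realType) (I : finType) (u : I -> nat -> R) (l : I -> R) :
  (forall i, u i @ \oo --> l i) -> \sum_i u i N @[N --> \oo] --> \sum_i l i.
Proof.
move=> ul; elim: (index_enum I) => [|i s IH].
  by rewrite big_nil; under eq_fun do rewrite big_nil; exact: cvg_cst.
rewrite big_cons (_ : (fun N => _) = (fun N => u i N + \sum_(j <- s) u j N)); last first.
  by apply/funext => N; rewrite big_cons.
exact: cvgD.
Qed.

(** * Convergence of products in mean square *)

Section product_convergence.
Context {d : measure_display} {Omega : measurableType d} {R : realType}.
Variables (P : probability Omega R) (k q : nat) (K : R).
Variables (X : nat -> 'I_k -> Omega -> R) (Z : 'I_k -> Omega -> R).
Hypothesis kq : (k.*2 < q)%N.
Hypothesis LX : forall N g, (0 < N)%N -> L2 P (X N g).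
Hypothesis LZ : forall g, L2 P (Z g).
Hypothesis XK : forall N g, (0 < N)%N -> (\int[P]_w (`|X N g w| ^+ q)%:E <= K%:E)%E.
Hypothesis ZK : forall g, (\int[P]_w (`|Z g w| ^+ q)%:E <= K%:E)%E.
Hypothesis XZ : forall g, e2 P (fun w => X N g w - Z g w) @[N --> \oo] --> 0.

Let int_pow (V : Omega -> R) : L2 P V -> (\int[P]_w (`|V w| ^+ q)%:E <= K%:E)%E ->
  int1 P (fun w => `|V w| ^+ q) /\ \int[P]_w (`|V w| ^+ q) <= K.
Proof.
move=> LV h; have i : int1 P (fun w => `|V w| ^+ q).
  apply: ge0_int1 => //; last exact: le_lt_trans h (ltry _).
  by apply: measurable_funX; apply: measurableT_comp => //; exact: L2_meas LV.
by split=> //; rewrite -lee_fin Rint_EFin.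
Qed.

Let prod_meas (V : 'I_k -> Omega -> R) : (forall g, L2 P (V g)) ->
  measurable_fun setT (fun w => \prod_(g < k) V g w).
Proof. by move=> LV; apply: measurable_prod => g _; exact: L2_meas (LV g). Qed.

Let prod_diff_e2 (A B : 'I_k -> Omega -> R) (L : R) : 1 <= L ->
  (forall g, L2 P (A g)) -> (forall g, L2 P (B g)) ->
  (forall g, \int[P]_w (`|A g w| ^+ q)%:E <= K%:E)%E ->
  (forall g, \int[P]_w (`|B g w| ^+ q)%:E <= K%:E)%E ->
  L2 P (fun w => \prod_(g < k) A g w - \prod_(g < k) B g w) /\
  e2 P (fun w => \prod_(g < k) A g w - \prod_(g < k) B g w) <=
  (2 * L ^+ 2) ^+ k * (\sum_(g < k) e2 P (fun w => A g w - B g w)) + 4 / L * (k%:R * (K + K)).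
Proof.
move=> L1 LA LB AK BK.
have iA g := int_pow (LA g) (AK g); have iB g := int_pow (LB g) (BK g).
have i1 : int1 P (fun w => \sum_(g < k) (A g w - B g w) ^+ 2).
  by apply: int1_sum => g; apply: L2_int1; exact: L2B.
have i2 : int1 P (fun w => \sum_(g < k) (`|A g w| ^+ q + `|B g w| ^+ q)).
  by apply: int1_sum => g; apply: int1D; [have [] := iA g|have [] := iB g].
have i3 := int1D (int1Z ((2 * L ^+ 2) ^+ k) i1) (int1Z (4 / L) i2).
have mAB : measurable_fun setT (fun w => \prod_(g < k) A g w - \prod_(g < k) B g w).
  by apply: measurable_funB; exact: prod_meas.
have LAB : L2 P (fun w => \prod_(g < k) A g w - \prod_(g < k) B g w).
  apply: int1_L2 => //; apply: int1_le i3 _; first exact: measurable_funX.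
  move=> w; rewrite ger0_norm ?sqr_ge0//; apply: le_trans _ (ler_norm _).
  exact: prod_diff_trunc.
split=> //; rewrite e2E; apply: (@le_trans _ _ (\int[P]_w ((2 * L ^+ 2) ^+ k * (\sum_(g < k) (A g w - B g w) ^+ 2) +
    4 / L * \sum_(g < k) (`|A g w| ^+ q + `|B g w| ^+ q)))).
  by apply: Rint_le => //; [exact: L2_int1|move=> w; exact: prod_diff_trunc].
rewrite RintD; [|exact: int1Z|exact: int1Z].
rewrite RintZ// RintZ// Rint_sum; last by move=> g; apply: L2_int1; exact: L2B.
rewrite lerD2l ler_wpM2l ?divr_ge0 ?(le_trans ler01 L1)//.
rewrite Rint_sum; last by move=> g; apply: int1D; [have [] := iA g|have [] := iB g].
rewrite mulr_natl -[X in _ *+ X](card_ord k) -sumr_const; apply: ler_sum => g _.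
have [iAg hA] := iA g; have [iBg hB] := iB g.
by rewrite RintD// lerD.
Qed.

Lemma prod_L2 : L2 P (fun w => \prod_(g < k) Z g w).
Proof.
have [k0|k0] := posnP k.
  have -> : (fun w => \prod_(g < k) Z g w) = (fun=> 1); last exact: L2_cst.
  apply/funext => w; rewrite big1// => g _; have := ltn_ord g; rewrite [X in (_ < X)%N]k0//.
have L0 (g : 'I_k) : L2 P (fun _ : Omega => 0 : R) by exact: L20.
have K0 : 0 <= K.
  rewrite -lee_fin; apply: le_trans (ZK (Ordinal k0)).
  by apply: integral_ge0 => w _; rewrite lee_fin exprn_ge0.
have q0 : (0 < q)%N by exact: leq_ltn_trans kq.
(* Comparison with the product of zero factors, which vanishes as [k > 0]. *)
have [|LP _] := prod_diff_e2 (lexx 1) LZ L0 ZK.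
  move=> g; rewrite integral0_eq ?lee_fin// => w _; rewrite normr0 expr0n; by case: q q0.
have := LP; congr (L2 P _); apply/funext => w.
by rewrite [X in _ - X](bigD1 (Ordinal k0))//= mul0r subr0.
Qed.

Lemma prod_cvg : e2 P (fun w => \prod_(g < k) X N g w - \prod_(g < k) Z g w) @[N --> \oo] --> 0.
Proof.
apply/cvgrPdist_le => eps e0.
pose c := 4 * (k%:R * (`|K| + `|K|)); have c0 : 0 <= c by rewrite !mulr_ge0// addr_ge0.
(* [L] makes the moment term at most [eps / 2] for every [N]; only then is [N] taken large. *)
pose L := 1 + c / (eps / 2).
have e2p : 0 < eps / 2 by rewrite divr_gt0.
have L1 : 1 <= L by rewrite lerDl divr_ge0// ltW.
have Lp : 0 < L by exact: lt_le_trans L1.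
have cL : 4 / L * (k%:R * (K + K)) <= eps / 2.
  rewrite -mulrA [L^-1 * _]mulrC mulrA ler_pdivrMr//.
  apply: (@le_trans _ _ c).
    by rewrite /c ler_wpM2l// ler_wpM2l// lerD// ler_norm.
  rewrite /L mulrDr mulr1 mulrCA mulfV ?gt_eqF// mulr1 lerDr ltW//.
pose C := (2 * L ^+ 2) ^+ k.
have C0 : 0 <= C by rewrite exprn_ge0// mulr_ge0// sqr_ge0.
have SZ : (fun N => C * \sum_(g < k) e2 P (fun w => X N g w - Z g w)) @ \oo --> 0.
  have h : (fun N => C * \sum_(g < k) e2 P (fun w => X N g w - Z g w)) @ \oo --> C * 0.
    by apply: cvgM; [exact: cvg_cst|have := cvg_fin_sum XZ; rewrite big1].
  by rewrite mulr0 in h.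
have /cvgrPdist_le/(_ _ e2p) H := SZ.
near=> N; have N0 : (0 < N)%N by near: N; exact: nbhs_infty_gt.
rewrite sub0r normrN ger0_norm ?e2_ge0//.
have [_ h] := prod_diff_e2 L1 (fun g => LX g N0) LZ (fun g => XK g N0) ZK.
apply: le_trans h _; rewrite (_ : eps = eps / 2 + eps / 2); last by field.
apply: lerD => //; rewrite -/C.
suff : `|0 - C * \sum_(g < k) e2 P (fun w => X N g w - Z g w)| <= eps / 2.
  by rewrite sub0r normrN => /(le_trans (ler_norm _)).
by near: N.
Unshelve. all: by end_near. Qed.

End product_convergence.

(** * Single Riemann sums of cell integrals *)

Section kernel_limits.
Context {d : measure_display} {Omega : measurableType d} {R : realType}.
Variables (P : probability Omega R) (F : R -> set_system Omega).
Variables (t T : R) (tau : nat -> nat -> R).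
Hypothesis t0 : 0 <= t.
Hypothesis tT : t < T.
Hypothesis Ffil : filtration T F.
Hypothesis part : forall N, (0 < N)%N -> is_partition t T N (tau N).
Hypothesis mesh0 : (fun N => \big[Order.max/0]_(j < N) (tau N j.+1 - tau N j)) @ \oo --> 0.
Variables (rel : (R * Omega -> R) -> (Omega -> R) -> Prop) (C : R).
Variables (S : nat -> nat -> Omega -> R).
Hypothesis ker : kernel P F tau rel C S.
Hypothesis C0 : 0 <= C.
Local Notation leb := (leb (R := R)).

Lemma time_L2 (u : R -> R) : L2 leb u ->
  L2 (horizon P) (fun z => u z.1) /\ e2 (horizon P) (fun z => u z.1) = e2 leb u.
Proof.
move=> Lu; have [j1 j2] := prod_int (L2_int1 Lu) (L2_L1 (L2_cst P 1)).
have E (z : R * Omega) : u z.1 ^+ 2 * 1 = u z.1 ^+ 2 by rewrite mulr1.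
split.
  apply: int1_L2; first exact: (measurableT_comp (L2_meas Lu)).
  by apply: eq_int1 j1 => z; rewrite E.
rewrite e2E; under eq_Rintegral do rewrite -E.
by rewrite j2 Rintegral_cst//= probability_setT mulr1 mulr1.
Qed.

Definition riemann_sum h N w := \sum_(q < N) h (tau N q) * S N q w.

Lemma riemann_sum_rel h N : (0 < N)%N -> rel (fun z => step tau N h z.1) (riemann_sum h N).
Proof.
move=> N0; have := kernel_cells ker (X := fun (q : 'I_N) (_ : Omega) => h (tau N q)) (Q := xpredT).
move=> H; apply: H => q _; have qN := ltnW (ltn_ord q); apply: (past_cst P Ffil).
  exact: (node0 t0 part N0 qN).
exact: (node_le part N0 qN).
Qed.

Lemma riemann_sum_L2 h N : (0 < N)%N -> L2 P (riemann_sum h N).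
Proof. by move=> N0; have [] := kernel_e2 ker (riemann_sum_rel h N0). Qed.

(** The Riemann sum is itself an integral, that of the step function of [h], so the kernel
    inequality reduces the claim to [step_cvg]. *)
Lemma riemann_sum_cvg h Z : pc t T h -> rel (fun z => cutoff t T h z.1) Z ->
  e2 P (fun w => riemann_sum h N w - Z w) @[N --> \oo] --> 0.
Proof.
move=> hpc rZ; have Hst := step_cvg part mesh0 hpc.
have H : (fun N => C * e2 leb (fun s => step tau N h s - cutoff t T h s)) @ \oo --> 0.
  by rewrite -(mulr0 C); apply: cvgM => //; exact: cvg_cst.
apply/cvgrPdist_le => e e0; have /cvgrPdist_le/(_ _ e0) H' := H.
near=> N; have N0 : (0 < N)%N by near: N; exact: nbhs_infty_gt.
rewrite sub0r normrN ger0_norm ?e2_ge0//.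
have [_ _ h1] := kernel_e2 ker (kernelB ker (riemann_sum_rel h N0) rZ).
have LB : L2 leb (fun s => step tau N h s - cutoff t T h s).
  by apply: L2B; [exact: (step_L2 tT part)|exact: cut_L2].
apply: le_trans h1 _; rewrite (time_L2 LB).2.
suff : `|0 - C * e2 leb (fun s => step tau N h s - cutoff t T h s)| <= e.
  by rewrite sub0r normrN => /(le_trans (ler_norm _)).
by near: N.
Unshelve. all: by end_near. Qed.

Definition moment_bounded q := forall h, pc t T h -> exists K : R, forall N, (0 < N)%N ->
  (\int[P]_w (`|riemann_sum h N w| ^+ q)%:E <= K%:E)%E.

Lemma riemann_limit_moment q h Z (K : R) : L2 P Z ->
  e2 P (fun w => riemann_sum h N w - Z w) @[N --> \oo] --> 0 ->
  (forall N, (0 < N)%N -> (\int[P]_w (`|riemann_sum h N w| ^+ q)%:E <= K%:E)%E) ->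
  (\int[P]_w (`|Z w| ^+ q)%:E <= K%:E)%E.
Proof.
move=> LZ cZ HK; apply: (@moment_limit _ _ _ P (fun N => riemann_sum h N.+1)) => //.
- by move=> n; exact: riemann_sum_L2.
- by rewrite (cvg_shiftS (fun N => e2 P (fun w => riemann_sum h N w - Z w))).
- by move=> n; exact: HK.
Qed.

End kernel_limits.

Lemma even_norm (R : realType) (x : R) p : ~~ odd p -> `|x| ^+ p = x ^+ p.
Proof.
move=> po; have e := odd_double_half p; rewrite (negbTE po) add0n -mul2n in e.
by rewrite -e !exprM real_normK ?num_real.
Qed.

(** * The cell integrals form a kernel with bounded moments *)

Section irel_kernel.
Context {d : measure_display} {Omega : measurableType d} {R : realType}.
Context {dY : measure_display} {Y : measurableType dY}.
Variables (P : probability Omega R) (F : R -> set_system Omega).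
Variables (Pi : {measure set Y -> \bar R}) (t T : R) (m : nat).
Variable nu : 'I_m.+1 -> R.-ker Omega ~> (R * Y)%type.
Hypothesis t0 : 0 <= t.
Hypothesis tT : t < T.
Hypothesis Ffil : filtration T F.
Hypothesis Hnu : poisson_system P F Pi T nu.
Variables (D : set Y) (PiD : {sigma_finite_measure set Y -> \bar R}).
Hypothesis mD : measurable D.
Hypothesis PiDE : forall A, measurable A -> PiD A = Pi (A `&` D).
Variables (phi : Y -> R) (i : 'I_m.+1).
Hypothesis phiD : forall y, ~ D y -> phi y = 0.
Hypothesis Lphi : L2 PiD phi.
Hypothesis iphi : i = ord0 -> int1 Pi phi.
Variable tau : nat -> nat -> R.
Hypothesis part : forall N, (0 < N)%N -> is_partition t T N (tau N).
Variable S : nat -> nat -> Omega -> R.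
Hypothesis HS : forall N q, (q < N)%N ->
  stoch_int P F Pi nu i (tau N q) (tau N q.+1) (fun _ y _ => phi y) (S N q).
Local Notation horizon := (horizon P).
Local Notation leb := (leb (R := R)).

Let T0 : 0 <= T. Proof. exact: le_trans (ltW tT). Qed.

Lemma poisson_system_adapted j : j != ord0 -> adapted_counts P F Pi T (nu j).
Proof.
case: Hnu => prm _ ad ind j0; split; first by case: (prm j j0).
  by move=> s A; exact: ad.
by move=> s h A; exact: ind.
Qed.

Local Notation rel := (irel P F Pi T nu D PiD phi i).
Let Hadapt := poisson_system_adapted.

Lemma irel0 : rel (fun=> 0) (fun=> 0).
Proof.
rewrite /irel; case: eqP => [_|_].
  split; [exact: L20|by []|exact: measurable_cst|].
  by apply: aeW => w; rewrite /Rintegral integral0 mulr0.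
split; first exact: L20.
split; [|exact: L20|move=> eps e0; exists nil].
  by under [Z in L2 _ Z]eq_fun do rewrite mulr0; exact: L20.
have en : eint (nu i) (nil : seq (elem P F Pi T D)) = fun=> 0 by apply/funext => w; rewrite /eint big_nil.
have ef0 : efun (nil : seq (elem P F Pi T D)) = fun=> 0 by apply/funext => w; rewrite /efun big_nil.
have zero d' (V : measurableType d') (mm : {measure set V -> \bar R}) (f : V -> R) : (forall v, f v = 0) -> e2 mm f <= eps.
  by move=> /funext ->; rewrite ae_e2_0 ?(ltW e0)//; exact: aeW.
by split; apply: zero => v; rewrite ?en ?ef0 ?mulr0 subrr.
Qed.

Lemma irel_kernel (C : R) : irel_cst Pi T PiD phi <= C -> kernel P F tau rel C S.
Proof.
move=> hC; split.
- move=> G Z H; have [LG LZ h] := irel_e2 T0 Ffil Hadapt PiDE Lphi H; split => //.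
  by apply: le_trans h _; rewrite ler_wpM2r ?e2_ge0.
- exact: irel0.
- by move=> G Z G' Z'; exact: (irelD T0 Ffil Hadapt PiDE).
- by move=> c G Z; exact: (irelZ T0 Ffil Hadapt PiDE).
- move=> N q X qN pX; have N0 : (0 < N)%N by exact: leq_trans qN.
  apply: (irel_cell T0 Ffil Hadapt mD PiDE phiD Lphi iphi _ _ _ (HS qN) pX).
  + exact: (node0 t0 part N0 (ltnW qN)).
  + exact: ltW (node_lt part qN).
  + exact: (node_le part N0 qN).
- move=> N q qN; have N0 : (0 < N)%N by exact: leq_trans qN.
  apply: (past_cell T0 Ffil Hadapt mD PiDE phiD iphi _ _ _ (HS qN)).
  + exact: (node0 t0 part N0 (ltnW qN)).
  + exact: ltW (node_lt part qN).
  + exact: (node_le part N0 qN).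
Qed.

Lemma integral_step_le h M : 0 <= M -> (forall s, s \in `[t, T] -> `|h s| <= M) -> pc t T h ->
  forall N, (0 < N)%N -> `|\int[leb]_s step tau N h s| <= M * (T - t).
Proof.
move=> M0 HM hpc N N0; rewrite (step_int part _ hpc).
apply: le_trans (ler_norm_sum _ _ _) _.
have -> : T - t = \sum_(q < N) (tau N q.+1 - tau N q).
  have [e1 e2 _] := part N0; rewrite -(big_mkord xpredT (fun q => tau N q.+1 - tau N q)).
  by rewrite telescope_sumr// e1 e2.
rewrite mulr_sumr; apply: ler_sum => q _; rewrite normrM.
have d0 : 0 <= tau N q.+1 - tau N q by rewrite subr_ge0 ltW// (node_lt part).
rewrite (ger0_norm d0) ler_wpM2r// HM//; apply: (node_in part N0).
exact: ltnW.
Qed.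

Variable p : nat.
Hypothesis p2 : (2 <= p)%N.
Hypothesis peven : ~~ odd p.
Hypothesis phip : int1 PiD (fun y => `|phi y| ^+ p).

(** The sum is almost surely deterministic: the number [c] times a Riemann sum bounded by
    [M * (T - t)]. *)
Let ordinary_moments : i = ord0 -> moment_bounded P t T tau S p.
Proof.
move=> i0 h hpc; have [M M0 HM] := pc_bound hpc.
pose c := \int[Pi]_y phi y.
exists ((`|c| * (M * (T - t))) ^+ p) => N N0.
have := riemann_sum_rel t0 Ffil part (irel_kernel (lexx _)) h N0.
rewrite /irel i0 eqxx => -[_ _ mZ ZE].
apply: (@le_trans _ _ (\int[P]_w ((`|c| * (M * (T - t))) ^+ p)%:E)%E); last first.
  by rewrite integral_cst//= probability_setT mule1.
apply: ae_ge0_le_integral => //.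
- by apply/measurable_EFinP; apply: measurable_funX; exact: measurableT_comp.
- by move=> w _; rewrite lee_fin exprn_ge0// mulr_ge0// mulr_ge0// subr_ge0 ltW.
- apply: filterS ZE => w -> _; rewrite lee_fin; apply: lerXn2r; rewrite ?nnegrE//.
    by rewrite mulr_ge0// mulr_ge0// subr_ge0 ltW.
  rewrite normrM ler_wpM2l//; exact: integral_step_le.
Qed.

Section martingale_moments.
Hypothesis i0 : i != ord0.
Variables (h : R -> R).
Hypothesis hpc : pc t T h.
Let mphi := L2_meas Lphi.
Let A n (bj : bool * 'I_(n * n)) := level_set phi bj.
Let lv n (bj : bool * 'I_(n * n)) : R := level R bj.

Let A_D n bj : @A n bj `<=` D.
Proof.
move=> y /(level_set_trunc (phi := phi))[_ _ py _]; apply: contrapT => /phiD py0.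
by rewrite py0 eqxx in py.
Qed.

Let PiA n bj : PiD (@A n bj) = Pi (@A n bj).
Proof.
rewrite PiDE; last exact: level_set_measurable.
by congr (Pi _); apply/setIidl; exact: A_D.
Qed.

Let A_fin n bj : finset_ Pi (@A n bj).
Proof.
by split; [exact: level_set_measurable|rewrite -PiA; exact: level_set_finite].
Qed.

Let X n N w := \sum_(qb : 'I_N * (bool * 'I_(n * n))) h (tau N qb.1) * lv qb.2 *
  compensated Pi (nu i) `[tau N qb.1, tau N qb.1.+1[ (A qb.2) w.

(** Dominates the integral of [|phi|^r] for every [2 <= r <= p], hence serves for all cumulants at
    once. *)
Let W := \int[PiD]_y (phi y ^+ 2 + `|phi y| ^+ p).

Let pow_le r (x : R) : (2 <= r <= p)%N -> `|x| ^+ r <= x ^+ 2 + `|x| ^+ p.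
Proof.
move=> /andP[r2 rp]; rewrite -(real_normK (num_real x)); have x0 := normr_ge0 x.
have [x1|x1] := leP `|x| 1.
  by apply: (@le_trans _ _ (`|x| ^+ 2)); [exact: ler_wiXn2l|rewrite lerDl exprn_ge0].
by apply: (@le_trans _ _ (`|x| ^+ p)); [by apply: ler_weXn2l => //; exact: ltW|rewrite lerDr exprn_ge0].
Qed.

Let W_int : int1 PiD (fun y => phi y ^+ 2 + `|phi y| ^+ p).
Proof. by apply: int1D => //; exact: L2_int1. Qed.

Let W0 : 0 <= W.
Proof. by apply: Rintegral_ge0 => y _; rewrite addr_ge0 ?sqr_ge0 ?exprn_ge0. Qed.

Let level_sum n r : (2 <= r <= p)%N ->
  \sum_(bj : bool * 'I_(n * n)) fine (Pi (A bj)) * `|lv bj| ^+ r <= W.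
Proof.
move=> rp; have ii bj : int1 PiD (\1_(@A n bj) : Y -> R).
  apply: ge0_int1 => //; first by apply: measurable_indic; exact: level_set_measurable.
  rewrite integral_indic//; last exact: level_set_measurable.
  by rewrite setIT; apply: le_lt_trans (A_fin bj).2; rewrite -PiA.
have -> : \sum_(bj : bool * 'I_(n * n)) fine (Pi (A bj)) * `|lv bj| ^+ r =
  \int[PiD]_y \sum_(bj : bool * 'I_(n * n)) `|lv bj| ^+ r * \1_(A bj) y.
  rewrite Rint_sum; last by move=> bj; exact: int1Z.
  apply: eq_bigr => bj _; rewrite RintZ// mulrC; congr (_ * _).
  rewrite /Rintegral integral_indic//; last exact: level_set_measurable.
  by rewrite setIT; congr fine; exact/esym/PiA.
apply: Rint_le => //; first by apply: int1_sum => bj; exact: int1Z.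
move=> y; have [[bj Hy]|H] := pselect (exists bj, @A n bj y).
  rewrite (bigD1 bj)//= big1 ?addr0.
    rewrite indicE mem_set// mulr1; apply: le_trans (pow_le (phi y) rp).
    by apply: lerXn2r; rewrite ?nnegrE//; exact: level_norm Hy.
  move=> bj' ne; rewrite indicE memNset ?mulr0// => Hy'.
  by move/eqP : ne; apply; exact: level_set_disj Hy' Hy.
rewrite big1 ?addr_ge0 ?sqr_ge0 ?exprn_ge0// => bj _.
by rewrite indicE memNset ?mulr0// => Hy; apply: H; exists bj.
Qed.

(** Every cumulant is at most [K]: in time the lengths of the cells add up to [T - t], in space
    [level_sum] applies. The resulting moment bound is uniform in both [n] and [N]. *)
Let X_moments : exists K : R, forall n N, (0 < N)%N ->
  L2 P (X n N) /\ (\int[P]_w (`|X n N w| ^+ p)%:E <= K%:E)%E.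
Proof.
have [M M0 HM] := pc_bound hpc; have Tt : 0 <= T - t by rewrite subr_ge0 ltW.
(* [1 + M] instead of [M], so that its powers of order [r <= p] are bounded by the [p]-th. *)
pose K := (T - t) * (1 + M) ^+ p * W.
have M1 : 1 <= 1 + M by rewrite lerDl.
have K0 : 0 <= K by rewrite !mulr_ge0// exprn_ge0// (le_trans ler01 M1).
have [prm _ _ _] := Hnu; have Hprm := prm i i0.
have [B HB] := compensated_moment_bound Hprm p K0; exists B => n N N0.
have n0 q : (q <= N)%N -> 0 <= tau N q by move=> qN; exact: (node0 t0 part N0 qN).
have [||r rp|aX hX] := HB ('I_N * (bool * 'I_(n * n)))%type
   (fun qb => `[tau N qb.1, tau N qb.1.+1[%classic) (fun qb => A qb.2) (fun qb => h (tau N qb.1) * lv qb.2).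
- move=> qb; apply: rectangle_itv; [exact: A_fin|exact: n0 (ltnW _)|exact: (node_le part N0)].
- move=> [q bj] [q' bj'] [s y] /= [s1 y1] [s2 y2].
  rewrite (level_set_disj y1 y2); congr (_, _); apply: ord_inj.
  exact: (cell_disj part (ltn_ord q) (ltn_ord q') s1 s2).
- apply: le_trans (ler_norm_sum _ _ _) _.
  rewrite -(pair_bigA _ (fun (q : 'I_N) (bj : bool * 'I_(n * n)) => `|fine (@lebesgue_measure R `[tau N q, tau N q.+1[ * Pi (A bj))%E * (h (tau N q) * lv bj) ^+ r|))/=.
  have -> : K = \sum_(q < N) (tau N q.+1 - tau N q) * ((1 + M) ^+ p * W).
    have [e1 e2 _] := part N0; rewrite -mulr_suml -(big_mkord xpredT (fun q => tau N q.+1 - tau N q)).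
    by rewrite telescope_sumr// e1 e2 mulrA.
  apply: ler_sum => q _; have qN := ltn_ord q.
  have d0 : 0 <= tau N q.+1 - tau N q by rewrite subr_ge0 ltW// (node_lt part).
  apply: (@le_trans _ _ (\sum_(bj : bool * 'I_(n * n)) (tau N q.+1 - tau N q) * ((1 + M) ^+ p * (fine (Pi (A bj)) * `|lv bj| ^+ r)))).
    apply: ler_sum => bj _; rewrite fine_muPi//; [|by first [exact: ltW (node_lt part qN)|exact: A_fin]].
    have f0 : 0 <= fine (Pi (A bj)) by rewrite fine_ge0.
    have -> : (tau N q.+1 - tau N q) * ((1 + M) ^+ p * (fine (Pi (A bj)) * `|lv bj| ^+ r)) =
      (tau N q.+1 - tau N q) * fine (Pi (A bj)) * ((1 + M) ^+ p * `|lv bj| ^+ r) by ring.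
    rewrite [leLHS]normrM (ger0_norm (mulr_ge0 d0 f0)); apply: ler_wpM2l; first exact: mulr_ge0.
    rewrite normrX normrM exprMn; apply: ler_wpM2r; first exact: exprn_ge0.
    apply: (@le_trans _ _ ((1 + M) ^+ r)).
      apply: lerXn2r; rewrite ?nnegrE//; first exact: le_trans ler01 M1.
      apply: le_trans (HM _ _) _; first by apply: (node_in part N0); exact: ltnW.
      by rewrite lerDr.
    by apply: ler_weXn2l => //; case/andP : rp.
  rewrite -mulr_sumr -mulr_sumr ler_wpM2l// ler_wpM2l//; last exact: level_sum.
  by rewrite exprn_ge0// (le_trans ler01 M1).
split; first exact: allmom_L2 aX.
have iX : int1 P (fun w => X n N w ^+ p) by case: aX => _; apply.
rewrite (_ : (\int[P]_w (`|X n N w| ^+ p)%:E = (\int[P]_w (X n N w ^+ p))%:E)%E); last first.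
  by rewrite Rint_EFin//; apply: eq_integral => w _; rewrite even_norm.
by rewrite lee_fin; exact: le_trans (ler_norm _) hX.
Qed.

(** By the isometry the squared error is that of [phi - rounded phi n], times the squared norm of
    the step function of [h]. *)
Let X_cvg N : (0 < N)%N -> e2 P (fun w => X n N w - riemann_sum tau S h N w) @[n --> \oo] --> 0.
Proof.
move=> N0; have := riemann_sum_rel t0 Ffil part (irel_kernel (lexx _)) h N0.
rewrite /irel (negbTE i0) => -[Lst IM].
have Ha := Hadapt i0.
have [_ LM _] := IM.
have n0 q : (q <= N)%N -> 0 <= tau N q by move=> qN; exact: (node0 t0 part N0 qN).
have nT q : (q <= N)%N -> tau N q <= T by move=> qN; exact: (node_le part N0 qN).
have nS q : (q < N)%N -> tau N q <= tau N q.+1 by move=> qN; exact: ltW (node_lt part qN).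
have sF (s : R) : 0 <= s -> s <= T -> sigma_algebra setT (F s).
  by move=> s0 sT; case: Ffil => + _ _; apply; exact: memI.
have [K HX] := X_moments.
have cl : (fun n => e2 PiD (fun y => phi y - rounded phi n y) * e2 horizon (fun z => step tau N h z.1)) @ \oo --> 0.
  have cl' : (fun n => e2 PiD (fun y => phi y - rounded phi n y) * e2 horizon (fun z => step tau N h z.1)) @ \oo
     --> 0 * e2 horizon (fun z => step tau N h z.1).
    by apply: cvgM; [exact: rounded_e2|exact: cvg_cst].
  by rewrite mul0r in cl'.
apply: cvg0_le cl => n; rewrite e2_ge0/=.
have [LX _] := HX n N N0.
have gq (qb : 'I_N * (bool * 'I_(n * n))) : Gm (F (tau N qb.1)) (fun=> h (tau N qb.1) * lv qb.2).
  by apply: Gm_cst; apply: sF; [apply: n0; exact: ltnW|apply: nT; exact: ltnW].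
pose mk (qb : 'I_N * (bool * 'I_(n * n))) : elem P F Pi T D :=
  Elem (gq qb) (L2_cst P (h (tau N qb.1) * lv qb.2)) (n0 _ (ltnW (ltn_ord qb.1)))
    (nS _ (ltn_ord qb.1)) (nT _ (ltn_ord qb.1)) (A_fin qb.2) (@A_D n qb.2).
pose s := map mk (enum {: 'I_N * (bool * 'I_(n * n))}).
have sE z : efun s z = rounded phi n z.1.2 * step tau N h z.1.1.
  rewrite /efun big_map big_enum/= /rounded /step mulr_suml.
  under [in RHS]eq_bigr => bj _ do rewrite mulr_sumr.
  rewrite exchange_big/= pair_bigA/=; apply: eq_bigr => qb _; rewrite /ef/= /lv /A; ring.
have siE w : eint (nu i) s w = \sum_(qb : 'I_N * (bool * 'I_(n * n))) h (tau N qb.1) * lv qb.2 * inc Pi (nu i) (tau N qb.1) (tau N qb.1.+1) (A qb.2) w.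
  by rewrite /eint big_map big_enum.
have ae : {ae P, forall w, eint (nu i) s w = X n N w}.
  have : {ae P, forall w, forall qb : 'I_N * (bool * 'I_(n * n)),
    inc Pi (nu i) (tau N qb.1) (tau N qb.1.+1) (A qb.2) w =
    compensated Pi (nu i) `[tau N qb.1, tau N qb.1.+1[ (A qb.2) w}.
    apply: filter_forall => qb.
    exact: (inc_ae Ha (A_fin qb.2) (n0 _ (ltnW (ltn_ord qb.1))) (nS _ (ltn_ord qb.1)) (nT _ (ltn_ord qb.1))).
  by apply: filterS => w H; rewrite siE; apply: eq_bigr => qb _; rewrite H.
have Ls := eint_L2 Ffil Ha s.
rewrite -(@e2_ae _ _ _ P (fun w => eint (nu i) s w - riemann_sum tau S h N w)); first last.
- by apply: filterS ae => w ->.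
- exact: L2_meas (L2B LX LM).
- exact: L2_meas (L2B Ls LM).
rewrite e2_subC -(integral_of_isometry Ffil Ha PiDE (integral_ofB Ffil Ha PiDE IM (integral_of_elem Ffil Ha PiDE s))).
have LB : L2 PiD (fun y => phi y - rounded phi n y) by apply: L2B => //; exact: rounded_L2.
have [_ <-] := phi_horizon LB Lst.
rewrite le_eqVlt; apply/orP; left; apply/eqP; congr (e2 _ _); apply/funext => z.
by rewrite sE/=; ring.
Qed.

Lemma martingale_moments : exists K : R, forall N, (0 < N)%N ->
  (\int[P]_w (`|riemann_sum tau S h N w| ^+ p)%:E <= K%:E)%E.
Proof.
have [K HX] := X_moments; exists K => N N0.
apply: (@moment_limit _ _ _ P (fun n => X n N)).
- exact: (riemann_sum_L2 t0 Ffil part (irel_kernel (lexx _)) h N0).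
- by move=> n; case: (HX n N N0).
- exact: X_cvg.
- by move=> n; case: (HX n N N0).
Qed.

(** [X n N] is a function of counts of rectangles, exactly measurable for the sigma-algebra they
    generate; the limit keeps this up to a null set. *)
Lemma riemann_sum_generated N : (0 < N)%N -> exists X',
  Gm (sigma_generated [set DA : set R * set Y | rectangle Pi T DA.1 DA.2]
        (fun DA w => nu i w (DA.1 `*` DA.2) : \bar R)) X' /\
  {ae P, forall w, riemann_sum tau S h N w = X' w}.
Proof.
move=> N0; set G := sigma_generated _ _.
have sG : sigma_algebra setT G by exact: smallest_sigma_algebra.
apply: (@limit_adapted _ _ _ P G (fun n => X n N)) => //.
- move=> n; apply: Gm_sum => // qb _; apply: GmZ => //; apply: GmB => //; last exact: Gm_cst.
  have N0' := ltn_ord qb.1.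
  have rA : rectangle Pi T `[tau N qb.1, tau N qb.1.+1[ (A qb.2).
    by apply: rectangle_itv => //; [exact: (node0 t0 part N0 (ltnW N0'))|exact: (node_le part N0 N0')].
  move=> _ [B mB <-]; apply: sub_sigma_algebra.
  exists (`[tau N qb.1, tau N qb.1.+1[%classic, A qb.2) => //; exists (fine @^-1` B) => //.
  by have := fine_measurable measurableT measurableT mB; rewrite setTI.
- by move=> n; have [K HX] := X_moments; case: (HX n N N0).
- exact: (riemann_sum_L2 t0 Ffil part (irel_kernel (lexx _)) h N0).
- exact: X_cvg.
Qed.

End martingale_moments.

Lemma irel_moments : moment_bounded P t T tau S p.
Proof.
have [i0|i0] := eqVneq i ord0; first exact: ordinary_moments.
by move=> h hpc; exact: martingale_moments.
Qed.

End irel_kernel.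

(** * Iterated integrals of deterministic functions *)

Section iterated_tail_integrals.
Variables (R : realType) (t T : R).
Hypothesis tT : t < T.
Local Notation pc := (pc t T).
Local Notation cut := (cutoff t T).
Local Notation leb := (leb (R := R)).

Lemma Rint_except1 (x : R) (u v : R -> R) : measurable_fun setT u -> measurable_fun setT v ->
  (forall s, s != x -> u s = v s) -> \int[leb]_s u s = \int[leb]_s v s.
Proof.
move=> mu mv uv; apply: Rint_ae => //; exists [set x]; split.
- exact: measurable_set1.
- exact: (@lebesgue_measure_set1 R x).
- by move=> s /= H; apply: contrapT => /eqP sx; apply: H; exact: uv.
Qed.

Lemma cut_bound h M : (forall s, s \in `[t, T] -> `|h s| <= M) -> 0 <= M ->
  forall s, `|cut h s| <= M * \1_(`[t, T[ : set R) s.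
Proof.
move=> HM M0 s; rewrite /cutoff indicE; have [sT|_] := boolP (_ \in _); last by rewrite !mulr0 normr0.
rewrite !mulr1 HM//; by move: sT; rewrite inE/= !in_itv/= => /andP[-> /ltW].
Qed.

Lemma cut_int1 h : pc h -> int1 leb (cut h).
Proof. by move=> hpc; apply: (L1_of_L2 tT (cut_L2 tT hpc)); exact: cut0. Qed.

Definition tail_integral (h : R -> R) (x : R) : R := \int[leb]_s (cut h s * \1_(`[x, T[ : set R) s).

Lemma tail_int1 h x : pc h -> int1 leb (fun s => cut h s * \1_(`[x, T[ : set R) s).
Proof.
move=> hpc; have [mh _ _] := hpc; apply: int1_le (cut_int1 hpc) _.
  by apply: measurable_funM => //; exact: measurable_indic.
by move=> s; rewrite indicE; case: (_ \in _); rewrite ?mulr1// mulr0 normr0.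
Qed.

Lemma tail_lip h M : pc h -> 0 <= M -> (forall s, s \in `[t, T] -> `|h s| <= M) ->
  forall x y, x \in `[t, T] -> y \in `[t, T] -> x <= y -> `|tail_integral h x - tail_integral h y| <= M * (y - x).
Proof.
move=> hpc M0 HM x y; rewrite !in_itv/= => /andP[tx xT] /andP[ty yT] xy.
have ii := itv_int1 x y; have ie := itv_int xy.
have E : tail_integral h x - tail_integral h y = \int[leb]_s (cut h s * \1_(`[x, y[ : set R) s).
  rewrite /tail_integral -mulN1r -RintZ; last exact: tail_int1.
  rewrite -RintD; [|exact: tail_int1|by apply: int1Z; exact: tail_int1].
  apply: eq_Rintegral => s _; rewrite mulN1r -mulrBr; congr (_ * _).
  rewrite !indicE !mem_setE !in_itv/=.
  have [xs|sx] := leP x s; last by rewrite (lt_geF (lt_le_trans sx xy))/= subrr.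
  have [ys|sy] /= := leP y s; last by rewrite (lt_le_trans sy yT) subr0.
  by case: (s < T); rewrite subrr.
have ic : int1 leb (fun s => cut h s * \1_(`[x, y[ : set R) s).
  have [mh _ _] := hpc; apply: int1_le (cut_int1 hpc) _.
    by apply: measurable_funM => //; exact: measurable_indic.
  by move=> s; rewrite indicE; case: (_ \in _); rewrite ?mulr1// mulr0 normr0.
rewrite E -[leRHS](_ : \int[leb]_s (M * \1_(`[x, y[ : set R) s) = _); last first.
  by rewrite RintZ// ie.
apply: le_trans (le_normr_Rintegral measurableT ic) _; apply: Rint_le.
- by apply/integrable_norm => //; exact: ic.
- exact: int1Z.
- move=> s; rewrite normrM [X in _ * X]ger0_norm// ler_wpM2r//.
  apply: le_trans (cut_bound HM M0 s) _; rewrite indicE; case: (_ \in _); by rewrite ?mulr1// mulr0.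
Qed.

Lemma lip_pc (u : R -> R) M : 0 <= M ->
  (forall x y, x \in `[t, T] -> y \in `[t, T] -> x <= y -> `|u x - u y| <= M * (y - x)) -> pc u.
Proof.
move=> M0 H; apply: pc_within => //; apply/subspace_continuousP => x xT.
apply/cvgrPdist_le => e e0; have d0 : 0 < e / (M + 1) by rewrite divr_gt0// ltr_wpDl.
exists (e / (M + 1)) => //= y xy yT.
have L : `|u x - u y| <= M * `|x - y|.
  have [xy'|yx] := leP x y; first by rewrite [X in M * X]distrC (@ger0_norm _ (y - x)) ?subr_ge0//; exact: H.
  by rewrite distrC (@ger0_norm _ (x - y)) ?subr_ge0 ?(ltW yx)//; apply: H => //; exact: ltW.
apply: le_trans L _; apply: le_trans (ler_wpM2l M0 (ltW xy)) _.
exact: scaled_small.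
Qed.

Lemma tail_pc h : pc h -> pc (tail_integral h).
Proof.
by move=> hpc; have [M M0 HM] := pc_bound hpc; apply: (lip_pc M0); exact: tail_lip.
Qed.

(** For [x] in [[t, T]], the integral of [h1 (s1) ... hk (sk)] over [x <= s1 <= ... <= sk < T]. The
    first variable is the outermost, in accordance with the nesting of [cube_int]. *)
Fixpoint V (hs : seq (R -> R)) (x : R) : R :=
  if hs is h :: hs' then tail_integral (fun s => h s * V hs' s) x else 1.

Fixpoint allpc (hs : seq (R -> R)) : Prop := if hs is h :: hs' then pc h /\ allpc hs' else True.

Lemma V_pc hs : allpc hs -> pc (V hs).
Proof.
elim: hs => [_|h hs IH /= [hpc /IH Vpc]]; first exact: pc_cst.
by apply: tail_pc; exact: pcM.
Qed.

Lemma V_lip hs : allpc hs -> exists2 M : R, 0 <= M & forall x y, x \in `[t, T] -> y \in `[t, T] -> x <= y ->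
  `|V hs x - V hs y| <= M * (y - x).
Proof.
case: hs => [_|h hs /= [hpc /V_pc Vpc]].
  by exists 0 => // x y _ _ _ /=; rewrite subrr normr0 mul0r.
by have [M M0 HM] := pc_bound (pcM hpc Vpc); exists M => //; exact: (tail_lip (pcM hpc Vpc) M0 HM).
Qed.

Section discretization.
Variable tau : nat -> nat -> R.
Hypothesis part : forall N, (0 < N)%N -> is_partition t T N (tau N).
Hypothesis mesh0 : (fun N => \big[Order.max/0]_(j < N) (tau N j.+1 - tau N j)) @ \oo --> 0.
Local Notation cell N q := (`[tau N q, tau N q.+1[%classic : set R).
Local Notation delta N q := (tau N q.+1 - tau N q).

(** The Riemann sum of [V]; passing on [q.+1] keeps the indices strictly increasing. *)
Fixpoint VN (N : nat) (hs : seq (R -> R)) (p : nat) : R :=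
  if hs is h :: hs' then \sum_(q < N | (p <= q)%N) h (tau N q) * delta N q * VN N hs' q.+1 else 1.

Let delta_ge0 N q : (q < N)%N -> 0 <= delta N q.
Proof. by move=> qN; rewrite subr_ge0 ltW// (node_lt part). Qed.

Let sum_delta N (Q : pred 'I_N) : (0 < N)%N -> \sum_(q < N | Q q) delta N q <= T - t.
Proof.
move=> N0; have [e1 e2 _] := part N0.
have -> : T - t = \sum_(q < N) delta N q.
  by rewrite -(big_mkord xpredT (fun q => delta N q)) telescope_sumr// e1 e2.
rewrite [leRHS](bigID Q)/= lerDl sumr_ge0// => q _; exact: delta_ge0.
Qed.

(** Uniformity in the starting node holds because the error is bounded through the mean-square error
    of the step function on the whole of [[t, T]]. *)
Lemma tail_riemann u : pc u -> forall eps : R, 0 < eps -> \forall N \near \oo, forall p, (p <= N)%N ->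
  `|\sum_(q < N | (p <= q)%N) u (tau N q) * delta N q - tail_integral u (tau N p)| <= eps.
Proof.
move=> upc eps e0; have Tt : 0 < T - t by rewrite subr_gt0.
have c0 : 0 < eps ^+ 2 / (T - t) by rewrite divr_gt0// exprn_gt0.
have /cvgrPdist_le/(_ _ c0) H := step_cvg part mesh0 upc.
near=> N => p pN; have N0 : (0 < N)%N by near: N; exact: nbhs_infty_gt.
have st : e2 leb (fun s => step tau N u s - cut u s) <= eps ^+ 2 / (T - t).
  suff : `|0 - e2 leb (fun s => step tau N u s - cut u s)| <= eps ^+ 2 / (T - t).
    by rewrite sub0r normrN ger0_norm ?e2_ge0.
  by near: N.
have [ic ec] := cells_int part (fun q : 'I_N => u (tau N q)) (fun q : 'I_N => (p <= q)%N).
rewrite -ec.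
have mu : measurable_fun setT (fun s => (step tau N u s - cut u s) * \1_(`[tau N p, T[ : set R) s).
  apply: measurable_funM; last exact: measurable_indic.
  by apply: measurable_funB; [exact: step_measurable|case: upc].
have E : \int[leb]_s \sum_(q < N | (p <= q)%N) u (tau N q) * \1_(cell N q) s - tail_integral u (tau N p) =
    \int[leb]_s ((step tau N u s - cut u s) * \1_(`[tau N p, T[ : set R) s).
  rewrite /tail_integral -mulN1r -RintZ; last exact: tail_int1.
  rewrite -RintD//; last by apply: int1Z; exact: tail_int1.
  apply: eq_Rintegral => s _; rewrite mulN1r mulrBl; congr (_ - _).
  have [sT|sT] := boolP (s \in `[t, T[); last first.
    rewrite (step0 part)// mul0r; apply: sum_cell0 => q _ qs.
    by move/negP : sT; apply; exact: (cell_sub part (ltn_ord q) qs).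
  move: (sT); rewrite in_itv/= => /andP[ts sltT].
  have [|q [_ qs]] := @cell_exists _ _ _ _ part N N s N0 (leqnn _) ts; first by have [_ -> _] := part N0.
  rewrite /step (sum_cell part (fun q => u (tau N q)) xpredT qs).
  rewrite (sum_cell part (fun q => u (tau N q)) (fun q : 'I_N => (p <= q)%N) qs).
  rewrite indicE mem_setE in_itv/= sltT andbT.
  move: qs; rewrite /= in_itv/= => /andP[qs1 qs2].
  have [pq|qp] := leqP p q.
    by rewrite (le_trans (node_mono part N0 pq (ltnW (ltn_ord q))) qs1) mulr1.
  by rewrite leNgt (lt_le_trans qs2 (node_mono part N0 qp pN)) mulr0.
rewrite E -(ler_pXn2r (n := 2))// ?nnegrE ?(ltW e0)// real_normK ?num_real//.
have Lst : L2 leb (fun s => step tau N u s - cut u s).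
  by apply: L2B; [exact: (step_L2 tT part)|exact: cut_L2].
have Lu : L2 leb (fun s => (step tau N u s - cut u s) * \1_(`[tau N p, T[ : set R) s).
  apply: int1_L2 => //; apply: int1_le (L2_int1 Lst) _; first exact: measurable_funX.
  move=> s; rewrite exprMn indicE; case: (_ \in _); rewrite ?expr1n ?mulr1// expr0n mulr0 normr0//.
apply: le_trans (integral_sqr_le tT Lu _) _.
  by move=> s sT; rewrite (step0 part)// cut0// subrr mul0r.
move: st; rewrite ler_pdivlMr// mulrC; apply: le_trans; rewrite ler_wpM2l ?(ltW Tt)//.
rewrite !e2E; apply: Rint_le; [exact: L2_int1|exact: L2_int1|move=> s].
by rewrite exprMn indicE; case: (_ \in _); rewrite ?expr1n ?mulr1// expr0n mulr0 sqr_ge0.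
Unshelve. all: by end_near. Qed.

(** The discretization at [q.+1] is compared with [V] at [tau N q], so that besides the uniform
    error the Lipschitz constant of [V] times the mesh appears. *)
Lemma VN_cvg hs : allpc hs -> forall eps : R, 0 < eps -> \forall N \near \oo, forall p, (p <= N)%N ->
  `|VN N hs p - V hs (tau N p)| <= eps.
Proof.
elim: hs => [_ eps e0|h hs IH /= [hpc apc] eps e0].
  by near=> N => p _ /=; rewrite subrr normr0 ltW.
have Vpc := V_pc apc; have [L L0 HL] := V_lip apc; have [M M0 HM] := pc_bound hpc.
have Tt : 0 <= T - t by rewrite subr_ge0 ltW.
have e3 : 0 < eps / 3 by rewrite divr_gt0.
pose a := M * (T - t); have a0 : 0 <= a by exact: mulr_ge0.
pose e1 := eps / 3 / (a + 1); have e10 : 0 < e1 by rewrite divr_gt0// ltr_wpDl.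
pose a2 := a * L; have a20 : 0 <= a2 by exact: mulr_ge0.
pose dl := eps / 3 / (a2 + 1); have dl0 : 0 < dl by rewrite divr_gt0// ltr_wpDl.
have Hr := tail_riemann (pcM hpc Vpc) e3.
near=> N => p pN.
have h1 : forall p, (p <= N)%N -> `|VN N hs p - V hs (tau N p)| <= e1 by near: N; exact: IH.
have [N0 mN] : (0 < N)%N /\ forall q, (q < N)%N -> tau N q.+1 - tau N q < dl.
  by near: N; exact: mesh_lt.
have h2 : forall p, (p <= N)%N -> `|\sum_(q < N | (p <= q)%N) h (tau N q) * V hs (tau N q) * delta N q -
    tail_integral (fun s => h s * V hs s) (tau N p)| <= eps / 3 by near: N.
have -> : \sum_(q < N | (p <= q)%N) h (tau N q) * delta N q * VN N hs q.+1 - tail_integral (fun s => h s * V hs s) (tau N p) =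
  \sum_(q < N | (p <= q)%N) h (tau N q) * delta N q * (VN N hs q.+1 - V hs (tau N q)) +
  (\sum_(q < N | (p <= q)%N) h (tau N q) * V hs (tau N q) * delta N q - tail_integral (fun s => h s * V hs s) (tau N p)).
  rewrite addrA; congr (_ - _); rewrite -big_split/=; apply: eq_bigr => q _; ring.
apply: le_trans (ler_normD _ _) _.
have h3 : `|\sum_(q < N | (p <= q)%N) h (tau N q) * delta N q * (VN N hs q.+1 - V hs (tau N q))| <= a * (e1 + L * dl).
  apply: le_trans (ler_norm_sum _ _ _) _.
  apply: (@le_trans _ _ (\sum_(q < N | (p <= q)%N) delta N q * (M * (e1 + L * dl)))).
    apply: ler_sum => q _; have qN := ltn_ord q.
    rewrite !normrM (ger0_norm (delta_ge0 qN)) [X in X * _]mulrC -mulrA ler_wpM2l ?delta_ge0//.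
    apply: ler_pM => //; first by apply: HM; apply: (node_in part N0); exact: ltnW.
    have -> : VN N hs q.+1 - V hs (tau N q) = (VN N hs q.+1 - V hs (tau N q.+1)) - (V hs (tau N q) - V hs (tau N q.+1)) by ring.
    apply: le_trans (ler_normB _ _) _; apply: lerD; first exact: h1.
    apply: le_trans (HL _ _ _ _ _) _; [exact: (node_in part N0 (ltnW qN))|exact: (node_in part N0 qN)|exact: ltW (node_lt part qN)|].
    by rewrite ler_wpM2l// ltW// mN.
  rewrite -mulr_suml [a]mulrC -mulrA ler_wpM2r//; last exact: sum_delta.
  exact: (mulr_ge0 M0 (addr_ge0 (ltW e10) (mulr_ge0 L0 (ltW dl0)))).
have f1 := scaled_small a0 e3; have f2 := scaled_small a20 e3.
rewrite -/e1 in f1; rewrite -/dl in f2.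
have h2p := h2 _ pN; have e : a * (e1 + L * dl) = a * e1 + a2 * dl by rewrite /a2; ring.
by rewrite e in h3; lra.
Unshelve. all: by end_near. Qed.

Lemma VN_cvg0 hs : allpc hs -> VN N hs 0 @[N --> \oo] --> V hs t.
Proof.
move=> apc; apply/cvgrPdist_le => e e0; have H := VN_cvg apc e0.
near=> N; have N0 : (0 < N)%N by near: N; exact: nbhs_infty_gt.
have [e1 _ _] := part N0; rewrite -e1 distrC.
have : forall p, (p <= N)%N -> `|VN N hs p - V hs (tau N p)| <= e by near: N.
by apply.
Unshelve. all: by end_near. Qed.

End discretization.
End iterated_tail_integrals.

Lemma sum_ord_mono (R : realType) (G : nat -> R) p q : (p <= q)%N -> (forall j, 0 <= G j) ->
  \sum_(j < p) G j <= \sum_(j < q) G j.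
Proof.
move=> pq G0; rewrite (big_ord_widen q G pq) [leRHS](bigID (fun j : 'I_q => (j < p)%N))/= lerDl.
exact: sumr_ge0.
Qed.

(** * Parseval's identity, one variable at a time *)

Section bessel_parseval.
Context d (X : measurableType d) (R : realType) (m : {measure set X -> \bar R}).
Variables (e : nat -> X -> R) (g : X -> R).
Hypothesis Le : forall j, L2 m (e j).
Hypothesis orth : forall j j', ip m (e j) (e j') = (j == j')%:R.
Hypothesis Lg : L2 m g.

(** Completing the square in the coefficients: the choice [c j = ip m g (e j)] gives Bessel's
    inequality, the approximating [c] the converse estimate. *)
Lemma orthonormal_dist p (c : nat -> R) : e2 m (fun x => g x - \sum_(j < p) c j * e j x) =
  e2 m g - \sum_(j < p) ip m g (e j) ^+ 2 + \sum_(j < p) (c j - ip m g (e j)) ^+ 2.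
Proof.
have Ls : L2 m (fun x => \sum_(j < p) c j * e j x) by apply: L2_sum => j _; exact: L2Z.
rewrite e2B//.
have -> : ip m g (fun x => \sum_(j < p) c j * e j x) = \sum_(j < p) c j * ip m g (e j).
  rewrite ipC ip_suml//; last by move=> j; exact: L2Z.
  by apply: eq_bigr => j _; rewrite ipZl// ipC.
have -> : e2 m (fun x => \sum_(j < p) c j * e j x) = \sum_(j < p) c j ^+ 2.
  rewrite e2_sumE; last by move=> j; exact: L2Z.
  apply: eq_bigr => i _; rewrite (bigD1 i)//= big1 ?addr0.
    by rewrite -/(e2 m _) e2Z// /e2 orth eqxx mulr1.
  move=> j ji; rewrite ipZl//; last exact: L2Z.
  by rewrite ipC ipZl// orth (inj_eq val_inj) (negbTE ji) !mulr0.
rewrite -addrA -addrA; congr (_ + _); rewrite -[RHS]addrC mulr_sumr -!sumrN -!big_split/=.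
by apply: eq_bigr => j _; ring.
Qed.

Lemma bessel p : \sum_(j < p) ip m g (e j) ^+ 2 <= e2 m g.
Proof.
have := orthonormal_dist p (fun j => ip m g (e j)).
rewrite [X in _ + X]big1 ?addr0; last by move=> j _; rewrite subrr expr0n.
by have := e2_ge0 m (fun x => g x - \sum_(j < p) ip m g (e j) * e j x); lra.
Qed.

Hypothesis complete : forall eps : R, 0 < eps -> exists p (c : nat -> R),
  e2 m (fun x => g x - \sum_(j < p) c j * e j x) <= eps.

Lemma parseval : \sum_(j < p) ip m g (e j) ^+ 2 @[p --> \oo] --> e2 m g.
Proof.
apply/cvgrPdist_le => eps e0; have [p [c Hp]] := complete e0.
near=> q; have pq : (p <= q)%N by near: q; exact: nbhs_infty_ge.
rewrite ger0_norm ?subr_ge0 ?bessel//.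
have h : \sum_(j < p) ip m g (e j) ^+ 2 <= \sum_(j < q) ip m g (e j) ^+ 2.
  by apply: (sum_ord_mono (G := fun j => ip m g (e j) ^+ 2)) => // j; exact: sqr_ge0.
have := orthonormal_dist p c.
have : 0 <= \sum_(j < p) (c j - ip m g (e j)) ^+ 2 by apply: sumr_ge0 => j _; exact: sqr_ge0.
lra.
Unshelve. all: by end_near. Qed.

End bessel_parseval.

Section box_sums.
Variable R : realType.

(** Indexed by lists, so that the recursion on the first index matches that of [V]. *)
Fixpoint box_sum (p k : nat) (G : seq nat -> R) : R :=
  if k is k'.+1 then \sum_(j < p) box_sum p k' (fun js => G (nat_of_ord j :: js)) else G [::].

Lemma eq_box_sum p k G G' : (forall js, G js = G' js) -> box_sum p k G = box_sum p k G'.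
Proof. by move=> /funext ->. Qed.

Lemma le_box_sum p k G G' : (forall js, G js <= G' js) -> box_sum p k G <= box_sum p k G'.
Proof.
elim: k G G' => [|k IH] G G' H /=; first exact: H.
by apply: ler_sum => j _; apply: IH => js; exact: H.
Qed.

Lemma box_sum_ge0 p k G : (forall js, 0 <= G js) -> 0 <= box_sum p k G.
Proof.
elim: k G => [|k IH] G H /=; first exact: H.
by apply: sumr_ge0 => j _; apply: IH => js.
Qed.

Lemma box_sumZ p k c G : box_sum p k (fun js => c * G js) = c * box_sum p k G.
Proof.
elim: k G => [|k IH] G //=; rewrite mulr_sumr; apply: eq_bigr => j _.
exact: (IH (fun js => G (nat_of_ord j :: js))).
Qed.

Lemma box_sum_mono p q k G : (p <= q)%N -> (forall js, 0 <= G js) -> box_sum p k G <= box_sum q k G.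
Proof.
move=> pq; elim: k G => [|k IH] G G0 //=.
apply: (@le_trans _ _ (\sum_(j < p) box_sum q k (fun js => G (nat_of_ord j :: js)))).
  by apply: ler_sum => j _; exact: IH.
apply: (sum_ord_mono (G := fun j => box_sum q k (fun js => G (j :: js)))) => // j.
by apply: box_sum_ge0 => js.
Qed.

Lemma box_sum_sum p k n (G : nat -> seq nat -> R) :
  box_sum p k (fun js => \sum_(i < n) G i js) = \sum_(i < n) box_sum p k (G i).
Proof.
elim: k G => [|k IH] G //=.
rewrite exchange_big/=; apply: eq_bigr => j _; exact: (IH (fun i js => G i (nat_of_ord j :: js))).
Qed.

Lemma box_sum_cvg p k (G : nat -> seq nat -> R) l : (forall js, G n js @[n --> \oo] --> l js) ->
  box_sum p k (G n) @[n --> \oo] --> box_sum p k l.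
Proof.
elim: k G l => [|k IH] G l H /=; first exact: H.
by apply: cvg_fin_sum => j; exact: (IH (fun n js => G n (nat_of_ord j :: js))).
Qed.

End box_sums.

Section iterated_parseval.
Variables (R : realType) (t T : R).
Hypothesis tT : t < T.
Local Notation mu := (@lebesgue_measure R).
Local Notation pc := (pc t T).
Local Notation cut := (cutoff t T).
Local Notation leb := (leb (R := R)).
Local Notation tail := (tail_integral t T).
Local Notation V := (V t T).
Local Notation allpc := (allpc t T).

Lemma pcD h h' : pc h -> pc h' -> pc (fun s => h s + h' s).
Proof.
move=> [mh [M HM] [D HD]] [mh' [M' HM'] [D' HD']]; split.
- have -> : cut (fun s => h s + h' s) = (fun s => cut h s + cut h' s).
    by apply/funext => s; rewrite /cutoff mulrDl.
  exact: measurable_funD.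
- by exists (M + M') => s sT; apply: le_trans (ler_normD _ _) _; apply: lerD; [exact: HM|exact: HM'].
- exists (D ++ D') => x xT; rewrite mem_cat negb_or => /andP[xD xD'].
  by apply: cvgD; [exact: HD|exact: HD'].
Qed.

Lemma pc_sum n (h : nat -> R -> R) : (forall i, pc (h i)) -> pc (fun s => \sum_(i < n) h i s).
Proof.
move=> H; elim: n => [|n IH].
  by under [X in pc X]eq_fun do rewrite big_ord0; exact: pc_cst.
by under [X in pc X]eq_fun do rewrite big_ord_recr/=; exact: pcD.
Qed.

Lemma pc_bs p k (u : seq nat -> R -> R) : (forall js, pc (u js)) -> pc (fun s => box_sum p k (fun js => u js s)).
Proof.
elim: k u => [|k IH] u H /=; first exact: H.
by apply: (@pc_sum p (fun j s => box_sum p k (fun js => u (j :: js) s))) => j; apply: IH.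
Qed.

Lemma tailD h h' x : pc h -> pc h' -> tail (fun s => h s + h' s) x = tail h x + tail h' x.
Proof.
move=> ph ph'; rewrite /tail_integral -RintD; [|exact: tail_int1|exact: tail_int1].
by apply: eq_Rintegral => s _; rewrite /cutoff !mulrDl.
Qed.

Lemma tail0 x : tail (fun=> 0) x = 0.
Proof.
by rewrite /tail_integral; under eq_Rintegral do rewrite /cutoff !mul0r; rewrite /Rintegral integral0.
Qed.

Lemma tail_sum n (h : nat -> R -> R) x : (forall i, pc (h i)) ->
  tail (fun s => \sum_(i < n) h i s) x = \sum_(i < n) tail (h i) x.
Proof.
move=> H; elim: n => [|n IH].
  by under [X in tail X]eq_fun do rewrite big_ord0; rewrite tail0 big_ord0.
under [X in tail X]eq_fun do rewrite big_ord_recr/=.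
by rewrite tailD ?IH ?big_ord_recr//; exact: pc_sum.
Qed.

Lemma tail_bs p k (u : seq nat -> R -> R) x : (forall js, pc (u js)) ->
  tail (fun s => box_sum p k (fun js => u js s)) x = box_sum p k (fun js => tail (u js) x).
Proof.
elim: k u => [|k IH] u H //=.
rewrite (@tail_sum p (fun j s => box_sum p k (fun js => u (j :: js) s))).
  by apply: eq_bigr => j _; apply: IH => js.
by move=> j; apply: pc_bs => js.
Qed.

Lemma tail_le h h' x : pc h -> pc h' -> (forall s, s \in `[t, T[ -> h s <= h' s) -> tail h x <= tail h' x.
Proof.
move=> ph ph' hh; apply: Rint_le; [exact: tail_int1|exact: tail_int1|move=> s].
rewrite /cutoff -!mulrA !indicE; have [sT|_] := boolP (s \in [set` `[t, T[]); last by rewrite !mul0r !mulr0.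
by rewrite ler_wpM2r// hh//; move: sT; rewrite inE.
Qed.

Lemma mu_cut u : measurable_fun setT (cut u) -> \int[mu]_(x in `[t, T]) u x = \int[leb]_s cut u s.
Proof.
move=> mu'; have E s : s \in `[t, T[%classic -> (u s)%:E = (cut u s)%:E.
  by move=> sT; rewrite /cutoff indicE sT mulr1.
have mE : measurable_fun setT (fun s => (cut u s)%:E) by exact/measurable_EFinP.
rewrite /Rintegral; congr fine.
rewrite -integral_itv_bndo_bndc; last first.
  by apply: eq_measurable_fun (measurable_funTS mE) => s sT; rewrite E.
transitivity (\int[mu]_(s in `[t, T[) (cut u s)%:E)%E; first by apply: eq_integral => s sT; rewrite E.
rewrite -integral_leb//; last exact: measurable_funTS.
rewrite [LHS]integral_mkcond; apply: eq_integral => s _; rewrite /patch; case: ifPn => // sT.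
by rewrite cut0//; apply: contra sT => sT; rewrite inE.
Qed.

Section orthonormal.
Variable f : nat -> R -> R.
Hypothesis fpc : forall j, pc (f j).
Hypothesis forth : orthonormal_system t T f.
Hypothesis fcomp : complete_system t T f.

Lemma cutM h h' s : cut (fun s => h s * h' s) s = cut h s * cut h' s.
Proof. by rewrite /cutoff indicE; case: (_ \in _); rewrite ?mulr1// !mulr0. Qed.

Lemma cut_orth j j' : ip leb (cut (f j)) (cut (f j')) = (j == j')%:R.
Proof.
have [_ H] := forth; rewrite -H mu_cut; last by have [] := pcM (fpc j) (fpc j').
by rewrite /ip; apply: eq_Rintegral => s _; rewrite cutM.
Qed.

(** Completeness is assumed on [[t, T]] for the functions themselves; here it is moved to their
    cutoffs, the endpoint [T] being null. *)
Lemma cut_complete g : L2 leb g -> (forall s, s \notin `[t, T[ -> g s = 0) ->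
  forall eps : R, 0 < eps -> exists p (c : nat -> R), e2 leb (fun s => g s - \sum_(j < p) c j * cut (f j) s) <= eps.
Proof.
move=> Lg g0 eps e0; have mg := L2_meas Lg.
have mE : measurable_fun setT (fun s => (g s ^+ 2)%:E) by apply/measurable_EFinP; exact: measurable_funX.
have sg : square_integrable t T g.
  split; first exact: measurable_funTS.
  rewrite -ge0_integral_leb//; [|exact: measurable_funTS|by move=> s _; rewrite lee_fin sqr_ge0].
  by apply: le_lt_trans Lg.2; apply: ge0_subset_integral => // s _; rewrite lee_fin sqr_ge0.
have [p [c Hp]] := fcomp sg e0; exists p, c.
have LB : L2 leb (fun s => g s - \sum_(j < p) c j * cut (f j) s).
  by apply: L2B => //; apply: L2_sum => j _; apply: L2Z; exact: cut_L2.
apply: e2_le_EFin => //; apply: le_trans (ltW Hp).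
have mB : measurable_fun setT (fun s => ((g s - \sum_(j < p) c j * cut (f j) s) ^+ 2)%:E).
  by apply/measurable_EFinP; apply: measurable_funX; exact: L2_meas LB.
pose G (s : R) := ((g s - \sum_(j < p) c j * f j s) ^+ 2)%:E.
have GE s : s \in `[t, T[%classic -> ((g s - \sum_(j < p) c j * cut (f j) s) ^+ 2)%:E = G s.
  move=> sT; rewrite /G; congr ((_ - _) ^+ 2)%:E; apply: eq_bigr => j _.
  by rewrite /cutoff indicE sT mulr1.
have mG : measurable_fun `[t, T[ G.
  by apply: eq_measurable_fun (measurable_funTS mB) => s sT; rewrite GE.
rewrite -integral_itv_bndo_bndc//.
rewrite -ge0_integral_leb//; last by move=> s _; rewrite lee_fin sqr_ge0.
rewrite [leRHS]integral_mkcond; apply: ge0_le_integral_unmeasured => s _; first by rewrite lee_fin sqr_ge0.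
rewrite /patch; case: ifPn => sT; first by rewrite GE.
have sT' : s \notin `[t, T[ by apply: contra sT => sT; rewrite inE.
by rewrite g0// big1 ?subrr ?expr0n// => j _; rewrite cut0// mulr0.
Qed.

Fixpoint mulf (psis : seq (R -> R)) (js : seq nat) : seq (R -> R) :=
  match psis, js with
  | psi :: psis', j :: js' => (fun s => psi s * f j s) :: mulf psis' js'
  | _, _ => [::]
  end.

Definition sqf (psis : seq (R -> R)) := [seq (fun s => psi s * psi s) | psi <- psis].

Lemma mulf_pc psis js : allpc psis -> allpc (mulf psis js).
Proof. by elim: psis js => [|psi psis IH] [|j js] //= [ppc /IH apc]; split => //; exact: pcM. Qed.

Lemma sqf_pc psis : allpc psis -> allpc (sqf psis).
Proof. by elim: psis => [|psi psis IH] //= [ppc /IH apc]; split => //; exact: pcM. Qed.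

(** Partial sums of the squared Fourier coefficients of the kernel restricted to variables above
    [x]. *)
Let Asum psis p x := box_sum p (size psis) (fun js => V (mulf psis js) x ^+ 2).

Section step.
Variables (psi : R -> R) (psis : seq (R -> R)).
Hypothesis ppc : pc psi.
Hypothesis apc : allpc psis.

(** What remains of the kernel as a function of its first variable once the others have been
    expanded; its Fourier coefficients are those of the longer list. *)
Let gj js x s := cut (fun s => psi s * V (mulf psis js) s) s * \1_(`[x, T[ : set R) s.

Let Vpc js : pc (V (mulf psis js)).
Proof. by apply: V_pc => //; exact: mulf_pc. Qed.

Let gj_L2 js x : L2 leb (gj js x).
Proof.
have Lc := cut_L2 tT (pcM ppc (Vpc js)).
have mg : measurable_fun setT (gj js x).
  by apply: measurable_funM; [exact: L2_meas Lc|exact: measurable_indic].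
apply: int1_L2 => //; apply: int1_le (L2_int1 Lc) _; first exact: measurable_funX.
by move=> s; rewrite /gj exprMn indicE; case: (_ \in _); rewrite ?expr1n ?mulr1// expr0n mulr0 normr0.
Qed.

Let gj0 js x s : s \notin `[t, T[ -> gj js x s = 0.
Proof. by move=> sT; rewrite /gj cut0// mul0r. Qed.

Let gj_ip js x j : ip leb (gj js x) (cut (f j)) = V (mulf (psi :: psis) (j :: js)) x.
Proof.
rewrite /ip /= /tail_integral; apply: eq_Rintegral => s _; rewrite /gj !cutM; ring.
Qed.

Let gj_e2 js x : e2 leb (gj js x) = tail (fun s => psi s * psi s * (V (mulf psis js) s * V (mulf psis js) s)) x.
Proof.
rewrite /e2 /ip /tail_integral; apply: eq_Rintegral => s _; rewrite /gj !cutM indicE.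
by case: (_ \in _); rewrite ?mulr1 ?mulr0 ?mul0r//; ring.
Qed.

Let ppA p : pc (fun s => psi s * psi s * Asum psis p s).
Proof.
apply: pcM; first exact: pcM.
by apply: pc_bs => js; under [X in pc X]eq_fun do rewrite expr2; exact: pcM.
Qed.

Let box_e2 p x : box_sum p (size psis) (fun js => e2 leb (gj js x)) = tail (fun s => psi s * psi s * Asum psis p s) x.
Proof.
rewrite (eq_box_sum _ _ (fun js => gj_e2 js x)) -(@tail_bs _ _ (fun js s => psi s * psi s * (V (mulf psis js) s * V (mulf psis js) s))); last first.
  by move=> js; do !apply: pcM.
congr (tail_integral _ _ _ _); apply/funext => s; rewrite /Asum -box_sumZ.
by apply: eq_box_sum => js; rewrite expr2.
Qed.

Let split_first p x : Asum (psi :: psis) p x =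
  box_sum p (size psis) (fun js => \sum_(j < p) ip leb (gj js x) (cut (f j)) ^+ 2).
Proof.
rewrite (box_sum_sum p (size psis) p (fun j js => ip leb (gj js x) (cut (f j)) ^+ 2)) /Asum/=.
by apply: eq_bigr => j _; apply: eq_box_sum => js; rewrite gj_ip.
Qed.

Let Le j : L2 leb (cut (f j)). Proof. exact: cut_L2. Qed.

(** Above: Bessel in the first variable, then the induction hypothesis under the integral. Below:
    the other indices are stopped at some [p'], taken large by dominated convergence, and the first
    index runs to infinity by Parseval; monotonicity of the box sums joins the two limits. *)
Lemma parseval_step : (forall x, x \in `[t, T] -> Asum psis p x @[p --> \oo] --> V (sqf psis) x) ->
  (forall p x, x \in `[t, T] -> Asum psis p x <= V (sqf psis) x) ->
  (forall x, x \in `[t, T] -> Asum (psi :: psis) p x @[p --> \oo] --> V (sqf (psi :: psis)) x) /\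
  (forall p x, x \in `[t, T] -> Asum (psi :: psis) p x <= V (sqf (psi :: psis)) x).
Proof.
move=> Hcvg Hle.
have Vs := V_pc tT (sqf_pc apc).
have up p x : x \in `[t, T] -> Asum (psi :: psis) p x <= V (sqf (psi :: psis)) x.
  move=> xT; rewrite split_first; apply: (@le_trans _ _ (box_sum p (size psis) (fun js => e2 leb (gj js x)))).
    by apply: le_box_sum => js; exact: bessel cut_orth _ _.
  rewrite box_e2 /=; apply: tail_le => //; first by apply: pcM => //; exact: pcM.
  move=> s sT; rewrite ler_wpM2l ?Hle// -?expr2 ?sqr_ge0//.
  by move: sT; rewrite !in_itv/= => /andP[-> /ltW].
split=> // x xT; apply/cvgrPdist_le => eps e0.
have e2p : 0 < eps / 2 by rewrite divr_gt0.
have lim1 : tail (fun s => psi s * psi s * Asum psis p s) x @[p --> \oo] --> V (sqf (psi :: psis)) x.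
  have mp p := (tail_int1 tT x (ppA p)).
  have pV : pc (fun s => psi s * psi s * V (sqf psis) s) by apply: pcM => //; exact: pcM.
  have [|||||_] := @int1_cvg _ _ _ leb (fun p s => cut (fun s => psi s * psi s * Asum psis p s) s * \1_(`[x, T[ : set R) s)
    (fun s => cut (fun s => psi s * psi s * V (sqf psis) s) s * \1_(`[x, T[ : set R) s)
    (fun s => cut (fun s => psi s * psi s * V (sqf psis) s) s).
  - by move=> p; exact: int1_meas (mp p).
  - exact: int1_meas (tail_int1 tT x pV).
  - apply: aeW => s; apply: cvgM; last exact: cvg_cst.
    have [sT|sT] := boolP (s \in `[t, T[); last first.
      by rewrite cut0//; under eq_fun => p do rewrite cut0//; exact: cvg_cst.
    rewrite /cutoff; apply: cvgM; last exact: cvg_cst.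
    apply: cvgM; first exact: cvg_cst.
    by apply: Hcvg; move: sT; rewrite !in_itv/= => /andP[-> /ltW].
  - exact: cut_int1.
  - apply: aeW => s p; have [sT|sT] := boolP (s \in `[t, T[); last by rewrite !cut0// mul0r normr0.
    have sT' : s \in `[t, T] by move: sT; rewrite !in_itv/= => /andP[-> /ltW].
    have A0 : 0 <= Asum psis p s.
      by apply: box_sum_ge0 => js; exact: sqr_ge0.
    have P0 : 0 <= psi s * psi s by rewrite -expr2 sqr_ge0.
    rewrite normrM [X in _ * X]ger0_norm//; apply: (@le_trans _ _ (`|cut (fun s => psi s * psi s * Asum psis p s) s|)).
      by rewrite indicE; case: (_ \in _); rewrite ?mulr1// mulr0.
    have PA := mulr_ge0 P0 A0; rewrite /cutoff indicE mem_set// !mulr1 ger0_norm//.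
    by rewrite ler_wpM2l// Hle.
  by [].
have /cvgrPdist_le/(_ _ e2p)[p' _ /(_ p' (leqnn p'))/=] := lim1.
rewrite ler_norml => /andP[_ h1].
have lim2 : box_sum p' (size psis) (fun js => \sum_(j < p) ip leb (gj js x) (cut (f j)) ^+ 2) @[p --> \oo] -->
    tail (fun s => psi s * psi s * Asum psis p' s) x.
  rewrite -box_e2; apply: box_sum_cvg => js; apply: (parseval Le cut_orth (gj_L2 js x)).
  exact: (cut_complete (gj_L2 js x) (@gj0 js x)).
have /cvgrPdist_le/(_ _ e2p) H2 := lim2.
near=> p; have pp : (p' <= p)%N by near: p; exact: nbhs_infty_ge.
have h2 : `|tail (fun s => psi s * psi s * Asum psis p' s) x - box_sum p' (size psis) (fun js => \sum_(j < p) ip leb (gj js x) (cut (f j)) ^+ 2)| <= eps / 2.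
  by near: p.
move: h2; rewrite ler_norml => /andP[_ h2].
have h3 : box_sum p' (size psis) (fun js => \sum_(j < p) ip leb (gj js x) (cut (f j)) ^+ 2) <= Asum (psi :: psis) p x.
  rewrite split_first; apply: box_sum_mono => // js; apply: sumr_ge0 => j _; exact: sqr_ge0.
rewrite ger0_norm ?subr_ge0 ?up//; lra.
Unshelve. all: by end_near. Qed.

End step.

Lemma iterated_parseval psis : allpc psis ->
  (forall x, x \in `[t, T] -> box_sum p (size psis) (fun js => V (mulf psis js) x ^+ 2) @[p --> \oo] --> V (sqf psis) x) /\
  (forall p x, x \in `[t, T] -> box_sum p (size psis) (fun js => V (mulf psis js) x ^+ 2) <= V (sqf psis) x).
Proof.
elim: psis => [_|psi psis IH [ppc apc]]; last by have [] := IH apc; exact: parseval_step.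
by split=> [x _|p x _] /=; rewrite expr1n; [exact: cvg_cst|].
Qed.

End orthonormal.

Definition hlist k (H : 'I_k -> R -> R) := [seq H l | l <- enum 'I_k].

Lemma hlistS k (H : 'I_k.+1 -> R -> R) : hlist H = H ord0 :: hlist (fun l => H (lift ord0 l)).
Proof. by rewrite /hlist enum_ordSl/= -map_comp. Qed.

Lemma hlist_pc k (H : 'I_k -> R -> R) : (forall l, pc (H l)) -> allpc (hlist H).
Proof.
elim: k H => [|k IH] H Hpc; first by rewrite /hlist (size0nil (_ : size (enum 'I_0) = 0%N)) ?size_enum_ord.
by rewrite hlistS/=; split => //; apply: IH => l.
Qed.

(** The starting point [x] and the factor [c] generalize the statement for the induction: once the
    first variable [y] is fixed, the rest must increase from [y], and the integrand has picked up a
    constant. *)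
Lemma cube_path k (H : 'I_k -> R -> R) c x : (forall l, pc (H l)) ->
  cube_int t T (fun s : k.-tuple R => c * ((if path <%R x s then 1 else 0) * \prod_(l < k) H l (tnth s l))) =
  c * V (hlist H) x.
Proof.
elim: k H c x => [|k IH] H c x Hpc.
  by rewrite /= big_ord0 !mulr1 /hlist (size0nil (_ : size (enum 'I_0) = 0%N)) ?size_enum_ord//= mulr1.
rewrite hlistS /=; pose u s := H ord0 s * V (hlist (fun l => H (lift ord0 l))) s.
have upc : pc u.
  by apply: pcM => //; apply: V_pc => //; apply: hlist_pc => l.
have E y : cube_int t T (fun s : k.-tuple R => c * ((if path <%R x [tuple of y :: s] then 1 else 0) *
    \prod_(l < k.+1) H l (tnth [tuple of y :: s] l))) = c * ((if x < y then 1 else 0) * u y).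
  rewrite /u [in RHS]mulrA [in RHS]mulrA -(IH (fun l => H (lift ord0 l)))//; congr cube_int.
  apply/funext => s; rewrite /= big_ord_recl tnth0.
  have tS (l : 'I_k) : tnth [tuple of y :: s] (lift ord0 l) = tnth s l by rewrite !(tnth_nth 0).
  rewrite (eq_bigr _ (fun l _ => congr1 (H (lift ord0 l)) (tS l))).
  by case: (x < y) => /=; rewrite ?mulr1 ?mul1r ?mul0r ?mulr0 ?mul0r//; ring.
rewrite (funext E).
have [mu' _ _] := upc.
have mI : measurable_fun setT (\1_(`]x, +oo[ : set R) : R -> R) by apply: measurable_indic; exact: measurable_itv.
have Ec s : cut (fun y => c * ((if x < y then 1 else 0) * u y)) s = c * (cut u s * \1_(`]x, +oo[ : set R) s).
  rewrite /cutoff [\1_`]x, +oo[ s]indicE mem_setE in_itv/= andbT.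
  by case: (x < s); rewrite ?mulr1 ?mul1r ?mul0r ?mulr0 ?mul0r ?mulrA ?mulr1//.
rewrite mu_cut; last by rewrite (funext Ec); apply: measurable_funM => //; exact: measurable_funM.
rewrite (funext Ec) RintZ; last first.
  apply: int1_le (cut_int1 tT upc) _; first exact: measurable_funM.
  by move=> s; rewrite indicE; case: (_ \in _); rewrite ?mulr1// mulr0 normr0.
(* The kernel asks for a variable above [x], the tail integral also admits [x] itself; they differ
   at one point. *)
congr (_ * _); rewrite /tail_integral -/u; apply: (@Rint_except1 _ x).
- exact: measurable_funM.
- by apply: measurable_funM => //; exact: measurable_indic.
- move=> s sx; have e : (x < s) = (x <= s) by rewrite lt_neqAle eq_sym sx.
  rewrite /cutoff !indicE !mem_setE !in_itv/= andbT e.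
  by case: (s < T); rewrite ?andbT// !andbF !mulr0 !mul0r.
Qed.

(** The first variable has no predecessor to exceed, so it is integrated separately before
    [cube_path] takes over. *)
Lemma fourier_coef_V k (psi : 'I_k -> R -> R) (f : nat -> R -> R) (j : 'I_k -> nat) :
  (forall l, pc (psi l)) -> (forall j, pc (f j)) ->
  fourier_coef t T psi f j = V (hlist (fun l s => psi l s * f (j l) s)) t.
Proof.
move=> ppc fpc; rewrite /fourier_coef /volterra_kernel.
pose H (l : 'I_k) s := psi l s * f (j l) s.
have Hpc l : pc (H l) by exact: pcM.
have E (s : k.-tuple R) : (if sorted <%R s then \prod_(l < k) psi l (tnth s l) else 0) * \prod_(l < k) f (j l) (tnth s l) =
    (if sorted <%R s then 1 else 0) * \prod_(l < k) H l (tnth s l).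
  by rewrite /H big_split/=; case: ifP => _; rewrite ?mul1r ?mul0r.
rewrite (funext E) -/H.
case: k psi j ppc H Hpc E => [|k] psi j ppc H Hpc _.
  by rewrite /= big_ord0 mul1r /hlist (size0nil (_ : size (enum 'I_0) = 0%N)) ?size_enum_ord.
rewrite hlistS/=; pose u s := H ord0 s * V (hlist (fun l => H (lift ord0 l))) s.
have upc : pc u.
  by apply: pcM => //; apply: V_pc => //; apply: hlist_pc => l.
have {}E y : cube_int t T (fun s : k.-tuple R => (if sorted <%R [tuple of y :: s] then 1 else 0) *
    \prod_(l < k.+1) H l (tnth [tuple of y :: s] l)) = u y.
  rewrite /u -(cube_path (H ord0 y) y)//; congr cube_int.
  apply/funext => s; rewrite /= big_ord_recl tnth0.
  have tS (l : 'I_k) : tnth [tuple of y :: s] (lift ord0 l) = tnth s l by rewrite !(tnth_nth 0).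
  rewrite (eq_bigr _ (fun l _ => congr1 (H (lift ord0 l)) (tS l))).
  by ring.
rewrite (funext E); have [mu' _ _] := upc.
rewrite mu_cut// /tail_integral -/u; apply: eq_Rintegral => s _.
by rewrite [in RHS]/cutoff -mulrA; congr (_ * _); rewrite indicE; case: (_ \in _); rewrite ?mulr1 ?mulr0.
Qed.

End iterated_parseval.

(** * Fourier expansion of the iterated stochastic integral *)

Section increasing_indices.
Variable N : nat.

Definition incr k (l : {ffun 'I_k -> 'I_N}) := [forall a : 'I_k, forall b : 'I_k, (a < b)%N ==> (l a < l b)%N].
(** Increasing tuples are peeled in two ways: [from] removes the smallest index, as the tail
    integrals [V] do, and [upto] the largest, as the iterated stochastic integral does. *)
Definition from k (p : nat) (l : {ffun 'I_k -> 'I_N}) := incr l && [forall a : 'I_k, (p <= l a)%N].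
Definition upto k (r : nat) (l : {ffun 'I_k -> 'I_N}) := incr l && [forall a : 'I_k, (l a < r)%N].

Lemma incrP k (l : {ffun 'I_k -> 'I_N}) : reflect (forall a b : 'I_k, (a < b)%N -> (l a < l b)%N) (incr l).
Proof.
apply: (iffP forallP) => [H a b ab|H a]; first by have /forallP/(_ b)/implyP := H a; exact.
by apply/forallP => b; apply/implyP; exact: H.
Qed.

Lemma incr_inj k (l : {ffun 'I_k -> 'I_N}) : incr l -> injectiveb l.
Proof.
move=> /incrP H; apply/injectiveP => a b e; apply: val_inj => /=.
by case: (ltngtP a b) => // /H; rewrite e ltnn.
Qed.

Lemma from_fins k p (q : 'I_N) (u : {ffun 'I_k -> 'I_N}) :
  from p (fins ord0 q u) = (p <= q)%N && from q.+1 u.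
Proof.
apply/idP/idP.
  move=> /andP[/incrP H /forallP Hp]; have := Hp ord0; rewrite fins_at => ->/=; apply/andP; split.
    by apply/incrP => a b ab; have := H (lift ord0 a) (lift ord0 b); rewrite !fins_lift; apply.
  by apply/forallP => a; have := H ord0 (lift ord0 a); rewrite fins_at fins_lift; apply.
move=> /andP[pq /andP[/incrP H /forallP Hq]]; apply/andP; split.
  apply/incrP => a b; case: (unliftP ord0 a) => [a' ->|->]; case: (unliftP ord0 b) => [b' ->|->] //.
  - by rewrite !fins_lift => ab; apply: H.
  - by move=> _; rewrite fins_at fins_lift Hq.
apply/forallP => a; case: (unliftP ord0 a) => [a' ->|->]; last by rewrite fins_at.
by rewrite fins_lift; apply: leq_trans pq _; exact: ltnW.
Qed.

Lemma upto_fins k r (q : 'I_N) (u : {ffun 'I_k -> 'I_N}) :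
  upto r (fins ord_max q u) = (q < r)%N && upto q u.
Proof.
apply/idP/idP.
  move=> /andP[/incrP H /forallP Hp]; have := Hp ord_max; rewrite fins_at => ->/=; apply/andP; split.
    apply/incrP => a b ab; have := H (lift ord_max a) (lift ord_max b); rewrite !fins_lift.
    by apply; rewrite !lift_max.
  apply/forallP => a; have := H (lift ord_max a) ord_max; rewrite fins_at fins_lift; apply.
  by rewrite lift_max.
move=> /andP[qr /andP[/incrP H /forallP Hq]]; apply/andP; split.
  apply/incrP => a b; case: (unliftP ord_max a) => [a' ->|->]; case: (unliftP ord_max b) => [b' ->|->] //.
  - by rewrite !fins_lift !lift_max => ab; apply: H.
  - by move=> _; rewrite fins_at fins_lift Hq.
  - by rewrite lift_max /= => h; have := ltn_ord b'; rewrite ltnNge (ltnW h).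
  - by rewrite ltnn.
apply/forallP => a; case: (unliftP ord_max a) => [a' ->|->]; last by rewrite fins_at.
by rewrite fins_lift; apply: ltn_trans (Hq _) qr.
Qed.

Lemma sum_from (V : nmodType) k p (F : {ffun 'I_k.+1 -> 'I_N} -> V) :
  \sum_(l | from p l) F l = \sum_(q : 'I_N | (p <= q)%N) \sum_(u | from q.+1 u) F (fins ord0 q u).
Proof.
rewrite (sum_fins ord0) [RHS]big_mkcond/=; apply: eq_bigr => q _; case: ifP => pq.
  by apply: eq_bigl => u; rewrite from_fins pq.
by rewrite big_pred0// => u; rewrite from_fins pq.
Qed.

Lemma sum_upto (V : nmodType) k r (F : {ffun 'I_k.+1 -> 'I_N} -> V) :
  \sum_(l | upto r l) F l = \sum_(q : 'I_N | (q < r)%N) \sum_(u | upto q u) F (fins ord_max q u).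
Proof.
rewrite (sum_fins ord_max) [RHS]big_mkcond/=; apply: eq_bigr => q _; case: ifP => qr.
  by apply: eq_bigl => u; rewrite upto_fins qr.
by rewrite big_pred0// => u; rewrite upto_fins qr.
Qed.

End increasing_indices.

(** * Sums over the grid and approximation by boxes *)

Section grid_sums.
Variables (R : realType) (t T : R) (tau : nat -> nat -> R).
Hypothesis tT : t < T.
Hypothesis part : forall N, (0 < N)%N -> is_partition t T N (tau N).
Hypothesis mesh0 : (fun N => \big[Order.max/0]_(j < N) (tau N j.+1 - tau N j)) @ \oo --> 0.
Local Notation pc := (pc t T).
Local Notation cut := (cutoff t T).
Local Notation leb := (leb (R := R)).
Local Notation cell N q := (`[tau N q, tau N q.+1[%classic : set R).
Local Notation delta N q := (tau N q.+1 - tau N q).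

Lemma delta_ge0 N q : (q < N)%N -> 0 <= delta N q.
Proof. by move=> qN; rewrite subr_ge0 ltW// (node_lt part). Qed.

Lemma sum_delta N : (0 < N)%N -> \sum_(q < N) delta N q = T - t.
Proof.
move=> N0; have [e1 e2 _] := part N0.
by rewrite -(big_mkord xpredT (fun q => delta N q)) telescope_sumr// e1 e2.
Qed.

Lemma grid_incr k (H : 'I_k -> R -> R) N p :
  \sum_(l : {ffun 'I_k -> 'I_N} | from p l) \prod_(g < k) (H g (tau N (l g)) * delta N (l g)) =
  VN tau N (hlist H) p.
Proof.
elim: k H p => [|k IH] H p.
  rewrite /hlist (size0nil (_ : size (enum 'I_0) = 0%N)) ?size_enum_ord//=.
  under eq_bigr do rewrite big_ord0.
  set l0 : {ffun 'I_0 -> 'I_N} := [ffun x : 'I_0 => False_rect _ (notF (ltn_ord x))].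
  rewrite (big_pred1 l0)// => l /=; have -> : l = l0 by apply/ffunP => -[].
  by rewrite eqxx; apply/andP; split; [apply/incrP => -[]|apply/forallP => -[]].
rewrite sum_from hlistS/=; apply: eq_bigr => q _; rewrite -(IH (fun g => H (lift ord0 g))) mulr_sumr.
by apply: eq_bigr => u _; rewrite (prod_fins ord0 q u (fun g q => H g (tau N q) * delta N q)).
Qed.

Lemma grid_incr_cvg k (H : 'I_k -> R -> R) : (forall g, pc (H g)) ->
  \sum_(l : {ffun 'I_k -> 'I_N} | incr l) \prod_(g < k) (H g (tau N (l g)) * delta N (l g)) @[N --> \oo] -->
  V t T (hlist H) t.
Proof.
move=> Hpc.
have E N : \sum_(l : {ffun 'I_k -> 'I_N} | incr l) \prod_(g < k) (H g (tau N (l g)) * delta N (l g)) = VN tau N (hlist H) 0.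
  by rewrite -grid_incr; apply: eq_bigl => l; rewrite /from; case: (incr l) => //=; apply/esym/forallP.
by rewrite (funext E); apply: (VN_cvg0 tT part mesh0); exact: hlist_pc.
Qed.

Lemma grid_prod k (H : 'I_k -> R -> R) N :
  \sum_(l : {ffun 'I_k -> 'I_N}) \prod_(g < k) (H g (tau N (l g)) * delta N (l g)) =
  \prod_(g < k) \sum_(q < N) H g (tau N q) * delta N q.
Proof. by rewrite bigA_distr_bigA. Qed.

Lemma cvg_fin_prod (I : finType) (u : I -> nat -> R) (l : I -> R) :
  (forall i, u i @ \oo --> l i) -> \prod_i u i N @[N --> \oo] --> \prod_i l i.
Proof.
move=> ul; elim: (index_enum I) => [|i s IH].
  by rewrite big_nil; under eq_fun do rewrite big_nil; exact: cvg_cst.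
rewrite big_cons (_ : (fun N => _) = (fun N => u i N * \prod_(j <- s) u j N)); last first.
  by apply/funext => N; rewrite big_cons.
exact: cvgM.
Qed.

Lemma grid_prod_cvg k (H : 'I_k -> R -> R) : (forall g, pc (H g)) ->
  \sum_(l : {ffun 'I_k -> 'I_N}) \prod_(g < k) (H g (tau N (l g)) * delta N (l g)) @[N --> \oo] -->
  \prod_(g < k) \int[leb]_s cut (H g) s.
Proof.
move=> Hpc; under eq_fun do rewrite grid_prod.
by apply: cvg_fin_prod => g; exact: (riemann tT part mesh0 (Hpc g)).
Qed.

Lemma step_pc M h : pc (step tau M h).
Proof.
apply: (@pc_sum R t T M (fun q s => h (tau M q) * \1_(cell M q) s)) => q.
by apply: pcM; [exact: pc_cst|exact: pc_indic].
Qed.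

Section box_approximation.
Variables (k : nat) (h : 'I_k -> R -> R).
Hypothesis hpc : forall g, pc (h g).

(* The product of the h g, frozen at the nodes of the M-th partition, on the
   boxes with pairwise distinct sides. *)
Definition box M N (l : {ffun 'I_k -> 'I_N}) : R :=
  \sum_(r : {ffun 'I_k -> 'I_M} | injectiveb r)
    \prod_(g < k) (h g (tau M (r g)) * \1_(cell M (r g)) (tau N (l g))).

Let bound : exists2 B : R, 1 <= B & forall g s, s \in `[t, T] -> `|h g s| <= B.
Proof.
have [g|b Hb] := @choice 'I_k R (fun g B => 0 <= B /\ forall s, s \in `[t, T] -> `|h g s| <= B).
  by have [B B0 HB] := pc_bound (hpc g); exists B.
exists (1 + \sum_g b g); first by rewrite lerDl; apply: sumr_ge0 => g _; case: (Hb g).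
move=> g s sT; have [b0 /(_ s sT) h1] := Hb g; apply: le_trans h1 _.
rewrite (bigD1 g)//= addrCA lerDl addr_ge0//; apply: sumr_ge0 => g' _; by case: (Hb g').
Qed.

(** A tuple that is not injective has two coordinates in one cell, so the total mass of such tuples
    is at most the mesh times the number of ordered pairs of positions times [(T - t)^(k - 1)]. *)
Let diag_small : forall eps : R, 0 < eps -> \forall M \near \oo,
  \sum_(r : {ffun 'I_k -> 'I_M} | ~~ injectiveb r) \prod_(g < k) delta M (r g) <= eps.
Proof.
move=> eps e0; have Tt : 0 <= T - t by rewrite subr_ge0 ltW.
case: k => [|k'].
  near=> M; rewrite big_pred0 ?ltW// => r; apply/negbTE; rewrite negbK; apply/injectiveP => -[]//.
pose c : R := (k'.+1)%:R * (k'%:R * (T - t) ^+ k'); have c0 : 0 <= c by rewrite !mulr_ge0 ?exprn_ge0.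
have d0 : 0 < eps / (c + 1) by rewrite divr_gt0// ltr_wpDl.
near=> M; have [M0 mM] : (0 < M)%N /\ forall q, (q < M)%N -> tau M q.+1 - tau M q < eps / (c + 1).
  by near: M; exact: mesh_lt.
have dl0 (q : 'I_M) : 0 <= delta M q by exact: delta_ge0.
have pd0 n (r : {ffun 'I_n -> 'I_M}) : 0 <= \prod_(g < n) delta M (r g) by apply: prodr_ge0.
apply: (@le_trans _ _ (\sum_(g < k'.+1) \sum_(j < k') \sum_(r : {ffun 'I_k'.+1 -> 'I_M} | r g == r (lift g j)) \prod_(g < k'.+1) delta M (r g))).
  rewrite pair_big/= (exchange_big_dep xpredT)//= big_mkcond/=.
  apply: ler_sum => r _; case: ifPn => [nr|_]; last by apply: sumr_ge0 => ? _; exact: pd0.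
  have [g [j e]] : exists g j, r g = r (lift g j).
    have /injectivePn[x [y xy e]] := nr; exists x.
    by move: e; case: (unliftP x y) xy => [j' -> _ e|-> ]; [exists j'|rewrite eqxx].
  rewrite (bigD1 (g, j))/= ?e ?eqxx// lerDl; apply: sumr_ge0 => ? _; exact: pd0.
apply: (@le_trans _ _ (\sum_(g < k'.+1) \sum_(j < k') (eps / (c + 1)) * (T - t) ^+ k')).
  apply: ler_sum => g _; apply: ler_sum => j _; rewrite (sum_fins g) (exchange_big_dep xpredT)//=.
  apply: (@le_trans _ _ (\sum_(u : {ffun 'I_k' -> 'I_M}) (eps / (c + 1)) * \prod_(j < k') delta M (u j))).
    apply: ler_sum => u _; rewrite (big_pred1 (u j)); last first.
      by move=> q /=; rewrite fins_at fins_lift.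
    rewrite (prod_fins g (u j) u (fun _ q => delta M q)) ler_wpM2r// ltW// mM//.
  rewrite -mulr_sumr ler_wpM2l ?(ltW d0)// -(bigA_distr_bigA (fun _ q => delta M (nat_of_ord q))).

  by rewrite (eq_bigr (fun _ => T - t)) ?prodr_const ?card_ord//= => ? _; exact: sum_delta.
rewrite !sumr_const !card_ord -[X in X *+ _]mulr_natl -[X in X <= _]mulr_natl.
have -> : (k'.+1)%:R * (k'%:R * (eps / (c + 1) * (T - t) ^+ k')) = c * (eps / (c + 1)) by rewrite /c; ring.
exact: scaled_small.
Unshelve. all: by end_near. Qed.

(** A grid point determines its box [r]; any other [r'] has a factor that vanishes there. *)
Let prod_cell M N (l : {ffun 'I_k -> 'I_N}) (r : {ffun 'I_k -> 'I_M}) (F : 'I_k -> 'I_M -> R) :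
  (forall g, cell M (r g) (tau N (l g))) ->
  forall r' : {ffun 'I_k -> 'I_M}, \prod_(g < k) (F g (r' g) * \1_(cell M (r' g)) (tau N (l g))) =
    if r' == r then \prod_(g < k) F g (r g) else 0.
Proof.
move=> Hr r'; case: eqP => [->|/eqP ne].
  by apply: eq_bigr => g _; rewrite indicE mem_set ?mulr1.
have [g Hg] : exists g, r' g != r g.
  apply/existsP; rewrite -negb_forall; apply: contra ne => /forallP H; apply/eqP/ffunP => g; exact/eqP.
rewrite (bigD1 g)//= indicE memNset ?mulr0 ?mul0r// => Hg'.
move/eqP : Hg; apply; apply: ord_inj; exact: (cell_disj part _ _ Hg' (Hr g)).
Qed.

Let cell_of M (s : R) : (0 < M)%N -> s \in `[t, T[ -> exists q : 'I_M, cell M q s.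
Proof.
move=> M0; rewrite in_itv/= => /andP[ts sT].
have [|q [_ qs]] := @cell_exists R t T tau part M M s M0 (leqnn _) ts; first by have [_ -> _] := part M0.
by exists q.
Qed.

Let node_inco N q : (q < N)%N -> tau N q \in `[t, T[.
Proof.
move=> qN; have N0 : (0 < N)%N by exact: leq_trans qN.
by rewrite in_itv/= (node_ge part N0 (ltnW qN)) (lt_le_trans (node_lt part qN) (node_le part N0 qN)).
Qed.

(** The error at a grid point is controlled by the errors of freezing each [h g] at the nodes of
    partition [M] and, in a box with a repeated side, by the size of the product. Both give sums
    that converge as [N] grows, to limits that are small by the choice of [M]. *)
Lemma box_close : forall eps : R, 0 < eps -> exists2 M, (0 < M)%N & \forall N \near \oo,
  \sum_(l : {ffun 'I_k -> 'I_N}) (\prod_(g < k) h g (tau N (l g)) - box M l) ^+ 2 * \prod_(g < k) delta N (l g) <= eps.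
Proof.
move=> eps e0; have Tt : 0 <= T - t by rewrite subr_ge0 ltW.
have [B B1 HB] := bound; have B0 : 0 <= B by exact: le_trans B1.
(* The constants of the pointwise bound [pt], with the power [k.-1] of [T - t] left by the
   coordinates that do not carry the squared difference. *)
pose a1 := 2 * (2 * B ^+ 2) ^+ k * (T - t) ^+ k.-1; pose a2 := 2 * (B ^+ 2) ^+ k.
have a10 : 0 <= a1 by rewrite !mulr_ge0 ?exprn_ge0 ?mulr_ge0 ?sqr_ge0.
have a20 : 0 <= a2 by rewrite mulr_ge0 ?exprn_ge0 ?sqr_ge0.
have e4 : 0 < eps / 4 by rewrite divr_gt0.
pose d1 := eps / 4 / (a1 + 1); have d10 : 0 < d1 by rewrite divr_gt0// ltr_wpDl.
pose d2 := eps / 4 / (a2 + 1); have d20 : 0 < d2 by rewrite divr_gt0// ltr_wpDl.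
have c1 : \sum_g e2 leb (fun s => step tau M (h g) s - cut (h g) s) @[M --> \oo] --> 0.
  by have := cvg_fin_sum (fun g => step_cvg part mesh0 (hpc g)); rewrite big1.
have /cvgrPdist_le/(_ _ d10) H1 := c1.
have H2 := diag_small d20.
have [M [M0 [HM1 HM2]]] : exists M, (0 < M)%N /\ (\sum_g e2 leb (fun s => step tau M (h g) s - cut (h g) s) <= d1 /\
    \sum_(r : {ffun 'I_k -> 'I_M} | ~~ injectiveb r) \prod_(g < k) delta M (r g) <= d2).
  have H0 : \forall M \near \oo, (0 < M)%N by exact: nbhs_infty_gt.
  have [M _ HM] := filterI H0 (filterI H1 H2); have [h0 [h1 h2]] := HM M (leqnn _).
  exists M; split => //; split => //; move: h1; rewrite sub0r normrN => /(le_trans (ler_norm _)); exact.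
exists M => //.
pose u g s := h g s - step tau M (h g) s.
have upc g : pc (fun s => u g s * u g s).
  have pcu : pc (u g).
    apply: pcD; first exact: hpc.
    have -> : (fun s => - step tau M (h g) s) = (fun s => -1 * step tau M (h g) s).
      by apply/funext => s; rewrite mulN1r.
    by apply: pcM; [exact: pc_cst|exact: step_pc].
  exact: pcM.
have L1 : \sum_(g < k) \sum_(q < N) u g (tau N q) * u g (tau N q) * delta N q @[N --> \oo] -->
    \sum_(g < k) e2 leb (fun s => step tau M (h g) s - cut (h g) s).
  apply: cvg_fin_sum => g.
  have -> : e2 leb (fun s => step tau M (h g) s - cut (h g) s) = \int[leb]_s cut (fun s => u g s * u g s) s.
    apply: eq_Rintegral => s _; rewrite /cutoff indicE.
    have [sT|sT] := boolP (s \in _); first by rewrite /u !mulr1; ring.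
    rewrite !mulr0 (step0 part) ?subrr ?mulr0//; by apply: contra sT => sT; rewrite inE.
  exact: (riemann tT part mesh0 (upc g)).
have L2 : \sum_(r : {ffun 'I_k -> 'I_M} | ~~ injectiveb r) \prod_(g < k) \sum_(q < N) \1_(cell M (r g)) (tau N q) * delta N q @[N --> \oo] -->
    \sum_(r : {ffun 'I_k -> 'I_M} | ~~ injectiveb r) \prod_(g < k) delta M (r g).
  rewrite [X in _ --> X]big_mkcond/=; under eq_fun do rewrite big_mkcond/=.
  apply: cvg_fin_sum => r; case: ifP => _; last exact: cvg_cst.
  apply: cvg_fin_prod => g.
  have -> : delta M (r g) = \int[leb]_s cut (\1_(cell M (r g))) s.
    have [_ ec] := cells_int part (fun _ : 'I_M => 1) (pred1 (r g)).
    rewrite big_pred1_eq mul1r in ec; rewrite -ec; apply: eq_Rintegral => s _.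
    rewrite big_pred1_eq mul1r /cutoff [in LHS]indicE [\1_(cell M (r g)) s]indicE [\1__ s]indicE.
    have [sc|_] := boolP (s \in `[tau M (r g), tau M (r g).+1[%classic); last by rewrite mul0r.
    by rewrite mem_set ?mulr1//; apply: (cell_sub part (ltn_ord (r g))); rewrite inE in sc.
  exact: (riemann tT part mesh0 (pc_indic t T (tau M (r g)) (tau M (r g).+1))).
have /cvgrPdist_le/(_ _ d10) N1 := L1; have /cvgrPdist_le/(_ _ d20) N2 := L2.
near=> N; have N0 : (0 < N)%N by near: N; exact: nbhs_infty_gt.
have n1 : \sum_(g < k) \sum_(q < N) u g (tau N q) * u g (tau N q) * delta N q <= d1 + d1.
  have : `|\sum_(g < k) e2 leb (fun s => step tau M (h g) s - cut (h g) s) -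
     \sum_(g < k) \sum_(q < N) u g (tau N q) * u g (tau N q) * delta N q| <= d1 by near: N.
  rewrite distrC => /(le_trans (ler_norm _)); lra.
have n2 : \sum_(r : {ffun 'I_k -> 'I_M} | ~~ injectiveb r) \prod_(g < k) \sum_(q < N) \1_(cell M (r g)) (tau N q) * delta N q <= d2 + d2.
  have : `|\sum_(r : {ffun 'I_k -> 'I_M} | ~~ injectiveb r) \prod_(g < k) delta M (r g) -
    \sum_(r : {ffun 'I_k -> 'I_M} | ~~ injectiveb r) \prod_(g < k) \sum_(q < N) \1_(cell M (r g)) (tau N q) * delta N q| <= d2 by near: N.
  rewrite distrC => /(le_trans (ler_norm _)); lra.
have pd0 (l : {ffun 'I_k -> 'I_N}) : 0 <= \prod_(g < k) delta N (l g).
  by apply: prodr_ge0 => g _; exact: delta_ge0.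
have pt (l : {ffun 'I_k -> 'I_N}) : (\prod_(g < k) h g (tau N (l g)) - box M l) ^+ 2 <=
   2 * (2 * B ^+ 2) ^+ k * (\sum_(g < k) u g (tau N (l g)) * u g (tau N (l g))) +
   a2 * \sum_(r : {ffun 'I_k -> 'I_M} | ~~ injectiveb r) \prod_(g < k) \1_(cell M (r g)) (tau N (l g)).
  have [r0 Hr0] : exists r0 : 'I_k -> 'I_M, forall g, cell M (r0 g) (tau N (l g)).
    have [g|r0 Hr0] := @choice 'I_k 'I_M (fun g q => cell M q (tau N (l g))).
      by apply: cell_of => //; exact: node_inco.
    by exists r0.
  pose r : {ffun 'I_k -> 'I_M} := [ffun g => r0 g].
  have Hr g : cell M (r g) (tau N (l g)) by rewrite ffunE.
  pose A := \prod_(g < k) h g (tau M (r g)).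
  have stE g : step tau M (h g) (tau N (l g)) = h g (tau M (r g)).
    by rewrite /step (sum_cell part (fun q => h g (tau M q)) xpredT (Hr g)).
  have bE : box M l = if injectiveb r then A else 0.
    rewrite /box (eq_bigr _ (fun r' _ => prod_cell (fun g q => h g (tau M q)) Hr r')).
    have [ri|ri] := boolP (injectiveb r).
      by rewrite (bigD1 r)//= eqxx [X in _ + X]big1 ?addr0// => r' /andP[_ /negbTE ->].
    by rewrite big1// => r' ir'; case: eqP => // e; rewrite e (negbTE ri) in ir'.
  have iE : \sum_(r' : {ffun 'I_k -> 'I_M} | ~~ injectiveb r') \prod_(g < k) \1_(cell M (r' g)) (tau N (l g)) =
      if injectiveb r then 0 else 1 :> R.
    have := prod_cell (fun _ _ => 1) Hr => pc1.
    have E1 (r' : {ffun 'I_k -> 'I_M}) : \prod_(g < k) \1_(cell M (r' g)) (tau N (l g)) = if r' == r then 1 else 0 :> R.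
      have := pc1 r'; rewrite [X in _ = (if _ then X else _)]big1// => <-.
      by apply: eq_bigr => g _; rewrite mul1r.
    rewrite (eq_bigr _ (fun r' _ => E1 r')) big_mkcond/= (bigD1 r)//= eqxx big1 ?addr0//; first by case: (injectiveb r).
    by move=> r' /negbTE ->; case: ifP.
  have hA g : `|h g (tau M (r g))| <= B by apply: HB; apply: (node_in part M0); exact: ltnW.
  have hl g : `|h g (tau N (l g))| <= B by apply: HB; apply: (node_in part N0); exact: ltnW.
  have D1 : (\prod_(g < k) h g (tau N (l g)) - A) ^+ 2 <= (2 * B ^+ 2) ^+ k * \sum_(g < k) u g (tau N (l g)) * u g (tau N (l g)).
    apply: le_trans (prod_diff_le B1 hl hA) _; rewrite le_eqVlt; apply/orP; left; apply/eqP; congr (_ * _).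
    by apply: eq_bigr => g _; rewrite /u stE expr2.
  have A2 : A ^+ 2 <= (B ^+ 2) ^+ k.
    rewrite /A -prodrXl -[X in _ <= _ ^+ X](card_ord k) -prodr_const; apply: ler_prod => g _.
    by rewrite sqr_ge0/= -(real_normK (num_real (h g _))) ler_pXn2r ?nnegrE.
  have Q0 : 0 <= (2 * B ^+ 2) ^+ k * \sum_(g < k) u g (tau N (l g)) * u g (tau N (l g)) by exact: le_trans (sqr_ge0 _) D1.
  rewrite bE iE; case: (injectiveb r); first by rewrite mulr0 addr0; lra.
  have := sqr_ge0 (\prod_(g < k) h g (tau N (l g)) - A - A); rewrite subr0 mulr1 /a2; nra.
apply: (@le_trans _ _ (a1 * (d1 + d1) + a2 * (d2 + d2))); last first.
  have f1 := scaled_small a10 e4; have f2 := scaled_small a20 e4.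
  by rewrite -/d1 in f1; rewrite -/d2 in f2; lra.
apply: (@le_trans _ _ (a1 * (\sum_(g < k) \sum_(q < N) u g (tau N q) * u g (tau N q) * delta N q) +
   a2 * \sum_(r : {ffun 'I_k -> 'I_M} | ~~ injectiveb r) \prod_(g < k) \sum_(q < N) \1_(cell M (r g)) (tau N q) * delta N q)); last first.
  by apply: lerD; apply: ler_wpM2l.
apply: le_trans (ler_sum _ (fun l _ => ler_wpM2r (pd0 l) (pt l))) _.
under eq_bigr => l _ do rewrite mulrDl.
rewrite big_split/=; apply: lerD.
  under eq_bigr => l _ do rewrite -!mulrA mulr_suml.
  rewrite -!mulr_sumr exchange_big/= /a1 -!mulrA ler_wpM2l// ler_wpM2l ?exprn_ge0 ?mulr_ge0 ?sqr_ge0//.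
  rewrite [leRHS]mulr_sumr; apply: ler_sum => g _; rewrite le_eqVlt; apply/orP; left; apply/eqP.
  pose H (g' : 'I_k) s := if g' == g then u g s * u g s else 1.
  transitivity (\sum_(l : {ffun 'I_k -> 'I_N}) \prod_(g' < k) (H g' (tau N (l g')) * delta N (l g'))).
    apply: eq_bigr => l _; rewrite big_split/=; congr (_ * _).
    by rewrite (bigD1 g)//= /H eqxx big1 ?mulr1// => g' /negbTE ->.
  rewrite grid_prod (bigD1 g)//= /H eqxx mulrC; congr (_ * _).
  rewrite (eq_bigr (fun _ => T - t)); last first.
    by move=> g' /negbTE ->; under eq_bigr do rewrite mul1r; rewrite sum_delta.
  by rewrite prodr_const cardC1 card_ord.
under eq_bigr => l _ do rewrite -mulrA mulr_suml.
rewrite -mulr_sumr exchange_big/= ler_wpM2l//; apply: ler_sum => r _.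
rewrite -(grid_prod (fun g => \1_(cell M (r g)))) le_eqVlt; apply/orP; left; apply/eqP.
by apply: eq_bigr => l _; rewrite big_split.
Unshelve. all: by end_near. Qed.

End box_approximation.
End grid_sums.

(** * Mean-square limits *)

Section mean_square_convergence.
Context {d : measure_display} {Omega : measurableType d} {R : realType}.
Variable P : probability Omega R.

(* The index 0 is exempted because a partition has at least one cell. *)
Definition ms_cvg (X : nat -> Omega -> R) (Z : Omega -> R) :=
  [/\ forall N, (0 < N)%N -> L2 P (X N), L2 P Z &
      e2 P (fun w => X N w - Z w) @[N --> \oo] --> 0].

Lemma cvg0_near_le (u v : nat -> R) : (\forall n \near \oo, 0 <= u n <= v n) ->
  v @ \oo --> 0 -> u @ \oo --> 0.
Proof.
move=> H v0; apply: (@squeeze_cvgr _ _ _ _ (fun=> 0) v); [exact: H|exact: cvg_cst|exact: v0].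
Qed.

Lemma ms_cvgD X Z X' Z' : ms_cvg X Z -> ms_cvg X' Z' ->
  ms_cvg (fun N w => X N w + X' N w) (fun w => Z w + Z' w).
Proof.
move=> [LX LZ c] [LX' LZ' c']; split => [N N0||]; [by apply: L2D; auto|exact: L2D|].
apply: (cvg0_near_le (v := fun N => 2 * (e2 P (fun w => X N w - Z w)) + 2 * e2 P (fun w => X' N w - Z' w))); last first.
  have -> : 0 = 2 * 0 + 2 * 0 :> R by ring.
  by apply: cvgD; apply: cvgM => //; exact: cvg_cst.
near=> N; have N0 : (0 < N)%N by near: N; exact: nbhs_infty_gt.
rewrite e2_ge0/=; have := e2D_le (L2B (LX _ N0) LZ) (L2B (LX' _ N0) LZ').
by under [X in e2 _ X <= _ -> _]eq_fun do rewrite addrACA -opprD.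
Unshelve. all: by end_near. Qed.

Lemma ms_cvgZ c X Z : ms_cvg X Z -> ms_cvg (fun N w => c * X N w) (fun w => c * Z w).
Proof.
move=> [LX LZ cv]; split => [N N0||]; [by apply: L2Z; auto|exact: L2Z|].
apply: (cvg0_near_le (v := fun N => c ^+ 2 * e2 P (fun w => X N w - Z w))); last first.
  have h : c ^+ 2 * e2 P (fun w => X N w - Z w) @[N --> \oo] --> c ^+ 2 * 0 by apply: cvgM => //; exact: cvg_cst.
  by rewrite mulr0 in h.
near=> N; have N0 : (0 < N)%N by near: N; exact: nbhs_infty_gt.
by rewrite e2_ge0/= -e2Z; [under [X in e2 _ X <= _]eq_fun do rewrite -mulrBr|exact: L2B (LX _ N0) LZ].
Unshelve. all: by end_near. Qed.

Lemma ms_cvgB X Z X' Z' : ms_cvg X Z -> ms_cvg X' Z' ->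
  ms_cvg (fun N w => X N w - X' N w) (fun w => Z w - Z' w).
Proof.
move=> c /(ms_cvgZ (-1)) /(ms_cvgD c); congr ms_cvg.
  by apply/funext => N; apply/funext => w; rewrite mulN1r.
by apply/funext => w; rewrite mulN1r.
Qed.

Lemma ms_cvg_cst Z : L2 P Z -> ms_cvg (fun=> Z) Z.
Proof.
move=> LZ; split => //; rewrite (_ : (fun N => _) = fun=> 0); first exact: cvg_cst.
apply/funext => N; rewrite ae_e2_0//; last by apply: aeW => w; rewrite subrr.
exact: L2_meas (L2B LZ LZ).
Qed.

Lemma ms_cvg_sum (I : Type) (s : seq I) (Q : pred I) (X : I -> nat -> Omega -> R) Z :
  (forall i, Q i -> ms_cvg (X i) (Z i)) ->
  ms_cvg (fun N w => \sum_(i <- s | Q i) X i N w) (fun w => \sum_(i <- s | Q i) Z i w).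
Proof.
move=> H; elim: s => [|i s IH].
  have := ms_cvg_cst (L20 P); congr ms_cvg; last by apply/funext => w; rewrite big_nil.
  by apply/funext => N; apply/funext => w; rewrite big_nil.
case: (boolP (Q i)) => [Qi|nQ].
  have := ms_cvgD (H i Qi) IH; congr ms_cvg; last by apply/funext => w; rewrite big_cons Qi.
  by apply/funext => N; apply/funext => w; rewrite big_cons Qi.
move: IH; congr ms_cvg; last by apply/funext => w; rewrite big_cons (negbTE nQ).
by apply/funext => N; apply/funext => w; rewrite big_cons (negbTE nQ).
Qed.

Lemma eq_ms_cvg X Z X' : ms_cvg X Z -> (forall N w, (0 < N)%N -> X N w = X' N w) -> ms_cvg X' Z.
Proof.
move=> [LX LZ c] E; have E' N : (0 < N)%N -> X N = X' N by move=> N0; apply/funext => w; exact: E.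
split => // [N N0|]; first by rewrite -E'//; exact: LX.
apply: (cvg0_near_le _ c); near=> N; have N0 : (0 < N)%N by near: N; exact: nbhs_infty_gt.
by rewrite e2_ge0/= E'.
Unshelve. all: by end_near. Qed.

Lemma ms_cvg_le X Z (D : nat -> R) l : ms_cvg X Z ->
  (forall N, (0 < N)%N -> e2 P (X N) <= D N) -> D @ \oo --> l -> e2 P Z <= l.
Proof.
move=> [LX LZ c] XD Dl.
have c1 : e2 P (X N.+1) @[N --> \oo] --> e2 P Z.
  apply: e2_cvg_cont => // [n|]; first exact: LX.
  by rewrite (cvg_shiftS (fun N => e2 P (fun w => X N w - Z w))).
have D1 : D N.+1 @[N --> \oo] --> l by rewrite (cvg_shiftS D).
apply: (ler_cvg_to c1 D1); apply: nearW => N; exact: XD.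
Qed.

(** A sequence that is eventually within every [eps] of some fixed variable is Cauchy; the index is
    shifted by one because 0 is exempt. *)
Lemma ms_cauchy X : (forall N, (0 < N)%N -> L2 P (X N)) ->
  (forall eps : R, 0 < eps -> exists Z, L2 P Z /\ \forall N \near \oo, e2 P (fun w => X N w - Z w) <= eps) ->
  exists Z, ms_cvg X Z.
Proof.
move=> LX H; have [|e e0|Z [LZ c _]] := @riesz_fischer _ _ _ P (fun n => X n.+1).
- by move=> n; exact: LX.
- have e4 : 0 < e / 4 by rewrite divr_gt0.
  have [Z [LZ [N _ HN]]] := H _ e4; exists N => m n Nm Nn.
  have h := e2_dist (LX _ (ltn0Sn m)) LZ (LX _ (ltn0Sn n)); apply: le_trans h _.
  rewrite [e2 P (fun x => Z x - _)]e2_subC; have := HN m.+1 (leqW Nm); have := HN n.+1 (leqW Nn); rewrite /=; lra.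
by exists Z; split => //; rewrite -(cvg_shiftS (fun N => e2 P (fun w => X N w - Z w))).
Qed.

Lemma ms_cvg_lim X Z : ms_cvg X Z -> lim_in_mean_square P \oo X Z.
Proof.
move=> [LX LZ c]; split; first exact: (L2_meas LZ).
apply/fine_cvgP; split.
  near=> N; have N0 : (0 < N)%N by near: N; exact: nbhs_infty_gt.
  by rewrite unlock -e2_EFin//; exact: L2B (LX _ N0) LZ.
apply: (cvg0_near_le _ c); near=> N; have N0 : (0 < N)%N by near: N; exact: nbhs_infty_gt.
rewrite unlock/= -e2_EFin/=; last exact: L2B (LX _ N0) LZ.
by rewrite e2_ge0/=.
Unshelve. all: by end_near. Qed.

End mean_square_convergence.

(** * Weighted multiple sums and their limits *)

Section multiple_integrals.
Context {d : measure_display} {Omega : measurableType d} {R : realType}.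
Variables (P : probability Omega R) (F : R -> set_system Omega).
Variables (t T : R) (tau : nat -> nat -> R).
Hypothesis t0 : 0 <= t.
Hypothesis tT : t < T.
Hypothesis Ffil : filtration T F.
Hypothesis part : forall N, (0 < N)%N -> is_partition t T N (tau N).
Hypothesis mesh0 : (fun N => \big[Order.max/0]_(j < N) (tau N j.+1 - tau N j)) @ \oo --> 0.
Variables (k : nat) (rel : 'I_k -> (R * Omega -> R) -> (Omega -> R) -> Prop) (C : R).
Variables (S : nat -> 'I_k -> nat -> Omega -> R).
Hypothesis ker : forall g, kernel P F tau (rel g) C (fun N q => S N g q).
Hypothesis C0 : 0 <= C.
Local Notation leb := (leb (R := R)).
Local Notation cell N q := (`[tau N q, tau N q.+1[%classic : set R).
Local Notation delta N q := (tau N q.+1 - tau N q).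
Local Notation pc := (pc t T).
Local Notation cut := (cutoff t T).
Local Notation ms_cvg := (ms_cvg P).

Definition multiple N (Phi : {ffun 'I_k -> 'I_N} -> R) (w : Omega) : R :=
  \sum_(l : {ffun 'I_k -> 'I_N} | injectiveb l) Phi l * \prod_(g < k) S N g (l g) w.

Lemma multipleB N (Phi Psi : {ffun 'I_k -> 'I_N} -> R) w :
  multiple Phi w - multiple Psi w = multiple (fun l => Phi l - Psi l) w.
Proof. by rewrite /multiple -sumrB; apply: eq_bigr => l _; rewrite mulrBl. Qed.

Lemma multipleZ N c (Phi : {ffun 'I_k -> 'I_N} -> R) w :
  c * multiple Phi w = multiple (fun l => c * Phi l) w.
Proof. by rewrite /multiple mulr_sumr; apply: eq_bigr => l _; rewrite mulrA. Qed.

Lemma multiple_suml N (I : Type) (s : seq I) (Phi : I -> {ffun 'I_k -> 'I_N} -> R) w :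
  \sum_(i <- s) multiple (Phi i) w = multiple (fun l => \sum_(i <- s) Phi i l) w.
Proof. by rewrite /multiple exchange_big; apply: eq_bigr => l _; rewrite mulr_suml. Qed.

Let prod_delta_ge0 N (l : {ffun 'I_k -> 'I_N}) : 0 <= \prod_(g < k) delta N (l g).
Proof. by apply: prodr_ge0 => g _; exact: (delta_ge0 part). Qed.

Lemma multiple_bound N (Phi : {ffun 'I_k -> 'I_N} -> R) : (0 < N)%N ->
  L2 P (multiple Phi) /\ e2 P (multiple Phi) <=
    C ^+ k * k`!%:R * \sum_l Phi l ^+ 2 * \prod_(g < k) delta N (l g).
Proof.
move=> N0; have bE (l : {ffun 'I_k -> 'I_N}) : below N l = injectiveb l.
  rewrite /below; case: (injectiveb l) => //=; exact/forallP.
have [h1 h2] := multiple_sum Ffil C0 (fun q (qN : (q <= N)%N) => node0 t0 part N0 qN)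
  (fun q (qN : (q <= N)%N) => node_le part N0 qN)
  (fun q q' qq' (qN : (q' <= N)%N) => node_mono part N0 qq' qN) Phi
  (fun g => kernel_cell_family t0 Ffil part (ker g) C0 N0) (leqnn N).
move: h1 h2; rewrite (_ : (fun w => _) = multiple Phi); last first.
  by apply/funext => w; apply: eq_bigl => l; rewrite bE.
move=> [L _] h2; split => //; apply: le_trans h2 _.
rewrite ler_wpM2l ?mulr_ge0 ?exprn_ge0// big_mkcond/=; apply: ler_sum => l _.
by case: ifP => // _; rewrite mulr_ge0 ?sqr_ge0.
Qed.

Section products.
Variables (q : nat).
Hypothesis kq : (k.*2 < q)%N.
Hypothesis moments : forall g, moment_bounded P t T tau (fun N r => S N g r) q.

Lemma riemann_prod_cvg (H : 'I_k -> R -> R) (Z : 'I_k -> Omega -> R) :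
  (forall g, pc (H g)) -> (forall g, rel g (fun z => cut (H g) z.1) (Z g)) ->
  ms_cvg (fun N w => \prod_(g < k) riemann_sum tau (fun N r => S N g r) (H g) N w)
    (fun w => \prod_(g < k) Z g w).
Proof.
move=> Hpc HZ.
have [K HK] : exists K : R, forall N g, (0 < N)%N ->
    (\int[P]_w (`|riemann_sum tau (fun N r => S N g r) (H g) N w| ^+ q)%:E <= K%:E)%E.
  have [g|K HK] := @choice 'I_k R (fun g K => forall N, (0 < N)%N ->
      (\int[P]_w (`|riemann_sum tau (fun N r => S N g r) (H g) N w| ^+ q)%:E <= K%:E)%E).
    exact: moments.
  exists (\sum_g `|K g|) => N g N0; apply: le_trans (HK g N N0) _.
  by rewrite lee_fin (bigD1 g)//= (le_trans (ler_norm _))// lerDl sumr_ge0.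
have LZ g : L2 P (Z g) by have [] := kernel_e2 (ker g) (HZ g).
have cZ g := riemann_sum_cvg t0 tT Ffil part mesh0 (ker g) (Hpc g) (HZ g).
have LX N g : (0 < N)%N -> L2 P (riemann_sum tau (fun N r => S N g r) (H g) N).
  by move=> N0; exact: (riemann_sum_L2 t0 Ffil part (ker g)).
have ZK g : (\int[P]_w (`|Z g w| ^+ q)%:E <= K%:E)%E.
  by apply: (riemann_limit_moment t0 Ffil part (ker g) (LZ g) (cZ g)) => N; exact: HK.
split; last 1 first.
- exact: (@prod_cvg _ _ _ P k q K _ _ kq LX LZ HK ZK cZ).
- move=> N N0; apply: (@prod_L2 _ _ _ P k q K (fun g => riemann_sum tau (fun N r => S N g r) (H g) N) kq) => // g.
  + exact: LX.
  + exact: HK.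
- exact: (@prod_L2 _ _ _ P k q K Z kq LZ ZK).
Qed.

(** Restricting to injective tuples changes nothing here: the sides of a box are distinct cells, so
    the indices that contribute are distinct too. The sum over all tuples then factorizes. *)
Lemma multiple_box (h : 'I_k -> R -> R) M N w : (0 < M)%N ->
  multiple (fun l : {ffun 'I_k -> 'I_N} => box tau h M l) w =
  \sum_(r : {ffun 'I_k -> 'I_M} | injectiveb r) (\prod_(g < k) h g (tau M (r g))) *
     \prod_(g < k) riemann_sum tau (fun N r => S N g r) (\1_(cell M (r g))) N w.
Proof.
move=> M0; rewrite /multiple /box; under eq_bigr => l _ do rewrite mulr_suml.
rewrite exchange_big/=; apply: eq_bigr => r ir.
rewrite /riemann_sum bigA_distr_bigA/= mulr_sumr big_mkcond/=; apply: eq_bigr => l _.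
rewrite !big_split/= -!mulrA; case: ifPn => // nl.
have /injectivePn[a [b ab e]] := nl.
suff -> : \prod_(g < k) \1_(cell M (r g)) (tau N (l g)) = 0 :> R by rewrite mul0r mulr0.
apply/eqP; rewrite prodf_seq_eq0; apply/hasP.
have [ha|ha] := boolP (tau N (l a) \in cell M (r a)); last first.
  by exists a; rewrite ?mem_index_enum//= indicE (negbTE ha).
have [hb|hb] := boolP (tau N (l b) \in cell M (r b)); last first.
  by exists b; rewrite ?mem_index_enum//= indicE (negbTE hb).
exfalso; move: ha hb; rewrite e !mem_setE => ha hb.
have /injectiveP/(_ a b) := ir.
move/eqP : ab => ab; move=> H; apply: ab; apply: H; apply: ord_inj.
exact: (cell_disj part (ltn_ord _) (ltn_ord _) ha hb).
Qed.

(** The limit is the multiple sum on the fixed partition [M] itself, since the Riemann sums of the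
    indicator of one of its cells tend to the integral over that cell. *)
Lemma multiple_box_cvg (h : 'I_k -> R -> R) M : (0 < M)%N ->
  ms_cvg (fun N => multiple (fun l : {ffun 'I_k -> 'I_N} => box tau h M l))
    (multiple (fun r : {ffun 'I_k -> 'I_M} => \prod_(g < k) h g (tau M (r g)))).
Proof.
move=> M0.
have -> : (fun N => multiple (fun l : {ffun 'I_k -> 'I_N} => box tau h M l)) = fun N w => \sum_(r : {ffun 'I_k -> 'I_M} | injectiveb r) (\prod_(g < k) h g (tau M (r g))) *
     \prod_(g < k) riemann_sum tau (fun N r => S N g r) (\1_(cell M (r g))) N w.
  by apply/funext => N; apply/funext => w; exact: multiple_box.
apply: ms_cvg_sum => r _; apply: ms_cvgZ; apply: riemann_prod_cvg => g; first exact: pc_indic.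
have qM := ltnW (ltn_ord (r g)).
have := kernel_cell (ker g) (ltn_ord (r g)) (past_cst P Ffil 1 (node0 t0 part M0 qM) (node_le part M0 qM)).
congr (rel g); last by apply/funext => w; rewrite mul1r.
apply/funext => z; rewrite mul1r /cutoff [RHS]mulrC.
have [sc|sc] := boolP (z.1 \in cell M (r g)).
  rewrite [X in _ = X * _]indicE mem_set ?mul1r//; apply: (cell_sub part (ltn_ord (r g))); by rewrite inE in sc.
by rewrite [LHS]indicE (negbTE sc) [X in _ = _ * X]indicE (negbTE sc) mulr0.
Qed.

Lemma multiple_prod_cvg (h : 'I_k -> R -> R) : (forall g, pc (h g)) ->
  exists Z, ms_cvg (fun N => multiple (fun l : {ffun 'I_k -> 'I_N} => \prod_(g < k) h g (tau N (l g)))) Z.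
Proof.
move=> hpc; apply: ms_cauchy => [N N0|eps e0]; first by have [] := multiple_bound (fun l : {ffun 'I_k -> 'I_N} => \prod_(g < k) h g (tau N (l g))) N0.
pose c := C ^+ k * k`!%:R; have c0 : 0 <= c by rewrite mulr_ge0 ?exprn_ge0.
have e4 : 0 < eps / 4 by rewrite divr_gt0.
have d0 : 0 < eps / 4 / (c + 1) by rewrite divr_gt0// ltr_wpDl.
have [M M0 HM] := box_close tT part mesh0 hpc d0.
have [LB LM cB] := multiple_box_cvg h M0.
exists (multiple (fun r : {ffun 'I_k -> 'I_M} => \prod_(g < k) h g (tau M (r g)))); split => //.
have /cvgrPdist_le/(_ _ e4) HB := cB.
near=> N; have N0 : (0 < N)%N by near: N; exact: nbhs_infty_gt.
have [LX _] := multiple_bound (fun l : {ffun 'I_k -> 'I_N} => \prod_(g < k) h g (tau N (l g))) N0.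
apply: le_trans (e2_dist LX (LB _ N0) LM) _.
have h1 : e2 P (fun w => multiple (fun l : {ffun 'I_k -> 'I_N} => box tau h M l) w -
    multiple (fun r : {ffun 'I_k -> 'I_M} => \prod_(g < k) h g (tau M (r g))) w) <= eps / 4.
  have : `|0 - e2 P (fun w => multiple (fun l : {ffun 'I_k -> 'I_N} => box tau h M l) w -
    multiple (fun r : {ffun 'I_k -> 'I_M} => \prod_(g < k) h g (tau M (r g))) w)| <= eps / 4 by near: N.
  by rewrite sub0r normrN => /(le_trans (ler_norm _)).
under [X in _ * e2 _ X + _]eq_fun do rewrite multipleB.
have [_ h2] := multiple_bound (fun l : {ffun 'I_k -> 'I_N} => \prod_(g < k) h g (tau N (l g)) - box tau h M l) N0.
have h3 : \sum_(l : {ffun 'I_k -> 'I_N}) (\prod_(g < k) h g (tau N (l g)) - box tau h M l) ^+ 2 * \prod_(g < k) delta N (l g) <= eps / 4 / (c + 1).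
  by near: N.
have h4 := ler_wpM2l c0 h3; have h5 := scaled_small c0 e4; rewrite -/c in h2; lra.
Unshelve. all: by end_near. Qed.

(* The sum over the complement of the injective indices is the full sum, which
   is a product of sums, minus [multiple]. *)
Lemma diagonal_cvg (h : 'I_k -> R -> R) Z Y : (forall g, pc (h g)) ->
  (forall g, rel g (fun z => cut (h g) z.1) (Z g)) ->
  ms_cvg (fun N => multiple (fun l : {ffun 'I_k -> 'I_N} => \prod_(g < k) h g (tau N (l g)))) Y ->
  ms_cvg (fun N w => \sum_(l : {ffun 'I_k -> 'I_N} | ~~ injectiveb l)
                \prod_(g < k) (h g (tau N (l g)) * S N g (l g) w))
    (fun w => \prod_(g < k) Z g w - Y w).
Proof.
move=> hpc hZ cY; have := ms_cvgB (riemann_prod_cvg hpc hZ) cY; move/eq_ms_cvg; apply => N w N0.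
rewrite /riemann_sum bigA_distr_bigA/= (bigID (fun l : {ffun 'I_k -> 'I_N} => injectiveb l))/=.
rewrite addrAC /multiple [X in X + _](_ : _ = 0) ?add0r//.
by apply/eqP; rewrite subr_eq0; apply/eqP/eq_bigr => l _; rewrite big_split.
Qed.

End products.

Section expansion.
Variables (psi : 'I_k -> R -> R) (f : nat -> R -> R).
Hypothesis ppc : forall l, pc (psi l).
Hypothesis fpc : forall j, pc (f j).
Hypothesis forth : orthonormal_system t T f.

Definition volterra N (l : {ffun 'I_k -> 'I_N}) : R :=
  if incr l then \prod_(g < k) psi g (tau N (l g)) else 0.

Let coef (j : 'I_k -> nat) := V t T (hlist (fun g s => psi g s * f (j g) s)) t.

Let fprod (j : 'I_k -> nat) N (l : {ffun 'I_k -> 'I_N}) := \prod_(g < k) f (j g) (tau N (l g)).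

(** Once the square is expanded, every term is a Riemann sum; orthonormality turns the last one into
    Kronecker deltas, factor by factor. Taking limits of discrete sums avoids integrals over the
    cube. *)
Let dist_cvg (I : finType) (jj : I -> 'I_k -> nat) (c : I -> R) :
  \sum_(l : {ffun 'I_k -> 'I_N}) (volterra l - \sum_x c x * fprod (jj x) l) ^+ 2 * \prod_(g < k) delta N (l g) @[N --> \oo] -->
  V t T (hlist (fun g s => psi g s * psi g s)) t - 2 * (\sum_x c x * coef (jj x)) +
  \sum_x \sum_y c x * c y * \prod_(g < k) (jj x g == jj y g)%:R.
Proof.
pose dl N (l : {ffun 'I_k -> 'I_N}) := \prod_(g < k) delta N (l g).
have E N : \sum_(l : {ffun 'I_k -> 'I_N}) (volterra l - \sum_x c x * fprod (jj x) l) ^+ 2 * dl N l =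
   (\sum_(l : {ffun 'I_k -> 'I_N} | incr l) \prod_(g < k) ((psi g (tau N (l g)) * psi g (tau N (l g))) * delta N (l g))
   - 2 * \sum_x c x * (\sum_(l : {ffun 'I_k -> 'I_N} | incr l) \prod_(g < k) ((psi g (tau N (l g)) * f (jj x g) (tau N (l g))) * delta N (l g))))
   + \sum_x \sum_y c x * c y * \sum_(l : {ffun 'I_k -> 'I_N}) \prod_(g < k) ((f (jj x g) (tau N (l g)) * f (jj y g) (tau N (l g))) * delta N (l g)).
  transitivity (\sum_(l : {ffun 'I_k -> 'I_N}) (volterra l ^+ 2 * dl N l
      - 2 * (\sum_x c x * (volterra l * fprod (jj x) l * dl N l))
      + \sum_x \sum_y c x * c y * (fprod (jj x) l * fprod (jj y) l * dl N l))).
    apply: eq_bigr => l _; rewrite sqrrB mulrDl mulrBl; congr (_ - _ + _).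
      rewrite -mulr_natl -!mulrA; congr (_ * _); rewrite mulrCA mulr_suml.
      by apply: eq_bigr => x _; ring.
    rewrite expr2 mulr_suml mulr_suml; apply: eq_bigr => x _.
    by rewrite mulr_sumr mulr_suml; apply: eq_bigr => y _; ring.
  rewrite big_split/= sumrB; congr (_ - _ + _).
  - rewrite [RHS]big_mkcond/=; apply: eq_bigr => l _; rewrite /volterra /dl; case: ifP => _.
      by rewrite !big_split/= expr2.
    by rewrite expr0n mul0r.
  - rewrite -mulr_sumr; congr (_ * _); rewrite exchange_big/=; apply: eq_bigr => x _.
    rewrite -mulr_sumr; congr (_ * _); rewrite [RHS]big_mkcond/=; apply: eq_bigr => l _.
    by rewrite /volterra /dl; case: ifP => _; rewrite ?mul0r// !big_split.
  - rewrite exchange_big/=; apply: eq_bigr => x _; rewrite exchange_big/=; apply: eq_bigr => y _.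
    by rewrite -mulr_sumr; congr (_ * _); apply: eq_bigr => l _; rewrite !big_split.
rewrite (funext E); apply: cvgD; first apply: cvgB.
- by apply: (grid_incr_cvg tT part mesh0 (H := fun g s => psi g s * psi g s)) => g; exact: pcM.
- apply: cvgM; first exact: cvg_cst.
  apply: cvg_fin_sum => x; apply: cvgM; first exact: cvg_cst.
  by apply: (grid_incr_cvg tT part mesh0 (H := fun g s => psi g s * f (jj x g) s)) => g; exact: pcM.
- apply: cvg_fin_sum => x; apply: cvg_fin_sum => y; apply: cvgM; first exact: cvg_cst.
  rewrite (eq_bigr (fun g => \int[leb]_s cut (fun s => f (jj x g) s * f (jj y g) s) s)).
    by apply: (grid_prod_cvg tT part mesh0 (H := fun g s => f (jj x g) s * f (jj y g) s)) => g; exact: pcM.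
  move=> g _; rewrite -(cut_orth fpc forth) /ip; apply: eq_Rintegral => s _.
  rewrite /cutoff indicE; case: (_ \in _); rewrite ?mulr1// !mulr0//.
Qed.

(** With the Fourier coefficients as weights, the limit in [dist_cvg] collapses to the defect in
    Bessel's inequality. A predicate [Q] on a finite type accommodates the different ranges of the
    summation indices. *)
Lemma expansion_bound (Iint : Omega -> R) (I : finType) (Q : pred I) (jj : I -> 'I_k -> nat) (Z : I -> Omega -> R) :
  (forall x y, (forall g, jj x g = jj y g) -> x = y) ->
  ms_cvg (fun N => multiple (@volterra N)) Iint ->
  (forall x, ms_cvg (fun N => multiple (fun l : {ffun 'I_k -> 'I_N} => fprod (jj x) l)) (Z x)) ->
  L2 P (fun w => Iint w - \sum_(x | Q x) coef (jj x) * Z x w) /\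
  e2 P (fun w => Iint w - \sum_(x | Q x) coef (jj x) * Z x w) <=
  C ^+ k * k`!%:R * (V t T (hlist (fun g s => psi g s * psi g s)) t - \sum_(x | Q x) coef (jj x) ^+ 2).
Proof.
move=> inj cI cZ; pose c x := if Q x then coef (jj x) else 0.
have cc := ms_cvgB cI (ms_cvg_sum (index_enum I) (Q := xpredT) (fun x _ => ms_cvgZ (c x) (cZ x))).
have dc := @dist_cvg I jj c.
have lE : V t T (hlist (fun g s => psi g s * psi g s)) t - 2 * (\sum_x c x * coef (jj x)) +
  \sum_x \sum_y c x * c y * \prod_(g < k) (jj x g == jj y g)%:R =
  V t T (hlist (fun g s => psi g s * psi g s)) t - \sum_(x | Q x) coef (jj x) ^+ 2.
  have -> : \sum_x \sum_y c x * c y * \prod_(g < k) (jj x g == jj y g)%:R = \sum_x c x * coef (jj x).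
    apply: eq_bigr => x _; rewrite (bigD1 x)//= [X in _ + X]big1 ?addr0; last first.
      move=> y yx; have [g Hg] : exists g, jj x g != jj y g.
        apply/existsP; rewrite -negb_forall; apply: contra yx => /forallP H; apply/eqP/inj => g.
        by apply/esym/eqP.
      by rewrite (bigD1 g)//= (negbTE Hg) mul0r mulr0.
    by rewrite [X in _ * X]big1 ?mulr1 => [|g _]; rewrite ?eqxx// /c; case: ifP => _; rewrite ?mul0r.
  rewrite [X in _ = _ - X]big_mkcond/= (eq_bigr (fun x => if Q x then coef (jj x) ^+ 2 else 0)); first by ring.
  by move=> x _; rewrite /c; case: ifP; rewrite ?mul0r.
have E w : Iint w - \sum_(x | Q x) coef (jj x) * Z x w = Iint w - \sum_x c x * Z x w.
  by rewrite big_mkcond/=; congr (_ - _); apply: eq_bigr => x _; rewrite /c; case: ifP; rewrite ?mul0r.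
rewrite lE in dc; rewrite (funext E); split; first by case: cc.
apply: (ms_cvg_le cc _ (cvgM (cvg_cst (C ^+ k * k`!%:R)) dc)) => N N0.
have [_ h] := multiple_bound (fun l : {ffun 'I_k -> 'I_N} => volterra l - \sum_x c x * fprod (jj x) l) N0.
apply: le_trans h; rewrite le_eqVlt; apply/orP; left; apply/eqP; congr (e2 P _); apply/funext => w.
by under eq_bigr do rewrite multipleZ; rewrite multiple_suml multipleB.
Qed.

End expansion.
End multiple_integrals.

Section box_sums.
Variable R : realType.

Lemma box_sum_ffun (G : seq nat -> R) n M k : (n <= M)%N ->
  box_sum n k G = \sum_(j : {ffun 'I_k -> 'I_M} | [forall l, (j l < n)%N]) G [seq nat_of_ord (j l) | l <- enum 'I_k].
Proof.
move=> nM; elim: k G => [|k IH] G /=.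
  set l0 : {ffun 'I_0 -> 'I_M} := [ffun x : 'I_0 => False_rect _ (notF (ltn_ord x))].
  rewrite (big_pred1 l0); first by rewrite (size0nil (_ : size (enum 'I_0) = 0%N)) ?size_enum_ord.
  by move=> l /=; have -> : l = l0 by [apply/ffunP => -[]]; rewrite eqxx; apply/forallP => -[].
rewrite (sum_fins ord0) (big_ord_widen M (fun j => box_sum n k (fun js => G (j :: js))))//= big_mkcond/=.
apply: eq_bigr => q _; case: ifPn => qn.
  rewrite IH; apply: eq_big => [u|u _].
    apply/forallP/forallP => [H l|H l]; last by have := H (lift ord0 l); rewrite fins_lift.
    by case: (unliftP ord0 l) => [l' ->|->]; rewrite ?fins_lift ?fins_at.
  rewrite enum_ordSl/= fins_at -map_comp; congr (G (_ :: _)); apply: eq_map => l /=.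
  by rewrite fins_lift.
rewrite big_pred0// => u; apply/negbTE; apply: contra qn => /forallP/(_ ord0).
by rewrite fins_at.
Qed.

Lemma mulf_hlist (f : nat -> R -> R) k (psi : 'I_k -> R -> R) (j : 'I_k -> nat) :
  mulf f (hlist psi) [seq j l | l <- enum 'I_k] = hlist (fun g s => psi g s * f (j g) s).
Proof.
elim: k psi j => [|k IH] psi j.
  by rewrite /hlist (size0nil (_ : size (enum 'I_0) = 0%N)) ?size_enum_ord.
by rewrite !hlistS enum_ordSl/= -map_comp IH.
Qed.

End box_sums.

Section iterated_integral.
Context {d : measure_display} {Omega : measurableType d} {R : realType}.
Variables (P : probability Omega R) (F : R -> set_system Omega).
Variables (t T : R) (tau : nat -> nat -> R).
Hypothesis t0 : 0 <= t.
Hypothesis tT : t < T.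
Hypothesis Ffil : filtration T F.
Hypothesis part : forall N, (0 < N)%N -> is_partition t T N (tau N).
Hypothesis mesh0 : (fun N => \big[Order.max/0]_(j < N) (tau N j.+1 - tau N j)) @ \oo --> 0.
Variables (k : nat) (rel : 'I_k -> (R * Omega -> R) -> (Omega -> R) -> Prop) (C : R).
Variables (S : nat -> 'I_k -> nat -> Omega -> R).
Hypothesis ker : forall g, kernel P F tau (rel g) C (fun N q => S N g q).
Hypothesis C0 : 0 <= C.
Local Notation leb := (leb (R := R)).
Local Notation horizon := (horizon P).
Local Notation pc := (pc t T).
Local Notation cut := (cutoff t T).
Variable psi : 'I_k -> R -> R.
Hypothesis ppc : forall l, pc (psi l).
Local Notation approx := (approx P F t T tau).

(** If [phi l] vanishes identically, the iterated integral says nothing about the measurability of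
    [psi l * J l], which [approx_step] asks for; but then both processes are 0 almost surely. *)
Lemma approx_degenerate l (J J' : R -> Omega -> R) Y : approx J Y ->
  (forall s, s \in `[t, T] -> L2 P (J' s) /\ e2 P (J' s) = 0) ->
  (forall N q, (q < N)%N -> e2 P (S N l q) = 0) ->
  approx J' (fun N r w => \sum_(q < N | (q < r)%N) psi l (tau N q) * Y N q w * S N l q w).
Proof.
move=> JY J0 S0.
have aS N (q : 'I_N) : {ae P, forall w, S N l q w = 0}.
  by apply: e2_eq0; [case: (kernel_past (ker l) (ltn_ord q))|exact: S0].
have aJ s : s \in `[t, T] -> {ae P, forall w, J' s w = 0} by move=> /J0[L e]; exact: e2_eq0.
have pY N r : (0 < N)%N -> (r <= N)%N -> past P F (tau N r)
    (fun w => \sum_(q < N | (q < r)%N) psi l (tau N q) * Y N q w * S N l q w).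
  move=> N0 rN; apply: (past_sum Ffil); [exact: (node0 t0 part)|exact: (node_le part)|move=> q qr].
  have pX : past P F (tau N q) (fun w => psi l (tau N q) * Y N q w).
    apply: (pastZ Ffil); [exact: (node0 t0 part N0 (ltnW (ltn_ord q)))|exact: (node_le part N0 (ltnW (ltn_ord q)))|].
    exact: (approx_past JY N0 (ltnW (ltn_ord q))).
  apply: (past_mono Ffil _ _ _ (kernel_mul_past t0 Ffil part (ker l) (ltn_ord q) pX)).
  - exact: (node0 t0 part).
  - exact: (node_mono part).
  - exact: (node_le part).
split => //.
- by exists 0 => s sT; have [L ->] := J0 s sT.
- exists 0 => s s' ts ss' s'T; rewrite mul0r.
  have sI : s \in `[t, T] by rewrite in_itv/= ts (le_trans ss' s'T).
  have s'I : s' \in `[t, T] by rewrite in_itv/= s'T (le_trans ts ss').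
  rewrite ae_e2_0//; first exact: L2_meas (L2B (J0 _ s'I).1 (J0 _ sI).1).
  by apply: filterS2 (aJ _ sI) (aJ _ s'I) => w -> ->; rewrite subrr.
move=> eps e0; near=> N => r rN; have N0 : (0 < N)%N by near: N; exact: nbhs_infty_gt.
have rI := node_in part N0 rN.
rewrite ae_e2_0 ?(ltW e0)//; first exact: L2_meas (L2B (pY _ _ N0 rN).1 (J0 _ rI).1).
have aY : {ae P, forall w, forall q : 'I_N, S N l q w = 0}.
  by apply: filter_forall => q; exact: aS.
apply: filterS2 aY (aJ _ rI) => w Hw ->; rewrite subr0 big1// => q _.
by rewrite Hw mulr0.
Unshelve. all: by end_near. Qed.

Variable J : nat -> R -> Omega -> R.
Hypothesis J0 : forall s w, J 0%N s w = 1.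
Hypothesis Jstep : forall l : 'I_k,
  (measurable_fun setT (fun z : R * Omega => cut (psi l) z.1 * J l z.1 z.2) /\
   forall s, s \in `[t, T] -> L2 horizon (fun z => psi l z.1 * J l z.1 z.2 * \1_(`[t, s[ : set R) z.1) ->
     rel l (fun z => psi l z.1 * J l z.1 z.2 * \1_(`[t, s[ : set R) z.1) (J l.+1 s)) \/
  ((forall s, s \in `[t, T] -> L2 P (J l.+1 s) /\ e2 P (J l.+1 s) = 0) /\
   forall N q, (q < N)%N -> e2 P (S N l q) = 0).

(** The discrete process that accompanies the [l]-fold iterated integral, peeled from the top by
    [sum_upto]. *)
Definition ordered_sum l (lk : (l <= k)%N) N r w :=
  \sum_(u : {ffun 'I_l -> 'I_N} | upto r u)
    \prod_(g < l) (psi (widen_ord lk g) (tau N (u g)) * S N (widen_ord lk g) (u g) w).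

Lemma ordered_approx l (lk : (l <= k)%N) : approx (J l) (ordered_sum lk).
Proof.
elim: l lk => [|l IH] lk.
  have E N r w : ordered_sum lk N r w = 1.
    set l0 : {ffun 'I_0 -> 'I_N} := [ffun x : 'I_0 => False_rect _ (notF (ltn_ord x))].
    rewrite /ordered_sum (big_pred1 l0) ?big_ord0// => u /=; have -> : u = l0 by apply/ffunP => -[].
    by rewrite eqxx; apply/andP; split; [apply/incrP => -[]|apply/forallP => -[]].
  have EJ s : J 0 s = fun=> 1 by apply/funext => w; exact: J0.
  split.
  - by exists (e2 P (fun=> 1)) => s _; rewrite EJ; split => //; exact: L2_cst.
  - exists 0 => s s' _ _ _; rewrite mul0r ae_e2_0//; first by rewrite !EJ; exact: measurable_funB.
    by apply: aeW => w; rewrite !J0 subrr.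
  - move=> N r N0 rN; rewrite (funext (E N r)); apply: (past_cst P Ffil 1).
      exact: (node0 t0 part).
    exact: (node_le part).
  - move=> eps e0; near=> N => r _; rewrite (funext (E N r)) EJ ae_e2_0 ?(ltW e0)//.
    by apply: aeW => w; rewrite subrr.
have -> : ordered_sum lk = fun N r w => \sum_(q < N | (q < r)%N)
    psi (Ordinal lk) (tau N q) * ordered_sum (ltnW lk) N q w * S N (Ordinal lk) q w.
  apply/funext => N; apply/funext => r; apply/funext => w; rewrite /ordered_sum sum_upto.
  apply: eq_bigr => q _; rewrite mulr_sumr mulr_suml; apply: eq_bigr => u _.
  rewrite (prod_fins ord_max q u (fun g q => psi (widen_ord lk g) (tau N q) * S N (widen_ord lk g) q w)).
  have -> : widen_ord lk ord_max = Ordinal lk by exact: val_inj.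
  rewrite [RHS]mulrAC; congr (_ * _); apply: eq_bigr => g _.
  by have -> : widen_ord lk (lift ord_max g) = widen_ord (ltnW lk) g by apply: val_inj; exact: lift_max.
have [[mJ rJ]|[Jz Sz]] := Jstep (Ordinal lk).
  exact: (approx_step t0 tT Ffil part mesh0 (ker (Ordinal lk)) C0 (IH (ltnW lk)) (ppc _) mJ rJ).
exact: (approx_degenerate (IH (ltnW lk)) Jz Sz).
Unshelve. all: by end_near. Qed.

(** Injective tuples that are not increasing have weight 0, so the multiple sum is the ordered sum
    at the last node. *)
Lemma volterra_cvg : ms_cvg P (fun N => multiple S (@volterra R tau k psi N)) (J k T).
Proof.
have ap := ordered_approx (leqnn k).
have E N : multiple S (@volterra R tau k psi N) = ordered_sum (leqnn k) N N.
  apply/funext => w; rewrite /multiple /ordered_sum.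
  rewrite [LHS]big_mkcond [RHS]big_mkcond/=; apply: eq_bigr => u _.
  have -> : upto N u = incr u by rewrite /upto; case: (incr u) => //=; apply/forallP => a; exact: ltn_ord.
  rewrite /volterra; case: (boolP (incr u)) => [iu|_]; last by case: ifP => //; rewrite mul0r.
  rewrite incr_inj// -big_split/=; apply: eq_bigr => g _.
  by have -> : widen_ord (leqnn k) g = g by exact: val_inj.
have TI : T \in `[t, T] by rewrite in_itv/= lexx ltW.
split.
- by move=> N N0; have [] := multiple_bound t0 Ffil part ker C0 (@volterra R tau k psi N) N0.
- by have [B HB] := approx_bound ap; case: (HB _ TI).
apply/cvgrPdist_le => eps e0; have H := approx_cvg ap e0.
near=> N; have N0 : (0 < N)%N by near: N; exact: nbhs_infty_gt.
rewrite sub0r normrN ger0_norm ?e2_ge0// E.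
have HN : forall r, (r <= N)%N -> e2 P (fun w => ordered_sum (leqnn k) N r w - J k (tau N r) w) <= eps by near: N.
by have := HN N (leqnn N); have [_ -> _] := part N0.
Unshelve. all: by end_near. Qed.

Variable f : nat -> R -> R.
Hypothesis fpc : forall j, pc (f j).
Hypothesis forth : orthonormal_system t T f.
Hypothesis fcomp : complete_system t T f.
Hypothesis k0 : (0 < k)%N.

(** Partial sums whose bounds are all at least [n] contain the cube of indices below [n], and
    dropping squares only enlarges the defect; joint convergence in [p] thus follows from Parseval
    along cubes. *)
Lemma expansion_cvg (Z : ('I_k -> nat) -> Omega -> R) :
  (forall j, ms_cvg P (fun N => multiple S (fun l : {ffun 'I_k -> 'I_N} => \prod_(g < k) f (j g) (tau N (l g)))) (Z j)) ->
  lim_in_mean_square P (@multi_infty k)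
    (fun p w => \sum_(j : {ffun 'I_k -> 'I_(\max_(l < k) p l).+1} | [forall l, (j l <= p l)%N])
         fourier_coef t T psi f (fun l => j l) * Z (fun l => j l) w) (J k T).
Proof.
move=> cZ; have cI := volterra_cvg.
have LI : L2 P (J k T) by case: cI.
split; first exact: (L2_meas LI).
pose c := C ^+ k * k`!%:R; have c0 : 0 <= c by rewrite mulr_ge0 ?exprn_ge0.
pose VV := V t T (hlist (fun g s => psi g s * psi g s)) t.
pose coef (j : 'I_k -> nat) := V t T (hlist (fun g s => psi g s * f (j g) s)) t.
have fE j : fourier_coef t T psi f j = coef j by exact: fourier_coef_V.
have tI : t \in `[t, T] by rewrite in_itv/= lexx ltW.
have [pars _] := iterated_parseval tT fpc forth fcomp (hlist_pc ppc).
have sqE : sqf (hlist psi) = hlist (fun g s => psi g s * psi g s) by rewrite /sqf /hlist -map_comp.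
have := pars t tI; rewrite sqE size_map size_enum_ord -/VV => cP.
have bound (p : 'I_k -> nat) :
    let X w := \sum_(j : {ffun 'I_k -> 'I_(\max_(l < k) p l).+1} | [forall l, (j l <= p l)%N])
         fourier_coef t T psi f (fun l => j l) * Z (fun l => j l) w in
    L2 P (fun w => X w - J k T w) /\ forall n, (forall l, (n <= p l)%N) ->
    e2 P (fun w => X w - J k T w) <= c * (VV - box_sum n k (fun js => V t T (mulf f (hlist psi) js) t ^+ 2)).
  have [|L B] := expansion_bound t0 tT Ffil part mesh0 ker C0 ppc fpc forth
    (fun j : {ffun 'I_k -> 'I_(\max_(l < k) p l).+1} => [forall l, (j l <= p l)%N])
    _ cI (jj := fun (j : {ffun 'I_k -> 'I_(\max_(l < k) p l).+1}) l => j l) (fun j => cZ _).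
    by move=> x y H; apply/ffunP => g; apply: val_inj; exact: H.
  move=> X; have XE w : X w - J k T w = -1 * (J k T w - \sum_(j : {ffun 'I_k -> 'I_(\max_(l < k) p l).+1} | [forall l, (j l <= p l)%N])
         coef (fun l => j l) * Z (fun l => j l) w).
    by rewrite mulN1r opprB /X; under eq_bigr do rewrite fE.
  rewrite (funext XE); split; first exact: L2Z.
  move=> n np; rewrite e2Z// sqrrN expr1n mul1r; apply: le_trans B _.
  rewrite ler_wpM2l// lerB//.
  (* The comparison with the maximum needs a position to look at, hence [k > 0]. *)
  have nM : (n <= (\max_(l < k) p l).+1)%N.
    by apply: leqW; apply: leq_trans (np (Ordinal k0)) _; exact: (leq_bigmax (F := p)).
  rewrite (box_sum_ffun _ k nM).
  rewrite [leRHS](bigID (fun j : {ffun 'I_k -> 'I_(\max_(l < k) p l).+1} => [forall l, (j l < n)%N]))/=.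
  rewrite -[leLHS]addr0; apply: lerD; last by apply: sumr_ge0 => j _; exact: sqr_ge0.
  rewrite [leLHS]big_mkcond [leRHS]big_mkcond/=; apply: ler_sum => j _.
  case: ifPn => [jn|_]; last by case: ifP => // _; exact: sqr_ge0.
  have -> /= : [forall l, (j l <= p l)%N].
    by apply/forallP => l; apply: leq_trans (np l); apply: ltnW; exact: (forallP jn l).
  by rewrite (mulf_hlist f psi (fun l => j l)).
move=> A A0; have /nbhs_ballP[e /= e0 HA] : nbhs (0 : R) (fun r => A r%:E) by exact: A0.
have e1 : 0 < e / 2 / (c + 1) by rewrite !divr_gt0// ltr_wpDl.
have /cvgrPdist_le/(_ _ e1)[n _ Hn] := cP.
exists n => p np; have [L B] := bound p.
rewrite /= unlock -e2_EFin//. apply: HA; rewrite /ball/= sub0r normrN ger0_norm ?e2_ge0//.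
apply: le_lt_trans (B n np) _; have := Hn n (leqnn n); move=> /(le_trans (ler_norm _)) h.
have := ler_wpM2l c0 h; have e2 : 0 < e / 2 by rewrite divr_gt0.
have := scaled_small c0 e2; lra.
Qed.

End iterated_integral.

(** * Independence and covariance *)

Section versions.
Context {d : measure_display} {T : measurableType d} {R : realType}.
Variable P : probability T R.

Lemma ae_eq_measure (A B : set T) : measurable A -> measurable B ->
  {ae P, forall w, A w <-> B w} -> P A = P B.
Proof.
move=> mA mB AB; rewrite -(setIT A) -(setIT B) -!integral_indic//.
apply: ae_eq_integral => //; try exact/measurable_EFinP/measurable_indic.
apply: filterS AB => w AB _; congr EFin; rewrite !indicE; congr (_%:R).
by congr nat_of_bool; apply/idP/idP; rewrite !inE => /AB.
Qed.

(** Independence tests only probabilities, so a sigma-algebra may be enlarged by the measurable sets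
    almost surely equal to its members. *)
Lemma version_sigma_algebra G : sigma_algebra setT G ->
  sigma_algebra setT [set A | measurable A /\ exists2 B, G B & {ae P, forall w, A w <-> B w}].
Proof.
move=> [G0 GC GU]; split.
- by split; [exact: measurable0|exists set0 => //; exact: aeW].
- move=> A [mA [B GB AB]]; split; first exact: measurableD.
  exists (setT `\` B); first exact: GC.
  by apply: filterS AB => w AB; split => -[_ nA]; split => // /AB.
- move=> A HA; split; first by apply: bigcup_measurable => n _; case: (HA n).
  have [n|B HB] := @choice nat (set T) (fun n B => G B /\ {ae P, forall w, A n w <-> B w}).
    by have [_ [B GB AB]] := HA n; exists B.
  exists (\bigcup_k B k); first by apply: GU => n; case: (HB n).
  have : {ae P, forall w, forall n, A n w <-> B n w}.
    by apply: ae_foralln => n; case: (HB n).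
  by apply: filterS => w H; split => -[n _ /H ?]; exists n.
Qed.

(** Every set generated by the [Z j] of one class has a version in [sig c], and the product rule
    over a finite type does not see null sets. *)
Lemma independent_versions (I : finType) (D : pred I) (sig : I -> set_system T)
    (J : Type) (E : I -> set J) (Z : J -> T -> R) :
  (forall c, D c -> sigma_algebra setT (sig c)) ->
  (forall c, D c -> sig c `<=` measurable) ->
  mutually_independent P D sig ->
  (forall c j, D c -> E c j -> measurable_fun setT (Z j) /\
     exists X, Gm (sig c) X /\ {ae P, forall w, Z j w = X w}) ->
  mutually_independent P D (fun c => sigma_generated (E c) Z).
Proof.
move=> sS sM ind HZ A HA.
have HB c : exists B, D c -> [/\ measurable (A c), sig c B & {ae P, forall w, A c w <-> B w}].
  have [Dc|nD] := boolP (D c); last by exists set0.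
  suff [mA [B sB AB]] : [set A | measurable A /\ exists2 B, sig c B & {ae P, forall w, A w <-> B w}] (A c).
    by exists B => _; split.
  apply: (smallest_sub (version_sigma_algebra (sS c Dc)) _ (HA c Dc)) => _ [j Ej [B mB <-]].
  have [mZ [X [GX ZX]]] := HZ c j Dc Ej; split; first exact: mZ.
  exists (setT `&` X @^-1` B); first by apply: GX; exists B.
  by apply: filterS ZX => w ZX; rewrite /preimage/= ZX.
have [B {}HB] := choice HB.
have fin : finite_set [set` D] by exact: finite_finset.
transitivity (P (\bigcap_(c in [set` D]) B c)).
  apply: ae_eq_measure.
  - by apply: fin_bigcap_measurable => // c /HB[].
  - by apply: fin_bigcap_measurable => // c Dc; have [_ /(sM c Dc)] := HB c Dc.
  have : {ae P, forall w, forall c, D c -> (A c w <-> B c w)}.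
    apply: filter_forall => c; have [Dc|nD] := boolP (D c); last exact: aeW.
    by have [_ _] := HB c Dc; apply: filterS.
  by apply: filterS => w H; split => HA' c Dc; apply/(H c Dc); exact: HA'.
rewrite ind; last by move=> c /HB[].
apply: eq_bigr => c Dc; have [mA sB AB] := HB c Dc.
by apply/esym/ae_eq_measure => //; exact: sM sB.
Qed.

Lemma mutually_independent2 (I : finType) (D : pred I) (sig : I -> set_system T) c c' :
  (forall c, D c -> sig c setT) -> mutually_independent P D sig ->
  D c -> D c' -> c != c' -> independent2 P (sig c) (sig c').
Proof.
move=> sT ind Dc Dc' cc' A B GA GB.
pose X x := if x == c then A else if x == c' then B else setT.
have Xc : X c = A by rewrite /X eqxx.
have Xc' : X c' = B by rewrite /X eq_sym (negbTE cc') eqxx.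
have := ind X; rewrite (bigD1 c)//= (bigD1 c')/=; last by rewrite Dc' eq_sym.
rewrite big1 ?mule1; last first.
  by move=> x /andP[/andP[_ /negbTE xc] /negbTE xc']; rewrite /X xc xc' probability_setT.
rewrite Xc Xc' => <-; last first.
  move=> x Dx; rewrite /X; case: eqP => [->//|_]; case: eqP => [->//|_]; exact: sT.
congr (P _); apply/seteqP; split => w.
  by move=> [Aw Bw] x _; rewrite /X; case: ifP => // _; case: ifP.
by move=> H; split; [have := H c Dc; rewrite Xc|have := H c' Dc'; rewrite Xc'].
Qed.

Lemma covariance_centered (X Y : T -> R) : L2 P X -> L2 P Y ->
  \int[P]_w X w = 0 -> \int[P]_w Y w = 0 -> covariance P X Y = (ip P X Y)%:E.
Proof.
move=> LX LY X0 Y0.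
have EX (Z : T -> R) : L2 P Z -> \int[P]_w Z w = 0 -> fine 'E_P[Z]%E = 0.
  by move=> LZ Z0; rewrite unlock -(Rint_EFin (L2_L1 LZ)) Z0.
rewrite covariance.unlock !EX// unlock /ip (Rint_EFin (L2_mul LX LY)).
by apply: eq_integral => w _; rewrite !fctE/= !subr0.
Qed.

End versions.

Section covariances.
Context {d : measure_display} {Omega : measurableType d} {R : realType}.
Context {dY : measure_display} {Y : measurableType dY}.
Variables (P : probability Omega R) (F : R -> set_system Omega).
Variables (Pi : {measure set Y -> \bar R}) (T : R) (nu : R.-ker Omega ~> (R * Y)%type).
Hypothesis Ffil : filtration T F.
Hypothesis Hnu : adapted_counts P F Pi T nu.
Variables (D : set Y) (PiD : {sigma_finite_measure set Y -> \bar R}).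
Hypothesis mD : measurable D.
Hypothesis PiDE : forall A, measurable A -> PiD A = Pi (A `&` D).
Local Notation integral_of := (integral_of P F Pi T nu D PiD).
Local Notation space_time := (space_time P PiD).

(** Elementary integrals are centred, and the mean is continuous in mean square by Cauchy-Schwarz
    against 1. *)
Lemma integral_of_mean xi Z : integral_of xi Z -> \int[P]_w Z w = 0.
Proof.
move=> [Lxi LZ H].
have elem0 (e : elem P F Pi T D) : int1 P (ei nu e) /\ \int[P]_w ei nu e w = 0.
  have eE w : ei nu e w = inc Pi nu (ea e) (eb e) (eA e) w * ez e w by rewrite /ei mulrC.
  have gz : Gm (F (ea e)) (ez e) by exact: ezF.
  split; first exact: L2_L1 (ei_L2 Ffil Hnu e).
  under eq_Rintegral do rewrite eE.
  exact: (inc_past Ffil Hnu (eAf e) (ea0 e) (eab e) (ebT e) gz (L2_L1 (ezL e))).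
have L1 := L2_cst P 1.
have ip1 X : ip P X (fun=> 1) = \int[P]_w X w by apply: eq_Rintegral => w _; rewrite mulr1.
have e1 : e2 P (fun _ : Omega => 1) = 1.
  by rewrite e2E /Rintegral; under eq_integral do rewrite expr1n; rewrite integral_cst//= probability_setT mule1.
apply/eqP; rewrite -sqrf_eq0; apply/eqP/le_anti; rewrite sqr_ge0 andbT.
apply/ler_addgt0Pl => eps e0; rewrite addr0; have [s [_ hs]] := H _ e0.
have Ls := eint_L2 Ffil Hnu s.
have s0 : \int[P]_w eint nu s w = 0.
  rewrite /eint Rint_sum; last by move=> e; case: (elem0 e).
  by rewrite big1// => e _; case: (elem0 e).
have -> : \int[P]_w Z w = ip P (fun w => Z w - eint nu s w) (fun=> 1).
  by rewrite ip1 RintegralB//; [rewrite s0 subr0|exact: L2_L1|exact: L2_L1].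
by apply: le_trans (cauchy_schwarz (L2B LZ Ls) L1) _; rewrite e1 mulr1.
Qed.

(** Polarization of the isometry. *)
Lemma integral_of_ip xi Z xi' Z' : integral_of xi Z -> integral_of xi' Z' ->
  ip P Z Z' = ip space_time xi xi'.
Proof.
move=> H H'; have [Lxi LZ _] := H; have [Lxi' LZ' _] := H'.
have := integral_of_isometry Ffil Hnu PiDE (integral_ofD Ffil Hnu PiDE H H').
rewrite !e2D// (integral_of_isometry Ffil Hnu PiDE H) (integral_of_isometry Ffil Hnu PiDE H'); lra.
Qed.

Lemma martingale_rel_ip (phi phi' : Y -> R) (u u' : R -> R) Z Z' :
  L2 PiD phi -> L2 PiD phi' -> L2 (leb (R := R)) u -> L2 (leb (R := R)) u' ->
  martingale_rel P F Pi T nu D PiD phi (fun z => u z.1) Z ->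
  martingale_rel P F Pi T nu D PiD phi' (fun z => u' z.1) Z' ->
  ip P Z Z' = ip PiD phi phi' * ip (leb (R := R)) u u'.
Proof.
move=> Lphi Lphi' Lu Lu' [_ H] [_ H']; rewrite (integral_of_ip H H').
have [i1 e1] := prod_int (L2_mul Lu Lu') (L2_mul Lphi Lphi').
have [i2 e2] := prod_int_sf (product_sigma_finite (leb (R := R)) PiD) i1 (L2_L1 (L2_cst P 1)).
rewrite mulrC /ip -e1 -[RHS]mulr1.
rewrite [X in _ * X](_ : 1 = \int[P]_w 1); last by rewrite Rintegral_cst//= probability_setT mulr1.
by rewrite -e2; apply: eq_Rintegral => z _ /=; ring.
Qed.

End covariances.

Section stochastic_integrands.
Context {d : measure_display} {Omega : measurableType d} {R : realType}.
Context {dY : measure_display} {Y : measurableType dY}.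
Variables (P : probability Omega R) (F : R -> set_system Omega).
Variables (Pi : {measure set Y -> \bar R}) (m : nat).
Variable nu : 'I_m.+1 -> R.-ker Omega ~> (R * Y)%type.

Lemma stoch_int_H2 i a b xi Z : stoch_int P F Pi nu i a b xi Z -> H2 P F Pi a b xi.
Proof. by rewrite /stoch_int; case: ifP => _ []. Qed.

(** Were the integral of [phi^2] infinite, the inner integral would be infinite at every time of an
    interval of positive length. *)
Lemma H2_deterministic (a b : R) (phi : Y -> R) : measurable_fun setT phi -> a < b ->
  H2 P F Pi a b (fun _ y _ => phi y) -> L2 Pi phi.
Proof.
move=> mphi ab [_ _ h]; split => //; rewrite ltNge leye_eq; apply/negP => /eqP infty.
move: h; rewrite (_ : (\int[_]_(s in _) _ = +oo)%E) ?ltxx//.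
transitivity (\int[@lebesgue_measure R]_(s in `[a, b]) (cst +oo%E) s)%E.
  apply: eq_integral => s _; rewrite -infty; apply: eq_integral => y _.
  by rewrite expectation_cst real_normK// num_real.
by rewrite integral_cst//= lebesgue_measure_itv/= lte_fin ab gt0_mulye// lte_fin subr_gt0.
Qed.

Lemma ordinary_int_deterministic (a b : R) (phi : Y -> R) Z : measurable_fun setT phi -> a < b ->
  ordinary_int P F Pi a b (fun _ y _ => phi y) Z -> int1 Pi phi.
Proof.
move=> mphi ab [_ _ H]; have pf : ProperFilter (almost_everywhere P).
  by have h : (0 < P [set: Omega])%E; [rewrite probability_setT|exact: ae_properfilter_algebraOfSetsType].
have [w [h _]] := filter_ex H.
apply/integrableP; split; first exact/measurable_EFinP.
rewrite ltNge leye_eq; apply/negP => /eqP infty.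
move: h; rewrite (_ : (\int[_]_(s in _) _ = +oo)%E) ?ltxx//.
transitivity (\int[@lebesgue_measure R]_(s in `[a, b]) (cst +oo%E) s)%E.
  by apply: eq_integral => s _; rewrite -infty; apply: eq_integral.
by rewrite integral_cst//= lebesgue_measure_itv/= lte_fin ab gt0_mulye// lte_fin subr_gt0.
Qed.

End stochastic_integrands.

(** [D] is where the sum of the [phi g ^ 2] is positive, exhausted by the sets where it is at least
    [1 / (n + 1)]; these have finite measure by Chebyshev. *)
Lemma carrier_restriction d (Y : measurableType d) (R : realType)
    (Pi : {measure set Y -> \bar R}) (I : finType) (phi : I -> Y -> R) :
  (forall g, L2 Pi (phi g)) ->
  exists (D : set Y) (PiD : {sigma_finite_measure set Y -> \bar R}),
    [/\ measurable D, forall A, measurable A -> PiD A = Pi (A `&` D) &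
        forall g y, ~ D y -> phi g y = 0].
Proof.
move=> Lphi; pose h y := \sum_g phi g y ^+ 2.
have h0 y : 0 <= h y by apply: sumr_ge0 => g _; exact: sqr_ge0.
have ih : int1 Pi h by apply: int1_sum => g; exact: L2_int1.
have mh := int1_meas ih.
pose E n := [set y | n.+1%:R^-1 <= h y].
have mE n : measurable (E n).
  rewrite -[X in measurable X]setTI; have -> : E n = h @^-1` `[n.+1%:R^-1, +oo[.
    by apply/seteqP; split => y; rewrite /E /preimage/= in_itv/= andbT.
  by apply: mh => //; exact: measurable_itv.
have En n : (Pi (E n) < +oo)%E.
  have n0 : 0 < n.+1%:R^-1 :> R by rewrite invr_gt0.
  have [_ fin] := integrableP _ _ _ ih.
  have := le_integral_abse Pi measurableT (proj1 (integrableP _ _ _ ih)) n0.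
  rewrite setTI (_ : [set x | _] = E n); last first.
    by apply/seteqP; split => y; rewrite /E/= lee_fin ger0_norm.
  move=> /le_lt_trans/(_ fin) lt; rewrite ltNge leye_eq; apply/negP => /eqP infty.
  by move: lt; rewrite infty gt0_muley ?ltxx// lte_fin.
have [PiD PiDE] := sigma_finite_restriction (fun n => conj (mE n) (En n)).
exists (\bigcup_n E n), PiD; split => //; first exact: bigcup_measurable.
move=> g y nD; apply/eqP; rewrite -sqrf_eq0; apply/eqP.
suff hy : h y = 0.
  apply/le_anti; rewrite sqr_ge0 andbT -hy /h (bigD1 g)//= lerDl; apply: sumr_ge0 => g' _; exact: sqr_ge0.
apply/le_anti; rewrite h0 andbT leNgt; apply/negP => hp; apply: nD.
have [n _ Hn] := near_infty_natSinv_lt (PosNum hp).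
by exists n => //; rewrite /E/=; apply: ltW; exact: (Hn n (leqnn n)).
Qed.

(** * Expansion, independence and covariances for the given noises *)

Section expansion_theorem.
Context {d : measure_display} {Omega : measurableType d} {R : realType}.
Context {dY : measure_display} {Y : measurableType dY}.
Variables (t T : R) (m : nat) (P : probability Omega R) (F : R -> set_system Omega).
Variables (Pi : {measure set Y -> \bar R}).
Variable nu : 'I_m.+1 -> R.-ker Omega ~> (R * Y)%type.
Variables (k : nat) (i : 'I_k -> 'I_m.+1) (psi : 'I_k -> R -> R) (phi : 'I_k -> Y -> R).
Variables (f : nat -> R -> R) (tau : nat -> nat -> R) (I : Omega -> R).
Variables (pi_ : 'I_k -> nat -> Omega -> R) (S : nat -> 'I_k -> nat -> Omega -> R).
Hypotheses (t0 : 0 <= t) (tT : t < T) (k0 : (0 < k)%N).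
Hypothesis Ffil : filtration T F.
Hypothesis Hnu : poisson_system P F Pi T nu.
Hypothesis psi_cont : forall l, {within `[t, T], continuous (psi l)}.
Hypothesis forth : orthonormal_system t T f.
Hypothesis fcomp : complete_system t T f.
Hypothesis fstar : forall j, star_condition t T (f j).
Hypothesis phi_power : forall l, measurable_fun setT (phi l) /\
  (\int[Pi]_y (`|phi l y| ^+ (2 ^ k.+1))%:E < +oo)%E.
Hypothesis part : forall N, (0 < N)%N -> is_partition t T N (tau N).
Hypothesis mesh0 : (fun N => \big[Order.max/0]_(j < N) (tau N j.+1 - tau N j)) @ \oo --> 0.
Hypothesis II : iterated_int P F Pi nu t T i (fun l s y => psi l s * phi l y) I.
Hypothesis Hpi : forall g j, stoch_int P F Pi nu (i g) t T (fun s y _ => f j s * phi g y) (pi_ g j).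
Hypothesis HS : forall N g l, (l < N)%N ->
  stoch_int P F Pi nu (i g) (tau N l) (tau N l.+1) (fun _ y _ => phi g y) (S N g l).
Local Notation leb := (leb (R := R)).
Local Notation sig c := (sigma_generated [set DA : set R * set Y | rectangle Pi T DA.1 DA.2]
  (fun DA w => nu c w (DA.1 `*` DA.2) : \bar R)).

Let T0 : 0 <= T. Proof. exact: le_trans (ltW tT). Qed.

(** The integral over the only cell of the partition with [N = 1] exists, and this already contains
    square integrability of [phi g]. *)
Lemma phi_square_integrable g : L2 Pi (phi g).
Proof.
have [_ e1 lt] := part (ltn0Sn 0); have [mphi _] := phi_power g.
exact: (H2_deterministic mphi (lt 0%N (ltn0Sn 0)) (stoch_int_H2 (HS g (ltn0Sn 0)))).
Qed.

Let phi_int g : i g = ord0 -> int1 Pi (phi g).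
Proof.
move=> ig; have [_ _ lt] := part (ltn0Sn 0); have [mphi _] := phi_power g.
have := HS g (ltn0Sn 0); rewrite /stoch_int ig eqxx.
exact: (ordinary_int_deterministic mphi (lt 0%N (ltn0Sn 0))).
Qed.

Let fpc j : pc t T (f j). Proof. by apply: pc_star => //; case: forth => + _; apply. Qed.

Let ppc l : pc t T (psi l). Proof. exact: pc_within. Qed.

Section carrier.
Variables (D : set Y) (PiD : {sigma_finite_measure set Y -> \bar R}).
Hypothesis mD : measurable D.
Hypothesis PiDE : forall A, measurable A -> PiD A = Pi (A `&` D).
Hypothesis phiD : forall g y, ~ D y -> phi g y = 0.
Local Notation rel g := (irel P F Pi T nu D PiD (phi g) (i g)).

Let restricted_finite (g : Y -> R) : measurable_fun setT g -> (forall y, 0 <= g y) ->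
  (\int[Pi]_y (g y)%:E < +oo)%E -> (\int[PiD]_y (g y)%:E < +oo)%E.
Proof.
move=> mg g0; apply: le_lt_trans; rewrite (integral_restricted mD PiDE); first last.
- by move=> y; rewrite lee_fin.
- exact/measurable_EFinP.
by apply: ge0_subset_integral => //; [exact/measurable_EFinP|move=> y _; rewrite lee_fin].
Qed.

Let Lphi g : L2 PiD (phi g).
Proof.
have [mphi fin] := phi_square_integrable g; split => //; apply: restricted_finite => //.
  exact: measurable_funX.
by move=> y; exact: sqr_ge0.
Qed.

Let phi_pow g : int1 PiD (fun y => `|phi g y| ^+ (2 ^ k.+1)).
Proof.
have [mphi fin] := phi_power g.
have mp : measurable_fun setT (fun y => `|phi g y| ^+ (2 ^ k.+1)).
  by apply: measurable_funX; exact: measurableT_comp.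
by apply: ge0_int1 => //; apply: restricted_finite.
Qed.

Let peven : ~~ odd (2 ^ k.+1). Proof. by rewrite oddX. Qed.

Let kq : (k.*2 < 2 ^ k.+1)%N.
Proof. by rewrite expnS mul2n ltn_double ltn_expl. Qed.

Let Hadapt j : j != ord0 -> adapted_counts P F Pi T (nu j).
Proof. exact: poisson_system_adapted. Qed.

Let C := \sum_g irel_cst Pi T PiD (phi g).

Let C0 : 0 <= C. Proof. by apply: sumr_ge0 => g _; exact: irel_cst_ge0. Qed.

Let ker g : kernel P F tau (rel g) C (fun N q => S N g q).
Proof.
apply: (irel_kernel t0 tT Ffil Hnu mD PiDE (@phiD g) (Lphi g) (@phi_int g) part (fun N q => @HS N g q)).
by rewrite /C (bigD1 g)//= lerDl; apply: sumr_ge0 => g' _; exact: irel_cst_ge0.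
Qed.

Let moments g : moment_bounded P t T tau (fun N r => S N g r) (2 ^ k.+1).
Proof.
exact: (irel_moments t0 tT Ffil Hnu mD PiDE (@phiD g) (Lphi g) (@phi_int g) part (fun N q => @HS N g q) peven (phi_pow g)).
Qed.

Let pi_rel g j : rel g (fun z => cutoff t T (f j) z.1) (pi_ g j).
Proof.
apply: (irel_process T0 Ffil Hadapt mD PiDE (@phiD g) (@phi_int g) (a := t) (b := T)
  (G := fun s _ => f j s) t0 (lexx _)).
  by have := Hpi g j; congr stoch_int; apply/funext => s; apply/funext => y; apply/funext => w; rewrite mulrC.
by case: (time_L2 P (cut_L2 tT (fpc j))).
Qed.

Let pi_L2 g j : L2 P (pi_ g j).
Proof. by case: (kernel_e2 (ker g) (pi_rel g j)). Qed.

Let vanishing_integral g a b xi Z : 0 <= a -> b <= T -> (forall y, phi g y = 0) ->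
  (forall s y w, xi s y w = phi g y * 0) ->
  stoch_int P F Pi nu (i g) a b xi Z -> L2 P Z /\ e2 P Z = 0.
Proof.
move=> a0 bT phi0 xi0 H.
have L0 : L2 (horizon P) (fun z => 0 * \1_`[a, b[ z.1).
  by have := L20 (horizon P); congr L2; apply/funext => z; rewrite mul0r.
have := irel_process T0 Ffil Hadapt mD PiDE (@phiD g) (@phi_int g) (G := fun _ _ => 0) (Z := Z) a0 bT.
rewrite (_ : (fun s y w => phi g y * 0) = xi); last first.
  by apply/funext => s; apply/funext => y; apply/funext => w; rewrite xi0.
move=> /(_ H L0) /(kernel_e2 (ker g))[_ LZ h]; split => //.
apply/le_anti; rewrite e2_ge0 andbT; apply: le_trans h _.
rewrite ae_e2_0 ?mulr0//; first exact: (L2_meas L0).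
by apply: aeW => z; rewrite mul0r.
Qed.

Lemma expansion_on_carrier : exists Q : ('I_k -> nat) -> Omega -> R,
  (forall j : 'I_k -> nat,
     lim_in_mean_square P \oo
       (fun N w => \sum_(l : {ffun 'I_k -> 'I_N} | ~~ injectiveb l)
          \prod_(g < k) (f (j g) (tau N (l g)) * S N g (l g) w))
       (Q j)) /\
  lim_in_mean_square P (@multi_infty k)
    (fun p w =>
       \sum_(j : {ffun 'I_k -> 'I_(\max_(l < k) p l).+1}
             | [forall l, (j l <= p l)%N])
         fourier_coef t T psi f (fun l => j l) *
         (\prod_(g < k) pi_ g (j g) w - Q (fun l => j l) w))
    I.
Proof.
have [j|Y' cY'] := @choice ('I_k -> nat) (Omega -> R) (fun j Z => ms_cvg P
    (fun N => multiple S (fun l : {ffun 'I_k -> 'I_N} => \prod_(g < k) f (j g) (tau N (l g)))) Z).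
  exact: (multiple_prod_cvg t0 tT Ffil part mesh0 ker C0 kq moments (h := fun g => f (j g))).
exists (fun j w => \prod_(g < k) pi_ g (j g) w - Y' j w); split => [j|].
  apply: ms_cvg_lim.
  exact: (@diagonal_cvg _ _ _ P F t T tau t0 tT Ffil part mesh0 k _ C S ker _ kq moments
    (fun g => f (j g)) (fun g => pi_ g (j g)) (Y' j)
    (fun g => fpc (j g)) (fun g => pi_rel g (j g)) (cY' j)).
have [J [J0 HJ ->]] := II.
have Jstep (l : 'I_k) :
  (measurable_fun setT (fun z : R * Omega => cutoff t T (psi l) z.1 * J l z.1 z.2) /\
   forall s, s \in `[t, T] -> L2 (horizon P) (fun z => psi l z.1 * J l z.1 z.2 * \1_(`[t, s[ : set R) z.1) ->
     rel l (fun z => psi l z.1 * J l z.1 z.2 * \1_(`[t, s[ : set R) z.1) (J l.+1 s)) \/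
  ((forall s, s \in `[t, T] -> L2 P (J l.+1 s) /\ e2 P (J l.+1 s) = 0) /\
   forall N q, (q < N)%N -> e2 P (S N l q) = 0).
  (* A nonzero value [phi l y0] lets the measurability of [psi l * J l] be read off the section at
     [y0] of the integrand of the [l]-th integral. *)
  have [[y0 y00]|phi0] := pselect (exists y0, phi l y0 != 0); [left|right].
    split.
      have TI : T \in `[t, T] by rewrite in_itv/= lexx ltW.
      have [mH _] := H2_L2 mD PiDE (stoch_int_H2 (HJ l T TI)).
      have E : (fun z : R * Omega => cutoff t T (psi l) z.1 * J l z.1 z.2) =
        (fun z => (phi l y0)^-1 * (psi l z.1 * phi l y0 * J l z.1 z.2 * \1_`[t, T[ z.1)).
        by apply/funext => z; rewrite /cutoff; field.
      rewrite E; apply: measurable_funM => //.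
      apply: (measurableT_comp mH (_ : measurable_fun setT (fun z : R * Omega => ((z.1, y0), z.2)))).
      by apply: measurable_fun_pair => //; apply: measurable_fun_pair.
    move=> s sT L; apply: (irel_process T0 Ffil Hadapt mD PiDE (@phiD l) (@phi_int l) (a := t) (b := s)
      (G := fun u w => psi l u * J l u w) t0) => //.
      by move: sT; rewrite in_itv/= => /andP[].
    have := HJ l s sT; congr stoch_int; apply/funext => u; apply/funext => y; apply/funext => w; ring.
  have {}phi0 y : phi l y = 0 by apply/eqP; apply/negPn/negP => py; apply: phi0; exists y.
  split=> [s sT|N q qN].
    have sT' : s <= T by move: sT; rewrite in_itv/= => /andP[].
    apply: (vanishing_integral t0 sT' phi0 _ (HJ l s sT)) => u y w.
    by rewrite phi0 !(mulr0, mul0r).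
  have N0 : (0 < N)%N by exact: leq_trans qN.
  have [] := vanishing_integral (node0 t0 part N0 (ltnW qN)) (node_le part N0 qN) phi0 _ (HS l qN) => //.
  by move=> s y w; rewrite phi0 mulr0.
have := expansion_cvg t0 tT Ffil part mesh0 ker C0 ppc J0 Jstep fpc forth fcomp k0 cY'.
congr lim_in_mean_square; apply/funext => p; apply/funext => w; apply: eq_bigr => j _.
by rewrite opprB addrC subrK.
Qed.

Let sig_algebra c : sigma_algebra setT (sig c).
Proof. exact: smallest_sigma_algebra. Qed.

Let sig_measurable c : sig c `<=` measurable.
Proof.
apply: smallest_sub; first exact: sigma_algebra_measurable.
move=> _ [DA [mDA _ mA _] [B mB <-]].
have := nu_measurable (nu c) mDA mA; exact.
Qed.

(** Two limits in a row: each Riemann sum has a version measurable for the counts of its noise, and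
    [pi_ g j] is the mean-square limit of these versions. *)
Let pi_version g j : i g != ord0 ->
  exists X, Gm (sig (i g)) X /\ {ae P, forall w, pi_ g j w = X w}.
Proof.
move=> ig.
have [n|X HX] := @choice nat (Omega -> R) (fun n X => Gm (sig (i g)) X /\
    {ae P, forall w, riemann_sum tau (fun N r => S N g r) (f j) n.+1 w = X w}).
  exact: (riemann_sum_generated t0 tT Ffil Hnu mD PiDE (@phiD g) (Lphi g) (@phi_int g) part (fun N q => @HS N g q)
    peven (phi_pow g) ig (fpc j)).
have mX n : measurable_fun setT (X n).
  by apply: (sub_preimage_measurable (@sig_measurable (i g))); case: (HX n).
have LR n := riemann_sum_L2 t0 Ffil part (ker g) (f j) (ltn0Sn n).
have LX n : L2 P (X n) by apply: L2_ae (LR n) => //; case: (HX n).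
apply: (limit_adapted (sig_algebra (i g)) (fun n => (HX n).1) LX (pi_L2 g j)).
have E n : e2 P (fun w => X n w - pi_ g j w) =
    e2 P (fun w => riemann_sum tau (fun N r => S N g r) (f j) n.+1 w - pi_ g j w).
  apply/esym/e2_ae; [exact: L2_meas (L2B (LR n) (pi_L2 g j))|exact: L2_meas (L2B (LX n) (pi_L2 g j))|].
  by apply: filterS (HX n).2 => w ->.
rewrite (funext E) (cvg_shiftS (fun n => e2 P (fun w => riemann_sum tau (fun N r => S N g r) (f j) n w - pi_ g j w))).
exact: (riemann_sum_cvg t0 tT Ffil part mesh0 (ker g) (fpc j) (pi_rel g j)).
Qed.

Lemma independence_on_carrier :
  mutually_independent P (fun c : 'I_m.+1 => c != ord0) (fun c =>
    sigma_generated [set gj : 'I_k * nat | i gj.1 = c] (fun gj => pi_ gj.1 gj.2)).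
Proof.
have [_ ind _ _] := Hnu.
apply: (independent_versions (fun c _ => sig_algebra c) (fun c _ => @sig_measurable c) ind).
move=> c [g j] c0 /= igc; split; first exact: L2_meas (pi_L2 g j).
by rewrite -igc; apply: pi_version; rewrite igc.
Qed.

Let pi_martingale g j : i g != ord0 ->
  martingale_rel P F Pi T (nu (i g)) D PiD (phi g) (fun z => cutoff t T (f j) z.1) (pi_ g j).
Proof. by move=> ig; have := pi_rel g j; rewrite /irel (negbTE ig). Qed.

(** For one noise the isometry reduces the covariance to the inner product of [f j] and [f j']; for
    different noises it vanishes as the variables are independent and centred. *)
Lemma covariance_on_carrier g g' j j' : i g != ord0 -> i g' != ord0 -> j != j' ->
  covariance P (pi_ g j) (pi_ g' j') = 0%E.
Proof.
move=> ig ig' jj'.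
have mean0 g1 j1 : i g1 != ord0 -> \int[P]_w pi_ g1 j1 w = 0.
  by move=> ig1; have [_ H] := pi_martingale j1 ig1; exact: (integral_of_mean Ffil (Hadapt ig1) H).
rewrite covariance_centered ?mean0//; congr EFin.
have [e|ne] := eqVneq (i g) (i g').
  have := pi_martingale j' ig'; rewrite -e => H'.
  rewrite (martingale_rel_ip Ffil (Hadapt ig) PiDE (Lphi g) (Lphi g') (cut_L2 tT (fpc j)) (cut_L2 tT (fpc j'))
    (pi_martingale j ig) H').
  by rewrite (cut_orth fpc forth) (negbTE jj') mulr0.
have hT c : c != ord0 -> sigma_generated [set gj : 'I_k * nat | i gj.1 = c] (fun gj => pi_ gj.1 gj.2) setT.
  move=> _; have [g0 gC _] := smallest_sigma_algebra [set: Omega]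
    (\bigcup_(gj in [set gj : 'I_k * nat | i gj.1 = c]) g_sigma_algebra_preimage (pi_ gj.1 gj.2)).
  by have := gC _ g0; rewrite setD0.
have ind := mutually_independent2 hT independence_on_carrier ig ig' ne.
have [|_] := indep_prod (P := P) (X := pi_ g j) (Y := pi_ g' j') _ (L2_L1 (pi_L2 g j)) (L2_L1 (pi_L2 g' j')).
  move=> A B GA GB; apply: ind.
  - by apply: sub_sigma_algebra; exists (g, j).
  - by apply: sub_sigma_algebra; exists (g', j').
by rewrite /ip => ->; rewrite mean0// mul0r.
Qed.

End carrier.
End expansion_theorem.

Theorem theorem3 (R : realType) (t T : R) (n m : nat)
  (d : measure_display) (Omega : measurableType d) (P : probability Omega R)
  (F : R -> set_system Omega)
  (Pi : {measure set (borelRn R n) -> \bar R})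
  (nu : 'I_m.+1 -> R.-ker Omega ~> (R * borelRn R n)%type)
  (k : nat) (i : 'I_k -> 'I_m.+1)
  (psi : 'I_k -> R -> R) (phi : 'I_k -> borelRn R n -> R)
  (f : nat -> R -> R)
  (* the partitions, the iterated integral, the variables pi_j^(g, i_g), and
     the integrals of phi_g over [tau_l, tau_(l+1)) *)
  (tau : nat -> nat -> R)
  (I : Omega -> R)
  (pi_ : 'I_k -> nat -> Omega -> R)
  (S : nat -> 'I_k -> nat -> Omega -> R) :
  0 <= t -> t < T -> (0 < k)%N ->
  filtration T F ->
  poisson_system P F Pi T nu ->
  (forall l, H2 P F Pi t T (fun s y _ => psi l s * phi l y)) ->
  (forall l, {within `[t, T], continuous (psi l)}) ->
  orthonormal_system t T f -> complete_system t T f ->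
  (forall j, star_condition t T (f j)) ->
  (forall l, measurable_fun setT (phi l) /\
     (\int[Pi]_y (`|phi l y| ^+ (2 ^ k.+1))%:E < +oo)%E) ->
  (forall N, (0 < N)%N -> is_partition t T N (tau N)) ->
  (fun N => \big[Order.max/0]_(j < N) (tau N j.+1 - tau N j)) @ \oo --> 0 ->
  iterated_int P F Pi nu t T i (fun l s y => psi l s * phi l y) I ->
  (forall g j,
     stoch_int P F Pi nu (i g) t T (fun s y _ => f j s * phi g y) (pi_ g j)) ->
  (forall N g l, (l < N)%N ->
     stoch_int P F Pi nu (i g) (tau N l) (tau N l.+1)
       (fun _ y _ => phi g y) (S N g l)) ->
  [/\ (* the expansion; the sum over G_k is over the non-injective l *)
      exists Q : ('I_k -> nat) -> Omega -> R,
        (forall j : 'I_k -> nat,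
           lim_in_mean_square P \oo
             (fun N w => \sum_(l : {ffun 'I_k -> 'I_N} | ~~ injectiveb l)
                \prod_(g < k) (f (j g) (tau N (l g)) * S N g (l g) w))
             (Q j)) /\
        lim_in_mean_square P (@multi_infty k)
          (fun p w =>
             \sum_(j : {ffun 'I_k -> 'I_(\max_(l < k) p l).+1}
                   | [forall l, (j l <= p l)%N])
               fourier_coef t T psi f (fun l => j l) *
               (\prod_(g < k) pi_ g (j g) w - Q (fun l => j l) w))
          I,
      mutually_independent P (fun c : 'I_m.+1 => c != ord0) (fun c =>
        sigma_generated [set gj : 'I_k * nat | i gj.1 = c]
          (fun gj => pi_ gj.1 gj.2)) &
      forall g g' j j', i g != ord0 -> i g' != ord0 -> j != j' ->
        covariance P (pi_ g j) (pi_ g' j') = 0%E].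
Proof.
move=> t0 tT k0 Ffil Hnu _ psi_cont forth fcomp fstar phi_power part mesh0 II Hpi HS.
have [D [PiD [mD PiDE phiD]]] := carrier_restriction (phi_square_integrable phi_power part HS).
split.
- exact: (expansion_on_carrier t0 tT k0 Ffil Hnu psi_cont forth fcomp fstar phi_power part mesh0 II Hpi HS mD PiDE phiD).
- exact: (independence_on_carrier t0 tT Ffil Hnu forth fstar phi_power part mesh0 Hpi HS mD PiDE phiD).
- exact: (covariance_on_carrier t0 tT Ffil Hnu forth fstar phi_power part mesh0 Hpi HS mD PiDE phiD).
Qed.
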